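(* Fix $m\in\mathbb{N}$ and let $\lambda_0^{m}>0$ be the principal (smallest) eigenvalue of $-\Delta_m$. Then for each $\lambda>\lambda_0^{m}$ there exists $\epsilon>0$ such that the equation $$(1+i\eta)\,\Delta_m\psi+i\lambda\Omega\,\psi+\lambda f(|\psi|^2,\mathbf{b})\,\psi=0,\qquad (\Omega,\psi)\in\mathbb{R}\times H_m^2(\mathbb{C}),$$ possesses nontrivial solution pairs $(\Omega(\eta,\mathbf{b}),\psi(\eta,\mathbf{b}))$ (nontrivial: $\psi(\eta,\mathbf b)\not\equiv 0$) parametrized by all $(\eta,\mathbf{b})\in\mathbb{R}\times\mathbb{R}^d$ with $0\le|\eta|,|\mathbf{b}|<\epsilon$. Moreover, the following statements hold: (i) $(\Omega(\eta,\mathbf{b}),\psi(\eta,\mathbf{b}))$ exhibits a rotating spiral if $(\eta,\mathbf{b})\neq(0,\mathbf{0})$ lies in a small cone with $(0,\mathbf{0})$ as vertex and $\{(\eta,\mathbf{0}):0\le|\eta|<\epsilon\}$ as axis; i.e. there is $\kappa>0$ such that this holds for all $(\eta,\mathbf{b})\ne(0,\mathbf 0)$ with $|\eta|,|\mathbf b|<\epsilon$ and $|\mathbf{b}|\le\kappa|\eta|$. (ii) Suppose $d=1$ and write $\mathbf{b}=\beta\in\mathbb{R}$. Assume in addition that $\partial_\beta f_{\mathcal I}(y,0)\neq0$ for all $y\in(0,C)$ and that $f_{\mathcal I}(0,\beta)=0$ for all $\beta\in\mathbb{R}$. Then $(\Omega(\eta,\beta),\psi(\eta,\beta))$ exhibits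 a rotating spiral if $(\eta,\beta)\neq(0,0)$ lies in a small cone with $(0,0)$ as vertex and $\{(0,\beta):0\le|\beta|<\epsilon\}$ as axis; i.e. there is $\kappa>0$ such that this holds for all $(\eta,\beta)\ne(0,0)$ with $|\eta|,|\beta|<\epsilon$ and $|\eta|\le\kappa|\beta|$.
   Context: Surface. $\mathcal{M}=\{(a(s)\cos\varphi,a(s)\sin\varphi,\tilde a(s)):s\in[0,s_*],\ \varphi\in\mathbb{R}/2\pi\mathbb{Z}\}\subset\mathbb{R}^3$ is a compact surface of revolution of class $C^{2,\nu}$ with a fixed $\nu\in(0,1)$; $a,\tilde a$ are $C^{2,\nu}$ functions, $s$ is arc length ($(a')^2+(\tilde a')^2=1$ on $[0,s_*]$), $a(0)=0$ and $a(s)>0$ for $s\in(0,s_* )$. Smoothness of $\mathcal M$ forces $a'(0)=1$. The boundary $\partial\mathcal{M}$ is empty if and only if $a(s_* )=0$, in which case $a'(s_* )=-1$. Function spaces and operator. $\Delta_{\mathcal M}$ is the Laplace-Beltrami operator with domain $H^2(\mathcal{M},\mathbb{C})$; if $\partial\mathcal{M}\neq\emptyset$ the domain is also equipped with Robin boundary conditions $\alpha_1\Psi+\alpha_2\nabla\Psi\cdot\mathbf{n}=0$ on $\partial\mathcal M$, where $\alpha_1,\alpha_2\ge0$ are fixed and not both zero and $\mathbf n$ is the unit outer normal. $L_m^2(\mathbb{C})=\{\psi\in L^2(\mathcal{M},\mathbb{C}):\psi(s,\varphi)=u(s)e^{im\varphi},\ u(s)\in\mathbb{C}\}$; $H_m^2(\mathbb{C})=L_m^2(\mathbb{C})\cap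 H^2(\mathcal{M},\mathbb{C})$ (with the boundary conditions); $\Delta_m$ is the restriction of $\Delta_{\mathcal{M}}$ to $L_m^2(\mathbb{C})$, i.e. $\Delta_m(u e^{im\varphi})=\left(u''+\frac{a'}{a}u'-\frac{m^2}{a^2}u\right)e^{im\varphi}$. Nonlinearity. $d\ge1$, $f=f_{\mathcal R}+if_{\mathcal I}\in C^3([0,\infty)\times\mathbb{R}^d,\mathbb{C})$ with $f_{\mathcal R},f_{\mathcal I}$ real valued, satisfying: (A1) $f_{\mathcal R}(0,\mathbf 0)=1$; there is a constant $C>0$ with $f_{\mathcal R}(C,\mathbf 0)=0$ and $f_{\mathcal R}(y,\mathbf 0)<0$ for $y>C$; and $f_{\mathcal I}(y,\mathbf 0)=0$ for all $y\ge0$. (A2) $\partial_yf_{\mathcal R}(0,\mathbf 0)<0$ and $\partial_yf_{\mathcal R}(y,\mathbf 0)\le0$ for all $y\in(0,C)$. Patterns. For a nontrivial solution pair $(\Omega,\psi)$ with $\psi(s,\varphi)=u(s)e^{im\varphi}$, write $u(s)=A(s)e^{ip(s)}$ in polar form with $A=|u|$ where $u\ne0$; $p'$ is the phase derivative. The pair exhibits a spiral if $p'$ is not identically zero; otherwise it exhibits a vortex. The pattern is rotating if $\Omega\neq0$ and frozen if $\Omega=0$. (The pair corresponds to the solution $\Psi=e^{-i\Omega t}\psi$ of $\partial_t\Psi=\frac1\lambda(1+i\eta)\Delta_{\mathcal M}\Psi+f(|\Psi|^2,\mathbf b)\Psi$.) *)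

(* Defs.v *)
From HB Require Import structures.
From mathcomp Require Import all_boot all_order all_algebra.
From mathcomp Require Import all_classical all_reals all_analysis.
From mathcomp Require Export complex.

Set Implicit Arguments.
Unset Strict Implicit.
Unset Printing Implicit Defensive.

Import Order.TTheory GRing.Theory Num.Theory.
Import numFieldNormedType.Exports.

Local Open Scope classical_set_scope.
Local Open Scope complex_scope.
Local Open Scope ring_scope.

Section ComplexPreliminaries.
Context {R : realType}.

Definition sqnorm (z : R[i]) : R := complex.Re z ^+ 2 + complex.Im z ^+ 2.

Definition modulus (z : R[i]) : R := Num.sqrt (sqnorm z).

(* e^{i x} *)
Definition cis (x : R) : R[i] := cos x +i* sin x.

Definition enorm (d : nat) (b : 'rV[R]_d) : R :=
  Num.sqrt (\sum_(i < d) b ord0 i ^+ 2).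

End ComplexPreliminaries.

Section RelativeDerivative.
Context {R : realType}.
Implicit Types (D : set R) (f : R -> R) (x : R).

(* Derivatives relative to a set: one-sided at the endpoints of an interval. *)
Definition diffq_in D f x : set_system R :=
  (f y - f x) / (y - x) @[y --> within D x^'].

Definition derivable_in D f := forall x, D x -> cvg (diffq_in D f x).

Definition deriv_in D f x : R := lim (diffq_in D f x).

Definition holder_C2 (nu : R) D f :=
  [/\ derivable_in D f,
      derivable_in D (deriv_in D f) &
      exists K : R, forall x y, D x -> D y ->
        `|deriv_in D (deriv_in D f) x - deriv_in D (deriv_in D f) y|
          <= K * `|x - y| `^ nu].

End RelativeDerivative.

Section Surface.
Context {R : realType}.
Variables (nu ss : R) (a atil : R -> R).

(* Injectivity of the profile curve says that the surface is embedded in R^3;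
   the conditions on a' at the poles say that it is smooth there. *)
Record surface_of_revolution : Prop := SurfaceOfRevolution {
  sr_nu : 0 < nu < 1;
  sr_length : 0 < ss;
  sr_a_C2 : holder_C2 nu `[0, ss] a;
  sr_atil_C2 : holder_C2 nu `[0, ss] atil;
  sr_arclength : forall s, 0 <= s <= ss ->
    deriv_in `[0, ss] a s ^+ 2 + deriv_in `[0, ss] atil s ^+ 2 = 1;
  sr_embedded : forall s t, 0 <= s <= ss -> 0 <= t <= ss ->
    a s = a t -> atil s = atil t -> s = t;
  sr_pole0 : a 0 = 0;
  sr_pos : forall s, 0 < s < ss -> 0 < a s;
  sr_smooth0 : deriv_in `[0, ss] a 0 = 1;
  sr_smooth1 : a ss = 0 -> deriv_in `[0, ss] a ss = -1 }.

End Surface.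

(* Functions on the surface are written in the coordinates z = (s, phi); the
   chart below covers the surface up to a null set.  The surface measure is
   a(s) ds dphi, and the metric is ds^2 + a(s)^2 dphi^2. *)
Section SobolevSpaces.
Context {R : realType}.

Notation mu := (@lebesgue_measure R).
Notation mu2 := ((@lebesgue_measure R) \x (@lebesgue_measure R))%E.

Definition chart (ss : R) : set (measurableTypeR R * measurableTypeR R) :=
  `]0, ss[ `*` `]0, 2 * pi[.

Variables (ss : R) (a : R -> R).

Implicit Types (w g : R * R -> R) (psi h : R * R -> R[i]).

Definition ae_chart (P : R * R -> Prop) :=
  {ae mu2, forall z, chart ss z -> P z}.

(* C^1 functions on (0, oo) x R/2piZ supported in [c, e] x R/2piZ for some
   compact [c, e] included in J, with their two partial derivatives. *)
Record test_on (J : set R) (chi chi_s chi_p : R * R -> R) : Prop := TestOn {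
  test_C0 : continuous chi;
  test_C1s : continuous chi_s;
  test_C1p : continuous chi_p;
  test_ds : forall s p : R, is_derive s 1 (fun t => chi (t, p)) (chi_s (s, p));
  test_dp : forall s p : R, is_derive p 1 (fun t => chi (s, t)) (chi_p (s, p));
  test_periodic : forall s p : R, chi (s, p + 2 * pi) = chi (s, p);
  test_supp : exists c e : R, `[c, e] `<=` J /\
    forall s p : R, ~~ (c <= s <= e) -> chi (s, p) = 0 }.

Definition chart_locally_integrable w := forall c e : R, 0 < c -> e < ss ->
  mu2.-integrable
    (`[c, e] `*` `]0, 2 * pi[ : set (measurableTypeR R * measurableTypeR R))
    (EFin \o w).

(* Weak derivatives on the surface without its poles and boundary.  Periodicity
   of the test functions makes the condition hold on the whole circle. *)
Definition weak_s_real w g :=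
  [/\ chart_locally_integrable w, chart_locally_integrable g &
      forall chi chi_s chi_p, test_on `]0, ss[ chi chi_s chi_p ->
        Rintegral mu2 (chart ss) (fun z => w z * chi_s z) =
        - Rintegral mu2 (chart ss) (fun z => g z * chi z)].

Definition weak_p_real w g :=
  [/\ chart_locally_integrable w, chart_locally_integrable g &
      forall chi chi_s chi_p, test_on `]0, ss[ chi chi_s chi_p ->
        Rintegral mu2 (chart ss) (fun z => w z * chi_p z) =
        - Rintegral mu2 (chart ss) (fun z => g z * chi z)].

(* Trace of w on the boundary circle s = ss, given its weak derivative ws: the
   test functions vanish near the pole s = 0, but not at s = ss. *)
Definition trace_real w ws (tr : R -> R) :=
  mu.-integrable (`]0, 2 * pi[ : set (measurableTypeR R)) (EFin \o tr) /\
  forall chi chi_s chi_p, test_on `]0, +oo[ chi chi_s chi_p ->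
    Rintegral mu2 (chart ss) (fun z => w z * chi_s z + ws z * chi z) =
    Rintegral mu `]0, 2 * pi[ (fun p => tr p * chi (ss, p)).

Definition weak_s psi h :=
  weak_s_real (@complex.Re R \o psi) (@complex.Re R \o h) /\
  weak_s_real (@complex.Im R \o psi) (@complex.Im R \o h).

Definition weak_p psi h :=
  weak_p_real (@complex.Re R \o psi) (@complex.Re R \o h) /\
  weak_p_real (@complex.Im R \o psi) (@complex.Im R \o h).

Definition trace psi psi_s (tr : R -> R[i]) :=
  trace_real (@complex.Re R \o psi) (@complex.Re R \o psi_s)
    (@complex.Re R \o tr) /\
  trace_real (@complex.Im R \o psi) (@complex.Im R \o psi_s)
    (@complex.Im R \o tr).

Definition L2 psi :=
  [/\ measurable_fun (chart ss) (@complex.Re R \o psi),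
      measurable_fun (chart ss) (@complex.Im R \o psi) &
      mu2.-integrable (chart ss) (fun z => (sqnorm (psi z) * a z.1)%:E)].

Record jet := Jet {
  d_s : R * R -> R[i];
  d_p : R * R -> R[i];
  d_ss : R * R -> R[i];
  d_sp : R * R -> R[i];
  d_pp : R * R -> R[i] }.

(* psi and its weak covariant derivatives of order 1 and 2, expressed in the
   orthonormal frame (d_s, a^-1 d_phi), are square integrable.  Removing the
   poles is harmless: points are removable for W^{2,2} in dimension 2. *)
Record H2_jet psi (j : jet) : Prop := H2Jet {
  weak_d_s : weak_s psi (d_s j);
  weak_d_p : weak_p psi (d_p j);
  weak_d_ss : weak_s (d_s j) (d_ss j);
  weak_d_sp : weak_s (d_p j) (d_sp j);
  weak_d_pp : weak_p (d_p j) (d_pp j);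
  L2_psi : L2 psi;
  L2_grad_s : L2 (d_s j);
  L2_grad_p : L2 (fun z => (a z.1)^-1%:C * d_p j z);
  L2_hess_ss : L2 (d_ss j);
  L2_hess_sp : L2 (fun z => (a z.1)^-1%:C * d_sp j z
                            - (derive1 a z.1 / a z.1 ^+ 2)%:C * d_p j z);
  L2_hess_pp : L2 (fun z => (a z.1 ^- 2)%:C * d_pp j z
                            + (derive1 a z.1 / a z.1)%:C * d_s j z) }.

Variables (alpha1 alpha2 : R).

(* alpha1 psi + alpha2 (grad psi . n) = 0 on the boundary, where n = d_s *)
Definition robin psi (j : jet) := exists tr0 tr1 : R -> R[i],
  [/\ trace psi (d_s j) tr0,
      trace (d_s j) (d_ss j) tr1 &
      {ae mu, forall p : R, 0 < p < 2 * pi ->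
        alpha1%:C * tr0 p + alpha2%:C * tr1 p = 0}].

(* psi is in the domain of the Laplace-Beltrami operator, with value lap *)
Definition laplace_beltrami psi (lap : R * R -> R[i]) := exists j : jet,
  [/\ H2_jet psi j,
      a ss != 0 -> robin psi j &
      ae_chart (fun z => lap z = d_ss j z + (derive1 a z.1 / a z.1)%:C * d_s j z
                                 + (a z.1 ^- 2)%:C * d_pp j z)].

Variable m : nat.

Definition mode (u : R -> R[i]) (z : R * R) : R[i] := u z.1 * cis (m%:R * z.2).

Definition L2m psi := L2 psi /\ exists u, psi = mode u.

Definition Delta_m psi (lap : R * R -> R[i]) :=
  L2m psi /\ laplace_beltrami psi lap.

Definition nontrivial psi := ~ ae_chart (fun z => psi z = 0).

Definition eigenvalue_neg_Delta_m (lambda : R) := exists psi lap,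
  [/\ Delta_m psi lap, nontrivial psi &
      ae_chart (fun z => - lap z = lambda%:C * psi z)].

Definition principal_eigenvalue (lambda0 : R) :=
  eigenvalue_neg_Delta_m lambda0 /\
  forall lambda, eigenvalue_neg_Delta_m lambda -> lambda0 <= lambda.

(* p is a differentiable phase of u near s0, with p'(s0) <> 0. *)
Definition spiral_profile (u : R -> R[i]) := exists s0 p,
  [/\ 0 < s0 < ss, u s0 != 0,
      \forall s \near s0, u s = (modulus (u s))%:C * cis (p s) /\
                          derivable p s 1 &
      derive1 p s0 != 0].

Definition spiral psi := exists u, psi = mode u /\ spiral_profile u.

Definition rotating_spiral (Omega : R) psi := Omega != 0 /\ spiral psi.

End SobolevSpaces.

Section Nonlinearity.
Context {R : realType} (d : nat).
Implicit Types (f : R -> 'rV[R]_d -> R).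

Definition dy f : R -> 'rV[R]_d -> R :=
  fun y b => deriv_in `[0, +oo[ (f^~ b) y.

Definition db (i : 'I_d) f : R -> 'rV[R]_d -> R :=
  fun y b => 'D_(delta_mx ord0 i) (f y) b.

(* Class C^k on the closed set [0, oo) x R^d *)
Fixpoint classC (k : nat) f : Prop :=
  {within `[0, +oo[ `*` setT, continuous (fun z : R * 'rV[R]_d => f z.1 z.2)} /\
  if k is k'.+1 then
    [/\ forall b, derivable_in `[0, +oo[ (f^~ b),
        classC k' (dy f) &
        forall i, (forall y b, 0 <= y -> derivable (f y) b (delta_mx ord0 i)) /\
                  classC k' (db i f)]
  else True.

Definition A1 (fR fI : R -> 'rV[R]_d -> R) (C : R) :=
  [/\ fR 0 0 = 1, 0 < C, fR C 0 = 0,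
      forall y, C < y -> fR y 0 < 0 &
      forall y, 0 <= y -> fI y 0 = 0].

Definition A2 (fR : R -> 'rV[R]_d -> R) (C : R) :=
  dy fR 0 0 < 0 /\ forall y, 0 < y < C -> dy fR y 0 <= 0.

End Nonlinearity.

(* (1 + i eta) Delta_m psi + i lambda Omega psi
   + lambda f(|psi|^2, b) psi = 0,  psi in H^2_m *)
Definition solves (R : realType) (ss : R) (a : R -> R) (alpha1 alpha2 : R)
    (m d : nat) (fR fI : R -> 'rV[R]_d -> R) (lambda eta : R) (b : 'rV[R]_d)
    (Omega : R) (psi : R * R -> R[i]) :=
  exists2 lap, Delta_m ss a alpha1 alpha2 m psi lap &
    ae_chart ss (fun z =>
      (1 +i* eta) * lap z + (0 +i* (lambda * Omega)) * psi z
      + lambda%:C * (fR (sqnorm (psi z)) b +i* fI (sqnorm (psi z)) b) * psi z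
      = 0).

(* Main.v *)
(* An eigenfunction for the principal eigenvalue [lambda0] is reduced by Fourier
   projection to a classical radial profile [V], and [th] is a positive function equal
   to [|V|] near the ends of [(0, l)]. At [(eta, b) = (0, 0)] a positive real solution
   [th * z] lies between the sub-solution [eps |V|] and a large super-solution. A
   solution [th * z * (1 + x) * exp (i P)] for small [(eta, b)] amounts to a contraction
   for [x]: the flux equation determines [P'], and its solvability determines [Omega] as
   a weighted mean of [eta f_R - f_I]. To first
   order on the two cones this quantity is a multiple of a function [G] of one sign that
   is not constant along the profile, so [Omega <> 0] and [P'] does not vanish. *)

Require Import Defs.
From mathcomp Require Import all_boot all_order all_algebra.
From mathcomp Require Import all_classical all_reals all_analysis.
From mathcomp Require Import ring lra measurable_realfun.
Import Order.TTheory GRing.Theory Num.Theory.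
Import numFieldNormedType.Exports.
Set Implicit Arguments.
Unset Strict Implicit.
Unset Printing Implicit Defensive.
Local Open Scope classical_set_scope.
Local Open Scope ring_scope.

Local Notation isd f x d := (is_derive (x : _) (1 : _) f d).

Local Notation "'forI' l s , P" := (forall s : Real.sort _, 0 < s < l -> P) (at level 200, l at level 9, s name).

(** The radial operator is singular at the poles and carries a Robin condition at a boundary. Both
    difficulties are absorbed into a factor: for [u = th w] and [rho = a th^2] the operator becomes
    [(rho w')' / rho] plus a bounded potential, and membership in the domain follows from
    [w' = O(distance to the ends)], because [th] itself already satisfies the regularity and Robin
    conditions. One degenerate Neumann problem with a maximum principle therefore serves for the
    ground state, for the correction [x] (with [rho] replaced by [rho z^2]) and for the assembled
    mode. In the variable [x] the linearisation at the ground state has the potential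
    [- 2 lam U f_R'(U)], which is nonnegative by (A2) and positive near a pole, where [U] is small;
    comparison inverts it in the uniform norm, so the branch comes from pointwise estimates alone.
    The phase derivative is eliminated by integrating its flux, which leaves [x] as the only unknown
    of the fixed-point problem. *)

Definition contI {R : realType} (l : R) (f : R -> R) := forI l s, {for s, continuous f}.

Definition derivI {R : realType} (l : R) (f f' : R -> R) := forI l s, isd f s (f' s).

(** * Derivatives on the line: arithmetic rules, mean value consequences, a C^1 truncation *)

Section Calculus.
Context {R : realType}.
Implicit Types (f g h : R -> R) (x y d e t : R).

Lemma isd_eqd f x d e : isd f x d -> d = e -> isd f x e.
Proof. by move=> H <-. Qed.

Lemma isd_cst (k : R) x : isd (fun _ : R => k) x 0.
Proof. exact: is_derive_cst. Qed.

Lemma isd_id x : isd (fun t : R => t) x 1.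
Proof. exact: is_derive_id. Qed.

Lemma isdD f g x d e : isd f x d -> isd g x e -> isd (fun t => f t + g t) x (d + e).
Proof. move=> ? ?; exact: is_deriveD. Qed.

Lemma isdN f x d : isd f x d -> isd (fun t => - f t) x (- d).
Proof. move=> ?; exact: is_deriveN. Qed.

Lemma isdB f g x d e : isd f x d -> isd g x e -> isd (fun t => f t - g t) x (d - e).
Proof. move=> ? ?; exact: is_deriveB. Qed.

Lemma isdM f g x d e : isd f x d -> isd g x e ->
  isd (fun t => f t * g t) x (d * g x + f x * e).
Proof.
move=> ? ?; apply: isd_eqd (is_deriveM _ _) _.
by rewrite /GRing.scale /=; ring.
Qed.

Lemma isdZ (k : R) f x d : isd f x d -> isd (fun t => k * f t) x (k * d).
Proof. by move=> H; apply: isd_eqd (isdM (isd_cst k x) H) _; rewrite mul0r add0r. Qed.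

Lemma isdV f x d : f x != 0 -> isd f x d -> isd (fun t => (f t)^-1) x (- d / f x ^+ 2).
Proof.
move=> fx0 H; apply: isd_eqd (is_deriveV fx0 H) _.
by rewrite /GRing.scale /= mulNr mulrC mulNr.
Qed.

Lemma isd_div f g x d e : g x != 0 -> isd f x d -> isd g x e ->
  isd (fun t => f t / g t) x ((d * g x - f x * e) / g x ^+ 2).
Proof.
move=> gx0 H H'; apply: isd_eqd (isdM H (isdV gx0 H')) _.
by field.
Qed.

Lemma isd_comp f g x d e : isd f x d -> isd g (f x) e -> isd (fun t => g (f t)) x (e * d).
Proof. move=> ? ?; apply: isd_eqd (is_derive1_comp _ _) _; by rewrite mulrC. Qed.

Lemma isd_sqr f x d : isd f x d -> isd (fun t => f t ^+ 2) x (2 * f x * d).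
Proof.
move=> H; apply: isd_eqd (isdM H H) _; ring.
Qed.

Lemma isd_cont f x d : isd f x d -> {for x, continuous f}.
Proof. by move=> H; apply: differentiable_continuous; apply/derivable1_diffP. Qed.

Lemma isd_expR f x d : isd f x d -> isd (fun t => expR (f t)) x (expR (f x) * d).
Proof. by move=> H; apply: isd_comp H _; exact: is_derive_expR. Qed.

Lemma isd_near f g x d : (\forall t \near x, f t = g t) -> isd f x d -> isd g x d.
Proof.
move=> fg H; apply: (near_eq_is_derive (f := f)) => //.
Qed.

Lemma isd_cos f x d : isd f x d -> isd (fun t => cos (f t)) x (- sin (f x) * d).
Proof. by move=> H; apply: isd_comp H _; exact: is_derive_cos. Qed.

Lemma isd_sin f x d : isd f x d -> isd (fun t => sin (f t)) x (cos (f x) * d).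
Proof. by move=> H; apply: isd_comp H _; exact: is_derive_sin. Qed.

Lemma isd_cvg f x d : (h^-1 * (f (x + h) - f x)) @[h --> 0^'] --> d -> isd f x d.
Proof.
move=> H.
have H' : h^-1 *: ((f \o shift x) (h *: (1 : R)) - f x) @[h --> 0^'] --> d.
  have E : (fun h : R => h^-1 *: ((f \o shift x) (h *: (1 : R)) - f x)) =
           (fun h : R => h^-1 * (f (x + h) - f x)).
    by apply/funext => h; rewrite /= [x + h]addrC /GRing.scale /= mulr1.
  by rewrite E.
apply: DeriveDef; first by apply/cvg_ex; exists d.
exact/cvg_lim.
Qed.

Lemma isd_uniq f x d e : isd f x d -> isd f x e -> d = e.
Proof. by move=> H1 H2; rewrite -(@derive_val _ _ _ _ _ _ _ H1) (@derive_val _ _ _ _ _ _ _ H2). Qed.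

Lemma mvt_int f f' (p q x y : R) : (forall t, p < t < q -> isd f t (f' t)) ->
  p < x -> x < y -> y < q -> exists2 c, x < c < y & f y - f x = f' c * (y - x).
Proof.
move=> H px xy yq.
have H1 (t : R) : t \in `]x, y[%R -> isd f t (f' t).
  by rewrite in_itv /= => /andP[a b]; apply: H; rewrite (lt_trans px a) (lt_trans b yq).
have [|c cin ->] := MVT xy H1.
  apply: derivable_within_continuous => t; rewrite in_itv /= => /andP[a b].
  by have := H t; rewrite (lt_le_trans px a) (le_lt_trans b yq) => /(_ isT) [].
by exists c => //; rewrite in_itv in cin.
Qed.

Lemma isd_ndecr f f' (p q x y : R) : (forall t, p < t < q -> isd f t (f' t)) ->
  (forall t, p < t < q -> 0 <= f' t) -> p < x -> x <= y -> y < q -> f x <= f y.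
Proof.
move=> H H0 px; rewrite le_eqVlt => /predU1P[->//|xy] yq.
have [c /andP[c1 c2] E] := mvt_int H px xy yq.
rewrite -subr_ge0 E; apply: mulr_ge0; last by rewrite subr_ge0 ltW.
apply: H0; by rewrite (lt_trans px c1) (lt_trans c2 yq).
Qed.

Lemma isd_nincr f f' (p q x y : R) : (forall t, p < t < q -> isd f t (f' t)) ->
  (forall t, p < t < q -> f' t <= 0) -> p < x -> x <= y -> y < q -> f y <= f x.
Proof.
move=> H H0 px xy yq; rewrite -lerN2.
apply: (@isd_ndecr (fun t => - f t) (fun t => - f' t) p q) => //.
- by move=> t /H /isdN.
- by move=> t /H0; rewrite oppr_ge0.
Qed.

Lemma isd_const f (p q x y : R) : (forall t, p < t < q -> isd f t 0) ->
  p < x < q -> p < y < q -> f x = f y.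
Proof.
move=> H /andP[px xq] /andP[py yq].
wlog xy : x y px xq py yq / x <= y.
  by move=> W; case: (leP x y) => [/W|/ltW /W] E; [|apply/esym]; exact: E.
apply/eqP; rewrite eq_le; apply/andP; split.
- exact: (@isd_ndecr f (fun=> 0) p q).
- exact: (@isd_nincr f (fun=> 0) p q).
Qed.

Lemma isd_lip f f' (p q K x y : R) : (forall t, p < t < q -> isd f t (f' t)) ->
  (forall t, p < t < q -> `|f' t| <= K) -> p < x < q -> p < y < q ->
  `|f x - f y| <= K * `|x - y|.
Proof.
move=> H HK /andP[px xq] /andP[py yq].
wlog xy : x y px xq py yq / x < y.
  move=> W; case: (ltgtP x y) => [/W H1|/W H1|->]; last by rewrite !subrr normr0 mulr0.
    exact: H1.
  by rewrite distrC [`|x - y|]distrC; exact: H1.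
have [c /andP[c1 c2] E] := mvt_int H px xy yq.
rewrite distrC E [`|x - y|]distrC normrM ler_wpM2r//; apply: HK.
by rewrite (lt_trans px c1) (lt_trans c2 yq).
Qed.

(* The C^1 function [t -> min(t, 0)^2] truncates at level [0]; the sign choice
   makes [npsq] increasing. *)
Definition npsq (t : R) : R := - (Num.min t 0) ^+ 2.

Lemma npsq_ge0 t : 0 <= t -> npsq t = 0.
Proof. by move=> t0; rewrite /npsq (min_idPr t0) expr0n oppr0. Qed.

Lemma npsq_le0 t : npsq t <= 0.
Proof. by rewrite oppr_le0 sqr_ge0. Qed.

Lemma npsq_lt0 t : t < 0 -> npsq t < 0.
Proof. by move=> t0; rewrite /npsq (min_idPl (ltW t0)) oppr_lt0 exprn_even_gt0 //= lt_eqF. Qed.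

Lemma isd_npsq t : isd npsq t (- 2 * Num.min t 0).
Proof.
have [t0|t0|->] := ltgtP t 0.
- apply: (@isd_near (fun s => - s ^+ 2)); last first.
    by apply: isd_eqd (isdN (isd_sqr (isd_id t))) _; ring.
  near=> s; rewrite /npsq (min_idPl _)//; apply/ltW; near: s.
  exact: lt_nbhsl.
- rewrite mulr0; apply: (@isd_near (fun _ => 0 : R)).
  near=> s; rewrite npsq_ge0//; apply/ltW; near: s.
  exact: lt_nbhsr.
- rewrite mulr0; apply: isd_cvg.
  apply/cvgrPdist_le => e e0; near=> h.
  rewrite /= !add0r (npsq_ge0 (lexx 0)) subr0 normrN /npsq.
  have h0 : h != 0 by near: h; exact: nbhs_dnbhs_neq.
  have he : `|h| <= e.
    near: h; apply: dnbhs0_le => //.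
  apply: le_trans he; case: (leP h 0) => hs.
    by rewrite mulrN normrN expr2 mulKf.
  by rewrite expr0n oppr0 mulr0 normr0 normr_ge0.
Unshelve. all: by end_near.
Qed.

End Calculus.

Local Notation intI l f := ((@lebesgue_measure _).-integrable ([set` `]0, l[%R] : set (measurableTypeR _)) (EFin \o f)).
Local Notation RintI l f := (Rintegral (@lebesgue_measure _) ([set` `]0, l[%R] : set (measurableTypeR _)) f).

(** * Continuity on the open interval (0, l) *)

Section Interval.
Context {R : realType} (l : R).
Implicit Types f g : R -> R.

Lemma derivI_cont f f' : derivI l f f' -> contI l f.
Proof. by move=> df s sI; exact: isd_cont (df s sI). Qed.

Lemma contIV f : (forI l s, 0 < f s) -> contI l f ->
  contI l (fun s => (f s)^-1) /\ contI l (fun s => (f s ^+ 2)^-1).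
Proof.
move=> f0 cf; split=> s sI; have fs := f0 s sI; apply: continuousV; rewrite ?expf_eq0 ?gt_eqF//; first exact: cf.
by apply: continuousM; exact: cf.
Qed.

Lemma contI_cst c : contI l (fun=> c).
Proof. by move=> s _; exact: cvg_cst. Qed.

Lemma contID f g : contI l f -> contI l g -> contI l (fun s => f s + g s).
Proof. by move=> cf cg s sI; apply: continuousD; [exact: cf|exact: cg]. Qed.

Lemma contIN f : contI l f -> contI l (fun s => - f s).
Proof. by move=> cf s sI; apply: continuousN; exact: cf. Qed.

Lemma contIM f g : contI l f -> contI l g -> contI l (fun s => f s * g s).
Proof. by move=> cf cg s sI; apply: continuousM; [exact: cf|exact: cg]. Qed.

Lemma cont_upper_bound f (p q : R) : contI l f ->
  0 < p -> q < l -> exists2 M : R, 0 < M & forall s : R, p <= s <= q -> `|f s| <= M.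
Proof.
move=> cf p0 ql; have [pq|qp] := leP p q; last first.
  by exists 1 => // s /andP[h1 h2]; move: (lt_le_trans qp (le_trans h1 h2)); rewrite ltxx.
have sub (s : R) : p <= s <= q -> 0 < s < l.
  by move=> /andP[h1 h2]; rewrite (lt_le_trans p0 h1) (le_lt_trans h2 ql).
have cw : {within `[p, q], continuous (fun s => `|f s|)}.
  by apply: continuous_in_subspaceT => s; rewrite inE /= in_itv /= => /sub sI; apply: cvg_norm; exact: cf.
have [c cI Hc] := EVT_max pq cw; exists (`|f c| + 1); first by rewrite ltr_wpDl.
by move=> s sI; rewrite (le_trans (Hc s _))// ?in_itv// lerDl.
Qed.

Lemma segment_sub (p q : R) : 0 < p -> q < l -> `[p, q] `<=` `]0, l[.
Proof.
by move=> p0 ql s /=; rewrite !in_itv /= => /andP[h1 h2]; rewrite (lt_le_trans p0 h1) (le_lt_trans h2 ql).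
Qed.

Lemma le_of_eq (x y : R) : x = y -> x <= y.
Proof. by move->. Qed.

End Interval.

Ltac complex_ring := by apply/eqP; rewrite eq_complex /=; apply/andP; split; apply/eqP; ring.

(** Continuity of an arithmetic expression by recursion on its shape. There is no rule for
    quotients: inverses must be among the hypotheses, usually through [contIV], and local
    definitions are unfolded last. *)
Ltac cont_tac := repeat match goal with
  | H : contI _ ?f |- contI _ ?g => constr_eq f g; exact H
  | |- contI _ (fun s => @?f s + @?g s) => refine (contID (f := f) (g := g) _ _)
  | |- contI _ (fun s => - @?f s) => refine (contIN (f := f) _)
  | |- contI _ (fun s => @?f s * @?g s) => refine (contIM (f := f) (g := g) _ _)
  | |- contI _ (fun s => @?f s ^+ 2) => refine (contIM (f := f) (g := f) _ _)
  | |- contI _ (fun _ => ?c) => exact: contI_cst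
  | |- contI ?l (fun s => ?h s) => progress change (contI l h)
  | |- contI _ ?h => unfold h
  | H : contI _ ?f |- contI _ ?f => exact H
  end.

(** No limit at the ends is required, since weights and fluxes may degenerate there. The class is
    closed under products and uniform limits, which makes it the function space of the contraction
    arguments below. *)
Definition bdcont {R : realType} (l : R) (g : R -> R) :=
  (contI l g) /\
  exists K : R, forI l s, `|g s| <= K.

(** * Primitives of bounded continuous functions *)

Section Prim.
Context {R : realType} (l : R).
Notation mu := (@lebesgue_measure R).
Implicit Types (f g h : R -> R) (s t K L r x y p q e : R).

Lemma near_in (p q s : R) : p < s < q -> \forall t \near s, p < t < q.
Proof.
move=> /andP[s0 sl]; near=> t; apply/andP; split; near: t.
  exact: lt_nbhsr.
exact: lt_nbhsl.
Unshelve. all: by end_near. Qed.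

Lemma cont_near f g s : (\forall t \near s, f t = g t) ->
  {for s, continuous f} -> {for s, continuous g}.
Proof.
move=> fg fs; have E : f s = g s by exact: (nbhs_singleton fg).
have H : f x @[x --> s] --> g s by rewrite -E; exact: fs.
by apply: cvg_trans H; exact: near_eq_cvg.
Qed.

Lemma bdcont_bound g : bdcont l g -> exists2 K : R, 0 < K & forall s, 0 < s < l -> `|g s| <= K.
Proof.
move=> [_ [K HK]]; exists (`|K| + 1); first by rewrite ltr_wpDl.
by move=> s /HK /le_trans; apply; rewrite (le_trans (ler_norm _))// lerDl.
Qed.

Lemma bdcont_cst (k : R) : bdcont l (fun=> k).
Proof. by split=> [s _|]; [exact: cvg_cst|exists `|k|]. Qed.

Lemma bdcontD f g : bdcont l f -> bdcont l g -> bdcont l (fun s => f s + g s).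
Proof.
move=> [cf [K HK]] [cg [L HL]]; split=> [s sI|].
  by apply: continuousD; [exact: cf|exact: cg].
by exists (K + L) => s sI; rewrite (le_trans (ler_normD _ _))// lerD ?HK ?HL.
Qed.

Lemma bdcontN f : bdcont l f -> bdcont l (fun s => - f s).
Proof.
move=> [cf [K HK]]; split=> [s sI|].
  by apply: continuousN; exact: cf.
by exists K => s sI; rewrite normrN HK.
Qed.

Lemma bdcontB f g : bdcont l f -> bdcont l g -> bdcont l (fun s => f s - g s).
Proof. by move=> cf /bdcontN; exact: bdcontD. Qed.

Lemma bdcontM f g : bdcont l f -> bdcont l g -> bdcont l (fun s => f s * g s).
Proof.
move=> [cf [K HK]] [cg [L HL]]; split=> [s sI|].
  by apply: continuousM; [exact: cf|exact: cg].
by exists (K * L) => s sI; rewrite normrM ler_pM ?HK ?HL.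
Qed.

Lemma bdcontZ k f : bdcont l f -> bdcont l (fun s => k * f s).
Proof. exact: bdcontM (bdcont_cst k). Qed.

Lemma bdcontX f n : bdcont l f -> bdcont l (fun s => f s ^+ n).
Proof.
move=> Ef; elim: n => [|n IH]; first exact: bdcont_cst.
by under eq_fun do rewrite exprS; exact: bdcontM.
Qed.

Lemma bdcont_norm f : bdcont l f -> bdcont l (fun s => `|f s|).
Proof.
move=> [cf [K HK]]; split=> [s sI|].
  by apply: continuous_comp; [exact: cf|exact: norm_continuous].
by exists K => s sI; rewrite normr_id HK.
Qed.

Lemma bdcont_lip f K : (forall s t, 0 < s < l -> 0 < t < l -> `|f s - f t| <= K * `|s - t|) ->
  bdcont l f.
Proof.
move=> H; split=> [s sI|].
  apply/cvgrPdist_le => e e0; near=> t.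
  have tI : 0 < t < l by near: t; exact: near_in.
  apply: le_trans (H _ _ sI tI) _.
  have : `|s - t| <= e / (`|K| + 1).
    near: t; apply: cvgr_dist_le; first exact: cvg_id.
    by rewrite divr_gt0// ltr_wpDl.
  rewrite ler_pdivlMr ?ltr_wpDl// mulrC; apply: le_trans.
  by rewrite ler_wpM2r// (le_trans (ler_norm _))// lerDl.
have [l0|l0] := ltP 0 l; last first.
  by exists 0 => s /andP[s0 /(lt_trans s0)]; rewrite ltNge l0.
have hI : 0 < l / 2 < l by lra.
exists (`|f (l / 2)| + `|K| * l) => s sI.
rewrite -[f s](subrK (f (l / 2))) (le_trans (ler_normD _ _))// addrC lerD2l.
apply: le_trans (H _ _ sI hI) _.
apply: (@le_trans _ _ (`|K| * `|s - l / 2|)); first by rewrite ler_wpM2r// ler_norm.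
by rewrite ler_wpM2l// ler_norml; lra.
Unshelve. all: by end_near. Qed.

Lemma bdcont_isd f f' : (forall s, 0 < s < l -> isd f s (f' s)) ->
  (exists K, forI l s, `|f' s| <= K) -> bdcont l f.
Proof.
move=> H [K HK]; apply: (@bdcont_lip _ K) => s t sI tI.
exact: isd_lip sI tI.
Qed.

(** Uniform limits stay in the class, which closes the fixed-point sets used below. *)
Lemma bdcont_unif f : (forall e, 0 < e -> exists2 g, bdcont l g &
  forall s, 0 < s < l -> `|f s - g s| <= e) -> bdcont l f.
Proof.
move=> H; split=> [s sI|].
  apply/cvgrPdist_le => e e0.
  have [g [cg _] fg] := H (e / 3) ltac:(lra).
  near=> t.
  have tI : 0 < t < l by near: t; exact: near_in.
  have : `|g s - g t| <= e / 3.
    near: t; apply: cvgr_dist_le; first exact: cg.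
    by rewrite divr_gt0.
  have := fg _ sI; have := fg _ tI; rewrite !ler_norml; lra.
have [g [_ [K HK]] fg] := H 1 ltr01.
exists (1 + K) => s sI; rewrite -[f s](subrK (g s)).
by rewrite (le_trans (ler_normD _ _))// lerD ?fg ?HK.
Unshelve. all: by end_near. Qed.

(** Extending [g] by zero outside []0, l[] makes the primitive total: it vanishes for [s <= 0], and
    [prim g l] is the full integral whatever [g] does outside the interval. *)
Definition prim g s : R := \int[mu]_(t in `]0, s]) (g \_ `]0, l[) t.

Lemma bdcont_integrable g : bdcont l g -> mu.-integrable setT (EFin \o (g \_ `]0, l[)).
Proof.
move=> [cg [K HK]].
have -> : EFin \o g \_ `]0, l[ = (EFin \o g) \_ `]0, l[.
  by apply/funext => x; rewrite /= /patch; case: ifP.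
apply/(@integrable_mkcond _ _ _ mu `]0, l[) => //.
apply: measurable_bounded_integrable => //.
- by rewrite [X in (X < _)%E](lebesgue_measure_itv `]0, l[) /=; case: ifP => _; rewrite ?ltry.
- apply: open_continuous_measurable_fun; first exact: interval_open.
  by move=> s; rewrite inE /= in_itv /= => sI; exact: cg.
- exists K; split; first exact: num_real.
  by move=> L KL s /=; rewrite in_itv /= => sI; rewrite (le_trans (HK _ sI))// ltW.
Qed.

Lemma bdcont_integrableS g (A : set R) : measurable A -> bdcont l g ->
  mu.-integrable A (EFin \o (g \_ `]0, l[)).
Proof. by move=> mA /bdcont_integrable; apply: integrableS. Qed.

Lemma isd_prim g s : bdcont l g -> 0 < s < l -> isd (prim g) s (g s).
Proof.
move=> Eg sI; have [s0 sl] := andP sI.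
have H := @continuous_FTC1 R (g \_ `]0, l[) (BRight 0) s l sl
  (bdcont_integrableS _ Eg).
have [|||D E] := H _; first by [].
- by rewrite lte_fin.
- case: Eg => cg _; apply: (cont_near _ (cg _ sI)).
  near=> t; rewrite patchE mem_set//= in_itv/=; near: t; exact: near_in.
- apply: DeriveDef; first exact: D.
  rewrite -derive1E E patchE mem_set//= in_itv/=.
Unshelve. all: by end_near. Qed.

Lemma prim_le0 g s : s <= 0 -> prim g s = 0.
Proof.
move=> s0; rewrite /prim set_itv_ge ?Rintegral_set0//.
by rewrite bnd_simp -leNgt.
Qed.

Lemma primB g s t : bdcont l g -> 0 <= s <= t ->
  prim g t - prim g s = \int[mu]_(r in `]s, t]) (g \_ `]0, l[) r.
Proof.
move=> Eg /andP[s0 st]; rewrite /prim.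
rewrite Rintegral_itvB ?bnd_simp//; exact: bdcont_integrableS.
Qed.

Lemma prim_bound g K s t : bdcont l g -> 0 <= s <= t -> 0 <= K ->
  (forall r, 0 < r < l -> s <= r <= t -> `|g r| <= K) ->
  `|prim g t - prim g s| <= K * (t - s).
Proof.
move=> Eg st K0 H; rewrite primB//.
apply: le_trans (le_normr_Rintegral _ _) _ => //; first exact: bdcont_integrableS.
apply: (@le_trans _ _ (\int[mu]_(r in `]s, t]) K)).
  apply: le_Rintegral => //.
  - by have := bdcont_integrableS (A := `]s, t]) _ Eg; move=> /(_ ltac:(done)) /integrable_norm.
  - apply: measurable_bounded_integrable => //.
      by rewrite [X in (X < _)%E](lebesgue_measure_itv `]s, t]) /=; case: ifP => _; rewrite ?ltry.
    exists `|K|; split; first exact: num_real.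
    by move=> L /ltW KL r _.
  move=> r /=; rewrite in_itv /= => /andP[sr rt].
  rewrite patchE; case: ifP => [|_]; last by rewrite normr0.
  by rewrite inE /= in_itv /= => rI; apply: H => //; rewrite (ltW sr) rt.
rewrite Rintegral_cst// [X in K * fine X](lebesgue_measure_itv `]s, t]) /= lte_fin.
case: ifP => _ //=; rewrite mulr0 mulr_ge0// subr_ge0; by case/andP: st.
Qed.

Lemma prim_lip g K s t : bdcont l g -> 0 <= K -> (forall r, 0 < r < l -> `|g r| <= K) ->
  0 <= s -> 0 <= t -> `|prim g s - prim g t| <= K * `|s - t|.
Proof.
move=> Eg K0 H s0 t0; wlog st : s t s0 t0 / s <= t.
  move=> W; case: (leP s t) => [|/ltW] st; first exact: W.
  by rewrite distrC [`|s - t|]distrC; exact: W.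
rewrite distrC [`|s - t|]distrC (ger0_norm (_ : 0 <= t - s)) ?subr_ge0//.
by apply: prim_bound => //; rewrite ?s0// => r rI _; exact: H.
Qed.

Lemma primD f g s : bdcont l f -> bdcont l g ->
  prim (fun t => f t + g t) s = prim f s + prim g s.
Proof.
move=> Ef Eg; rewrite /prim -RintegralD//; try exact: bdcont_integrableS.
by apply: eq_Rintegral => t _; rewrite !patchE; case: ifP => //; rewrite addr0.
Qed.

Lemma primZ k f s : bdcont l f -> prim (fun t => k * f t) s = k * prim f s.
Proof.
move=> Ef; rewrite /prim -RintegralZl//; try exact: bdcont_integrableS.
by apply: eq_Rintegral => t _; rewrite !patchE; case: ifP => //; rewrite mulr0.
Qed.

Lemma primN f s : bdcont l f -> prim (fun t => - f t) s = - prim f s.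
Proof.
by move=> Ef; rewrite -mulN1r -primZ//; congr prim; apply/funext => t; rewrite mulN1r.
Qed.

Lemma prim_subr f g s : bdcont l f -> bdcont l g ->
  prim (fun t => f t - g t) s = prim f s - prim g s.
Proof. by move=> Ef Eg; rewrite primD ?primN//; exact: bdcontN. Qed.

Lemma le_prim f g s : bdcont l f -> bdcont l g -> (forall t, 0 < t < l -> f t <= g t) ->
  prim f s <= prim g s.
Proof.
move=> Ef Eg H; apply: le_Rintegral => //; try exact: bdcont_integrableS.
move=> r _; rewrite !patchE; case: ifP => //.
by rewrite inE /= in_itv /=; exact: H.
Qed.

Lemma eq_prim f g s : (forall t, 0 < t < l -> f t = g t) -> prim f s = prim g s.
Proof.
move=> H; apply: eq_Rintegral => r _; rewrite !patchE; case: ifP => //.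
by rewrite inE /= in_itv /=; exact: H.
Qed.

Lemma prim_cst0 s : prim (fun=> 0) s = 0.
Proof.
by rewrite -[RHS](mul0r (prim (fun=> 0) s)) -primZ ?mul0r//; exact: bdcont_cst.
Qed.

Lemma prim_ge0 f s : bdcont l f -> (forall t, 0 < t < l -> 0 <= f t) -> 0 <= prim f s.
Proof. by move=> Ef H; rewrite -(prim_cst0 s); apply: le_prim => //; exact: bdcont_cst. Qed.

(** A vanishing total integral would force the nondecreasing primitive of [f] to vanish on the whole
    interval, and with it its derivative [f t]. *)
Lemma prim_gt0 f t : bdcont l f -> (forall t, 0 < t < l -> 0 <= f t) ->
  0 < t < l -> 0 < f t -> 0 < prim f l.
Proof.
move=> Ef H /[dup] tI /andP[t0 tl] ft.
rewrite lt_neqAle prim_ge0// andbT; apply/negP => /eqP P0.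
have mono x y : 0 <= x -> x <= y -> prim f x <= prim f y.
  move=> x0 xy; rewrite -subr_ge0 primB ?x0//; apply: Rintegral_ge0 => r _.
  rewrite patchE; case: ifP => //; rewrite inE /= in_itv /=; exact: H.
have Z x : 0 < x < l -> prim f x = 0.
  move=> /andP[x0 xl]; apply/eqP; rewrite eq_le prim_ge0// andbT P0.
  by apply: mono; exact: ltW.
have D0 : isd (prim f) t 0.
  apply: (@isd_near _ (fun=> 0 : R)).
  by near=> r; rewrite Z//; near: r; exact: near_in.
by move: ft; rewrite (isd_uniq (isd_prim Ef tI) D0) ltxx.
Unshelve. all: by end_near. Qed.

End Prim.

(* The comparison clause makes [(int_0^s rho) / rho s] of order [s] at [0], and
   symmetrically at [l]. *)
Record weight {R : realType} (l : R) (rho : R -> R) : Prop := Weight {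
  weight_l : 0 < l;
  weight_bd : bdcont l rho;
  weight_gt0 : forI l s, 0 < rho s;
  weight_mono : exists2 K : R, 0 < K & forall s t : R, 0 < s < l -> 0 < t < l ->
    s <= t <= l / 2 \/ l / 2 <= t <= s -> rho s <= K * rho t }.

(* [x] solves [(rho x')' = rho F] on [(0, l)] with [rho x' = 0] at both ends. *)
Definition neumann {R : realType} (l : R) (rho F x : R -> R) := exists (y : R -> R) (K : R),
  [/\ forI l s, `|y s| <= K * Num.min s (l - s),
      derivI l x y &
      forI l s, isd (fun t => rho t * y t) s (rho s * F s)].

(** * The degenerate Neumann problem: comparison, flux, estimates, solvability *)

Section Neumann.
Context {R : realType} (l : R) (rho : R -> R).
Hypothesis W : weight l rho.
Implicit Types (F G f g h x y z w q : R -> R) (s t K M c d e : R).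

Let ll0 : 0 < l. Proof. exact: weight_l W. Qed.
Let rho0 s : 0 < s < l -> 0 < rho s. Proof. exact: (weight_gt0 W). Qed.
Let brho : bdcont l rho. Proof. exact: weight_bd W. Qed.

Lemma min_gt0 (s : R) : 0 < s < l -> 0 < Num.min s (l - s).
Proof. by move=> /andP[s0 sl]; rewrite lt_min s0 subr_gt0. Qed.

Lemma min_le (s : R) : Num.min s (l - s) <= l.
Proof. have l0 := weight_l W; rewrite ge_min; have [//|sl] := leP s l; rewrite /=; lra. Qed.

Lemma neumann_eq F G x z : (forI l s, F s = G s) ->
  (forI l s, x s = z s) -> neumann l rho F x -> neumann l rho G z.
Proof.
move=> FG xz [y [K [H1 H2 H3]]]; exists y, K; split=> // s sI.
- apply: (@isd_near _ x); last exact: H2.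
  by near=> t; apply: xz; near: t; exact: near_in.
- by rewrite -FG//; exact: H3.
Unshelve. all: by end_near. Qed.

Lemma neumannD F G x z : neumann l rho F x -> neumann l rho G z ->
  neumann l rho (fun s => F s + G s) (fun s => x s + z s).
Proof.
move=> [y [K [H1 H2 H3]]] [y' [K' [H1' H2' H3']]].
exists (fun s => y s + y' s), (K + K'); split=> s sI.
- by rewrite mulrDl (le_trans (ler_normD _ _))// lerD ?H1 ?H1'.
- by apply: isdD; [exact: H2|exact: H2'].
- under eq_fun do rewrite mulrDr; rewrite mulrDr.
  by apply: isdD; [exact: H3|exact: H3'].
Qed.

Lemma neumannZ c F x : neumann l rho F x ->
  neumann l rho (fun s => c * F s) (fun s => c * x s).
Proof.
move=> [y [K [H1 H2 H3]]]; exists (fun s => c * y s), (`|c| * K); split=> s sI.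
- by rewrite normrM -mulrA ler_wpM2l// H1.
- exact/isdZ/H2.
- have -> : (fun t => rho t * (c * y t)) = (fun t => c * (rho t * y t)).
    by apply/funext => t; ring.
  by rewrite mulrCA; exact/isdZ/H3.
Qed.

Lemma neumannB F G x z : neumann l rho F x -> neumann l rho G z ->
  neumann l rho (fun s => F s - G s) (fun s => x s - z s).
Proof.
move=> H /(neumannZ (-1)) H'; have := neumannD H H'.
by apply: neumann_eq => s _; rewrite mulN1r.
Qed.

Lemma neumann_cst c : neumann l rho (fun=> 0) (fun=> c).
Proof.
exists (fun=> 0), 0; split=> s sI.
- by rewrite normr0 mul0r.
- exact: isd_cst.
- under eq_fun do rewrite mulr0; rewrite mulr0; exact: isd_cst.
Qed.

Lemma neumann_bdcont F x : neumann l rho F x -> bdcont l x.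
Proof.
move=> [y [K [H1 H2 _]]]; apply: (bdcont_isd H2).
exists (`|K| * l) => s sI; apply: le_trans (H1 _ sI) _.
apply: (@le_trans _ _ (`|K| * Num.min s (l - s))).
  by rewrite ler_wpM2r ?ler_norm// ltW// min_gt0.
by rewrite ler_wpM2l// min_le.
Qed.

(* The flux [rho y] tends to [0] at both ends. *)
Lemma flux_bound y K : (forI l s, `|y s| <= K * Num.min s (l - s)) ->
  exists2 M : R, 0 < M & forI l s, `|rho s * y s| <= M * Num.min s (l - s).
Proof.
move=> H; have [L L0 HL] := bdcont_bound brho.
exists (L * (`|K| + 1)); first by rewrite mulr_gt0// ltr_wpDl.
move=> s sI; rewrite normrM -mulrA; apply: ler_pM => //; first exact: HL.
apply: le_trans (H _ sI) _; rewrite ler_wpM2r ?(ltW (min_gt0 sI))//.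
by rewrite (le_trans (ler_norm _))// lerDl.
Qed.

(* A monotone function tending to [0] at both ends vanishes. *)
Lemma ndecr_ends0 (f f' : R -> R) (M : R) : derivI l f f' ->
  (forI l s, 0 <= f' s) ->
  (forI l s, `|f s| <= M * Num.min s (l - s)) ->
  forI l s, f s = 0.
Proof.
move=> H H0 HM s sI; have [s0 sl] := andP sI.
have M0 : 0 <= M.
  have := le_trans (normr_ge0 _) (HM s sI).
  by rewrite pmulr_lge0// min_gt0.
apply/eqP; rewrite eq_le; apply/andP; split; apply/ler_addgt0Pr => e e0.
(* A point beyond [s] so close to [l] that the end bound [M (l - t)] is at most [e]; monotonicity
   carries the bound back to [s]. *)
- pose t := Num.max s (l - e / (M + 1)).
  have tI : 0 < t < l.
    by rewrite /t lt_max s0/= gt_max sl/= ltrBlDr ltrDl divr_gt0// ltr_wpDl.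
  have [t0 tl] := andP tI.
  have st : s <= t by rewrite /t le_max lexx.
  rewrite add0r; apply: le_trans (isd_ndecr H H0 s0 st tl) _.
  apply: le_trans (ler_norm _) _; apply: le_trans (HM _ tI) _.
  have : l - t <= e / (M + 1).
    by rewrite lerBlDr -lerBlDl /t le_max lexx orbT.
  rewrite ler_pdivlMr ?ltr_wpDl// mulrC => L.
  have : Num.min t (l - t) <= l - t by rewrite ge_min lexx orbT.
  nra.
- pose t := Num.min s (e / (M + 1)).
  have tI : 0 < t < l.
    by rewrite /t gt_min sl/= lt_min s0/= divr_gt0// ltr_wpDl.
  have [t0 tl] := andP tI.
  have st : t <= s by rewrite /t ge_min lexx.
  rewrite -lerBlDr sub0r; apply: le_trans (isd_ndecr H H0 t0 st sl).
  rewrite lerNl (le_trans (ler_norm _))// normrN; apply: le_trans (HM _ tI) _.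
  have : t <= e / (M + 1) by rewrite /t ge_min lexx orbT.
  rewrite ler_pdivlMr ?ltr_wpDl// mulrC => L.
  have : Num.min t (l - t) <= t by rewrite ge_min lexx.
  nra.
Qed.

(* [npsq w] times the flux is nondecreasing and vanishes at both ends, hence is
   constant; this replaces testing the equation against the negative part of [w]. *)
Lemma neumann_comparison F w : neumann l rho F w ->
  (forI l s, w s < 0 -> F s <= 0) ->
  ((forI l s, w s < 0) -> exists2 s : R, 0 < s < l & F s < 0) ->
  forI l s, 0 <= w s.
Proof.
move=> N F0 Fneg s sI; rewrite leNgt; apply/negP => ws.
have [_ [L HL]] := neumann_bdcont N.
have [y [K [H1 H2 H3]]] := N.
have [M M0 HM] := flux_bound H1.
pose H t := rho t * y t * npsq (w t).
pose H' t := rho t * F t * npsq (w t) + rho t * y t * (- 2 * Num.min (w t) 0 * y t).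
have dH t : 0 < t < l -> isd H t (H' t).
  move=> tI; apply: isdM; first exact: H3.
  by apply: isd_comp; [exact: H2|exact: isd_npsq].
have T1 t : 0 < t < l -> 0 <= rho t * F t * npsq (w t).
  move=> tI; have r0 := rho0 tI.
  have [w0|w0] := leP 0 (w t); first by rewrite npsq_ge0// mulr0.
  by rewrite mulr_le0// ?npsq_le0// pmulr_rle0// F0.
have T2 t : 0 < t < l -> 0 <= rho t * y t * (- 2 * Num.min (w t) 0 * y t).
  move=> tI; have r0 := rho0 tI.
  have : Num.min (w t) 0 <= 0 by rewrite ge_min lexx orbT.
  move=> m0; rewrite (_ : _ * _ = 2 * rho t * - Num.min (w t) 0 * y t ^+ 2); last by ring.
  by rewrite mulr_ge0 ?sqr_ge0// mulr_ge0 ?oppr_ge0// mulr_ge0// ltW.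
have H'0 t : 0 < t < l -> 0 <= H' t by move=> tI; rewrite addr_ge0 ?T1 ?T2.
have HL2 t : 0 < t < l -> `|npsq (w t)| <= L ^+ 2.
  move=> tI; rewrite /npsq normrN normrX lerXn2r ?nnegrE ?(le_trans (normr_ge0 _) (HL _ tI))//.
  case: (leP (w t) 0) => _; first exact: HL.
  by rewrite normr0 (le_trans (normr_ge0 _) (HL _ tI)).
have E0 : forall t, 0 < t < l -> H t = 0.
  apply: (@ndecr_ends0 _ _ (M * L ^+ 2)) dH H'0 _ => t tI.
  by rewrite /H normrM mulrAC ler_pM ?HM ?HL2.
have E1 t : 0 < t < l -> H' t = 0.
  move=> tI; apply: (isd_uniq (dH t tI)); apply: (@isd_near _ (fun=> 0 : R)).
  by near=> r; rewrite E0//; near: r; exact: near_in.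
(* Both nonnegative summands of [H'] now vanish. Where [w < 0] this kills the flux and the source,
   so [npsq (w t)] is constant, [w] is negative everywhere and the source cannot be strictly
   negative anywhere. *)
have Ey t : 0 < t < l -> w t < 0 -> y t = 0.
  move=> tI wt; have := E1 t tI; rewrite /H' => /eqP; rewrite paddr_eq0 ?T1 ?T2//.
  move=> /andP[_]; rewrite (min_idPl (ltW wt)) !mulf_eq0 (gt_eqF (rho0 tI)) oppr_eq0 /=.
  by rewrite pnatr_eq0 (lt_eqF wt) /= orbb => /eqP.
have EF t : 0 < t < l -> w t < 0 -> F t = 0.
  move=> tI wt; have := E1 t tI; rewrite /H' => /eqP; rewrite paddr_eq0 ?T1 ?T2//.
  move=> /andP[+ _]; rewrite !mulf_eq0 (gt_eqF (rho0 tI)) /= => /orP[/eqP//|].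
  by rewrite (lt_eqF (npsq_lt0 wt)).
have C t : 0 < t < l -> npsq (w s) = npsq (w t).
  move=> tI; apply: (@isd_const _ (fun r => npsq (w r)) 0 l) => // r rI.
  apply: isd_eqd (isd_comp (H2 r rI) (isd_npsq _)) _.
  have [w0|w0] := ltP (w r) 0; first by rewrite Ey// mulr0.
  by rewrite mulr0 mul0r.
have wneg t : 0 < t < l -> w t < 0.
  move=> tI; rewrite ltNge; apply/negP => wt.
  by have := npsq_lt0 ws; rewrite (C t tI) npsq_ge0// ltxx.
have [t tI] := Fneg wneg.
by rewrite EF ?ltxx// wneg.
Unshelve. all: by end_near. Qed.

(** [rho y] and the primitive of [rho F] have the same derivative and both tend to 0 at [0], so they
    coincide; letting [s] tend to [l] gives the compatibility condition of a Neumann problem. *)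
Lemma neumann_flux F y K : bdcont l F ->
  (forI l s, `|y s| <= K * Num.min s (l - s)) ->
  (forI l s, isd (fun t => rho t * y t) s (rho s * F s)) ->
  prim l (fun s => rho s * F s) l = 0 /\
  forI l s, rho s * y s = prim l (fun t => rho t * F t) s.
Proof.
move=> bF H1 H3; have bG := bdcontM brho bF.
have [M M0 HM] := flux_bound H1.
have [L L0 HL] := bdcont_bound bG.
pose P := prim l (fun s => rho s * F s).
have l0 := weight_l W; have hl : 0 < l / 2 < l by lra.
have C s : 0 < s < l -> rho s * y s - P s = rho (l / 2) * y (l / 2) - P (l / 2).
  move=> sI; apply: (@isd_const _ (fun s => rho s * y s - P s) 0 l) => // r rI.
  by apply: isd_eqd (isdB (H3 r rI) (isd_prim bG rI)) _; rewrite subrr.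
set c := rho (l / 2) * y (l / 2) - P (l / 2) in C.
have small e : 0 < e -> exists2 d : R, 0 < d <= l / 2 & (M + L) * d <= e.
  move=> e0; exists (Num.min (l / 2) (e / (M + L))).
    apply/andP; split; last by rewrite ge_min lexx.
    by rewrite lt_min !divr_gt0 ?addr_gt0.
  rewrite -ler_pdivlMl ?addr_gt0// [_^-1 * e]mulrC.
  by rewrite ge_min lexx orbT.
have c0 : c = 0.
  apply/eqP; rewrite -normr_le0; apply/ler_addgt0Pr => e e0; rewrite add0r.
  have [d /andP[d0 dl] de] := small e e0.
  have dI : 0 < d < l by lra.
  rewrite -(C d dI); apply: le_trans de; apply: le_trans (ler_normB _ _) _.
  rewrite mulrDl lerD//.
    apply: le_trans (HM _ dI) _; rewrite ler_wpM2l ?(ltW M0)// ge_min lexx//.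
  have := @prim_lip _ l _ L d 0 bG (ltW L0) HL (ltW d0) (lexx 0).
  by rewrite (prim_le0 _ _ (lexx 0)) !subr0 (gtr0_norm d0).
have E s : 0 < s < l -> rho s * y s = P s.
  by move=> sI; have := C s sI; rewrite c0 => /eqP; rewrite subr_eq0 => /eqP.
split=> //; apply/eqP; rewrite -normr_le0; apply/ler_addgt0Pr => e e0; rewrite add0r.
have [d /andP[d0 dl] de] := small e e0.
have dI : 0 < l - d < l by lra.
have -> : prim l (fun s => rho s * F s) l = P (l - d) - (P (l - d) - P l) by rewrite /P; ring.
apply: le_trans de; apply: le_trans (ler_normB _ _) _.
rewrite mulrDl lerD//.
  rewrite -E//; apply: le_trans (HM _ dI) _; rewrite ler_wpM2l ?(ltW M0)//.
  by rewrite subKr ge_min lexx orbT.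
have := @prim_lip _ l _ L (l - d) l bG (ltW L0) HL ltac:(lra) (ltW l0).
by rewrite [l - d - l](_ : _ = - d) ?normrN ?(gtr0_norm d0)//; lra.
Qed.

(** The flux at [s] is an integral from the nearer end, over which the comparison clause of [weight]
    bounds [rho] by a multiple of [rho s]. The vanishing total integral is what permits integrating
    from [l] in the right half. *)
Lemma weight_bound : exists2 K : R, 0 < K & forall (F : R -> R) (M : R), bdcont l F ->
  prim l (fun s => rho s * F s) l = 0 -> (forI l s, `|F s| <= M) ->
  forI l s, `|prim l (fun t => rho t * F t) s| <= K * M * Num.min s (l - s) * rho s.
Proof.
have [K K0 HK] := weight_mono W; exists K => // F M bF F0 HM s sI.
have [s0 sl] := andP sI.
have M0 : 0 <= M by exact: le_trans (normr_ge0 _) (HM s sI).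
have bG := bdcontM brho bF.
have rs := rho0 sI.
have Q0 : 0 <= K * rho s * M by rewrite !mulr_ge0// ltW.
have [h|h] := leP s (l / 2).
- rewrite (min_idPl _); last by lra.
  have := @prim_bound _ l _ (K * rho s * M) 0 s bG; rewrite lexx (prim_le0 _ _ (lexx 0)) !subr0.
  move=> /(_ (ltW s0) Q0) H.
  rewrite (_ : K * M * s * rho s = K * rho s * M * s); last by ring.
  apply: H => r rI /andP[_ rs']; rewrite normrM (gtr0_norm (rho0 rI)).
  by apply: ler_pM; rewrite ?(ltW (rho0 rI))// ?HM// HK//; left; rewrite rs'.
- rewrite (min_idPr _); last by lra.
  have := @prim_bound _ l _ (K * rho s * M) s l bG; rewrite F0 sub0r normrN.
  rewrite (ltW s0) (ltW sl) => /(_ isT Q0) H.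
  rewrite (_ : K * M * (l - s) * rho s = K * rho s * M * (l - s)); last by ring.
  apply: H => r rI /andP[rs' _]; rewrite normrM (gtr0_norm (rho0 rI)).
  by apply: ler_pM; rewrite ?(ltW (rho0 rI))// ?HM// HK//; right; rewrite rs' ltW.
Qed.

(** Dividing the flux bound by [rho] bounds [x'] by the distance to the ends. The constant depends
    on the weight alone, as the contraction arguments require. *)
Lemma neumann_estimate : exists2 K : R, 0 < K & forall (F x : R -> R) (M : R), bdcont l F ->
  neumann l rho F x -> (forI l s, `|F s| <= M) ->
  (forall s d : R, 0 < s < l -> isd x s d -> `|d| <= K * M * Num.min s (l - s)) /\
  (forall s t : R, 0 < s < l -> 0 < t < l -> `|x s - x t| <= K * M * l * `|s - t|).
Proof.
have [K K0 HK] := weight_bound; exists K => // F x M bF N HM.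
have [y [L [H1 H2 H3]]] := N.
have [F0 E] := neumann_flux bF H1 H3.
have B s : 0 < s < l -> `|y s| <= K * M * Num.min s (l - s).
  move=> sI; have rs := rho0 sI; rewrite -(ler_pM2r rs).
  by have := HK _ _ bF F0 HM s sI; rewrite -E// normrM (gtr0_norm rs) [rho s * _]mulrC.
split=> [s d sI D|s t sI tI]; first by rewrite (isd_uniq D (H2 _ sI)) B.
apply: (isd_lip H2) sI tI => r rI; apply: le_trans (B r rI) _.
have M0 : 0 <= M by exact: le_trans (normr_ge0 _) (HM r rI).
by rewrite ler_wpM2l ?min_le// mulr_ge0// ltW.
Qed.

Lemma neumann_exists F : bdcont l F -> prim l (fun s => rho s * F s) l = 0 ->
  exists x, neumann l rho F x.
Proof.
move=> bF F0; have [K K0 HK] := weight_bound.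
have bG := bdcontM brho bF.
have [M M0 HM] := bdcont_bound bF.
pose y s := prim l (fun t => rho t * F t) s / rho s.
have Hy s : 0 < s < l -> `|y s| <= K * M * Num.min s (l - s).
  move=> sI; have rs := rho0 sI.
  by rewrite /y normf_div (gtr0_norm rs) ler_pdivrMr//; exact: HK.
have by_ : bdcont l y.
  split=> [s sI|].
    apply: continuousM; first exact: isd_cont (isd_prim bG sI).
    by apply: continuousV; [rewrite gt_eqF// rho0|case: brho => + _; exact].
  exists (K * M * l) => s sI; apply: le_trans (Hy _ sI) _.
  by rewrite ler_wpM2l ?min_le// mulr_ge0// ltW.
exists (prim l y), y, (K * M); split=> // s sI; first exact: isd_prim.
apply: (@isd_near _ (prim l (fun t => rho t * F t))); last exact: isd_prim.
near=> t; rewrite /y mulrC divfK// gt_eqF// rho0//; near: t; exact: near_in.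
Unshelve. all: by end_near. Qed.

End Neumann.

(** * Contractions in the uniform norm *)

Section Contraction.
Context {R : realType} (l : R).

Lemma exists_half_pow (c e : R) : 0 < e -> exists n : nat, c / 2 ^+ n <= e.
Proof.
move=> e0; exists (Num.bound `|c / e|).
rewrite ler_pdivrMr ?exprn_gt0// mulrC -ler_pdivrMr//.
apply: le_trans (ler_norm _) _; apply: le_trans (ltW (archi_boundP (normr_ge0 _))) _.
by rewrite -natrX ler_nat; exact/ltnW/ltn_expl.
Qed.

(** Iteration with ratio 1/2 in the uniform norm of [(0, l)]. The predicate [B] stands for a closed
    set; values outside the interval are not compared, hence closedness is phrased through uniform
    approximation on the interval. *)
Lemma contraction_fixpoint (B : (R -> R) -> Prop) (Phi : (R -> R) -> R -> R)
    (x0 : R -> R) (K0 : R) : B x0 -> (forall x, B x -> B (Phi x)) ->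
  (forall u : R -> R, (forall e : R, 0 < e -> exists2 x : R -> R, B x &
     forI l s, `|u s - x s| <= e) -> B u) ->
  0 <= K0 ->
  (forI l s, `|Phi x0 s - x0 s| <= K0) ->
  (forall (x z : R -> R) (K : R), B x -> B z ->
    (forI l s, `|x s - z s| <= K) ->
    forI l s, `|Phi x s - Phi z s| <= K / 2) ->
  exists x : R -> R, [/\ B x, forI l s, Phi x s = x s &
    forI l s, `|x s - x0 s| <= 2 * K0].
Proof.
move=> B0 BP Bcl K00 H0 HC.
pose u n := iter n Phi x0.
have Bu n : B (u n) by elim: n => //= n; exact: BP.
have du n (s : R) : 0 < s < l -> `|u n.+1 s - u n s| <= K0 / 2 ^+ n.
  elim: n s => [s sI|n IH s sI]; first by rewrite expr0 divr1; exact: H0.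
  apply: le_trans (HC _ _ _ (Bu n.+1) (Bu n) IH s sI) _.
  by rewrite exprSr invfM mulrA.
have half n : K0 / 2 ^+ n.+1 = K0 / 2 ^+ n / 2 by rewrite exprSr invfM mulrA.
have tel n k (s : R) : 0 < s < l -> `|u (n + k)%N s - u n s| <= 2 * (K0 / 2 ^+ n) - 2 * (K0 / 2 ^+ (n + k)).
  move=> sI; elim: k => [|k IH]; first by rewrite addn0 !subrr normr0.
  have := du (n + k)%N s sI; have := IH; rewrite addnS half !ler_norml; lra.
have pos n : 0 <= K0 / 2 ^+ n by rewrite divr_ge0// exprn_ge0.
have tel2 n k (s : R) : 0 < s < l -> `|u k s - u n s| <= 2 * (K0 / 2 ^+ n) + 2 * (K0 / 2 ^+ k).
  move=> sI; have := pos n; have := pos k => p1 p2.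
  have [nk|/ltnW kn] := leqP n k.
    have := tel n (k - n)%N s sI; rewrite subnKC//; move/le_trans; apply; lra.
  have := tel k (n - k)%N s sI; rewrite subnKC// distrC; move/le_trans; apply; lra.
(* The limit is built pointwise as the supremum of the lower bounds [u n s - 2 K0 / 2^n]; by [tel2]
   each [u n s + 2 K0 / 2^n] is an upper bound of this set. *)
pose S s := [set u n s - 2 * (K0 / 2 ^+ n) | n in @setT nat].
pose x s := sup (S s).
have Hx n (s : R) : 0 < s < l -> `|x s - u n s| <= 2 * (K0 / 2 ^+ n).
  move=> sI.
  have ub : ubound (S s) (u n s + 2 * (K0 / 2 ^+ n)).
    move=> _ [k _ <-]; have := tel2 n k s sI; rewrite ler_norml; lra.
  rewrite ler_distlC; apply/andP; split; last first.
    rewrite -lerBlDr; apply: ub_le_sup; first by exists (u n s + 2 * (K0 / 2 ^+ n)).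
    by exists n.
  rewrite lerBlDr; apply: ge_sup => //; by exists (u 0%N s - 2 * (K0 / 2 ^+ 0)), 0%N.
have Bx : B x.
  apply: Bcl => e e0; have [n Hn] := exists_half_pow (2 * K0) e0.
  exists (u n) => // s sI; apply: le_trans (Hx n s sI) _.
  by rewrite mulrA.
exists x; split=> // s sI; last first.
  by have := Hx 0%N s sI; rewrite expr0 divr1.
apply/eqP; rewrite -subr_eq0 -normr_le0; apply/ler_addgt0Pr => e e0; rewrite add0r.
have [n Hn] := exists_half_pow (2 * K0) e0.
have H1 := HC _ _ _ Bx (Bu n) (Hx n) s sI.
have H2 := Hx n.+1 s sI; rewrite half in H2.
rewrite -mulrA in Hn.
rewrite (_ : Phi x s - x s = (Phi x s - Phi (u n) s) - (x s - u n.+1 s)); last by rewrite /u iterS; ring.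
apply: le_trans (ler_normB _ _) _; move: H1 H2; lra.
Qed.

Lemma bdcont_fixpoint (Phi : (R -> R) -> R -> R) :
  (forall x, bdcont l x -> bdcont l (Phi x)) ->
  (forall (x y : R -> R) (L : R), bdcont l x -> bdcont l y ->
    (forI l s, `|x s - y s| <= L) ->
    forI l s, `|Phi x s - Phi y s| <= L / 2) ->
  exists2 x, bdcont l x & forI l s, Phi x s = x s.
Proof.
move=> bPhi H; have [M M0 HM] := bdcont_bound (bPhi _ (bdcont_cst l (0 : R))).
have [||||x [bx xE _]] := @contraction_fixpoint (bdcont l) Phi (fun=> 0) M _ _ _ (ltW M0) _ H; last by exists x.
- exact: bdcont_cst.
- exact: bPhi.
- exact: bdcont_unif.
- by move=> s sI; rewrite subr0 HM.
Qed.

End Contraction.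

(** * Linear Neumann problems with a nonnegative potential *)

Section LinearNeumann.
Context {R : realType} (l : R) (rho : R -> R).
Hypothesis W : weight l rho.

Let S := prim l rho l.

Lemma prim_weight_gt0 : 0 < S.
Proof.
have l0 := weight_l W.
apply: (@prim_gt0 _ _ _ (l / 2)); first exact: weight_bd W.
- by move=> t tI; rewrite ltW// (weight_gt0 W).
- lra.
- by apply: (weight_gt0 W); lra.
Qed.

(* Barrier: [ps + th], where [(rho ps')' = rho (q th - 1)] and [th = S / prim (rho q) l]. *)
Lemma linear_neumann_estimate (Qm m : R) : 0 < m -> exists2 B : R, 0 < B &
  forall q : R -> R, bdcont l q -> (forI l s, 0 <= q s <= Qm) ->
    m <= prim l (fun s => rho s * q s) l ->
  forall (g x : R -> R) (M : R), bdcont l g ->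
    neumann l rho (fun s => q s * x s - g s) x ->
    (forI l s, `|g s| <= M) ->
    forI l s, `|x s| <= B * M.
Proof.
move=> m0; have l0 := weight_l W; have S0 := prim_weight_gt0.
have brho := weight_bd W.
have [K K0 HK] := neumann_estimate W.
pose th := S / m; have th0 : 0 < th by rewrite divr_gt0.
have hl : 0 < l / 2 < l by lra.
(* Bounds the oscillation of the auxiliary solution [ph] over the interval, uniformly in the
   admissible [q]. *)
pose Kp := K * (`|Qm| * th + 1) * l * l.
have Kp0 : 0 < Kp by rewrite !mulr_gt0// ltr_wpDl// mulr_ge0// ltW.
exists (2 * Kp + th); first by rewrite addr_gt0// mulr_gt0.
move=> q bq qQ mq.
have bQ : bdcont l (fun s => rho s * q s) by exact: bdcontM.
set I := prim l _ l in mq.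
have I0 : 0 < I by exact: lt_le_trans mq.
pose tq := S / I.
have tq0 : 0 < tq by rewrite divr_gt0.
have tqth : tq <= th by rewrite /tq /th ler_pM2l// lef_pV2.
have bF : bdcont l (fun s => tq * q s - 1).
  by apply: bdcontB; [exact: bdcontZ|exact: bdcont_cst].
have [ph Hph] : exists ph, neumann l rho (fun s => tq * q s - 1) ph.
  apply: neumann_exists => //.
  rewrite (eq_prim (g := fun s => tq * (rho s * q s) - rho s)); last by move=> s _; ring.
  rewrite prim_subr ?primZ//; last exact: bdcontZ.
  by rewrite -/I -/S /tq divfK ?subrr// gt_eqF.
have FM (s : R) : 0 < s < l -> `|tq * q s - 1| <= `|Qm| * th + 1.
  move=> sI; apply: le_trans (ler_normB _ _) _; rewrite normr1 lerD2r normrM mulrC.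
  have /andP[q0 q1] := qQ s sI.
  apply: ler_pM => //; last by rewrite gtr0_norm.
  by rewrite (ger0_norm q0) (le_trans q1)// ler_norm.
have [_ Lph] := HK _ _ _ bF Hph FM.
have Pb (s : R) : 0 < s < l -> `|ph s - ph (l / 2)| <= Kp.
  move=> sI; apply: le_trans (Lph _ _ sI hl) _; rewrite /Kp ler_wpM2l//.
    by rewrite !mulr_ge0 ?ltW// ltr_wpDl// mulr_ge0// ltW.
  by rewrite ler_norml; lra.
have main (g x : R -> R) (M : R) : bdcont l g ->
    neumann l rho (fun s => q s * x s - g s) x ->
    (forI l s, `|g s| <= M) ->
    forI l s, x s <= (2 * Kp + th) * M.
  move=> bg Nx gM s sI.
  have M0 : 0 <= M by exact: le_trans (normr_ge0 _) (gM s sI).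
  (* The shift gives [M tq <= b <= (2 Kp + th) M]. Where [x] exceeds [b], one has [q x >= M tq q],
     so the source of [b - x] is at most [g - M <= 0] and comparison applies. *)
  pose b (s : R) := M * (ph s - ph (l / 2) + Kp + tq).
  have Nb : neumann l rho (fun s => M * (tq * q s - 1)) b.
    have := neumannZ M (neumannD Hph (neumann_cst l rho (- ph (l / 2) + Kp + tq))).
    by apply: neumann_eq => t _; rewrite ?addr0// /b; ring.
  have bge (t : R) : 0 < t < l -> M * tq <= b t.
    by move=> tI; rewrite /b ler_wpM2l//; have := Pb t tI; rewrite ler_norml; lra.
  have ble (t : R) : 0 < t < l -> b t <= (2 * Kp + th) * M.
    by move=> tI; rewrite /b mulrC ler_wpM2r//; have := Pb t tI; rewrite ler_norml; lra.
  have Nw := neumannB Nb Nx.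
  have := neumann_comparison W Nw; move=> C.
  rewrite (le_trans _ (ble s sI))// -subr_ge0; apply: C => //.
    move=> t tI; have := bge t tI; have /andP[q0 _] := qQ t tI.
    have := gM t tI; rewrite ler_norml; nra.
  move=> wneg.
  have [t tI qt] : exists2 t : R, 0 < t < l & 0 < q t.
    apply: contrapT => Hn; move: I0.
    rewrite /I (eq_prim (g := fun=> 0)) ?prim_cst0 ?ltxx//.
    move=> t tI; have /andP[q0 _] := qQ t tI.
    have [/eqP ->|q1] := boolP (q t == 0); first by rewrite mulr0.
    by exfalso; apply: Hn; exists t => //; rewrite lt0r q1.
  exists t => //; have := bge t tI; have := wneg t tI; have := gM t tI.
  rewrite ler_norml; nra.
move=> g x M bg Nx gM s sI; rewrite ler_norml (main g)// andbT.
rewrite lerNl; apply: (main (fun s => - g s) (fun s => - x s)) => //.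
- exact: bdcontN.
- have := neumannZ (-1) Nx; apply: neumann_eq => t _; ring.
- by move=> t tI; rewrite normrN gM.
Qed.

Definition linear_solvable (q : R -> R) := forall g : R -> R, bdcont l g ->
  exists x, neumann l rho (fun s => q s * x s - g s) x.

(** A constant potential [k] so small that the mean-free part of [k x - g] defines a contraction;
    the mean of the equation is satisfied afterwards by adding a constant to the fixed point. This
    is the starting point of the continuation in the potential. *)
Lemma small_linear_solvable : exists2 k : R, 0 < k & linear_solvable (fun=> k).
Proof.
have l0 := weight_l W; have S0 := prim_weight_gt0; have brho := weight_bd W.
have [K K0 HK] := neumann_estimate W.
have hl : 0 < l / 2 < l by lra.
(* Makes [K (2 k) l^2 = 1/2], the contraction ratio below. *)
pose k := (4 * K * l * l)^-1.
have k0 : 0 < k by rewrite invr_gt0 !mulr_gt0.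
exists k => // g bg.
pose mean x := prim l (fun s => rho s * x s) l / S.
have meanB (x z : R -> R) : bdcont l x -> bdcont l z -> mean x - mean z = mean (fun s => x s - z s).
  move=> bx bz; rewrite /mean -mulrBl -prim_subr; try exact: bdcontM.
  by congr (_ / S); apply: eq_prim => s _; ring.
have mean_le (x : R -> R) (M : R) : bdcont l x -> (forI l s, `|x s| <= M) -> `|mean x| <= M.
  move=> bx xM; rewrite ler_norml /mean ler_pdivlMr// ler_pdivrMr// -!primZ//.
  apply/andP; split; apply: le_prim; do ?[exact: bdcontM|exact: bdcontZ].
    move=> t tI; have := weight_gt0 W tI; have := xM t tI; rewrite ler_norml; nra.
  move=> t tI; have := weight_gt0 W tI; have := xM t tI; rewrite ler_norml; nra.
pose F (x : R -> R) := fun s : R => k * (x s - mean x) - (g s - mean g).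
have bF x : bdcont l x -> bdcont l (F x).
  move=> bx; apply: bdcontB; first apply: bdcontZ.
    by apply: bdcontB => //; exact: bdcont_cst.
  by apply: bdcontB => //; exact: bdcont_cst.
have F0 x : bdcont l x -> prim l (fun s => rho s * F x s) l = 0.
  move=> bx.
  have E (h : R -> R) : bdcont l h -> prim l (fun s => rho s * (h s - mean h)) l = 0.
    move=> bh; rewrite (eq_prim (g := fun s => rho s * h s - mean h * rho s)); last by move=> t _; ring.
    rewrite prim_subr; [|exact: bdcontM|exact: bdcontZ].
    by rewrite primZ// -/S /mean divfK ?subrr// gt_eqF.
  rewrite (eq_prim (g := fun s => k * (rho s * (x s - mean x)) - rho s * (g s - mean g))); last first.
    by move=> t _; rewrite /F; ring.
  have b1 (h : R -> R) : bdcont l h -> bdcont l (fun s => rho s * (h s - mean h)).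
    by move=> bh; apply: bdcontM => //; apply: bdcontB => //; exact: bdcont_cst.
  rewrite prim_subr; [|by apply: bdcontZ; exact: b1|exact: b1].
  by rewrite primZ; [rewrite !E// mulr0 subr0|exact: b1].
(* The default [x] outside [bdcont] only serves to obtain a total map from the axiom of choice. *)
have ex x : exists z : R -> R, bdcont l x -> neumann l rho (F x) z /\ z (l / 2) = 0.
  have [bx|nbx] := pselect (bdcont l x); last by exists x.
  have [z Nz] := neumann_exists W (bF x bx) (F0 x bx).
  exists (fun s => z s - z (l / 2)) => _; split; last by rewrite subrr.
  have := neumannB Nz (neumann_cst l rho (z (l / 2))).
  by apply: neumann_eq => t _; rewrite ?subr0.
have [Phi HPhi] := choice ex.
have bPhi x : bdcont l x -> bdcont l (Phi x).
  by move=> /HPhi[/(neumann_bdcont W)].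
have [|x bx xE] := bdcont_fixpoint bPhi.
  move=> x z L bx bz xzL s sI.
  have [Nx x0] := HPhi x bx; have [Nz z0] := HPhi z bz.
  have N := neumannB Nx Nz.
  have bFF : bdcont l (fun s => F x s - F z s) by apply: bdcontB; exact: bF.
  have FL (t : R) : 0 < t < l -> `|F x t - F z t| <= k * (2 * L).
    move=> tI; rewrite /F (_ : _ - _ = k * ((x t - z t) - (mean x - mean z))); last by ring.
    rewrite normrM (gtr0_norm k0) ler_wpM2l ?(ltW k0)//.
    apply: le_trans (ler_normB _ _) _; rewrite mulr_natl mulr2n lerD//; first exact: xzL.
    by rewrite meanB//; apply: mean_le => //; exact: bdcontB.
  have [_ H] := HK _ _ _ bFF N FL.
  have := H _ _ sI hl; rewrite x0 z0 subrr subr0 => /le_trans; apply.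
  have L0 : 0 <= L by exact: le_trans (normr_ge0 _) (xzL s sI).
  have D : `|s - l / 2| <= l by rewrite ler_norml; lra.
  apply: (@le_trans _ _ (K * (k * (2 * L)) * l * l)).
    by rewrite ler_wpM2l// !mulr_ge0// ltW.
  rewrite (_ : K * (k * (2 * L)) * l * l = L / 2)//.
  by rewrite /k; field; rewrite !gt_eqF.
have [Nx _] := HPhi x bx.
exists (fun s => Phi x s + (mean g / k - mean x)).
have := neumannD Nx (neumann_cst l rho (mean g / k - mean x)).
apply: neumann_eq => // s sI; rewrite addr0 /F xE//.
by field; rewrite gt_eqF.
Qed.

(** The difference of potentials is moved to the right-hand side; with the a priori bound [B], a
    change of size at most [1 / (2 B)] gives a contraction of ratio 1/2. *)
Lemma perturb_linear_solvable (q0 q : R -> R) (B : R) : 0 < B ->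
  bdcont l q0 -> bdcont l q -> linear_solvable q0 ->
  (forall (g x : R -> R) (M : R), bdcont l g ->
    neumann l rho (fun s => q0 s * x s - g s) x ->
    (forI l s, `|g s| <= M) ->
    forI l s, `|x s| <= B * M) ->
  (forI l s, `|q s - q0 s| <= (2 * B)^-1) ->
  linear_solvable q.
Proof.
move=> B0 bq0 bq S0 est qq g bg.
have bG x : bdcont l x -> bdcont l (fun s => g s + (q0 s - q s) * x s).
  by move=> bx; apply: bdcontD => //; apply: bdcontM => //; exact: bdcontB.
have ex x : exists z : R -> R, bdcont l x ->
    neumann l rho (fun s => q0 s * z s - (g s + (q0 s - q s) * x s)) z.
  have [bx|nbx] := pselect (bdcont l x); last by exists x.
  have [z Nz] := S0 _ (bG x bx).
  by exists z.
have [Phi HPhi] := choice ex.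
have bPhi x : bdcont l x -> bdcont l (Phi x).
  by move=> /HPhi/(neumann_bdcont W).
have [|x bx xE] := bdcont_fixpoint bPhi.
  move=> x z L bx bz xzL s sI.
  have N := neumannB (HPhi x bx) (HPhi z bz).
  have := est (fun s => (q0 s - q s) * (x s - z s)) (fun s => Phi x s - Phi z s) ((2 * B)^-1 * L).
  move=> /(_ _ _ _ s sI) H; rewrite (_ : L / 2 = B * ((2 * B)^-1 * L)); last first.
    by field; rewrite gt_eqF.
  apply: H.
  + by apply: bdcontM; exact: bdcontB.
  + by move: N; apply: neumann_eq => t _ //; ring.
  + by move=> t tI; rewrite normrM ler_pM// ?xzL// distrC qq.
exists (Phi x); have := HPhi x bx; apply: neumann_eq => // s sI; rewrite xE//; ring.
Qed.

(** Continuation along [k + t (q - k)]: all these potentials are nonnegative, at most [Q + k], and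
    have weighted integral at least [m], so a single a priori constant [B] fixes the step length
    once and for all. *)
Theorem linear_neumann (q : R -> R) : bdcont l q ->
  (forI l s, 0 <= q s) ->
  (exists2 s : R, 0 < s < l & 0 < q s) ->
  linear_solvable q /\ exists2 B : R, 0 < B &
  forall (g x : R -> R) (M : R), bdcont l g ->
    neumann l rho (fun s => q s * x s - g s) x ->
    (forI l s, `|g s| <= M) ->
    forI l s, `|x s| <= B * M.
Proof.
move=> bq q0 [s1 s1I qs1]; have brho := weight_bd W.
have [k k0 Sk] := small_linear_solvable.
have [Q Q0 HQ] := bdcont_bound bq.
have I0 : 0 < prim l (fun s => rho s * q s) l.
  apply: (prim_gt0 (t := s1)) => //; first exact: bdcontM.
    by move=> t tI; rewrite mulr_ge0 ?q0// ltW// (weight_gt0 W).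
  by rewrite mulr_gt0// (weight_gt0 W).
have S0 := prim_weight_gt0.
pose m := Num.min (k * S) (prim l (fun s => rho s * q s) l).
have m0 : 0 < m by rewrite lt_min I0 mulr_gt0.
have [B B0 HB] := linear_neumann_estimate (Q + k) m0.
have qQ (s : R) : 0 < s < l -> q s <= Q.
  by move=> sI; exact: le_trans (ler_norm _) (HQ s sI).
split; last first.
  exists B => //; apply: HB => //.
    by move=> s sI; rewrite q0//= (le_trans (qQ s sI))// lerDl ltW.
  by rewrite /m ge_min lexx orbT.
(* With [n.+1] steps the potential changes by at most [(Q + k) / n.+1 <= 1 / (2 B)] per step. *)
pose n := Num.bound ((Q + k) * (2 * B)).
have n0 : 0 < n.+1%:R :> R by rewrite ltr0n.
pose qt (t : R) (s : R) := k + t * (q s - k).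
have bqt t : bdcont l (qt t).
  apply: bdcontD; first exact: bdcont_cst.
  by apply: bdcontZ; apply: bdcontB => //; exact: bdcont_cst.
have Ht (t : R) : 0 <= t <= 1 -> forall (g x : R -> R) (M : R), bdcont l g ->
    neumann l rho (fun s => qt t s * x s - g s) x ->
    (forI l s, `|g s| <= M) ->
    forI l s, `|x s| <= B * M.
  move=> t01; apply: HB => //.
    by move=> s sI; have := q0 s sI; have := qQ s sI; rewrite /qt; nra.
  rewrite (eq_prim (g := fun s => (1 - t) * k * rho s + t * (rho s * q s))); last first.
    by move=> s _; rewrite /qt; ring.
  rewrite primD ?primZ//; do ?[exact: bdcontM|exact: bdcontZ]; last first.
    by apply: bdcontZ; exact: bdcontM.
  have M1 : m <= k * S by rewrite /m ge_min lexx.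
  have M2 : m <= prim l (fun s => rho s * q s) l by rewrite /m ge_min lexx orbT.
  rewrite -/S; move: (prim l (fun s => rho s * q s) l) M2 => I M2.
  nra.
have step j : (j <= n.+1)%N -> linear_solvable (qt (j%:R / n.+1%:R)).
  elim: j => [_|j IH jn].
    move=> g bg; have [x Nx] := Sk g bg; exists x; move: Nx.
    by apply: neumann_eq => // s _; rewrite /qt mul0r mul0r addr0.
  apply: (@perturb_linear_solvable (qt (j%:R / n.+1%:R)) _ B) => //.
  - by apply: IH; exact: ltnW.
  - apply: Ht; rewrite divr_ge0//= ler_pdivrMr// mul1r ler_nat; exact: ltnW.
  - move=> s sI; rewrite /qt (_ : _ - _ = n.+1%:R^-1 * (q s - k)); last first.
      rewrite -[in LHS]natr1; field; exact: lt0r_neq0.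
    rewrite normrM gtr0_norm ?invr_gt0// ler_pdivrMl// -(@ler_pM2r _ (2 * B)) ?mulr_gt0//.
    rewrite -mulrA mulVf ?mulr1; last by rewrite gt_eqF// mulr_gt0.
    have : `|q s - k| <= Q + k.
      by apply: le_trans (ler_normB _ _) _; rewrite (gtr0_norm k0) lerD2r HQ.
    move=> h; apply: (@le_trans _ _ ((Q + k) * (2 * B))).
      by rewrite ler_wpM2r// mulr_ge0// ltW.
    have := @archi_boundP _ ((Q + k) * (2 * B)); rewrite -/n => h2.
    have : 0 <= (Q + k) * (2 * B) by rewrite !mulr_ge0// ?addr_ge0// ltW.
    move=> /h2 /ltW /le_trans; apply; by rewrite ler_nat.
have := step n.+1 (leqnn _); rewrite divff ?gt_eqF// => H g bg.
have [x Nx] := H g bg; exists x; move: Nx; apply: neumann_eq => // s _.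
by rewrite /qt mul1r; ring.
Qed.

End LinearNeumann.

(** * Sub- and supersolutions *)

Section SubSuper.
Context {R : realType} (l : R) (rho : R -> R).
Hypothesis W : weight l rho.

(* Knaster-Tarski on the uniformly Lipschitz functions between [`|Y|] and [Zb],
   which are closed under pointwise suprema. *)
Theorem sub_super_solution (h : R -> R -> R) (k Zm Mn : R) (Y c Zb FZ : R -> R) :
  0 < k ->
  (forall s x z : R, 0 < s < l -> 0 <= x -> x <= z -> z <= Zm ->
    (k - h s x) * x <= (k - h s z) * z) ->
  (forall z : R -> R, bdcont l z -> (forI l s, 0 <= z s <= Zm) ->
    bdcont l (fun s => (k - h s (z s)) * z s)) ->
  (forall s x : R, 0 < s < l -> 0 <= x <= Zm -> (k - h s x) * x <= Mn) ->
  neumann l rho (fun s => c s * Y s) Y ->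
  (forI l s, Y s != 0 -> h s `|Y s| <= c s) ->
  neumann l rho FZ Zb ->
  (forI l s, `|Y s| <= Zb s <= Zm) ->
  (forI l s, FZ s <= h s (Zb s) * Zb s) ->
  exists z, neumann l rho (fun s => h s (z s) * z s) z /\
    forI l s, `|Y s| <= z s <= Zb s.
Proof.
move=> k0 hmono hb hMn NY hY NZ YZ hZ; have l0 := weight_l W.
have [Sk [B B0 HB]] : linear_solvable l rho (fun=> k) /\ exists2 B : R, 0 < B &
  forall (g x : R -> R) (M : R), bdcont l g ->
    neumann l rho (fun s => k * x s - g s) x ->
    (forI l s, `|g s| <= M) ->
    forI l s, `|x s| <= B * M.
  apply: (linear_neumann W); first exact: bdcont_cst.
    by move=> s _; exact: ltW.
  by exists (l / 2) => //; lra.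
have bY := neumann_bdcont W NY; have bZ := neumann_bdcont W NZ.
pose adm z := bdcont l z /\ forI l s, 0 <= z s <= Zm.
(* Adding [k z] to both sides makes [N] nonnegative and nondecreasing on [[0, Zm]], so the solution
   map [Phi] preserves order by comparison. *)
pose N (z : R -> R) (s : R) := (k - h s (z s)) * z s.
have N0 z : adm z -> forI l s, 0 <= N z s.
  move=> [_ zZ] s sI; have /andP[z0 z1] := zZ s sI.
  by have := hmono s 0 (z s) sI (lexx 0) z0 z1; rewrite mulr0.
have ex z : exists x : R -> R, adm z -> neumann l rho (fun s => k * x s - N z s) x.
  have [[bz zZ]|nz] := pselect (adm z); last by exists z.
  by have [x Nx] := Sk _ (hb z bz zZ); exists x.
have [Phi HPhi] := choice ex.
have Phi0 z : adm z -> forI l s, 0 <= Phi z s.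
  move=> az; apply: (neumann_comparison W (HPhi z az)).
    by move=> s sI w0; have := N0 z az s sI; nra.
  move=> wn; have hI : 0 < l / 2 < l by lra.
  exists (l / 2) => //; have := wn _ hI; have := N0 z az _ hI; nra.
have Phimono x z : adm x -> adm z -> (forI l s, x s <= z s) ->
    forI l s, Phi x s <= Phi z s.
  move=> ax az xz s sI; rewrite -subr_ge0.
  have NN (t : R) : 0 < t < l -> N x t <= N z t.
    move=> tI; case: ax az => _ ax [_ az].
    have /andP[x0 _] := ax t tI; have /andP[_ z1] := az t tI.
    by apply: hmono => //; exact: xz.
  move: s sI; apply: (neumann_comparison W (neumannB (HPhi z az) (HPhi x ax))).
    by move=> t tI; have := NN t tI; nra.
  move=> wn; have hI : 0 < l / 2 < l by lra.
  exists (l / 2) => //; have := wn _ hI; have := NN _ hI; nra.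
have PhiZ z : adm z -> (forI l s, z s <= Zb s) ->
    forI l s, Phi z s <= Zb s.
  move=> az zZ s sI; rewrite -subr_ge0.
  have NN (t : R) : 0 < t < l -> N z t <= N Zb t.
    move=> tI; case: az => _ az; have /andP[z0 _] := az t tI.
    have /andP[_ Z1] := YZ t tI.
    by apply: hmono => //; exact: zZ.
  have FF (t : R) : 0 < t < l -> Zb t - Phi z t < 0 -> FZ t - (k * Phi z t - N z t) < 0.
    by move=> tI; have := NN t tI; have := hZ t tI; rewrite /N; nra.
  move: s sI; apply: (neumann_comparison W (neumannB NZ (HPhi z az))).
    by move=> t tI /(FF t tI)/ltW.
  move=> wn; have hI : 0 < l / 2 < l by lra.
  by exists (l / 2) => //; exact: FF (wn _ hI).
have PhiY z : adm z -> (forI l s, `|Y s| <= z s) ->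
    forI l s, `|Y s| <= Phi z s.
  move=> az Yz.
  (* [|Y|] is handled through the two smooth solutions [Y] and [- Y]: a point where [X] exceeds
     [Phi z] has [X > 0], so the subsolution inequality applies there with [X = |Y|]. *)
  have gen (X : R -> R) : neumann l rho (fun s => c s * X s) X ->
      (forall s : R, `|X s| = `|Y s|) -> forI l s, X s <= Phi z s.
    move=> NX XY s sI; rewrite -subr_ge0.
    have FF (t : R) : 0 < t < l -> Phi z t - X t < 0 -> k * Phi z t - N z t - c t * X t < 0.
      move=> tI w0; have P0 := Phi0 z az t tI.
      have X0 : 0 < X t by lra.
      have hc : h t (X t) <= c t.
        rewrite -(gtr0_norm X0) XY; apply: hY => //.
        by rewrite -normr_gt0 -XY normr_gt0 gt_eqF.
      have : (k - h t (X t)) * X t <= N z t.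
        apply: hmono => //; first exact: ltW.
          by apply: le_trans (Yz t tI); rewrite -XY ler_norm.
        by case: az => _ /(_ t tI)/andP[].
      nra.
    move: s sI; apply: (neumann_comparison W (neumannB (HPhi z az) NX)).
      by move=> t tI /(FF t tI)/ltW.
    move=> wn; have hI : 0 < l / 2 < l by lra.
    by exists (l / 2) => //; exact: FF (wn _ hI).
  move=> s sI; rewrite ler_norml lerNl; apply/andP; split; last exact: gen.
  apply: (gen (fun s => - Y s)) => // [|t]; last by rewrite normrN.
  by have := neumannZ (-1) NY; apply: neumann_eq => t _; ring.
have [K K0 HK] := neumann_estimate W.
(* A bound on the source times the constants of [neumann_estimate]: every [Phi z] with [z] between
   the barriers is [Lip]-Lipschitz, a property that pointwise suprema keep. *)
pose Lip := K * (k * Zm + Mn) * l.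
pose Lam z := (forI l s, `|Y s| <= z s <= Zb s) /\
  forall s t : R, 0 < s < l -> 0 < t < l -> `|z s - z t| <= Lip * `|s - t|.
have Lamadm z : Lam z -> adm z.
  move=> [H1 H2]; split; first exact: bdcont_lip H2.
  move=> s sI; have /andP[a b] := H1 s sI; have /andP[_ d] := YZ s sI.
  by rewrite (le_trans (normr_ge0 _) a) (le_trans b d).
have PhiLam z : adm z -> (forI l s, `|Y s| <= z s <= Zb s) -> Lam (Phi z).
  move=> az YzZ.
  have H1 (s : R) : 0 < s < l -> `|Y s| <= Phi z s <= Zb s.
    move=> sI; rewrite PhiY//= ?PhiZ// => t tI; by have /andP[] := YzZ t tI.
  split=> //.
  have bP := neumann_bdcont W (HPhi z az).
  have bN : bdcont l (N z) by case: az => bz zZ; exact: hb.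
  have bF : bdcont l (fun s => k * Phi z s - N z s).
    by apply: bdcontB => //; exact: bdcontZ.
  have FM (s : R) : 0 < s < l -> `|k * Phi z s - N z s| <= k * Zm + Mn.
    move=> sI; have /andP[a b] := H1 s sI; have /andP[_ d] := YZ s sI.
    have n0 := N0 z az s sI; have p0 := Phi0 z az s sI.
    have n1 : N z s <= Mn by apply: hMn => //; case: az => _; exact.
    rewrite ler_norml; nra.
  have [_ H] := HK _ _ _ bF (HPhi z az) FM.
  by move=> s t sI tI; rewrite /Lip; exact: H.
have aY : adm (fun s => `|Y s|).
  split; first exact: bdcont_norm.
  by move=> s sI; have /andP[a b] := YZ s sI; rewrite normr_ge0 (le_trans a b).
pose S (z : R -> R) := Lam z /\ forI l s, z s <= Phi z s.
have LY : Lam (Phi (fun s => `|Y s|)).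
  apply: PhiLam => // s sI; rewrite lexx; by have /andP[] := YZ s sI.
have SY : S (Phi (fun s => `|Y s|)).
  split=> //; apply: Phimono => //; first exact: Lamadm.
  by move=> s sI; case: LY => /(_ s sI)/andP[].
pose T s := [set z s | z in S].
pose zs s := sup (T s).
have ubT (s : R) : 0 < s < l -> ubound (T s) (Zb s).
  by move=> sI _ [z [[/(_ s sI)/andP[_ zZ] _] _] <-].
have T0 s : T s !=set0 by exists (Phi (fun s => `|Y s|) s), (Phi (fun s => `|Y s|)).
have zs_ge z : S z -> forI l s, z s <= zs s.
  move=> Sz s sI; apply: ub_le_sup; first by exists (Zb s); exact: ubT.
  by exists z.
have Lzs : Lam zs.
  split=> [s sI|s t sI tI].
    rewrite (le_trans _ (zs_ge _ SY s sI))/=; last by case: LY => /(_ s sI)/andP[].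
    by apply: ge_sup => //; exact: ubT.
  have half (p q : R) : 0 < p < l -> 0 < q < l -> zs p <= zs q + Lip * `|p - q|.
    move=> pI qI; apply: ge_sup => // _ [z Sz <-].
    have := zs_ge z Sz q qI; case: (Sz) => -[_ /(_ p q pI qI)] + _.
    rewrite ler_norml; lra.
  have := half s t sI tI; have := half t s tI sI; rewrite [`|t - s|]distrC ler_norml; lra.
have azs := Lamadm zs Lzs.
have up (s : R) : 0 < s < l -> zs s <= Phi zs s.
  move=> sI; apply: ge_sup => // _ [z Sz <-].
  have [Lz /(_ s sI) zP] := Sz; apply: le_trans zP _.
  by apply: Phimono => //; [exact: Lamadm|exact: zs_ge].
have LP : Lam (Phi zs) by apply: PhiLam => //; case: Lzs.
have down (s : R) : 0 < s < l -> Phi zs s <= zs s.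
  apply: zs_ge; split=> //.
  by apply: Phimono => //; exact: Lamadm.
have E (s : R) : 0 < s < l -> Phi zs s = zs s.
  by move=> sI; apply/eqP; rewrite eq_le up ?down.
exists zs; split; last by case: Lzs.
move: (HPhi zs azs); apply: neumann_eq => // s sI.
by rewrite E// /N; ring.
Qed.

End SubSuper.

Lemma sqr_near1 {R : realType} (t d : R) : 0 < d -> d <= 1 / 4 -> 1 - 2 * d < t < 1 + 2 * d -> `|1 - t ^+ 2| <= 5 * d.
Proof. by move=> d0 d1 tI; rewrite ler_norml; nra. Qed.

Lemma three_terms {R : realType} (a b c e e' d M : R) : 1 <= M -> 0 < d -> `|a| <= e -> `|b| <= e' ->
  `|c| <= (e' + 5 * d) * M -> `|a + b + c| <= M * (e + 2 * e' + 5 * d).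
Proof.
move=> m1 d0 ha hb hc; apply: le_trans (ler_normD _ _) _; apply: le_trans (lerD (ler_normD _ _) hc) _.
by have := normr_ge0 a; have := normr_ge0 b; nra.
Qed.

(** * Perturbation of the ground state by small parameters *)

Section Perturbation.
Context {R : realType} (l : R) (rho : R -> R).
Hypothesis W : weight l rho.
Context (U : R -> R) (C lam : R).
Hypotheses (bU : bdcont l U) (C0 : 0 < C) (hU : forI l s, 0 < U s <= C).
Hypothesis lam0 : 0 < lam.

Lemma bdcont_compU (g : R -> R) (M : R) : (forI (3 * C) y, {for y, continuous g}) ->
  (forI (3 * C) y, `|g y| <= M) -> bdcont l (fun s => g (U s)).
Proof.
have c0 := C0; move=> cg gM; split=> [s sI|].
  apply: continuous_comp; first by case: bU => + _; exact.
  by apply: cg; have := hU sI; lra.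
by exists M => s sI; apply: gM; have := hU sI; lra.
Qed.

Section Fixed.
Context (FR dFR FI dFI : R -> R) (eta M eps delta : R).
Hypothesis dFRE : forI (3 * C) y, isd FR y (dFR y).
Hypothesis dFIE : forI (3 * C) y, isd FI y (dFI y).
Hypothesis FRM : forI (3 * C) y, `|FR y| <= M /\ `|dFR y| <= M.
Hypothesis FIeps : forI (3 * C) y, `|FI y| <= eps /\ `|dFI y| <= eps.
Hypotheses (etaeps : `|eta| <= eps) (M1 : 1 <= M) (eps0 : 0 < eps <= 1).
Hypothesis delta0 : 0 < delta <= 1 / 4.

Definition near_id (x : R -> R) := bdcont l x /\ forI l s, `|x s| <= delta.
Definition modsq (x : R -> R) (s : R) := U s * (1 + x s) ^+ 2.
(** Dividing the equation by [1 + i eta] gives [Delta psi = - lam (amp + i (Om - ell) / (1 + eta^2))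
    psi]. Here [x] is the relative change of the modulus, and the imaginary part is the flux
    equation of the phase, with source [Om - ell]. *)
Definition ell (x : R -> R) (s : R) := eta * FR (modsq x s) - FI (modsq x s).
Definition wgt (x : R -> R) (s : R) := rho s * (1 + x s) ^+ 2.
Definition Om (x : R -> R) := prim l (fun s => wgt x s * ell x s) l / prim l (wgt x) l.
Definition flux (x : R -> R) := prim l (fun s => rho s * ((1 + x s) ^+ 2 * (Om x - ell x s))).
(** This is the derivative of the phase: the flux divided by the weight [wgt x]. The fixed-point
    problem involves the phase through it only. *)
Definition phase (x : R -> R) (s : R) := - lam / (1 + eta ^+ 2) * flux x s / wgt x s.

Context (E : R).
Hypothesis EE : E = 2 * eps * M.

Lemma E_gt0 : 0 < E. Proof. by rewrite EE; have /andP[e0 _] := eps0; have := M1; nra. Qed.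

Lemma norm_prod_le (a1 a2 b1 b2 p q D A B : R) : `|a1 - a2| <= p * D -> `|b1 - b2| <= q * D ->
  `|a2| <= A -> `|b1| <= B -> `|a1 * b1 - a2 * b2| <= (p * B + A * q) * D.
Proof.
move=> H1 H2 H3 H4; rewrite (_ : _ - _ = (a1 - a2) * b1 + a2 * (b1 - b2)); last by ring.
apply: le_trans (ler_normD _ _) _; rewrite !normrM mulrDl lerD//.
  by rewrite mulrAC ler_pM.
by rewrite -mulrA ler_pM.
Qed.

(** All hypotheses on the reaction are made on [(0, 3 C)]: with [U <= C] and [delta <= 1/4] the
    perturbed squared modulus stays in this window, and so does [U t^2] for every [t] within
    [2 delta] of 1. *)
Lemma near_id_bounds x (s : R) : near_id x -> 0 < s < l ->
  [/\ 1 - delta <= 1 + x s <= 1 + delta, 1 / 2 <= (1 + x s) ^+ 2 <= 2 & 0 < modsq x s < 3 * C].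
Proof.
move=> [_ /(_ s)] + sI => /(_ sI); rewrite ler_norml => xd.
have /andP[u0 uC] := hU sI; have /andP[d0 d1] := delta0.
have h : 1 / 2 <= (1 + x s) ^+ 2 <= 2 by nra.
split=> //; first by lra.
by rewrite /modsq; nra.
Qed.

Lemma bdcont_r2 x : near_id x -> bdcont l (fun s => (1 + x s) ^+ 2).
Proof. by move=> [bx _]; apply: bdcontX; apply: bdcontD => //; exact: bdcont_cst. Qed.

Lemma bdcont_modsq x : near_id x -> bdcont l (modsq x).
Proof. by move=> nx; apply: bdcontM => //; exact: bdcont_r2. Qed.

Lemma bdcont_wgt x : near_id x -> bdcont l (wgt x).
Proof. by move=> nx; apply: bdcontM; [exact: weight_bd W|exact: bdcont_r2]. Qed.

Lemma bdcont_compw (F dF : R -> R) x K :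
  (forI (3 * C) y, isd F y (dF y)) ->
  (forI (3 * C) y, `|F y| <= K) ->
  near_id x -> bdcont l (fun s => F (modsq x s)).
Proof.
move=> HF HK nx; split=> [s sI|]; last first.
  by exists K => s sI; apply: HK; have [] := near_id_bounds nx sI.
apply: continuous_comp; first by case: (bdcont_modsq nx) => + _; exact.
by apply: (isd_cont (HF _ _)); have [] := near_id_bounds nx sI.
Qed.

Lemma bdcont_FR x : near_id x -> bdcont l (fun s => FR (modsq x s)).
Proof. by apply: (bdcont_compw (K := M)) dFRE _ => y /FRM[]. Qed.

Lemma bdcont_FI x : near_id x -> bdcont l (fun s => FI (modsq x s)).
Proof. by apply: (bdcont_compw (K := eps)) dFIE _ => y /FIeps[]. Qed.

Lemma bdcont_ell x : near_id x -> bdcont l (ell x).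
Proof.
by move=> nx; apply: bdcontB; [apply: bdcontZ; exact: bdcont_FR|exact: bdcont_FI].
Qed.

Lemma ell_bound x (s : R) : near_id x -> 0 < s < l -> `|ell x s| <= E.
Proof.
move=> nx sI; have [_ _ wI] := near_id_bounds nx sI.
have [a1 _] := FRM wI; have [a2 _] := FIeps wI.
apply: le_trans (ler_normB _ _) _; rewrite normrM.
have : `|eta| * `|FR (modsq x s)| <= eps * M by rewrite ler_pM.
case/andP: eps0; rewrite EE; move: M1 a2; nra.
Qed.

(** The mean value theorem is applied to [t -> F (U t^2)] at [t = 1 + x], whose derivative is at
    most [K C 2 t <= 3 K C] on the enlarged interval. *)
Lemma comp_lip (F dF : R -> R) K x z (s D : R) :
  (forI (3 * C) y, isd F y (dF y)) ->
  (forI (3 * C) y, `|dF y| <= K) ->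
  near_id x -> near_id z -> 0 < s < l -> `|x s - z s| <= D ->
  `|F (modsq x s) - F (modsq z s)| <= (K * (3 * C)) * D.
Proof.
move=> HF HK nx nz sI xz; have /andP[u0 uC] := hU sI; have /andP[d0 d1] := delta0.
have [rx _ _] := near_id_bounds nx sI; have [rz _ _] := near_id_bounds nz sI.
have wt (t : R) : 1 - 2 * delta < t < 1 + 2 * delta -> 0 < U s * t ^+ 2 < 3 * C.
  move=> tI; have t2 : 0 < t ^+ 2 <= 9 / 4 by nra.
  nra.
have K0 : 0 <= K by apply: le_trans (HK C _); rewrite ?normr_ge0//; lra.
have dt (t : R) : 1 - 2 * delta < t < 1 + 2 * delta ->
    isd (fun t => F (U s * t ^+ 2)) t (dF (U s * t ^+ 2) * (U s * (2 * t))).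
  move=> tI; apply: isd_comp; last exact: HF (wt t tI).
  by apply: isdZ; apply: isd_eqd (isd_sqr (isd_id t)) _; rewrite mulr1.
have := @isd_lip _ _ _ (1 - 2 * delta) (1 + 2 * delta) (K * (3 * C)) (1 + x s) (1 + z s) dt.
move=> H; apply: (@le_trans _ _ (K * (3 * C) * `|1 + x s - (1 + z s)|)).
  apply: H; [|lra|lra] => t tI; rewrite normrM.
  apply: ler_pM => //; first exact: HK (wt t tI).
  by rewrite ger0_norm; nra.
rewrite (_ : 1 + x s - (1 + z s) = x s - z s); last by ring.
by rewrite ler_wpM2l// mulr_ge0//; lra.
Qed.

Lemma ell_lip x z (s D : R) : near_id x -> near_id z -> 0 < s < l -> `|x s - z s| <= D ->
  `|ell x s - ell z s| <= 3 * C * E * D.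
Proof.
move=> nx nz sI xz.
have H1 := comp_lip dFRE (fun y yI => proj2 (FRM yI)) nx nz sI xz.
have H2 := comp_lip dFIE (fun y yI => proj2 (FIeps yI)) nx nz sI xz.
have D0 : 0 <= D by exact: le_trans xz.
rewrite /ell (_ : _ - _ = eta * (FR (modsq x s) - FR (modsq z s)) - (FI (modsq x s) - FI (modsq z s))); last by ring.
apply: le_trans (ler_normB _ _) _; rewrite normrM.
have : `|eta| * `|FR (modsq x s) - FR (modsq z s)| <= eps * (M * (3 * C) * D) by rewrite ler_pM.
have CD : 0 <= C * D by rewrite mulr_ge0// ltW.
have : eps * (C * D) <= eps * M * (C * D).
  by rewrite ler_wpM2r// ler_peMr//; case/andP: eps0 => /ltW.
rewrite EE; move: H2; lra.
Qed.

Let S := prim l rho l.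
Let S0 : 0 < S. Proof. exact: prim_weight_gt0. Qed.
Let brho : bdcont l rho. Proof. exact: weight_bd W. Qed.

Lemma prim_norm_le (g : R -> R) K : bdcont l g -> (forI l s, `|g s| <= K) ->
  `|prim l (fun s => rho s * g s) l| <= K * S.
Proof.
move=> bg gK; rewrite ler_norml -mulNr -!primZ//; apply/andP; split.
  apply: le_prim; [exact: bdcontZ|exact: bdcontM|] => s sI.
  have := gK s sI; have := weight_gt0 W sI; rewrite ler_norml; nra.
apply: le_prim; [exact: bdcontM|exact: bdcontZ|] => s sI.
have := gK s sI; have := weight_gt0 W sI; rewrite ler_norml; nra.
Qed.

Lemma wgt_ge x : near_id x -> S / 2 <= prim l (wgt x) l.
Proof.
move=> nx; rewrite mulrC -primZ//; apply: le_prim; [exact: bdcontZ|exact: bdcont_wgt|].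
move=> s sI; have [_ /andP[r1 _] _] := near_id_bounds nx sI.
have := weight_gt0 W sI; rewrite /wgt; nra.
Qed.

Lemma wgt_prim_gt0 x : near_id x -> 0 < prim l (wgt x) l.
Proof. by move=> /wgt_ge; apply: lt_le_trans; rewrite divr_gt0. Qed.

Lemma Om_weighted x : near_id x ->
  prim l (fun s => rho s * ((1 + x s) ^+ 2 * (Om x - ell x s))) l = 0.
Proof.
move=> nx; have w0 := wgt_prim_gt0 nx.
have bw := bdcont_wgt nx; have be := bdcont_ell nx.
rewrite (eq_prim (g := fun s => Om x * wgt x s - wgt x s * ell x s)); last first.
  by move=> s _; rewrite /wgt; ring.
rewrite prim_subr; [|exact: bdcontZ|exact: bdcontM].
by rewrite primZ// /Om divfK ?subrr// gt_eqF.
Qed.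

Lemma Om_bound x : near_id x -> `|Om x| <= E.
Proof.
move=> nx; have w0 := wgt_prim_gt0 nx; have bw := bdcont_wgt nx; have be := bdcont_ell nx.
have wp (s : R) : 0 < s < l -> 0 < wgt x s.
  move=> sI; have [_ /andP[r1 _] _] := near_id_bounds nx sI.
  by rewrite mulr_gt0 ?(weight_gt0 W)//; lra.
rewrite /Om ler_norml ler_pdivlMr// ler_pdivrMr// -!primZ//.
apply/andP; split; apply: le_prim; do ?[exact: bdcontM|exact: bdcontZ].
  move=> s sI; have := wp s sI; have := ell_bound nx sI; rewrite ler_norml; nra.
move=> s sI; have := wp s sI; have := ell_bound nx sI; rewrite ler_norml; nra.
Qed.

Lemma r2_lip x z (s D : R) : near_id x -> near_id z -> 0 < s < l -> `|x s - z s| <= D ->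
  `|(1 + x s) ^+ 2 - (1 + z s) ^+ 2| <= 3 * D.
Proof.
move=> nx nz sI xz; have [rx _ _] := near_id_bounds nx sI; have [rz _ _] := near_id_bounds nz sI.
rewrite (_ : _ - _ = (2 + x s + z s) * (x s - z s)); last by ring.
rewrite normrM ler_pM// ger0_norm; have /andP[d0 d1] := delta0; lra.
Qed.

Definition c1 : R := 12 + 12 * C.

(** Rather than estimating a difference of quotients, the two vanishing integrals of [Om_weighted]
    are subtracted; this expresses [Om x - Om z] times the total weight of [z] as the weighted
    integral of a quantity of order [E D]. *)
Lemma Om_lip x z (D : R) : near_id x -> near_id z -> (forI l s, `|x s - z s| <= D) ->
  `|Om x - Om z| <= c1 * E * D.
Proof.
move=> nx nz xz; have Ep := E_gt0.
have bx := bdcont_ell nx; have bz := bdcont_ell nz.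
have bx2 := bdcont_r2 nx; have bz2 := bdcont_r2 nz.
have bd x' : near_id x' -> bdcont l (fun s => Om x - ell x' s).
  by move=> /bdcont_ell; apply: bdcontB; exact: bdcont_cst.
pose g s := ((1 + z s) ^+ 2 - (1 + x s) ^+ 2) * (Om x - ell x s) +
  (1 + z s) ^+ 2 * (ell x s - ell z s).
have bg : bdcont l g.
  by apply: bdcontD; apply: bdcontM => //; [exact: bdcontB|exact: bd|exact: bdcontB].
have EQ : (Om x - Om z) * prim l (wgt z) l = prim l (fun s => rho s * g s) l.
  have H1 := Om_weighted nx; have H2 := Om_weighted nz.
  have b1 : bdcont l (fun s => rho s * ((1 + x s) ^+ 2 * (Om x - ell x s))).
    by apply: bdcontM => //; apply: bdcontM => //; exact: bd.
  have b2 : bdcont l (fun s => rho s * ((1 + z s) ^+ 2 * (Om z - ell z s))).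
    apply: bdcontM => //; apply: bdcontM => //; apply: bdcontB => //; exact: bdcont_cst.
  have bwz := bdcont_wgt nz.
  rewrite -primZ// (eq_prim (g := fun s => rho s * g s +
    (rho s * ((1 + x s) ^+ 2 * (Om x - ell x s)) - rho s * ((1 + z s) ^+ 2 * (Om z - ell z s))))).
    rewrite primD; [|exact: bdcontM|exact: bdcontB].
    by rewrite prim_subr// H1 H2 subrr addr0.
  by move=> s _; rewrite /g /wgt; ring.
have gb (s : R) : 0 < s < l -> `|g s| <= (6 + 6 * C) * E * D.
  move=> sI; have D0 : 0 <= D by exact: le_trans (xz s sI).
  apply: le_trans (ler_normD _ _) _.
  rewrite (normrM _ (Om x - ell x s)) (normrM _ (ell x s - ell z s)).
  have a1 : `|(1 + z s) ^+ 2 - (1 + x s) ^+ 2| <= 3 * D.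
    by apply: r2_lip => //; rewrite distrC xz.
  have a2 : `|Om x - ell x s| <= 2 * E.
    apply: le_trans (ler_normB _ _) _; have := Om_bound nx; have := ell_bound nx sI; lra.
  have a3 : `|(1 + z s) ^+ 2| <= 2.
    by have [_ r1 _] := near_id_bounds nz sI; rewrite ger0_norm; lra.
  have a4 := ell_lip nx nz sI (xz s sI).
  have : `|(1 + z s) ^+ 2 - (1 + x s) ^+ 2| * `|Om x - ell x s| <= (3 * D) * (2 * E) by rewrite ler_pM.
  have : `|(1 + z s) ^+ 2| * `|ell x s - ell z s| <= 2 * (3 * C * E * D) by rewrite ler_pM.
  lra.
have := prim_norm_le bg gb; rewrite -EQ normrM (gtr0_norm (wgt_prim_gt0 nz)) => H.
have H2 : `|Om x - Om z| * (S / 2) <= (6 + 6 * C) * E * D * S.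
  by apply: le_trans H; rewrite ler_wpM2l// wgt_ge.
rewrite -(@ler_pM2r _ (S / 2)) ?divr_gt0//; apply: le_trans H2 _; rewrite /c1; lra.
Qed.

Definition c2 : R := 6 + 2 * c1 + 6 * C.

Lemma bdcont_j x : near_id x -> bdcont l (fun s => (1 + x s) ^+ 2 * (Om x - ell x s)).
Proof.
move=> nx; apply: bdcontM; first exact: bdcont_r2.
by apply: bdcontB; [exact: bdcont_cst|exact: bdcont_ell].
Qed.

Lemma j_bound x (s : R) : near_id x -> 0 < s < l ->
  `|(1 + x s) ^+ 2 * (Om x - ell x s)| <= 4 * E.
Proof.
move=> nx sI; rewrite normrM (_ : 4 * E = 2 * (2 * E)); last by ring.
apply: ler_pM => //.
  by have [_ r1 _] := near_id_bounds nx sI; rewrite ger0_norm; lra.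
apply: le_trans (ler_normB _ _) _; have := Om_bound nx; have := ell_bound nx sI; lra.
Qed.

Lemma j_lip x z (D : R) (s : R) : near_id x -> near_id z ->
  (forI l s, `|x s - z s| <= D) -> 0 < s < l ->
  `|(1 + x s) ^+ 2 * (Om x - ell x s) - (1 + z s) ^+ 2 * (Om z - ell z s)| <= c2 * E * D.
Proof.
move=> nx nz xz sI.
apply: le_trans (norm_prod_le (p := 3) (q := c1 * E + 3 * C * E) (D := D) (A := 2) (B := 2 * E) _ _ _ _) _.
- exact: r2_lip (xz s sI).
- rewrite (_ : _ - _ = (Om x - Om z) - (ell x s - ell z s)); last by ring.
  apply: le_trans (ler_normB _ _) _; rewrite mulrDl lerD ?Om_lip//.
  exact: ell_lip (xz s sI).
- by have [_ r1 _] := near_id_bounds nz sI; rewrite ger0_norm; lra.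
- apply: le_trans (ler_normB _ _) _; have := Om_bound nx; have := ell_bound nx sI; lra.
- by rewrite /c2; lra.
Qed.

Context (K : R).
Hypothesis K0 : 0 < K.
Hypothesis HK : forall (F : R -> R) (M : R), bdcont l F ->
  prim l (fun s => rho s * F s) l = 0 -> (forI l s, `|F s| <= M) ->
  forI l s, `|prim l (fun t => rho t * F t) s| <= K * M * Num.min s (l - s) * rho s.

Lemma kappa_bounds : 0 < (1 + eta ^+ 2)^-1 <= 1.
Proof.
have h : 1 <= 1 + eta ^+ 2 by rewrite lerDl sqr_ge0.
by rewrite invr_gt0 (lt_le_trans ltr01 h)/= invf_le1// (lt_le_trans ltr01 h).
Qed.

Lemma lamkappa_bounds : `|- lam / (1 + eta ^+ 2)| <= lam.
Proof.
have /andP[k0 k1] := kappa_bounds.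
by rewrite normrM normrN (gtr0_norm lam0) (gtr0_norm k0) ler_piMr// ltW.
Qed.

Lemma phase_bound x (s : R) : near_id x -> 0 < s < l ->
  `|phase x s| <= 8 * lam * K * E * Num.min s (l - s).
Proof.
move=> nx sI; have r0 := weight_gt0 W sI.
have [_ /andP[r1 r2] _] := near_id_bounds nx sI.
have := HK (bdcont_j nx) (Om_weighted nx) (fun t tI => j_bound nx tI) sI.
rewrite -/(flux x s) => H.
rewrite /phase -mulrA normrM.
apply: (@le_trans _ _ (lam * (8 * K * E * Num.min s (l - s)))); last by apply: le_of_eq; ring.
apply: ler_pM => //; first exact: lamkappa_bounds.
have w0 : 0 < wgt x s by rewrite /wgt mulr_gt0//; lra.
rewrite normf_div (gtr0_norm w0) ler_pdivrMr//; apply: le_trans H _.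
have m0 := min_gt0 sI.
have Ep := E_gt0; have : 0 <= K * E * Num.min s (l - s) * rho s by rewrite !mulr_ge0 ?ltW.
by rewrite /wgt; nra.
Qed.

Lemma bdcont_phase x : near_id x -> bdcont l (phase x).
Proof.
move=> nx; split=> [s sI|].
  have [_ /andP[r1 r2] _] := near_id_bounds nx sI.
  apply: continuousM.
    apply: continuousM; first exact: cvg_cst.
    by apply: (isd_cont (isd_prim _ sI)); apply: bdcontM => //; exact: bdcont_j.
  apply: continuousV; first by rewrite gt_eqF// /wgt mulr_gt0 ?(weight_gt0 W)//; lra.
  by case: (bdcont_wgt nx) => + _; exact.
exists (8 * lam * K * E * l) => s sI; apply: le_trans (phase_bound nx sI) _.
by have Ep := E_gt0; rewrite ler_wpM2l ?(min_le W)// !mulr_ge0 ?ltW.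
Qed.

Definition c3 : R := lam * (2 * K * c2 * l + 48 * K * l).
Definition c4 : R := 8 * lam * K * l.

Lemma phase_bound' x (s : R) : near_id x -> 0 < s < l -> `|phase x s| <= c4 * E.
Proof.
move=> nx sI; apply: le_trans (phase_bound nx sI) _.
rewrite (_ : c4 * E = 8 * lam * K * E * l); last by rewrite /c4; ring.
by have Ep := E_gt0; rewrite ler_wpM2l ?(min_le W)// !mulr_ge0 ?ltW.
Qed.

(** The difference splits into that of the fluxes, controlled by [HK] since it again has zero total
    integral, and that of the inverse weights; both carry the small factor [E]. *)
Lemma phase_lip x z (D : R) (s : R) : near_id x -> near_id z ->
  (forI l s, `|x s - z s| <= D) -> 0 < s < l ->
  `|phase x s - phase z s| <= c3 * E * D.
Proof.
move=> nx nz xz sI; have r0 := weight_gt0 W sI; have l0 := weight_l W; have Ep := E_gt0.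
have D0 : 0 <= D by exact: le_trans (xz s sI).
have [_ /andP[x1 x2] _] := near_id_bounds nx sI.
have [_ /andP[z1 z2] _] := near_id_bounds nz sI.
have bj := bdcontB (bdcont_j nx) (bdcont_j nz).
have bjx := bdcontM brho (bdcont_j nx); have bjz := bdcontM brho (bdcont_j nz).
have FE t : prim l (fun s => rho s * ((1 + x s) ^+ 2 * (Om x - ell x s) -
    (1 + z s) ^+ 2 * (Om z - ell z s))) t = flux x t - flux z t.
  by rewrite /flux -prim_subr//; apply: eq_prim => r _; ring.
have H1 : `|flux x s - flux z s| <= K * (c2 * E * D) * l * rho s.
  rewrite -FE; apply: le_trans (HK bj _ (fun t tI => j_lip nx nz xz tI) sI) _.
    by rewrite FE /flux (Om_weighted nx) (Om_weighted nz) subrr.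
  rewrite ler_wpM2r ?(ltW r0)// ler_wpM2l ?(min_le W)//.
  rewrite mulr_ge0 ?(ltW K0)// !mulr_ge0 ?(ltW Ep)// /c2 /c1; have := C0; lra.
have H2 : `|flux z s| <= K * (4 * E) * l * rho s.
  have := HK (bdcont_j nz) (Om_weighted nz) (fun t tI => j_bound nz tI) sI.
  rewrite -/(flux z s) => /le_trans; apply.
  rewrite ler_wpM2r ?(ltW r0)// ler_wpM2l ?(min_le W)//.
  by rewrite !mulr_ge0 ?ltW.
have H3 : `|((1 + x s) ^+ 2)^-1 - ((1 + z s) ^+ 2)^-1| <= 12 * D.
  rewrite (_ : _ - _ = ((1 + z s) ^+ 2 - (1 + x s) ^+ 2) / ((1 + x s) ^+ 2 * (1 + z s) ^+ 2)); last first.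
    have := gt_eqF (lt_le_trans (ltac:(lra) : (0 : R) < 1 / 2) x1).
    have := gt_eqF (lt_le_trans (ltac:(lra) : (0 : R) < 1 / 2) z1).
    rewrite !expf_eq0 /= => h1 h2.
    by field; rewrite h1 h2.
  have h : `|(1 + z s) ^+ 2 - (1 + x s) ^+ 2| <= 3 * D.
    by apply: r2_lip => //; rewrite distrC xz.
  have p : 1 / 4 <= (1 + x s) ^+ 2 * (1 + z s) ^+ 2 by nra.
  rewrite normf_div ler_pdivrMr ?normr_gt0 ?gt_eqF//; last by lra.
  rewrite (@gtr0_norm _ (_ * _)); last by lra.
  nra.
rewrite /phase /wgt (_ : _ - _ = (- lam / (1 + eta ^+ 2)) *
  ((flux x s - flux z s) / rho s * ((1 + x s) ^+ 2)^-1 +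
   flux z s / rho s * (((1 + x s) ^+ 2)^-1 - ((1 + z s) ^+ 2)^-1))); last first.
  rewrite !invfM; ring.
rewrite normrM (_ : c3 * E * D = lam * (2 * K * c2 * l * E * D + 48 * K * l * E * D)); last first.
  by rewrite /c3; ring.
apply: ler_pM => //; first exact: lamkappa_bounds.
apply: le_trans (ler_normD _ _) _; rewrite !normrM lerD//.
- rewrite normfV (gtr0_norm r0) (_ : 2 * K * c2 * l * E * D = K * (c2 * E * D) * l * 2); last by ring.
  apply: ler_pM => //; [by rewrite divr_ge0// ltW|by rewrite ler_pdivrMr|].
  rewrite normfV (@gtr0_norm _ (_ ^+ 2)); last by lra.
  by rewrite -[2]invrK lef_pV2 ?posrE ?invr_gt0//; lra.
- rewrite normfV (gtr0_norm r0) (_ : 48 * K * l * E * D = K * (4 * E) * l * (12 * D)); last by ring.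
  by apply: ler_pM => //; [rewrite divr_ge0// ltW|rewrite ler_pdivrMr].
Qed.

Context (f0 df0 : R -> R) (e1 : R).
Hypothesis f0eps : forI (3 * C) y, `|f0 y - FR y| <= eps /\ `|df0 y - dFR y| <= eps.
Hypothesis f0mod : forall y z : R, 0 < y < 3 * C -> 0 < z < 3 * C -> `|y - z| <= 5 * C * delta ->
  `|f0 y - f0 z| <= e1 /\ `|df0 y - df0 z| <= e1.
Hypothesis cdf0 : forI (3 * C) y, {for y, continuous df0}.
Hypothesis f0M : forI (3 * C) y, `|f0 y| <= M /\ `|df0 y| <= M.
Hypothesis cf0 : forI (3 * C) y, {for y, continuous f0}.

Definition amp (x : R -> R) (s : R) :=
  (FR (modsq x s) + eta * FI (modsq x s) + eta * Om x) / (1 + eta ^+ 2).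
(** With [q = - 2 lam U f0'(U)], the equation for [x] has the right-hand side [q x + rem x]: the
    derivative at [x = 0] of the unperturbed reaction term has been removed, so [rem] has a small
    Lipschitz constant. *)
Definition rem (x : R -> R) (s : R) :=
  (1 + x s) * (lam * (f0 (U s) - amp x s) + phase x s ^+ 2) + 2 * lam * U s * df0 (U s) * x s.

Let kap := (1 + eta ^+ 2)^-1.

Lemma kap_eps : `|1 - kap| <= eps.
Proof.
have /andP[k0 k1] := kappa_bounds; have /andP[e0 e2] := eps0.
have h : kap * (1 + eta ^+ 2) = 1 by rewrite /kap mulVf// gt_eqF// ltr_pwDl// sqr_ge0.
have : eta ^+ 2 <= eps.
  rewrite -[eta ^+ 2]ger0_norm ?sqr_ge0// normrX expr2.
  have := etaeps; have := normr_ge0 eta; nra.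
have := sqr_ge0 eta; rewrite -/kap in k0 k1; rewrite ger0_norm; nra.
Qed.

(** In [t = 1 + x] the derivative of the main part is [lam] times [f0(U) - kap FR(U t^2)] plus
    [2 lam U] times [f0'(U) - kap t^2 FR'(U t^2)]. Both differences vanish in the unperturbed case
    at [t = 1], which yields the small factor. *)
Lemma main_part_lip x z (s D : R) : near_id x -> near_id z -> 0 < s < l -> `|x s - z s| <= D ->
  `|((1 + x s) * (lam * (f0 (U s) - kap * FR (modsq x s))) + 2 * lam * U s * df0 (U s) * x s) -
    ((1 + z s) * (lam * (f0 (U s) - kap * FR (modsq z s))) + 2 * lam * U s * df0 (U s) * z s)|
  <= lam * (1 + 2 * C) * M * (e1 + 2 * eps + 5 * delta) * D.
Proof.
move=> nx nz sI xz; have /andP[u0 uC] := hU sI; have /andP[d0 d1] := delta0.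
have /andP[ep0 ep1] := eps0; have l0 := lam0; have c0 := C0; have m1 := M1.
have M00 : 0 < M by exact: lt_le_trans M1.
have [rx _ _] := near_id_bounds nx sI; have [rz _ _] := near_id_bounds nz sI.
have uI : 0 < U s < 3 * C by lra.
pose phi (t : R) := t * (lam * (f0 (U s) - kap * FR (U s * t ^+ 2))) + 2 * lam * U s * df0 (U s) * (t - 1).
pose dphi (t : R) := lam * (f0 (U s) - kap * FR (U s * t ^+ 2)) +
   t * (lam * (0 - kap * (dFR (U s * t ^+ 2) * (U s * (2 * t))))) + 2 * lam * U s * df0 (U s).
have wt (t : R) : 1 - 2 * delta < t < 1 + 2 * delta -> 0 < U s * t ^+ 2 < 3 * C.
  move=> tI; have t2 : 0 < t ^+ 2 <= 9 / 4 by nra.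
  nra.
have dt (t : R) : 1 - 2 * delta < t < 1 + 2 * delta -> isd phi t (dphi t).
  move=> tI; apply: isdD; last first.
    by apply: isd_eqd (isdZ _ (isdB (isd_id t) (isd_cst 1 t))) _; rewrite subr0 mulr1.
  apply: isd_eqd (isdM (isd_id t) (isdZ lam (isdB (isd_cst (f0 (U s)) t)
    (isdZ kap (isd_comp (isdZ (U s) (isd_sqr (isd_id t))) (dFRE (wt t tI))))))) _.
  by rewrite /dphi mul1r mulr1.
have bt (t : R) : 1 - 2 * delta < t < 1 + 2 * delta ->
    `|dphi t| <= lam * (1 + 2 * C) * M * (e1 + 2 * eps + 5 * delta).
  move=> tI; have wI := wt t tI; set w := U s * t ^+ 2 in wI *.
  have t25 := sqr_near1 d0 d1 tI.
  have Uw : `|U s - w| <= 5 * C * delta.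
    rewrite /w (_ : _ - _ = U s * (1 - t ^+ 2)); last by ring.
    rewrite normrM (gtr0_norm u0) (_ : 5 * C * delta = C * (5 * delta)); last by ring.
    by rewrite ler_pM// ltW.
  have [m1' m2] := f0mod uI wI Uw; have [g1 g2] := f0eps wI; have [h1 h2] := FRM wI.
  have ke := kap_eps; have /andP[k0 k1] := kappa_bounds; rewrite -/kap in k0 k1.
  have kt : `|1 - kap * t ^+ 2| <= eps + 5 * delta.
    rewrite (_ : 1 - _ = (1 - kap) + kap * (1 - t ^+ 2)); last by ring.
    apply: le_trans (ler_normD _ _) _; rewrite lerD// normrM (gtr0_norm k0).
    by rewrite (le_trans _ t25)// ler_piMl.
  rewrite (_ : dphi t = lam * ((f0 (U s) - f0 w) + (f0 w - FR w) + (1 - kap) * FR w) +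
     2 * lam * U s * ((df0 (U s) - df0 w) + (df0 w - dFR w) + (1 - kap * t ^+ 2) * dFR w)); last first.
    by rewrite /dphi -/w; ring.
  have q1 : `|(1 - kap) * FR w| <= (eps + 5 * delta) * M.
    by rewrite normrM ler_pM// (le_trans ke)// lerDl mulr_ge0// ltW.
  have q2 : `|(1 - kap * t ^+ 2) * dFR w| <= (eps + 5 * delta) * M by rewrite normrM ler_pM.
  have s1 : `|(f0 (U s) - f0 w) + (f0 w - FR w) + (1 - kap) * FR w| <= M * (e1 + 2 * eps + 5 * delta).
    exact: three_terms M1 d0 m1' g1 q1.
  have s2 : `|(df0 (U s) - df0 w) + (df0 w - dFR w) + (1 - kap * t ^+ 2) * dFR w| <= M * (e1 + 2 * eps + 5 * delta).
    exact: three_terms M1 d0 m2 g2 q2.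
  apply: le_trans (ler_normD _ _) _; rewrite !normrM (gtr0_norm l0) (gtr0_norm u0) normr_nat.
  set Q := M * _ in s1 s2.
  rewrite (_ : lam * (1 + 2 * C) * M * _ = lam * Q + 2 * lam * C * Q); last by rewrite /Q; ring.
  rewrite lerD//; first by rewrite ler_wpM2l// ltW.
  have Q0 : 0 <= Q by exact: le_trans s1.
  apply: ler_pM => //; first by rewrite !mulr_ge0// ltW.
  by rewrite ler_wpM2l// mulr_ge0// ltW.
have D0 : 0 <= D by exact: le_trans xz.
have := @isd_lip _ _ _ _ _ _ (1 + x s) (1 + z s) dt bt ltac:(lra) ltac:(lra).
have phiE (v : R -> R) : phi (1 + v s) = (1 + v s) * (lam * (f0 (U s) - kap * FR (modsq v s))) +
    2 * lam * U s * df0 (U s) * v s.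
  by rewrite /phi /modsq; congr (_ + _ * _); ring.
rewrite !phiE (_ : 1 + x s - (1 + z s) = x s - z s); last by ring.
move=> /le_trans; apply.
have e10 : 0 <= e1.
  have [] := f0mod uI uI _; rewrite ?subrr ?normr0//.
  by rewrite !mulr_ge0// ltW.
by rewrite ler_wpM2l// !mulr_ge0// ?addr_ge0 ?mulr_ge0// ltW.
Qed.

Definition c5 : R := 2 + 6 * C + 2 * c1.
Definition c6 : R := c4 ^+ 2 + 4 * c3 * c4.

Lemma rem_lip x z (D : R) : near_id x -> near_id z ->
  (forI l s, `|x s - z s| <= D) -> forI l s,   `|rem x s - rem z s| <= (lam * (1 + 2 * C) * M * (e1 + 2 * eps + 5 * delta)
     + lam * c5 * E + c6 * E ^+ 2) * D.
Proof.
move=> nx nz xz s sI.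
have H1 := main_part_lip nx nz sI (xz s sI).
have /andP[k0 k1] := kappa_bounds; rewrite -/kap in k0 k1; have /andP[ep0 ep1] := eps0.
have D0 : 0 <= D by exact: le_trans (xz s sI).
have Ep := E_gt0; have l0 := lam0.
have epsE : eps <= E by rewrite EE; have := M1; nra.
have [rx _ wx] := near_id_bounds nx sI; have [rz _ wz] := near_id_bounds nz sI.
have /andP[d0 d1] := delta0.
have z2 : `|1 + z s| <= 2 by rewrite ger0_norm; lra.
have xz1 : `|1 + x s - (1 + z s)| <= 1 * D.
  by rewrite mul1r (_ : _ - _ = x s - z s); [exact: xz|ring].
have H2 : `|(1 + x s) * (FI (modsq x s) + Om x) - (1 + z s) * (FI (modsq z s) + Om z)| <= c5 * E * D.
  apply: le_trans (norm_prod_le (q := (3 * C + c1) * E) (A := 2) (B := 2 * E) xz1 _ z2 _) _.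
  - rewrite (_ : _ - _ = (FI (modsq x s) - FI (modsq z s)) + (Om x - Om z)); last by ring.
    apply: le_trans (ler_normD _ _) _; have := Om_lip nx nz xz.
    have := comp_lip dFIE (fun y yI => proj2 (FIeps yI)) nx nz sI (xz s sI).
    have : eps * (3 * C) * D <= E * (3 * C) * D.
      by rewrite !ler_wpM2r// mulr_ge0// ltW.
    lra.
  - apply: le_trans (ler_normD _ _) _; have := Om_bound nx; have [+ _] := FIeps wx; lra.
  - by rewrite /c5; lra.
have P1 := phase_bound' nx sI; have P2 := phase_bound' nz sI; have P3 := phase_lip nx nz xz sI.
have H3 : `|(1 + x s) * phase x s ^+ 2 - (1 + z s) * phase z s ^+ 2| <= c6 * E ^+ 2 * D.
  apply: le_trans (norm_prod_le (q := 2 * c3 * c4 * E ^+ 2) (A := 2) (B := (c4 * E) ^+ 2) xz1 _ z2 _) _.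
  - apply: le_trans (norm_prod_le (p := c3 * E) (q := c3 * E) (A := c4 * E) (B := c4 * E) (D := D) _ _ _ _) _ => //.
    lra.
  - by rewrite normrX lerXn2r// nnegrE (le_trans _ P1).
  - by rewrite /c6; lra.
(* Main part, coupling through [eta (FI + Om)], and the square of the phase derivative, with
   Lipschitz constants of orders [e1 + eps + delta], [E] and [E^2]. *)
rewrite (_ : rem x s - rem z s =
  (((1 + x s) * (lam * (f0 (U s) - kap * FR (modsq x s))) + 2 * lam * U s * df0 (U s) * x s) -
    ((1 + z s) * (lam * (f0 (U s) - kap * FR (modsq z s))) + 2 * lam * U s * df0 (U s) * z s))
  - lam * (kap * eta) * ((1 + x s) * (FI (modsq x s) + Om x) - (1 + z s) * (FI (modsq z s) + Om z))
  + ((1 + x s) * phase x s ^+ 2 - (1 + z s) * phase z s ^+ 2)); last first.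
  by rewrite /rem /amp -/kap; ring.
have H4 : `|lam * (kap * eta) * ((1 + x s) * (FI (modsq x s) + Om x) - (1 + z s) * (FI (modsq z s) + Om z))|
    <= lam * (c5 * E * D).
  rewrite normrM; apply: ler_pM => //.
  rewrite normrM (gtr0_norm l0) ler_piMr ?(ltW l0)// normrM (gtr0_norm k0).
  have := etaeps; have := normr_ge0 eta; nra.
apply: le_trans (ler_normD _ _) _; apply: le_trans (lerD (ler_normB _ _) H3) _; lra.
Qed.

Lemma near_id0 : near_id (fun=> 0).
Proof.
by split=> [|s _]; [exact: bdcont_cst|rewrite normr0; case/andP: delta0 => /ltW].
Qed.

Lemma rem0 (s : R) : 0 < s < l ->
  `|rem (fun=> 0) s| <= lam * (eps * (1 + M) + 2 * E) + c4 ^+ 2 * E ^+ 2.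
Proof.
move=> sI; have n0 := near_id0.
have [_ _ wI] := near_id_bounds n0 sI.
have /andP[k0 k1] := kappa_bounds; rewrite -/kap in k0 k1; have /andP[ep0 ep1] := eps0.
have Ep := E_gt0; have l0 := lam0.
have epsE : eps <= E by rewrite EE; have := M1; nra.
have P1 := phase_bound' n0 sI.
have w0 : modsq (fun=> 0) s = U s by rewrite /modsq addr0 expr1n mulr1.
have [g1 _] := f0eps wI; have [h1 _] := FRM wI; have [i1 _] := FIeps wI.
rewrite w0 in g1 h1 i1; have o1 := Om_bound n0.
rewrite (_ : rem _ s = lam * ((f0 (U s) - FR (U s)) + (1 - kap) * FR (U s) -
  kap * eta * (FI (U s) + Om (fun=> 0))) + phase (fun=> 0) s ^+ 2); last first.
  by rewrite /rem /amp w0 -/kap; ring.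
apply: le_trans (ler_normD _ _) _; rewrite lerD//; last first.
  by rewrite normrX -exprMn lerXn2r// nnegrE (le_trans _ P1).
rewrite normrM (gtr0_norm l0) ler_wpM2l ?(ltW l0)//.
apply: le_trans (ler_normB _ _) _; rewrite lerD//.
  apply: le_trans (ler_normD _ _) _; rewrite mulrDr mulr1 lerD// normrM.
  by apply: ler_pM => //; exact: kap_eps.
rewrite !normrM (gtr0_norm k0).
have a1 : kap * `|eta| <= 1 by have := etaeps; have := normr_ge0 eta; nra.
have a2 : `|FI (U s) + Om (fun=> 0)| <= 2 * E.
  by apply: le_trans (ler_normD _ _) _; lra.
have := normr_ge0 (FI (U s) + Om (fun=> 0)); have := normr_ge0 eta; nra.
Qed.

Lemma bdcont_rem x : near_id x -> bdcont l (rem x).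
Proof.
move=> nx; have bx : bdcont l x by case: nx.
have b1 : bdcont l (fun s => f0 (U s)) by apply: (bdcont_compU (M := M)) => // y /f0M[].
have b2 : bdcont l (fun s => df0 (U s)) by apply: (bdcont_compU (M := M)) => // y /f0M[].
have bamp : bdcont l (amp x).
  rewrite /amp; under eq_fun do rewrite mulrC.
  apply: bdcontZ; apply: bdcontD; last exact: bdcont_cst.
  by apply: bdcontD; [exact: bdcont_FR|apply: bdcontZ; exact: bdcont_FI].
apply: bdcontD.
  apply: bdcontM; first by apply: bdcontD => //; exact: bdcont_cst.
  apply: bdcontD; last by apply: bdcontX; exact: bdcont_phase.
  by apply: bdcontZ; exact: bdcontB.
by do 2![apply: bdcontM => //]; apply: bdcontZ.
Qed.

End Fixed.

(** A common modulus for the function and its derivative up to the open ends, since [delta] must be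
    fixed before the perturbed reaction is known. *)
Definition unif_mod (C' : R) (f0 df0 : R -> R) := forall e : R, 0 < e -> exists2 d : R, 0 < d &
  forall y z : R, 0 < y < C' -> 0 < z < C' -> `|y - z| <= d ->
    `|f0 y - f0 z| <= e /\ `|df0 y - df0 z| <= e.

Lemma unif_mod_cont C' f0 df0 : unif_mod C' f0 df0 ->
  forall y : R, 0 < y < C' -> {for y, continuous f0} /\ {for y, continuous df0}.
Proof.
move=> H y yI; split; apply/cvgrPdist_le => e e0; have [d d0 Hd] := H e e0; near=> z;
  have zI : 0 < z < C' by near: z; exact: near_in.
  by have [] := Hd y z yI zI _ => //; near: z; apply: cvgr_dist_le => //; exact: cvg_id.
by have [] := Hd y z yI zI _ => //; near: z; apply: cvgr_dist_le => //; exact: cvg_id.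
Unshelve. all: by end_near. Qed.

End Perturbation.

(** The linearisation has an inverse of norm [B] in the uniform norm, since its potential is
    nonnegative and somewhere positive; [x] is the fixed point of that inverse applied to [rem] on
    the ball of radius [delta]. The constants are chosen in the order [B], [e1], [delta], [eps]. *)
Theorem perturbation (R : realType) (l : R) (rho U : R -> R) (C lam : R)
    (f0 df0 : R -> R) (M0 : R) :
  weight l rho -> bdcont l U -> 0 < C -> (forI l s, 0 < U s <= C) ->
  0 < lam ->
  unif_mod (3 * C) f0 df0 ->
  (forI (3 * C) y, `|f0 y| <= M0 /\ `|df0 y| <= M0) ->
  (forI l s, df0 (U s) <= 0) ->
  (exists2 s : R, 0 < s < l & df0 (U s) < 0) ->
  forall tau : R, 0 < tau -> exists2 eps : R, 0 < eps &
  forall (FR dFR FI dFI : R -> R) (eta : R),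
  (forI (3 * C) y, isd FR y (dFR y)) ->
  (forI (3 * C) y, isd FI y (dFI y)) ->
  (forI (3 * C) y, `|f0 y - FR y| <= eps /\ `|df0 y - dFR y| <= eps) ->
  (forI (3 * C) y, `|FI y| <= eps /\ `|dFI y| <= eps) ->
  `|eta| <= eps ->
  exists (Om : R) (x P : R -> R) (K : R),
  [/\ bdcont l x /\ (forI l s, `|x s| <= tau /\ `|x s| <= 1 / 4),
      neumann l rho (fun s => (1 + x s) * (lam * (f0 (U s) -
        (FR (modsq U x s) + eta * FI (modsq U x s) + eta * Om) / (1 + eta ^+ 2)) + P s ^+ 2)) x,
      bdcont l P /\ (forI l s, `|P s| <= K * Num.min s (l - s)),
      forI l s, isd (fun t => wgt rho x t * P t) s
        (- lam / (1 + eta ^+ 2) * (wgt rho x s * (Om - (eta * FR (modsq U x s) - FI (modsq U x s))))) &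
      prim l (fun s => wgt rho x s * (Om - (eta * FR (modsq U x s) - FI (modsq U x s)))) l = 0].
Proof.
move=> W bU C0 hU lam0 um fM dneg dneg1 tau tau0; have l0 := weight_l W; have C0' := C0; have lm0 := lam0.
have uc := unif_mod_cont um.
pose q (s : R) := - (2 * lam * U s * df0 (U s)).
have cU (g : R -> R) : (forI (3 * C) y, {for y, continuous g}) ->
    (forI (3 * C) y, `|g y| <= M0) -> bdcont l (fun s => g (U s)).
  by move=> cg gM; apply: (bdcont_compU bU C0 hU (M := M0)).
have bq : bdcont l q.
  apply: bdcontN; apply: bdcontM; first exact: bdcontZ.
  by apply: cU => y yI; [case: (uc y yI)|case: (fM y yI)].
have q0 (s : R) : 0 < s < l -> 0 <= q s.
  move=> sI; rewrite /q oppr_ge0 mulr_ge0_le0 ?dneg//.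
  by have /andP[u0 _] := hU _ sI; rewrite !mulr_ge0 ?ltW.
have qpos : exists2 s : R, 0 < s < l & 0 < q s.
  case: dneg1 => s sI d0; exists s => //; rewrite /q oppr_gt0 pmulr_rlt0//.
  by have /andP[u0 _] := hU _ sI; rewrite !mulr_gt0.
have [Sq [B B0 HB]] := linear_neumann W bq q0 qpos.
have [K K0 HK] := weight_bound W.
(* Constants enter as opaque variables with an equation, so that the arithmetic tactics treat them
   as atoms. *)
have [M ME] : exists M : R, M = `|M0| + 1 by eexists.
have M1 : 1 <= M by rewrite ME lerDr.
have M00 : 0 < M by exact: lt_le_trans M1.
have C2 : 0 < 1 + 2 * C by clear -C0; lra.
have [a aE] : exists a : R, a = lam * (1 + 2 * C) * M by eexists.
have a0 : 0 < a by rewrite aE !mulr_gt0.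
(* This choice, the bound [1 / (40 B a)] on [delta] and the bound [1 / (8 B b)] on [eps] each
   contribute at most [1/8] to [B th], the contraction ratio below. *)
have [e1 e1E] : exists e1 : R, e1 = (8 * B * a)^-1 by eexists.
have e10 : 0 < e1 by rewrite e1E invr_gt0 !mulr_gt0.
have [d d0 Hd] := um e1 e10.
(* The four bounds give the required closeness [tau], the window of [near_id_bounds], the modulus of
   continuity at distance [5 C delta], and the contraction. *)
pose delta := Num.min (Num.min tau (1 / 4)) (Num.min (d / (5 * C)) (40 * B * a)^-1).
have delta0 : 0 < delta by rewrite !lt_min tau0 divr_gt0 ?divr_gt0 ?invr_gt0 ?mulr_gt0.
have dl1 : delta <= tau by rewrite /delta !ge_min lexx.
have dl2 : delta <= 1 / 4 by rewrite /delta !ge_min lexx !orbT.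
have dl3 : delta <= d / (5 * C) by rewrite /delta !ge_min lexx !orbT.
have dl4 : delta <= (40 * B * a)^-1 by rewrite /delta !ge_min lexx !orbT.
clearbody delta.
have c10 : 0 < c1 C by rewrite /c1; clear -C0; lra.
have c20 : 0 < c2 C by move: c10; rewrite /c2; clear -C0; lra.
have c30 : 0 < c3 l C lam K by rewrite /c3 mulr_gt0// addr_gt0// !mulr_gt0.
have c40 : 0 < c4 l lam K by rewrite /c4 !mulr_gt0.
have c50 : 0 < c5 C by move: c10; rewrite /c5; clear -C0; lra.
have c60 : 0 < c6 l C lam K.
  rewrite /c6; apply: addr_gt0; first exact: exprn_gt0.
  by apply: (mulr_gt0 (mulr_gt0 _ c30) c40).
have [k5 k5E] : exists k : R, k = c5 C by eexists.
have [k6 k6E] : exists k : R, k = c6 l C lam K by eexists.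
have [k4 k4E] : exists k : R, k = c4 l lam K by eexists.
rewrite -k5E in c50; rewrite -k6E in c60; rewrite -k4E in c40.
have [b bE] : exists b : R, b = 2 * a + lam * k5 * (2 * M) + k6 * (2 * M) by eexists.
have b0 : 0 < b by rewrite bE !addr_gt0// !mulr_gt0.
have [g gE] : exists g : R, g = lam * (1 + M + 4 * M) + k4 ^+ 2 * (2 * M) by eexists.
have g0 : 0 < g by rewrite gE addr_gt0// mulr_gt0 ?exprn_gt0 ?mulr_gt0// !addr_gt0// mulr_gt0.
(* In turn: [E <= 1], the contraction, and [|Phi 0| <= delta / 2], by which the ball is mapped into
   itself. *)
pose eps := Num.min (2 * M)^-1 (Num.min (8 * B * b)^-1 (delta / (2 * B * g))).
have eps0 : 0 < eps.
  by rewrite !lt_min !invr_gt0 divr_gt0 ?andbT ?mulr_gt0.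
have es1 : eps <= (2 * M)^-1 by rewrite /eps !ge_min lexx.
have es2 : eps <= (8 * B * b)^-1 by rewrite /eps !ge_min lexx !orbT.
have es3 : eps <= delta / (2 * B * g) by rewrite /eps !ge_min lexx !orbT.
clearbody eps.
have E1 : 2 * eps * M <= 1.
  by move: es1; clear -M1; rewrite -div1r ler_pdivlMr; lra.
have eps1 : eps <= 1 by move: E1; clear -M1 eps0; nra.
exists eps => // FR dFR FI dFI eta dFRE dFIE f0eps FIeps etaeps.
have FRM (y : R) : 0 < y < 3 * C -> `|FR y| <= M /\ `|dFR y| <= M.
  move=> yI; have [h1 h2] := fM y yI; have [h3 h4] := f0eps y yI; have h5 := ler_norm M0.
  move: h1 h2 h3 h4; clear -ME eps1 h5; rewrite ME !ler_norml; split; apply/andP; split; lra.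
have f0M (y : R) : 0 < y < 3 * C -> `|f0 y| <= M /\ `|df0 y| <= M.
  move=> yI; have [h1 h2] := fM y yI; have h5 := ler_norm M0; rewrite ME; clear -h1 h2 h5; split; lra.
have f0mod (y z : R) : 0 < y < 3 * C -> 0 < z < 3 * C -> `|y - z| <= 5 * C * delta ->
    `|f0 y - f0 z| <= e1 /\ `|df0 y - df0 z| <= e1.
  move=> yI zI yz; apply: Hd => //; apply: le_trans yz _.
  by rewrite mulrC -ler_pdivlMr// mulr_gt0.
have eps01 : 0 < eps <= 1 by rewrite eps0.
have delta01 : 0 < delta <= 1 / 4 by rewrite delta0.
have [E EE] : exists E : R, E = 2 * eps * M by eexists.
have E0 : 0 < E by rewrite EE; clear -eps0 M1; nra.
have E1' : E <= 1 by rewrite EE.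
have EE2 : E ^+ 2 <= E by rewrite expr2 ler_piMl// ltW.
pose th := lam * (1 + 2 * C) * M * (e1 + 2 * eps + 5 * delta) + lam * k5 * E + k6 * E ^+ 2.
have thB : B * th <= 1 / 2.
  have t1 : B * (a * e1) = 1 / 8 by rewrite e1E; field; rewrite !gt_eqF.
  have t2 : B * (a * (5 * delta)) <= 1 / 8.
    apply: (@le_trans _ _ (B * (a * (5 * (40 * B * a)^-1)))).
      by rewrite !ler_wpM2l// ltW.
    by apply: le_of_eq; field; rewrite !gt_eqF.
  have t3 : B * (b * eps) <= 1 / 8.
    apply: (@le_trans _ _ (B * (b * (8 * B * b)^-1))).
      by rewrite !ler_wpM2l// ltW.
    by apply: le_of_eq; field; rewrite !gt_eqF.
  have : th <= a * e1 + a * (5 * delta) + b * eps.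
    have : k6 * E ^+ 2 <= k6 * E by rewrite ler_wpM2l// ltW.
    by rewrite /th -aE bE => h; move: h; rewrite EE; clear; lra.
  rewrite -(ler_pM2l B0) => h; move: t1 t2 t3 h; clear; lra.
have th0 : 0 <= th.
  rewrite /th -aE; apply: addr_ge0 (mulr_ge0 (ltW c60) (sqr_ge0 E)).
  apply: addr_ge0 (mulr_ge0 (mulr_ge0 (ltW lm0) (ltW c50)) (ltW E0)).
  by rewrite mulr_ge0 ?(ltW a0)// ltW// !addr_gt0// mulr_gt0.
pose nid := near_id l delta.
have remL := rem_lip W bU C0 hU lam0 dFRE dFIE FRM FIeps etaeps M1 eps01 delta01 EE K0 HK f0eps f0mod.
have remb := bdcont_rem W bU C0 hU lam0 dFRE dFIE FRM FIeps etaeps M1 eps01 delta01 EE K0 HK (fun y yI => proj2 (uc y yI)) f0M (fun y yI => proj1 (uc y yI)).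
set rm := rem l rho U lam FR FI eta f0 df0 in remL remb.
have n0 : nid (fun=> 0) by exact: near_id0.
have rem0B (s : R) : 0 < s < l -> B * `|rm (fun=> 0) s| <= delta / 2.
  move=> sI; have := rem0 W bU hU lam0 dFRE dFIE FRM FIeps etaeps M1 eps01 delta01 EE K0 HK f0eps sI.
  rewrite -/rm => H.
  have H2 : `|rm (fun=> 0) s| <= eps * g.
    apply: le_trans H _.
    have : c4 l lam K ^+ 2 * E ^+ 2 <= k4 ^+ 2 * E by rewrite k4E ler_wpM2l// sqr_ge0.
    move=> h; move: h; rewrite gE EE; clear; lra.
  apply: (@le_trans _ _ (B * (delta / (2 * B * g) * g))).
    rewrite ler_wpM2l ?(ltW B0)//; apply: le_trans H2 _; by rewrite ler_wpM2r// ltW.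
  by apply: le_of_eq; field; rewrite !gt_eqF.
have ex x : exists z : R -> R, nid x -> neumann l rho (fun s => q s * z s - (- rm x s)) z.
  have [nx|nx] := pselect (nid x); last by exists x.
  by have [z Nz] := Sq _ (bdcontN (remb x nx)); exists z.
have [Phi HPhi] := choice ex.
have PhiL x z (D : R) : nid x -> nid z -> (forI l s, `|x s - z s| <= D) ->
    forI l s, `|Phi x s - Phi z s| <= D / 2.
  move=> nx nz xz s sI; have N := neumannB (HPhi x nx) (HPhi z nz).
  have D0 : 0 <= D by exact: le_trans (xz s sI).
  have := HB (fun s => rm z s - rm x s) (fun s => Phi x s - Phi z s) (th * D).
  move=> H; apply: (@le_trans _ _ (B * (th * D))).
    apply: H => //; first by apply: bdcontB; exact: remb.
      by move: N; apply: neumann_eq => t _ //; ring.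
    by move=> t tI; rewrite distrC /th k5E k6E; exact: remL.
  by move: thB D0; rewrite mulrA; clear; nra.
have Phi0 (s : R) : 0 < s < l -> `|Phi (fun=> 0) s| <= delta / 2.
  move=> sI; have := HB (fun s => - rm (fun=> 0) s) (Phi (fun=> 0)) (delta / 2 / B).
  rewrite [B * _]mulrC divfK ?gt_eqF//; apply => //.
  - by apply: bdcontN; exact: remb.
  - exact: HPhi.
  - by move=> t tI; rewrite normrN ler_pdivlMr// mulrC rem0B.
have [||||||x [nx xE xb]] := @contraction_fixpoint R l nid Phi (fun=> 0) (delta / 2).
- exact: n0.
- move=> x nx; have bPx := neumann_bdcont W (HPhi x nx); split; first exact: bPx.
  move=> s sI; have : `|Phi x s - Phi (fun=> 0) s| <= delta / 2.
    by apply: PhiL sI => // t tI; rewrite subr0; case: nx => _; exact.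
  by have := Phi0 s sI; clear; rewrite !ler_norml; lra.
- move=> u Hu; split.
    by apply: bdcont_unif => e e0; have [x [bx _] ux] := Hu e e0; exists x.
  move=> s sI; apply/ler_addgt0Pr => e e0; have [x [_ /(_ s sI) xd] /(_ s sI) ux] := Hu e e0.
  by move: xd ux; clear; rewrite !ler_norml; lra.
- by rewrite ltW// divr_gt0.
- by move=> s sI; rewrite subr0 Phi0.
- exact: PhiL.
have bP := bdcont_phase W bU hU lam0 dFRE dFIE FRM FIeps etaeps M1 eps01 delta01 EE K0 HK nx.
have PB s := phase_bound W bU hU lam0 dFRE dFIE FRM FIeps etaeps M1 eps01 delta01 EE K0 HK (s := s) nx.
have Omw := Om_weighted W bU hU eta dFRE dFIE FRM FIeps delta01 nx.
have bj := bdcont_j rho bU hU eta dFRE dFIE FRM FIeps delta01 nx.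
exists (Om l rho U FR FI eta x), x, (phase l rho U lam FR FI eta x), (8 * lam * K * E).
split.
- split; first by case: nx.
  by move=> s sI; case: nx => _ /(_ s sI) h; move: h dl1 dl2; clear; split; lra.
- move: (HPhi x nx); apply: neumann_eq => // s sI.
  by rewrite xE// /rm /rem /amp /q; ring.
- by split.
- move=> s sI; apply: (@isd_near _ (fun t => - lam / (1 + eta ^+ 2) * flux l rho U FR FI eta x t)).
    near=> t; have tI : 0 < t < l by near: t; exact: near_in.
    rewrite /phase [RHS]mulrC divfK// gt_eqF// mulr_gt0 ?(weight_gt0 W)//.
    have := near_id_bounds hU delta01 nx tI.
    by move=> [_ /andP[h _] _]; move: h; clear; lra.
  apply: isdZ; apply: isd_eqd (isd_prim _ sI) _; first by apply: bdcontM bj; exact: weight_bd W.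
  by rewrite /wgt /ell; ring.
- rewrite -[RHS]Omw; apply: eq_prim => s _; by rewrite /wgt /ell; ring.
Unshelve. all: by end_near. Qed.

Lemma ae_sub {d} {T : measurableType d} {R : realType} {nu : {measure set T -> \bar R}} {P Q : T -> Prop} :
  {ae nu, forall s, P s} -> (forall s, P s -> Q s) -> {ae nu, forall s, Q s}.
Proof. by move=> A H; apply: (@filterS _ _ (ae_filter_ringOfSetsType (nu : measure T R)) _ _ _ A). Qed.

Lemma ae_and {d} {T : measurableType d} {R : realType} {nu : {measure set T -> \bar R}} {P Q : T -> Prop} :
  {ae nu, forall s, P s} -> {ae nu, forall s, Q s} -> {ae nu, forall s, P s /\ Q s}.
Proof. exact: (@filterI _ _ (ae_filter_ringOfSetsType (nu : measure T R))). Qed.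

(** * Integration over rectangles *)

Section PlaneMeasure.
Context {R : realType}.
Notation mu := (@lebesgue_measure R).
Notation mu2 := ((@lebesgue_measure R) \x (@lebesgue_measure R))%E.
Notation RT := (measurableTypeR R).
Notation RR := (measurableTypeR R * measurableTypeR R)%type.
Local Notation "{ 'aeI' l s , P }" := ({ae mu, forI l s, P}) (l at level 9, s name).
Notation circle := ([set` `]0, 2 * pi[] : set RT).

Lemma integrable_patch (d : measure_display) (T : measurableType d)
    (nu : {measure set T -> \bar R}) (D : set T) (f : T -> R) : measurable D ->
  nu.-integrable D (EFin \o f) <-> nu.-integrable setT (EFin \o (f \_ D)).
Proof.
move=> mD; have E : (EFin \o f) \_ D = EFin \o (f \_ D).
  by apply/funext => x; rewrite /= /patch; case: ifP.
split=> [/(integrable_mkcond _ mD)|H]; first by rewrite E.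
by apply/(integrable_mkcond _ mD); rewrite E.
Qed.

Lemma itv_integrableS (E D : interval R) (f : R -> R) : [set` D] `<=` [set` E] ->
  mu.-integrable ([set` E] : set (measurableTypeR R)) (EFin \o f) ->
  mu.-integrable ([set` D] : set (measurableTypeR R)) (EFin \o f).
Proof. by move=> DE; apply: integrableS => //; exact: measurable_itv. Qed.

Lemma Rintegral_fine (d : measure_display) (T : measurableType d) (nu : {measure set T -> \bar R})
    (D : set T) (F : T -> \bar R) (mD : measurable D) : nu.-integrable D F ->
  nu.-integrable D (EFin \o (fine \o F)) /\ Rintegral nu D (fine \o F) = fine (\int[nu]_(x in D) F x)%E.
Proof.
move=> iF; have mF := measurable_int nu iF.
have mfF : measurable_fun D (fine \o F).
  exact: (measurableT_comp (@fine_measurable R setT measurableT) mF).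
split.
  apply: (le_integrable mD _ _ iF); first exact/measurable_EFinP.
  move=> x Dx /=.
  by case: (F x) => [r| |] //=; rewrite normr0 ?leey // leey.
congr fine; apply: ae_eq_integral => //; first exact/measurable_EFinP.
have := integrable_ae mD iF; apply: filterS => x H Dx /=.
by rewrite fineK// H.
Qed.

Lemma fubini_rect (A B : set (measurableTypeR R)) (w : R * R -> R) (mA : measurable A) (mB : measurable B) :
  mu2.-integrable (A `*` B : set RR) (EFin \o w) ->
  [/\ mu.-integrable A (EFin \o (fun s => Rintegral mu B (fun p => w (s, p)))),
      Rintegral mu2 (A `*` B : set RR) w = Rintegral mu A (fun s => Rintegral mu B (fun p => w (s, p))) &
      {ae mu, forall s, A s -> mu.-integrable B (EFin \o (fun p => w (s, p)))}].
Proof.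
move=> iw; have mAB : measurable (A `*` B : set RR) by exact: measurableX.
pose f : RR -> \bar R := (EFin \o w) \_ (A `*` B).
have fi : mu2.-integrable setT f by exact/(integrable_mkcond _ mAB).
have fE (x : R) : A x -> (fun y => f (x, y)) = (EFin \o (fun p => w (x, p))) \_ B.
  move=> Ax; apply/funext => y; rewrite /f !patchE.
  by congr (if _ then _ else _); apply/idP/idP; rewrite !inE => // -[].
pose F : RT -> \bar R := fubini_F mu f.
have FE (x : R) : A x -> F x = (\int[mu]_(y in B) (w (x, y))%:E)%E.
  by move=> Ax; rewrite /F /fubini_F fE// -integral_mkcond.
have iF : mu.-integrable setT F by exact: (integrable_fubini_F (m1 := mu) (m2 := mu) fi).
have iFA : mu.-integrable A F by exact: integrableS iF.
have [H1 H2] := Rintegral_fine mA iFA.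
have E x : A x -> (fine \o F) x = Rintegral mu B (fun p => w (x, p)).
  by move=> Ax; rewrite /= FE.
split.
- by apply: eq_integrable H1 => // x /[!inE] Ax; rewrite /= -E.
- transitivity (Rintegral mu A (fine \o F)); last by apply: eq_Rintegral => x /[!inE] Ax; exact: E.
  rewrite H2 /Rintegral; congr fine.
  have -> : (\int[mu]_(x in A) F x = \int[mu]_x F x)%E.
    rewrite integral_mkcond; apply: eq_integral => x _; rewrite patchE.
    case: ifPn => //; rewrite notin_setE => nA; rewrite /F /fubini_F.
    rewrite integral0_eq// => y _; rewrite /f patchE.
    by case: ifP => //; rewrite inE => -[].
  by rewrite /F (integral12_prod_meas1 (m1 := mu) (m2 := mu) fi) [LHS]integral_mkcond.
- have := ae_integrable1 (m1 := mu) (m2 := mu) fi; apply: filterS => x H Ax.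
  by apply/(integrable_mkcond _ mB); rewrite -fE//; exact: H.
Qed.

Lemma fubini_rect2 (A B : set (measurableTypeR R)) (w : R * R -> R) (mA : measurable A) (mB : measurable B) :
  mu2.-integrable (A `*` B : set RR) (EFin \o w) ->
  Rintegral mu2 (A `*` B : set RR) w = Rintegral mu B (fun p => Rintegral mu A (fun s => w (s, p))).
Proof.
move=> iw; have mAB : measurable (A `*` B : set RR) by exact: measurableX.
pose f : RR -> \bar R := (EFin \o w) \_ (A `*` B).
have fi : mu2.-integrable setT f by exact/(integrable_mkcond _ mAB).
have fE (y : R) : B y -> (fun x => f (x, y)) = (EFin \o (fun s => w (s, y))) \_ A.
  move=> By; apply/funext => x; rewrite /f !patchE.
  by congr (if _ then _ else _); apply/idP/idP; rewrite !inE => // -[].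
pose G : RT -> \bar R := fubini_G mu f.
have GE (y : R) : B y -> G y = (\int[mu]_(x in A) (w (x, y))%:E)%E.
  by move=> By; rewrite /G /fubini_G fE// -integral_mkcond.
have mG := measurable_fubini_G (m1 := mu) (m2 := mu) fi.
have aeG : {ae mu, forall y, B y -> G y \is a fin_num}.
  have := ae_integrable2 (m1 := mu) (m2 := mu) fi; apply: filterS => y H By.
  exact: integrable_fin_num (H : mu.-integrable setT (fun x => f (x, y))).
rewrite {1}/Rintegral; transitivity (fine (\int[mu]_(y in B) G y))%E.
  congr fine; rewrite integral_mkcond -(integral21_prod_meas1 (m1 := mu) (m2 := mu) fi).
  rewrite [RHS]integral_mkcond; apply: eq_integral => y _; rewrite patchE.
  case: ifPn => //; rewrite notin_setE => nB; rewrite /fubini_G.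
  rewrite integral0_eq// => x _; rewrite /f patchE.
  by case: ifP => //; rewrite inE => -[].
congr fine; transitivity (\int[mu]_(y in B) (EFin \o (fine \o G)) y)%E; last first.
  by apply: eq_integral => y /[!inE] By; rewrite /= GE.
apply: ae_eq_integral => //.
- exact: (measurable_funS measurableT (@subsetT _ _) mG).
- apply/measurable_EFinP.
  apply: (measurableT_comp (@fine_measurable R setT measurableT) (measurable_funS measurableT (@subsetT _ _) mG)).
- by move: aeG; apply: filterS => y H By; rewrite /= fineK// H.
Qed.

(** * Locally integrable functions and the fundamental lemma *)

Section Distributions.
Variable l : R.

Definition locint (v : R -> R) := forall c e : R, 0 < c -> e < l ->
  mu.-integrable (`[c, e] : set RT) (EFin \o v).

Record bumpf (X X' : R -> R) : Prop := Bump {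
  bump_isd : forall s : R, isd X s (X' s);
  bump_cont : forall s : R, {for s, continuous X'};
  bump_supp : exists c e : R, [/\ 0 < c, c < e, e < l &
    forall s : R, ~~ (c <= s <= e) -> X s = 0 /\ X' s = 0] }.

Lemma integrable_supp (d : measure_display) (T : measurableType d) (nu : {measure set T -> \bar R})
    (D E : set T) (f : T -> R) : measurable D -> measurable E -> E `<=` D ->
  (forall x, D x -> ~ E x -> f x = 0) ->
  (nu.-integrable E (EFin \o f) -> nu.-integrable D (EFin \o f)) /\
  Rintegral nu D f = Rintegral nu E f.
Proof.
move=> mD mE ED f0.
have EQ : f \_ D = f \_ E.
  apply/funext => x; rewrite !patchE; case: ifPn => [|]; case: ifPn => //.
    by rewrite notin_setE inE => nE Dx; rewrite f0.
  by rewrite inE notin_setE => Ex; case; exact: ED.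
split; last by rewrite Rintegral_mkcond EQ -Rintegral_mkcond.
by move=> /(integrable_patch _ _ mE); rewrite -EQ => /(integrable_patch _ _ mD).
Qed.

Lemma locint_cont (v : R -> R) : contI l v -> locint v.
Proof.
move=> cv c e c0 el; apply: continuous_compact_integrable; first exact: segment_compact.
apply: continuous_in_subspaceT => s; rewrite inE /= in_itv /= => /andP[cs se].
by apply: cv; rewrite (lt_le_trans c0 cs) (le_lt_trans se el).
Qed.

Lemma locintM (v X : R -> R) : locint v -> contI l X ->
  locint (fun s => v s * X s).
Proof.
move=> lv cX c e c0 el.
have cs : {within `[c, e], continuous X}.
  apply: continuous_in_subspaceT => s; rewrite inE /= in_itv /= => /andP[cs se].
  by apply: cX; rewrite (lt_le_trans c0 cs) (le_lt_trans se el).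
have := @integrableMl _ RT R mu `[c, e] _ (EFin \o v) X (lv c e c0 el).
apply.
- exact: measurable_itv.
- by apply: subspace_continuous_measurable_fun => //; exact: measurable_itv.
- have [M Mr] := compact_bounded (continuous_compact cs (@segment_compact _ c e)).
  exists M; split; first by case: Mr.
  by move=> y My s sI; case: Mr => _ /(_ y My); apply; exists s.
Qed.

Lemma locintD (v w : R -> R) : locint v -> locint w -> locint (fun s => v s + w s).
Proof.
move=> lv lw c e c0 el.
by have := @integrableD _ RT R mu `[c, e] (measurable_itv _) _ _ (lv c e c0 el) (lw c e c0 el).
Qed.

Lemma supp_cont_integral (k X : R -> R) (c e : R) : locint k -> 0 < c -> e < l ->
  contI l X ->
  (forall s : R, ~~ (c <= s <= e) -> X s = 0) ->
  intI l (fun s => k s * X s) /\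
  RintI l (fun s => k s * X s) =
  Rintegral mu (`[c, e] : set RT) (fun s => k s * X s).
Proof.
move=> lk c0 el cX X0.
have [] := @integrable_supp _ RT mu `]0, l[ `[c, e] (fun s => k s * X s).
- exact: measurable_itv.
- exact: measurable_itv.
- move=> s /=; rewrite !in_itv /= => /andP[cs se].
  by rewrite (lt_le_trans c0 cs) (le_lt_trans se el).
- move=> s _ /= ns; rewrite X0 ?mulr0//; apply/negP => h; apply: ns.
  by rewrite /= in_itv.
move=> H ->; split=> //; apply: H.
by apply: locintM.
Qed.

Lemma bump_cont0 X X' : bumpf X X' -> forall s : R, {for s, continuous X}.
Proof. by move=> B s; exact: isd_cont (bump_isd B s). Qed.

(** With [tau] the product of the two [npsq] factors, which is of class C^1 and positive exactly on
    [(c, e)], this is [n tau / (1 + n tau)]: a test function increasing with [n] to the indicator of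
    [(c, e)]. *)
Definition plateau (c e : R) (n : nat) (s : R) : R :=
  1 - (1 + n%:R * (npsq (c - s) * npsq (s - e)))^-1.

Lemma plateau_bump (c e : R) n : 0 < c -> c < e -> e < l ->
  [/\ exists X', bumpf (plateau c e n) X', forall s : R, ~~ (c < s < e) -> plateau c e n s = 0,
      forall s : R, 0 <= plateau c e n s <= 1 &
      forall s : R, c < s < e -> plateau c e m s @[m --> \oo] --> (1 : R)].
Proof.
move=> c0 ce el.
pose tau (s : R) := npsq (c - s) * npsq (s - e).
have tau0 (s : R) : 0 <= tau s by rewrite mulr_le0// npsq_le0.
have den m (s : R) : 1 <= 1 + m%:R * tau s by rewrite lerDl mulr_ge0.
have den0 m (s : R) : 1 + m%:R * tau s != 0 by rewrite gt_eqF// (lt_le_trans ltr01 (den m s)).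
have tauE (s : R) : ~~ (c < s < e) -> tau s = 0.
  rewrite negb_and -!leNgt => /orP[h|h].
    by rewrite /tau (npsq_ge0 (t := c - s)) ?mul0r// subr_ge0.
  by rewrite /tau (npsq_ge0 (t := s - e)) ?mulr0// subr_ge0.
pose tau' (s : R) := 2 * Num.min (c - s) 0 * npsq (s - e) - npsq (c - s) * (2 * Num.min (s - e) 0).
have dtau (s : R) : isd tau s (tau' s).
  have d1 : isd (fun s => npsq (c - s)) s (2 * Num.min (c - s) 0).
    by apply: isd_eqd (isd_comp (isdB (isd_cst c s) (isd_id s)) (isd_npsq _)) _; ring.
  have d2 : isd (fun s => npsq (s - e)) s (- (2 * Num.min (s - e) 0)).
    by apply: isd_eqd (isd_comp (isdB (isd_id s) (isd_cst e s)) (isd_npsq _)) _; ring.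
  by apply: isd_eqd (isdM d1 d2) _; rewrite /tau'; ring.
have cmin (f : R -> R) (s : R) : {for s, continuous f} -> {for s, continuous (fun t => Num.min (f t) 0)}.
  by move=> cf; apply: continuous_min => //; exact: cvg_cst.
have cs (s : R) : {for s, continuous (fun t : R => c - t)}.
  by apply: continuousB; [exact: cvg_cst|exact: cvg_id].
have ces (s : R) : {for s, continuous (fun t : R => t - e)}.
  by apply: continuousB; [exact: cvg_id|exact: cvg_cst].
have cn (f : R -> R) (s : R) : {for s, continuous f} -> {for s, continuous (fun t => npsq (f t))}.
  by move=> cf; apply: continuous_comp => //; exact: isd_cont (isd_npsq _).
have ctau' (s : R) : {for s, continuous tau'}.
  apply: continuousB; apply: continuousM; do ?[by apply: cn].
    by apply: continuousM; [exact: cvg_cst|exact: cmin].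
  by apply: continuousM; [exact: cvg_cst|exact: cmin].
split.
- exists (fun s => n%:R * tau' s / (1 + n%:R * tau s) ^+ 2); split.
  + move=> s; have dd : isd (fun t => 1 + n%:R * tau t) s (n%:R * tau' s).
      by apply: isd_eqd (isdD (isd_cst 1 s) (isdZ _ (dtau s))) _; rewrite add0r.
    have H := isdB (isd_cst 1 s) (@isdV _ (fun t => 1 + n%:R * tau t) s _ (den0 n s) dd).
    by rewrite sub0r mulNr opprK in H; exact: H.
  + move=> s; apply: continuousM.
      by apply: continuousM; [exact: cvg_cst|exact: ctau'].
    apply: continuousV; first by rewrite expf_neq0.
    have c1 : {for s, continuous (fun t => 1 + n%:R * tau t)}.
      apply: continuousD; first exact: cvg_cst.
      by apply: continuousM; [exact: cvg_cst|exact: isd_cont (dtau s)].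
    exact: (continuousM c1 c1).
  + exists c, e; split=> // s nce.
    have nce' : ~~ (c < s < e) by apply: contra nce => /andP[/ltW -> /ltW ->].
    split; first by rewrite /plateau -/(tau s) tauE// mulr0 addr0 invr1 subrr.
    rewrite (_ : tau' s = 0) ?mulr0 ?mul0r//.
    move: nce; rewrite negb_and -!ltNge => /orP[h|h].
      have h1 : 0 <= c - s by lra.
      by rewrite /tau' (npsq_ge0 h1) (min_idPr h1) mulr0 !mul0r subrr.
    have h1 : 0 <= s - e by lra.
    by rewrite /tau' (npsq_ge0 h1) (min_idPr h1) !mulr0 subrr.
- by move=> s /tauE; rewrite /plateau -/(tau s) => ->; rewrite mulr0 addr0 invr1 subrr.
- move=> s; rewrite /plateau -/(tau s) subr_ge0 invf_le1 ?(lt_le_trans ltr01 (den n s))// den/=.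
  by rewrite gerBl invr_ge0 (le_trans ler01 (den n s)).
- move=> s /andP[cs' se].
  have t0 : 0 < tau s by rewrite /tau nmulr_lgt0 npsq_lt0//; lra.
  rewrite -[X in _ --> X]subr0; apply: cvgB; first exact: cvg_cst.
  apply/cvgrPdist_le => eps eps0; near=> m.
  rewrite sub0r normrN -/(tau s) ger0_norm ?invr_ge0 ?(le_trans ler01 (den m s))//.
  rewrite -[eps]invrK lef_pV2 ?posrE ?invr_gt0 ?(lt_le_trans ltr01 (den m s))//.
  have : eps^-1 / tau s <= m%:R by near: m; exact: nbhs_infty_ger.
  rewrite ler_pdivrMr//; lra.
Unshelve. all: by end_near. Qed.

(** Dominated convergence along the plateaus, which are bounded by 1 and tend to 1 on []c, e[]. *)
Lemma locint_integral0 (k : R -> R) : locint k ->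
  (forall X X', bumpf X X' -> RintI l (fun s => k s * X s) = 0) ->
  forall c e : R, 0 < c -> c < e -> e < l -> Rintegral mu (`]c, e[ : set RT) k = 0.
Proof.
move=> lk H c e c0 ce el.
have mI : measurable (`]c, e[ : set RT) by exact: measurable_itv.
have ik : mu.-integrable (`]c, e[ : set RT) (EFin \o k).
  by apply: (@itv_integrableS `[c, e]); [exact: subset_itvW|exact: lk].
have mk : measurable_fun (`]c, e[ : set RT) k by apply/measurable_EFinP; exact: measurable_int ik.
have cp n (s : R) : {for s, continuous (plateau c e n)}.
  by have [[X' B] _ _ _] := plateau_bump n c0 ce el; exact: bump_cont0 B s.
have Z n : (\int[mu]_(s in (`]c, e[ : set RT)) (k s * plateau c e n s)%:E)%E = 0%E.
  have [[X' B] p0 _ _] := plateau_bump n c0 ce el.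
  have E := H _ _ B.
  have [Hi Hr] : (mu.-integrable (`]c, e[ : set RT) (EFin \o (fun s => k s * plateau c e n s)) ->
     intI l (fun s => k s * plateau c e n s)) /\
     RintI l (fun s => k s * plateau c e n s) =
     Rintegral mu (`]c, e[ : set RT) (fun s => k s * plateau c e n s).
    apply: integrable_supp => //.
      by apply: subset_itvW; exact: ltW.
    move=> s _ /= ns; rewrite p0 ?mulr0//; apply/negP => h; apply: ns.
    by rewrite /= in_itv.
  have I1 : mu.-integrable (`[c, e] : set RT) (EFin \o (fun s => k s * plateau c e n s)).
    by apply: locintM => //.
  have I2 : mu.-integrable (`]c, e[ : set RT) (EFin \o (fun s => k s * plateau c e n s)).
    by apply: (@itv_integrableS `[c, e]) I1; exact: subset_itvW.
  have := integrable_fin_num mI I2; move: Hr; rewrite E /Rintegral => Hr Hf.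
  by rewrite -[LHS](fineK Hf) -Hr.
have D := @dominated_cvg _ RT R mu `]c, e[ mI (fun n s => (k s * plateau c e n s)%:E)
  (EFin \o k) (EFin \o (fun s => `|k s|)).
have : (\int[mu]_(s in (`]c, e[ : set RT)) (k s * plateau c e n s)%:E)%E @[n --> \oo]
    --> (\int[mu]_(s in (`]c, e[ : set RT)) (k s)%:E)%E.
  apply: D.
  - move=> n; apply/measurable_EFinP; apply: measurable_funM => //.
    apply: open_continuous_measurable_fun; first exact: interval_open.
    by move=> s _; exact: cp.
  - move=> s /=; rewrite in_itv /= => sI; have [_ _ _ L] := plateau_bump 0 c0 ce el.
    apply: cvg_EFin; first by near=> n.
    rewrite -[X in _ --> X]mulr1; apply: cvgM; first exact: cvg_cst.
    exact: L.
  - by [].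
  - exact: integrable_norm.
  - move=> n s _ /=; rewrite lee_fin normrM ler_piMr//.
    by have [_ _ /(_ s)/andP[a b] _] := plateau_bump n c0 ce el; rewrite ger0_norm.
under eq_fun do rewrite Z.
move=> /(cvg_unique (@ereal_hausdorff R)) /(_ (cvg_cst 0%E)) E.
by rewrite /Rintegral /= E.
Unshelve. all: by end_near. Qed.

Lemma ae_exhaust (Q : R -> Prop) :
  (forall c e : R, 0 < c -> c < e -> e < l -> {ae mu, forall s : R, c < s < e -> Q s}) ->
  {aeI l s, Q s}.
Proof.
move=> ae1.
(* For [l > 0] the offset in [n.+3] keeps [l / n.+3] below [l / 2], so the exhausting intervals are
   never degenerate. *)
have A : {ae mu, forall s : R, forall n : nat, l / n.+3%:R < s < l - l / n.+3%:R -> Q s}.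
  apply: ae_foralln => n.
  have [l0|l0] := ltP 0 l; last first.
    apply: aeW => s /andP[h1 h2].
    have : l / 2 <= l / n.+3%:R.
      by rewrite ler_wnM2l// lef_pV2 ?posrE// ler_nat.
    by move=> h3; have : l / n.+3%:R < l - l / n.+3%:R := lt_trans h1 h2; move: h3; generalize (l / n.+3%:R) => q q1 q2; exfalso; move: q1 q2; clear; lra.
  have p0 : 0 < l / n.+3%:R by rewrite divr_gt0.
  have p1 : l / n.+3%:R <= l / 3.
    by rewrite ler_wpM2l ?(ltW l0)// lef_pV2 ?posrE// ler_nat.
  by apply: ae1; move: p0 p1 l0; generalize (l / n.+3%:R) => q; clear; lra.
apply: (ae_sub A) => s H1 /andP[s0 sl].
pose d := Num.min s (l - s); have d0 : 0 < d by rewrite lt_min s0 subr_gt0.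
have l0 : 0 < l by exact: lt_trans sl.
apply: (H1 (Num.bound (l / d))).
have h : l / (Num.bound (l / d)).+3%:R < d.
  rewrite ltr_pdivrMr// mulrC -ltr_pdivrMr//.
  apply: lt_le_trans (archi_boundP _) _; first by rewrite ltW// divr_gt0.
  by rewrite ler_nat -addn3 leq_addr.
have h1 : d <= s by rewrite /d ge_min lexx.
have h2 : d <= l - s by rewrite /d ge_min lexx orbT.
rewrite (lt_le_trans h h1) /= ltrBrDl -ltrBrDr.
exact: lt_le_trans h h2.
Qed.

(** All integrals of [k] over compact subintervals vanish, so the primitive of the truncation of [k]
    is zero inside, while by Lebesgue differentiation its derivative is [k] almost everywhere. *)
Lemma fundamental_lemma (k : R -> R) : locint k ->
  (forall X X', bumpf X X' -> RintI l (fun s => k s * X s) = 0) ->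
  {aeI l s, k s = 0}.
Proof.
move=> lk H; have Z := locint_integral0 lk H.
have ae1 (c e : R) : 0 < c -> c < e -> e < l -> {ae mu, forall s : R, c < s < e -> k s = 0}.
  move=> c0 ce el; pose kk := k \_ `[c, e].
  have ikk : mu.-integrable (setT : set RT) (EFin \o kk).
    have [+ _] := @integrable_patch _ RT mu `[c, e] k (measurable_itv `[c, e]).
    by apply; exact: lk.
  have A := @FTC1Ny R kk (fun y => @integrableS _ RT R mu _ _ _ measurableT (measurable_itv `]-oo, y]) (@subsetT _ _) ikk)
    (integrable_locally (measurable_itv `[c, e]) (lk c e c0 el)).
  pose F := fun x : R => \int[mu]_(t in `]-oo, x]) kk t.
  have A' : {ae mu, forall x : R, derivable F x 1 /\ derive1 F x = kk x} := A.
  apply: (ae_sub A') => s + /andP[cs se] => -[D E].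
  have F0 (x : R) : c < x < e -> F x = 0.
    move=> /andP[cx xe]; rewrite /F.
    rewrite (_ : Rintegral _ _ _ = Rintegral mu (`[c, x] : set RT) k); last first.
      rewrite Rintegral_mkcond [RHS]Rintegral_mkcond; apply: eq_Rintegral => t _.
      rewrite /kk !patchE !mem_setE !in_itv /=.
      case: (lerP t x) => tx; case: (lerP c t) => ct //=.
      by rewrite (le_trans tx (ltW xe)).
    rewrite -Rintegral_itv_obnd_cbnd; last first.
      apply: (@itv_integrableS `[c, e]); last exact: lk.
      by move=> t /=; rewrite !in_itv /= => /andP[/ltW -> h2]; exact: le_trans h2 (ltW xe).
    rewrite -Rintegral_itv_bndo_bndc ?Z//; first exact: lt_trans el.
    apply: (@itv_integrableS `[c, e]); last exact: lk.
    by apply: subset_itvW => //; exact: ltW.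
  have D0 : isd F s 0.
    apply: (@isd_near _ (fun=> 0 : R)).
    by near=> x; rewrite F0//; near: x; apply: near_in; rewrite cs.
  have := E; rewrite /kk patchE mem_set; last by rewrite /= in_itv /= !ltW.
  move=> <-; rewrite derive1E; exact: (@derive_val _ _ _ _ _ _ _ D0).
exact: ae_exhaust.
Unshelve. all: by end_near. Qed.

End Distributions.

(** By Tonelli: the iterated integral of the modulus factors into two finite integrals. *)
Lemma integrable_tensor (A B : set RT) (f g : R -> R) : measurable A -> measurable B ->
  mu.-integrable A (EFin \o f) -> mu.-integrable B (EFin \o g) ->
  mu2.-integrable (A `*` B : set RR) (EFin \o (fun z : RR => f z.1 * g z.2)).
Proof.
move=> mA mB iF iG; have mAB : measurable (A `*` B : set RR) by exact: measurableX.
apply/(@integrable_patch _ RR mu2 _ _ mAB).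
move: iF iG => /(@integrable_patch _ RT mu _ _ mA) iF /(@integrable_patch _ RT mu _ _ mB) iG.
have mf : measurable_fun (setT : set RT) (f \_ A) by apply/measurable_EFinP; exact: measurable_int iF.
have mg : measurable_fun (setT : set RT) (g \_ B) by apply/measurable_EFinP; exact: measurable_int iG.
have -> : (fun z : RR => f z.1 * g z.2) \_ (A `*` B) = (fun z : RR => (f \_ A) z.1 * (g \_ B) z.2).
  apply/funext => -[s p]; rewrite !patchE /= in_setX.
  by case: (s \in A) => /=; case: (p \in B); rewrite ?mulr0 ?mul0r.
have mfg : measurable_fun (setT : set RR) (fun z : RR => (f \_ A) z.1 * (g \_ B) z.2).
  apply: measurable_funM.
    exact: (measurableT_comp mf (@measurable_fst _ _ RT RT)).
  exact: (measurableT_comp mg (@measurable_snd _ _ RT RT)).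
apply/(@integrable12ltyP _ _ RT RT R mu mu); first exact/measurable_EFinP.
have E (x : R) : (\int[mu]_y `|((f \_ A) x * (g \_ B) y)%:E| = `|(f \_ A) x|%:E * \int[mu]_y `|((g \_ B) y)%:E|)%E.
  rewrite -ge0_integralZl_EFin//; last by do 2!apply: measurableT_comp => //.
  by apply: eq_integral => y _; rewrite /= normrM.
have [mF lF] := integrableP _ _ _ iF; have [mG lG] := integrableP _ _ _ iG.
under eq_integral => x _ do rewrite /= E.
have fG : (\int[mu]_y `|((g \_ B) y)%:E|)%E \is a fin_num.
  by rewrite ge0_fin_numE//; exact: integral_ge0.
rewrite -(fineK fG) ge0_integralZr//.
- have fF : (\int[mu]_y `|(f \_ A) y|%:E)%E \is a fin_num.
    by rewrite ge0_fin_numE//; exact: integral_ge0.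
  by rewrite -(fineK fF) -EFinM ltry.
- by do 2!apply: measurableT_comp => //.
- by rewrite lee_fin fine_ge0// integral_ge0.
Qed.

Lemma integrable_bdM (d : measure_display) (T : measurableType d) (nu : {measure set T -> \bar R})
    (D : set T) (b f : T -> R) (K : R) : measurable D -> measurable_fun D b ->
  (forall x, D x -> `|b x| <= K) -> nu.-integrable D (EFin \o f) ->
  nu.-integrable D (EFin \o (fun x => b x * f x)).
Proof.
move=> mD mb bK iF; have mf : measurable_fun D f by apply/measurable_EFinP; exact: measurable_int iF.
have iK : nu.-integrable D (fun x => K%:E * (EFin \o f) x)%E by exact: integrableZl.
apply: (le_integrable mD _ _ iK).
  by apply/measurable_EFinP; exact: measurable_funM.
move=> x Dx /=; rewrite lee_fin !normrM ler_wpM2r// (le_trans (bK x Dx))//.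
exact: ler_norm.
Qed.

Lemma rintegrableZ (d : measure_display) (T : measurableType d) (nu : {measure set T -> \bar R})
    (D : set T) (k : R) (f : T -> R) : measurable D -> nu.-integrable D (EFin \o f) ->
  nu.-integrable D (EFin \o (fun x => k * f x)).
Proof. by move=> mD iF; apply: eq_integrable (integrableZl mD k iF). Qed.

Lemma rintegrableD (d : measure_display) (T : measurableType d) (nu : {measure set T -> \bar R})
    (D : set T) (f g : T -> R) : measurable D -> nu.-integrable D (EFin \o f) ->
  nu.-integrable D (EFin \o g) -> nu.-integrable D (EFin \o (fun x => f x + g x)).
Proof. by move=> mD iF iG; apply: eq_integrable (integrableD mD iF iG). Qed.

Lemma isd_Rintegral (X X' : R -> R) (c e : R) : c <= e ->
  (forall s : R, c <= s <= e -> isd X s (X' s)) ->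
  (forall s : R, c <= s <= e -> {for s, continuous X'}) ->
  mu.-integrable (`[c, e] : set RT) (EFin \o X') /\
  Rintegral mu (`[c, e] : set RT) X' = X e - X c.
Proof.
move=> ce dX cX'.
have cw : {within `[c, e], continuous X'}.
  apply: continuous_in_subspaceT => s; rewrite inE /= in_itv /=; exact: cX'.
split; first exact: continuous_compact_integrable (@segment_compact _ c e) cw.
move: ce; rewrite le_eqVlt => /predU1P[<-|ce].
  by rewrite subrr set_itv1 Rintegral_set1.
have cX (s : R) : c <= s <= e -> {for s, continuous X} by move=> h; exact: isd_cont (dX s h).
have := @continuous_FTC2 R X' X c e ce cw; rewrite /Rintegral => ->.
- by [].
- split.
  + move=> s; rewrite in_itv /= => /andP[h1 h2].
    have D : isd X s (X' s) by apply: dX; rewrite !ltW.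
    exact: (@ex_derive _ _ _ _ _ _ _ D).
  + by apply: cvg_at_right_filter; apply: cX; rewrite lexx ltW.
  + by apply: cvg_at_left_filter; apply: cX; rewrite lexx ltW.
- move=> s; rewrite in_itv /= => /andP[h1 h2]; rewrite derive1E.
  have D : isd X s (X' s) by apply: dX; rewrite !ltW.
  exact: (@derive_val _ _ _ _ _ _ _ D).
Qed.

(** * Weak derivatives on the interval and their classical representatives *)

Section WeakDerivative.
Variable l : R.

Definition wder (v g : R -> R) := [/\ locint l v, locint l g &
  forall X X', bumpf l X X' -> RintI l (fun s => v s * X' s) =
    - RintI l (fun s => g s * X s)].

(** [G] is only the primitive of an integrable function, so the integration by parts is an exchange
    of integrals over the triangle [t <= s] of the square [[c, e]^2]. *)
Lemma ibp_locint (g G X X' : R -> R) : locint l g ->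
  (forall c s : R, 0 < c -> c <= s -> s < l -> G s - G c = Rintegral mu (`[c, s] : set RT) g) ->
  locint l G -> bumpf l X X' ->
  RintI l (fun s => G s * X' s) =
  - RintI l (fun s => g s * X s).
Proof.
move=> lg HG lG BX; have cX := bump_cont0 BX; have [dX cX' [c [e [c0 ce el X0]]]] := BX.
have [_ ->] := supp_cont_integral lG c0 el (fun s _ => cX' s) (fun s h => proj2 (X0 s h)).
have [_ ->] := supp_cont_integral lg c0 el (fun s _ => cX s) (fun s h => proj1 (X0 s h)).
have mI : measurable (`[c, e] : set RT) by exact: measurable_itv.
have Xe : X e = 0.
  apply: (@cvg_unique _ (@Rhausdorff R) (X @ e^'+)).
    exact: cvg_at_right_filter (cX e).
  apply: cvg_near_cst; near=> t; apply: (proj1 (X0 t _)).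
  by rewrite negb_and -!ltNge; apply/orP; right; near: t; exact: nbhs_right_gt.
have Xc : X c = 0.
  apply: (@cvg_unique _ (@Rhausdorff R) (X @ c^'-)).
    exact: cvg_at_left_filter (cX c).
  apply: cvg_near_cst; near=> t; apply: (proj1 (X0 t _)).
  by rewrite negb_and -!ltNge; apply/orP; left; near: t; exact: nbhs_left_lt.
have [iX' EX'] := isd_Rintegral (ltW ce) (fun s _ => dX s) (fun s _ => cX' s).
have ig := lg c e c0 el.
have mle : measurable_fun (setT : set RR) (fun z : RR => ((z.2 <= z.1)%R%:R : R)).
  have mb : measurable_fun (setT : set RR) (fun z : RR => (z.2 <= z.1)%R).
    exact: (@measurable_fun_ler _ RR R setT snd fst (@measurable_snd _ _ RT RT) (@measurable_fst _ _ RT RT)).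
  rewrite (_ : (fun z : RR => ((z.2 <= z.1)%R%:R : R)) = (fun b : bool => if b then 1 else 0) \o (fun z : RR => z.2 <= z.1)).
    by apply: measurableT_comp => //.
  by apply/funext => z /=; case: ifP.
pose w (z : RR) : R := (z.2 <= z.1)%R%:R * (X' z.1 * g z.2).
have iw : mu2.-integrable (`[c, e] `*` `[c, e] : set RR) (EFin \o w).
  apply: (@integrable_bdM _ RR mu2 _ (fun z : RR => (z.2 <= z.1)%R%:R) (fun z : RR => X' z.1 * g z.2) 1).
  - exact: measurableX.
  - exact: (measurable_funS measurableT (@subsetT _ _) mle).
  - by move=> z _; case: (z.2 <= z.1)%R; rewrite ?normr1 ?normr0.
  - exact: integrable_tensor.
have [_ F1 _] := fubini_rect mI mI iw; have F2 := fubini_rect2 mI mI iw.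
have iGX : mu.-integrable (`[c, e] : set RT) (EFin \o (fun s => G s * X' s)).
  by apply: (@locintM l) => //; move=> s _; exact: cX'.
have -> : Rintegral mu (`[c, e] : set RT) (fun s => G s * X' s) = Rintegral mu (`[c, e] : set RT) (fun s => (G s - G c) * X' s).
  transitivity (Rintegral mu (`[c, e] : set RT) (fun s => G s * X' s - G c * X' s)).
    rewrite RintegralB//; last exact: (integrableZl mI (G c) iX').
    by rewrite RintegralZl// EX' Xe Xc subrr mulr0 subr0.
  by apply: eq_Rintegral => s _; rewrite mulrBl.
transitivity (Rintegral mu2 (`[c, e] `*` `[c, e] : set RR) w).
  rewrite F1; apply: eq_Rintegral => s; rewrite inE /= in_itv /= => /andP[cs se].
  rewrite HG ?(le_lt_trans se el)// mulrC -RintegralZl; last 2 first.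
  - exact: measurable_itv.
  - by apply: (@itv_integrableS `[c, e]) ig; apply: subset_itvl; rewrite bnd_simp.
  rewrite Rintegral_mkcond [RHS]Rintegral_mkcond; apply: eq_Rintegral => t _.
  rewrite !patchE !mem_setE !in_itv /w /=.
  case: (lerP t s) => ts /=; rewrite ?mul1r ?mul0r ?andbT ?andbF ?if_same//.
  by rewrite (le_trans ts se) andbT.
rewrite F2.
transitivity (Rintegral mu (`[c, e] : set RT) (fun t => - (g t * X t))); last first.
  rewrite -mulN1r -RintegralZl//; first by apply: eq_Rintegral => t _; rewrite mulN1r.
  by apply: (@locintM l) => //; move=> s _; exact: cX.
apply: eq_Rintegral => t; rewrite inE /= in_itv /= => /andP[ct te].
have [iX1 E1] := isd_Rintegral te (fun s _ => dX s) (fun s _ => cX' s).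
transitivity (g t * Rintegral mu (`[t, e] : set RT) X'); last by rewrite E1 Xe sub0r mulrN.
transitivity (Rintegral mu (`[t, e] : set RT) (fun s => g t * X' s)); last by rewrite RintegralZl.
rewrite [LHS]Rintegral_mkcond [RHS]Rintegral_mkcond; congr Rintegral; apply/funext => s.
rewrite !patchE !mem_setE !in_itv /w /=.
case: (lerP t s) => ts /=; rewrite ?mul1r ?mul0r ?andbT ?andbF ?if_same//.
by rewrite (le_trans ct ts) mulrC.
Unshelve. all: by end_near. Qed.

Lemma bumpf_bdcont X X' : bumpf l X X' -> bdcont l X.
Proof.
move=> BX; have cX := bump_cont0 BX; have [_ _ [c [e [c0 ce el X0]]]] := BX.
split=> [s _|]; first exact: cX.
have [M M0 HM] := @cont_upper_bound _ l X c e (fun s _ => cX s) c0 el.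
exists M => s _; have [/HM//|sI] := boolP (c <= s <= e).
by rewrite (proj1 (X0 s sI)) normr0 ltW.
Qed.

Lemma prim_total g : prim l g l = RintI l g.
Proof.
rewrite /prim [LHS]Rintegral_mkcond [RHS]Rintegral_mkcond; apply: eq_Rintegral => t _.
rewrite !patchE !mem_setE !in_itv /=.
by case: (ltrP 0 t) => //= t0; case: (ltrP t l) => tl; rewrite ?(ltW tl)// if_same.
Qed.

Lemma bumpf_unit : 0 < l -> exists X X', bumpf l X X' /\ RintI l X = 1.
Proof.
move=> l0; have [] := @plateau_bump l (l / 3) (2 * l / 3) 1; [lra|lra|lra|].
move=> [P' BP] P0 P1 _; set P := plateau _ _ _ in BP P0 P1.
have bP := bumpf_bdcont BP.
have I0 : 0 < RintI l P.
  rewrite -prim_total; apply: (@prim_gt0 _ l P (l / 2)) => //.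
  - by move=> t _; case/andP: (P1 t).
  - lra.
  - rewrite /P /plateau subr_gt0 invf_lt1 ?ltrDl ?mul1r.
      by rewrite nmulr_lgt0 npsq_lt0//; lra.
    by rewrite ltr_pwDl// mulr_le0// npsq_le0.
pose k := (RintI l P)^-1.
have [dP cP [c [e [c0 ce el X0]]]] := BP.
exists (fun s => k * P s), (fun s => k * P' s); split; first split.
- by move=> s; exact: isdZ.
- by move=> s; apply: continuousM; [exact: cvg_cst|exact: cP].
- by exists c, e; split=> // s /X0[-> ->]; rewrite mulr0.
- by rewrite -prim_total primZ// prim_total mulVf// gt_eqF.
Qed.

(** A test function of integral zero is the derivative of a test function: its primitive vanishes on
    both sides of the support. *)
Lemma bumpf_prim (X Y Y' : R -> R) : bumpf l Y Y' -> RintI l Y = 0 ->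
  bumpf l (prim l Y) Y.
Proof.
move=> BY I0; have bY := bumpf_bdcont BY; have cY := bump_cont0 BY.
have [_ _ [c [e [c0 ce el Y0]]]] := BY.
have T0 : prim l Y l = 0 by rewrite prim_total.
have P0 : prim l Y 0 = 0 by rewrite prim_le0.
have Z (s : R) : ~~ (c <= s <= e) -> prim l Y s = 0.
  have [s0|s0] := leP s 0; first by rewrite prim_le0.
  rewrite negb_and -!ltNge => /orP[sc|es].
    have := @prim_bound _ l Y 0 0 s bY; rewrite lexx (ltW s0) P0 subr0 mul0r normr_le0.
    move=> H; apply/eqP; apply: H => // r _ /andP[_ rs].
    by rewrite (proj1 (Y0 r _)) ?normr0// negb_and -ltNge (le_lt_trans rs sc).
  have [sl|/ltW ls] := leP s l.
    have := @prim_bound _ l Y 0 s l bY; rewrite sl (ltW s0) T0 sub0r normrN mul0r normr_le0.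
    move=> H; apply/eqP; apply: H => // r _ /andP[sr _].
    by rewrite (proj1 (Y0 r _)) ?normr0// negb_and -!ltNge (lt_le_trans es sr) orbT.
  have := @prim_bound _ l Y 0 l s bY; rewrite ls (ltW (lt_trans c0 (lt_trans ce el))) T0 subr0 mul0r normr_le0.
  move=> H; apply/eqP; apply: H => // r _ /andP[lr _].
  by rewrite (proj1 (Y0 r _)) ?normr0// negb_and -!ltNge (lt_le_trans el lr) orbT.
split=> //; last by exists c, e; split=> // s sI; split; [exact: Z|exact: (proj1 (Y0 s sI))].
move=> s; have [/andP[cs se]|sI] := boolP (c <= s <= e).
  by apply: isd_prim => //; rewrite (lt_le_trans c0 cs) (le_lt_trans se el).
rewrite (proj1 (Y0 s sI)); apply: (@isd_near _ (fun=> 0 : R)).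
move: sI; rewrite negb_and -!ltNge => /orP[sc|es].
  near=> t; rewrite Z// negb_and -ltNge; apply/orP; left; near: t; exact: lt_nbhsl.
near=> t; rewrite Z// negb_and -!ltNge; apply/orP; right; near: t; exact: lt_nbhsr.
Unshelve. all: by end_near. Qed.

Lemma bumpf_lin (k : R) X X' Y Y' : bumpf l X X' -> bumpf l Y Y' ->
  bumpf l (fun s => X s - k * Y s) (fun s => X' s - k * Y' s).
Proof.
move=> [dX cX [c [e [c0 ce el X0]]]] [dY cY [c' [e' [c0' ce' el' Y0]]]]; split.
- by move=> s; exact: isdB (dX s) (isdZ k (dY s)).
- by move=> s; apply: continuousB => //; apply: continuousM; [exact: cvg_cst|exact: cY].
- exists (Num.min c c'), (Num.max e e'); split.
  + by rewrite lt_min c0.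
  + by rewrite gt_min lt_max ce.
  + by rewrite gt_max el.
  + move=> s; rewrite ge_min le_max negb_and !negb_or => h.
    have [-> ->] : X s = 0 /\ X' s = 0.
      by apply: X0; rewrite negb_and; case/orP: h => /andP[-> _]; rewrite ?orbT.
    have [-> ->] : Y s = 0 /\ Y' s = 0.
      by apply: Y0; rewrite negb_and; case/orP: h => /andP[_ ->]; rewrite ?orbT.
    by rewrite mulr0 subrr.
Qed.

Lemma locint_bump_integrable (k X X' : R -> R) : locint l k -> bumpf l X X' ->
  intI l (fun s => k s * X s).
Proof.
move=> lk BX; have cX := bump_cont0 BX; have [_ _ [c [e [c0 ce el X0]]]] := BX.
exact: (proj1 (supp_cont_integral lk c0 el (fun s _ => cX s) (fun s h => proj1 (X0 s h)))).
Qed.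

(** Any test function minus its integral times a unit bump [P] has a compactly supported primitive;
    testing with that primitive shows that [k] minus its mean against [P] is orthogonal to every
    test function. *)
Lemma du_bois_reymond (k : R -> R) : 0 < l -> locint l k ->
  (forall X X', bumpf l X X' -> RintI l (fun s => k s * X' s) = 0) ->
  exists c : R, {aeI l s, k s = c}.
Proof.
move=> l0 lk H; have [P [P' [BP I1]]] := bumpf_unit l0.
pose c := RintI l (fun s => k s * P s).
have mI : measurable (`]0, l[ : set RT) by exact: measurable_itv.
have lc : locint l (fun=> - c) by apply: locint_cont => s _; exact: cvg_cst.
have iB (X X' : R -> R) : bumpf l X X' -> intI l X.
  move=> BX; apply: eq_integrable (locint_bump_integrable (k := fun=> 1) _ BX) => //.
    by move=> s _ /=; rewrite mul1r.
  by apply: locint_cont => s _; exact: cvg_cst.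
have : {aeI l s, k s + - c = 0}.
  apply: fundamental_lemma; first exact: locintD.
  move=> X X' BX; pose cX := RintI l X.
  have BY := bumpf_lin cX BX BP.
  have iX := iB _ _ BX; have iP := iB _ _ BP.
  have ikX := locint_bump_integrable lk BX; have ikP := locint_bump_integrable lk BP.
  have Y0 : RintI l (fun s => X s - cX * P s) = 0.
    rewrite RintegralB//; last exact: (integrableZl mI cX iP).
    by rewrite RintegralZl// I1 mulr1 subrr.
  have := H _ _ (bumpf_prim X BY Y0).
  have -> : RintI l (fun s => k s * (X s - cX * P s)) =
            RintI l (fun s => k s * X s) - cX * c.
    rewrite -RintegralZl// -RintegralB//; last exact: (integrableZl mI cX ikP).
    by apply: eq_Rintegral => s _; ring.
  move=> E; rewrite -[RHS]E /cX mulrC -RintegralZl// -RintegralB//; last exact: (integrableZl mI c iX).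
  by apply: eq_Rintegral => s _; ring.
move=> A; exists c; apply: (ae_sub A) => s + sI.
by move=> /(_ sI) /eqP; rewrite subr_eq0 => /eqP.
Qed.

(** The base point [c0] is interior because [g] need not be integrable up to the ends; both
    orientations therefore occur. *)
Definition sint (g : R -> R) (c0 s : R) : R :=
  if c0 <= s then Rintegral mu (`[c0, s] : set RT) g else - Rintegral mu (`[s, c0] : set RT) g.

Lemma locint_itvD g (c s t : R) : locint l g -> 0 < c -> c <= s -> s <= t -> t < l ->
  Rintegral mu (`[c, t] : set RT) g = Rintegral mu (`[c, s] : set RT) g + Rintegral mu (`[s, t] : set RT) g.
Proof.
move=> lg c0 cs st tl; have ict := lg c t c0 tl.
apply/eqP; rewrite addrC -subr_eq Rintegral_itvB ?bnd_simp//; apply/eqP.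
rewrite -Rintegral_itv_obnd_cbnd//; apply: (@itv_integrableS `[c, t]) ict.
move=> r /=; rewrite !in_itv /= => /andP[/ltW sr ->]; by rewrite (le_trans cs sr).
Qed.

Lemma sintB g (c0 c s : R) : locint l g -> 0 < c0 < l -> 0 < c -> c <= s -> s < l ->
  sint g c0 s - sint g c0 c = Rintegral mu (`[c, s] : set RT) g.
Proof.
move=> lg /andP[h0 h1] cp cs sl; rewrite /sint.
case: (leP c0 c) => h2.
  rewrite (le_trans h2 cs) (locint_itvD lg h0 h2 cs sl); ring.
case: (leP c0 s) => h3.
  by rewrite opprK (locint_itvD lg cp (ltW h2) h3 sl) addrC.
rewrite opprK (locint_itvD lg cp cs (ltW h3) h1); ring.
Qed.

Lemma ae_eq_Rintegral (g G : R -> R) (c e : R) : 0 < c -> e < l ->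
  locint l g -> locint l G -> {aeI l t, g t = G t} ->
  Rintegral mu (`[c, e] : set RT) g = Rintegral mu (`[c, e] : set RT) G.
Proof.
move=> c0 el lg lG A; rewrite /Rintegral; congr fine; apply: ae_eq_integral.
- exact: measurable_itv.
- exact: measurable_int (lg c e c0 el).
- exact: measurable_int (lG c e c0 el).
apply: (ae_sub A) => s + sI.
move: sI; rewrite /= in_itv /= => /andP[cs se] ->//.
by rewrite (lt_le_trans c0 cs) (le_lt_trans se el).
Qed.

Lemma clamp_bdcont (G : R -> R) (c e : R) : 0 < c -> c <= e -> e < l ->
  contI l G ->
  bdcont l (fun t => G (Num.min (Num.max t c) e)).
Proof.
move=> c0 ce el cG.
have cl (t : R) : c <= Num.min (Num.max t c) e <= e by rewrite le_min le_max lexx orbT ce ge_min lexx orbT.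
have cl' (t : R) : 0 < Num.min (Num.max t c) e < l.
  by have /andP[h1 h2] := cl t; rewrite (lt_le_trans c0 h1) (le_lt_trans h2 el).
split=> [t tI|].
  apply: (@continuous_comp _ _ _ (fun t => Num.min (Num.max t c) e) G); last exact: cG.
  apply: continuous_min; last exact: cvg_cst.
  by apply: continuous_max; [exact: cvg_id|exact: cvg_cst].
have [M M0 HM] := cont_upper_bound cG c0 el; exists M => s _; exact: HM.
Qed.

(** Near [s] the function [G] is replaced by its clamped version [Gc], which is bounded and
    continuous on all of [(0, l)], so that [isd_prim] applies. *)
Lemma isd_sint g G (c0 s : R) : locint l g -> 0 < c0 < l -> 0 < s < l ->
  contI l G ->
  {aeI l t, g t = G t} -> isd (sint g c0) s (G s).
Proof.
move=> lg c0I /andP[s0 sl] cG A.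
pose c := s / 2; pose e := (s + l) / 2.
have [cp cs se el] : [/\ 0 < c, c < s, s < e & e < l] by rewrite /c /e; split; lra.
have ce : c <= e by exact: ltW (lt_trans cs se).
move: cp => c1.
pose Gc (t : R) := G (Num.min (Num.max t c) e).
have bG : bdcont l Gc by exact: clamp_bdcont.
have GcE (t : R) : c <= t <= e -> Gc t = G t.
  by move=> /andP[ct te]; rewrite /Gc (max_idPl ct) (min_idPl te).
have E : \forall t \near s, sint g c0 c - prim l Gc c + prim l Gc t = sint g c0 t.
  near=> t; have /andP[ct te] : c < t < e by near: t; apply: near_in; rewrite cs.
  have tl : t < l by exact: lt_trans el.
  rewrite addrAC -addrA primB ?(ltW c1) ?(ltW ct)//.
  rewrite -[RHS](subrK (sint g c0 c)) addrC sintB ?(ltW ct)//; congr (_ + _).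
  rewrite (@ae_eq_Rintegral g G)//; last exact: locint_cont.
  rewrite -Rintegral_itv_obnd_cbnd; last first.
    apply: (@itv_integrableS `[c, t]); last by apply: (locint_cont cG).
    by move=> r /=; rewrite !in_itv /= => /andP[/ltW -> ->].
  rewrite Rintegral_mkcond [RHS]Rintegral_mkcond; apply: eq_Rintegral => r _.
  rewrite !patchE !mem_setE !in_itv /=.
  case: (ltrP c r) => //= cr; case: (lerP r t) => //= rt.
  by rewrite (lt_trans c1 cr) (le_lt_trans rt tl)/= GcE// (ltW cr) (le_trans rt (ltW te)).
have GcS : Gc s = G s by rewrite GcE ?ltW.
apply: (isd_near E); rewrite -GcS.
by apply: isd_eqd (isdD (isd_cst _ s) (isd_prim bG _)) _; rewrite ?s0 ?add0r.
Unshelve. all: by end_near. Qed.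

Lemma sint_cont g (c0 s : R) : locint l g -> 0 < c0 < l -> 0 < s < l ->
  {for s, continuous (sint g c0)}.
Proof.
move=> lg c0I /andP[s0 sl].
pose c := s / 2; pose e := (s + l) / 2.
have [cp cs se el] : [/\ 0 < c, c < s, s < e & e < l] by rewrite /c /e; split; lra.
have ce : c < e by exact: lt_trans cs se.
have ig := lg c e cp el.
have C := @parameterized_integral_continuous R c e g (ltW ce) ig.
have C1 : {within `]c, e[, continuous (fun x => parameterized_integral mu c x g)}.
  by apply: continuous_subspaceW C; exact: subset_itvW.
rewrite continuous_open_subspace in C1; last exact: interval_open.
have {}C1 : {for s, continuous (fun x => parameterized_integral mu c x g)}.
  by apply: C1; rewrite inE /= in_itv /= cs.
have C2 : {for s, continuous (fun x => sint g c0 c + parameterized_integral mu c x g)}.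
  by apply: continuousD; [exact: cvg_cst|exact: C1].
apply: (cont_near _ C2); near=> t.
have /andP[ct te] : c < t < e by near: t; apply: near_in; rewrite cs.
rewrite /parameterized_integral -(sintB lg c0I cp (ltW ct) (lt_trans te el)).
by rewrite addrC subrK.
Unshelve. all: by end_near. Qed.

(** The representative is [c + G] with [G] a primitive of [g], the constant coming from the lemma of
    du Bois-Reymond. The last clause allows a bootstrap: as soon as [g] agrees almost everywhere
    with a continuous function, that function is the classical derivative. *)
Lemma wder_classical (v g : R -> R) (l0 : 0 < l) : wder v g ->
  exists V : R -> R, [/\ {aeI l s, v s = V s},
    contI l V &
    forall G, contI l G ->
      {aeI l t, g t = G t} -> forI l s, isd V s (G s)].
Proof.
move=> [lv lg H]; have hI : 0 < l / 2 < l by lra.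
pose G := sint g (l / 2).
have cG : contI l G by move=> s sI; exact: sint_cont.
have lG : locint l G by exact: locint_cont.
have lk : locint l (fun s => v s - G s).
  by apply: locintD => // c e c0 el; have := integrableN (lG c e c0 el); apply.
have [|c A] := du_bois_reymond (k := fun s => v s - G s) l0 lk.
  move=> X X' BX; have := H _ _ BX.
  have := ibp_locint lg _ lG BX.
  have cX := bump_cont0 BX; have [_ cX' [c [e [c0 ce el X0]]]] := BX.
  move=> E1; have {}E1 := E1 (fun c s h1 h2 h3 => sintB lg hI h1 h2 h3); rewrite -E1 => E2.
  have [i1 _] := supp_cont_integral lG c0 el (fun s _ => cX' s) (fun s h => proj2 (X0 s h)).
  have [i2 _] := supp_cont_integral lv c0 el (fun s _ => cX' s) (fun s h => proj2 (X0 s h)).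
  transitivity (RintI l (fun s => v s * X' s - G s * X' s)).
    by apply: eq_Rintegral => s _; rewrite mulrBl.
  by rewrite RintegralB// E2 subrr.
exists (fun s => c + G s); split.
- apply: (ae_sub A) => s + sI.
  by move=> /(_ sI) <-; rewrite subrK.
- by move=> s sI; apply: continuousD; [exact: cvg_cst|exact: cG].
- move=> K cK AK s sI; apply: isd_eqd (isdD (isd_cst c s) (isd_sint lg hI sI cK AK)) _.
  by rewrite add0r.
Qed.

End WeakDerivative.

(** * Fourier projection in the angle *)

Section Projection.
Variable l : R.

Record angular (Y Y' : R -> R) (B : R) : Prop := Angular {
  ang_isd : forall p : R, isd Y p (Y' p);
  ang_cont : forall p : R, {for p, continuous Y'};
  ang_per : forall p : R, Y (p + 2 * pi) = Y p;
  ang_bd : forall p : R, `|Y p| <= B }.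

Definition angproj (Y : R -> R) (F : R * R -> R) (s : R) : R :=
  Rintegral mu circle (fun p => F (s, p) * Y p).

Lemma measurable_circle : measurable circle. Proof. exact: measurable_itv. Qed.
Lemma measurable_I : measurable (`]0, l[ : set RT). Proof. exact: measurable_itv. Qed.
Lemma measurable_chart : measurable (chart l).
Proof. by apply: measurableX; exact: measurable_itv. Qed.

Lemma measurable_fun_comp_fst (A B : set RT) (f : R -> R) : measurable A -> measurable B ->
  measurable_fun A f -> measurable_fun (A `*` B : set RR) (fun z : RR => f z.1).
Proof.
move=> mA mB mf; rewrite -[f]/(f : RT -> R).
apply: (@measurable_comp _ _ _ RR RT _ A f (A `*` B) fst) => //.
  by move=> s [[x y] [Ax By]] <-.
exact: (measurable_funS measurableT (@subsetT _ _) (@measurable_fst _ _ RT RT)).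
Qed.

Lemma measurable_fun_comp_snd (A B : set RT) (f : R -> R) : measurable A -> measurable B ->
  measurable_fun B f -> measurable_fun (A `*` B : set RR) (fun z : RR => f z.2).
Proof.
move=> mA mB mf; rewrite -[f]/(f : RT -> R).
apply: (@measurable_comp _ _ _ RR RT _ B f (A `*` B) snd) => //.
  by move=> s [[x y] [Ax By]] <-.
exact: (measurable_funS measurableT (@subsetT _ _) (@measurable_snd _ _ RT RT)).
Qed.

Lemma measurable_fun_cont (f : R -> R) (A : set RT) : measurable A ->
  continuous f -> measurable_fun A f.
Proof.
move=> mA cf; apply: (measurable_funS measurableT (@subsetT _ _)).
by apply: continuous_measurable_fun => s; exact: cf.
Qed.

Lemma measurable_fun_I (f : R -> R) : contI l f ->
  measurable_fun (`]0, l[ : set RT) f.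
Proof.
move=> cf; apply: open_continuous_measurable_fun; first exact: interval_open.
by move=> s; rewrite inE /= in_itv /=; exact: cf.
Qed.

Lemma proj_fubini (Y X : R -> R) (B : R) (F : R * R -> R) (c e : R) :
  chart_locally_integrable l F -> 0 < c -> e < l ->
  continuous Y -> (forall p : R, `|Y p| <= B) ->
  contI l X ->
  (forall s : R, ~~ (c <= s <= e) -> X s = 0) ->
  [/\ mu2.-integrable (chart l) (EFin \o (fun z : RR => F z * (X z.1 * Y z.2))),
      Rintegral mu2 (chart l) (fun z : RR => F z * (X z.1 * Y z.2)) =
      RintI l (fun s => angproj Y F s * X s) &
      mu.-integrable (`[c, e] : set RT) (EFin \o angproj Y F)].
Proof.
move=> iF c0 el cY bY cX X0.
have mI : measurable (`[c, e] : set RT) by exact: measurable_itv.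
have mC := measurable_circle.
have iFY : mu2.-integrable (`[c, e] `*` circle : set RR) (EFin \o (fun z : RR => Y z.2 * F z)).
  apply: (@integrable_bdM _ RR mu2 _ (fun z : RR => Y z.2) F B) => //; first exact: measurableX.
    by apply: measurable_fun_comp_snd => //; exact: measurable_fun_cont.
  exact: iF.
have [M _ bX] := cont_upper_bound cX c0 el.
have mX : measurable_fun (`[c, e] : set RT) X.
  apply: (@measurable_funS _ _ _ _ `]0, l[); first exact: measurable_itv.
    exact: segment_sub.
  exact: measurable_fun_I.
have iFYX : mu2.-integrable (`[c, e] `*` circle : set RR) (EFin \o (fun z : RR => F z * (X z.1 * Y z.2))).
  apply: eq_integrable (@integrable_bdM _ RR mu2 _ (fun z : RR => X z.1) (fun z : RR => Y z.2 * F z) M _ _ _ iFY).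
  - exact: measurableX.
  - by move=> z _ /=; congr (_%:E); ring.
  - exact: measurableX.
  - exact: measurable_fun_comp_fst.
  - by move=> [s p] [/= h _]; apply: bX; move: h; rewrite in_itv.
have [H1 H2] : (mu2.-integrable (`[c, e] `*` circle : set RR) (EFin \o (fun z : RR => F z * (X z.1 * Y z.2))) ->
     mu2.-integrable (chart l) (EFin \o (fun z : RR => F z * (X z.1 * Y z.2)))) /\
    Rintegral mu2 (chart l) (fun z : RR => F z * (X z.1 * Y z.2)) =
    Rintegral mu2 (`[c, e] `*` circle : set RR) (fun z : RR => F z * (X z.1 * Y z.2)).
  apply: (@integrable_supp _ RR mu2).
  - exact: measurable_chart.
  - exact: measurableX.
  - move=> [s p] [/= h1 h2]; split=> //=; move: h1; rewrite !in_itv /= => /andP[h1 h3].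
    by rewrite (lt_le_trans c0 h1) (le_lt_trans h3 el).
  - move=> [s p] [/= h1 h2] h3; rewrite X0 ?mul0r ?mulr0//.
    by apply/negP => h4; apply: h3; split=> //=; rewrite in_itv.
split; first exact: H1.
- have iP : mu.-integrable (`[c, e] : set RT) (EFin \o angproj Y F).
    have [i1 _ _] := fubini_rect mI mC iFY; apply: eq_integrable i1 => // s _ /=.
    by congr (_%:E); apply: eq_Rintegral => p _ /=; rewrite mulrC.
  have iPX : mu.-integrable (`[c, e] : set RT) (EFin \o (fun s => X s * angproj Y F s)).
    by apply: (@integrable_bdM _ RT mu _ X (angproj Y F) M) => // s; rewrite /= in_itv; exact: bX.
  rewrite H2; have [i2 -> _] := fubini_rect mI mC iFYX.
  have [_ _ ae1] := fubini_rect mI mC iFY.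
  transitivity (Rintegral mu (`[c, e] : set RT) (fun s => X s * angproj Y F s)).
    rewrite /Rintegral; congr fine; apply: ae_eq_integral => //.
    + exact: measurable_int i2.
    + exact: measurable_int iPX.
    apply: (ae_sub ae1) => s i3 sI.
    congr (_%:E); rewrite /angproj -RintegralZl//.
      by apply: eq_Rintegral => p _ /=; ring.
    by apply: eq_integrable (i3 sI) => // p _ /=; rewrite mulrC.
  have sub : `[c, e] `<=` `]0, l[.
    exact: segment_sub.
  have z0 (s : R) : `]0, l[%classic s -> ~ `[c, e]%classic s -> angproj Y F s * X s = 0.
    by move=> _ h; rewrite X0 ?mulr0//; apply/negP => h4; apply: h; rewrite /= in_itv.
  have [_ ->] := @integrable_supp _ RT mu `]0, l[ `[c, e] (fun s => angproj Y F s * X s) measurable_I mI sub z0.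
  by apply: eq_Rintegral => s _; rewrite mulrC.
- have [i1 _ _] := fubini_rect mI mC iFY; apply: eq_integrable i1 => // s _ /=.
  by congr (_%:E); apply: eq_Rintegral => p _ /=; rewrite mulrC.
Qed.

Lemma angproj_locint (Y : R -> R) (B : R) (F : R * R -> R) : chart_locally_integrable l F ->
  continuous Y -> (forall p : R, `|Y p| <= B) -> locint l (angproj Y F).
Proof.
move=> iF cY bY c e c0 el.
have [//||_ _ //] := @proj_fubini Y (fun=> 0) B F c e iF c0 el cY bY; last by [].
by move=> s _; exact: cvg_cst.
Qed.

Lemma test_tensor (X X' Y Y' : R -> R) (B : R) (J : set R) : 
  (forall s : R, isd X s (X' s)) -> continuous X' ->
  (exists c e : R, `[c, e] `<=` J /\ forall s : R, ~~ (c <= s <= e) -> X s = 0) -> angular Y Y' B ->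
  test_on J (fun z : R * R => X z.1 * Y z.2) (fun z => X' z.1 * Y z.2) (fun z => X z.1 * Y' z.2).
Proof.
move=> dX cX' [c [e [ceJ X0]]] [dY cY' pY _].
have cX (s : R) : {for s, continuous X} by exact: isd_cont (dX s).
have cY (s : R) : {for s, continuous Y} by exact: isd_cont (dY s).
have c1 (f : R -> R) (z : R * R) : continuous f -> {for z, continuous (fun z : R * R => f z.1)}.
  by move=> cf; apply: continuous_comp; [exact: cvg_fst|exact: cf].
have c2 (f : R -> R) (z : R * R) : continuous f -> {for z, continuous (fun z : R * R => f z.2)}.
  by move=> cf; apply: continuous_comp; [exact: cvg_snd|exact: cf].
split.
- by move=> z; apply: continuousM; [exact: c1|exact: c2].
- by move=> z; apply: continuousM; [exact: c1|exact: c2].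
- by move=> z; apply: continuousM; [exact: c1|exact: c2].
- move=> s p; have -> : (fun t : R => (fun z : R * R => X z.1 * Y z.2) (t, p)) = (fun t => Y p * X t).
    by apply/funext => t /=; rewrite mulrC.
  by rewrite /= mulrC; exact: isdZ.
- by move=> s p; exact: (isdZ (X s) (dY p)).
- by move=> s p /=; rewrite pY.
- by exists c, e; split=> // s p /X0 /= ->; rewrite mul0r.
Qed.

Lemma bumpf_test X X' Y Y' B : bumpf l X X' -> angular Y Y' B ->
  test_on `]0, l[ (fun z : R * R => X z.1 * Y z.2) (fun z => X' z.1 * Y z.2) (fun z => X z.1 * Y' z.2).
Proof.
move=> [dX cX' [c [e [c0 ce el X0]]]] AY; apply: test_tensor AY => //.
exists c, e; split; last by move=> s /X0[].
exact: segment_sub.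
Qed.

Lemma angular_cont Y Y' B : angular Y Y' B -> forall p : R, {for p, continuous Y}.
Proof. by move=> A p; exact: isd_cont (ang_isd A p). Qed.

Lemma weak_s_proj (F G : R * R -> R) Y Y' B : weak_s_real l F G -> angular Y Y' B ->
  wder l (angproj Y F) (angproj Y G).
Proof.
move=> [iF iG H] AY; have cY := angular_cont AY; have bY := ang_bd AY.
split; [exact: angproj_locint iF cY bY|exact: angproj_locint iG cY bY|].
move=> X X' BX; have := H _ _ _ (bumpf_test BX AY); have cX := bump_cont0 BX.
have [_ cX' [c [e [c0 ce el X0]]]] := BX.
have [_ -> _] := proj_fubini iF c0 el cY bY (fun s _ => cX' s) (fun s h => proj2 (X0 s h)).
by have [_ -> _] := proj_fubini iG c0 el cY bY (fun s _ => cX s) (fun s h => proj1 (X0 s h)).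
Qed.

(** Testing with tensor products [X Y] moves the angular derivative onto [Y]; the fundamental lemma
    removes [X]. *)
Lemma weak_p_proj (F G : R * R -> R) Y Y' B Z B' : weak_p_real l F G -> angular Y Y' B ->
  angular Y' Z B' -> {aeI l s, angproj Y G s = - angproj Y' F s}.
Proof.
move=> [iF iG H] AY AY'; have cY := angular_cont AY; have bY := ang_bd AY.
have cY' := angular_cont AY'; have bY' := ang_bd AY'.
have l1 := angproj_locint iF cY' bY'; have l2 := angproj_locint iG cY bY.
suff A : {aeI l s, angproj Y G s + angproj Y' F s = 0}.
  apply: (ae_sub A) => s + sI.
  by move=> /(_ sI) /eqP; rewrite addr_eq0 => /eqP.
apply: fundamental_lemma; first exact: locintD.
move=> X X' BX; have := H _ _ _ (bumpf_test BX AY); have cX := bump_cont0 BX.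
have i1 := locint_bump_integrable l1 BX; have i2 := locint_bump_integrable l2 BX.
have [_ cX' [c [e [c0 ce el X0]]]] := BX.
have [_ -> _] := proj_fubini iF c0 el cY' bY' (fun s _ => cX s) (fun s h => proj1 (X0 s h)).
have [_ -> _] := proj_fubini iG c0 el cY bY (fun s _ => cX s) (fun s h => proj1 (X0 s h)).
move=> E; transitivity (RintI l (fun s => angproj Y G s * X s + angproj Y' F s * X s)).
  by apply: eq_Rintegral => s _; rewrite mulrDl.
by rewrite RintegralD// E subrr.
Qed.

Lemma wder_uniq v w g h : wder l v g -> wder l w h -> {aeI l s, v s = w s} ->
  {aeI l s, g s = h s}.
Proof.
move=> [lv lg Hv] [lw lh Hw] A.
have lgh : locint l (fun s => g s - h s).
  by apply: locintD => // c e c0 el; have := integrableN (lh c e c0 el); apply.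
suff A' : {aeI l s, g s - h s = 0}.
  apply: (ae_sub A') => s + sI.
  by move=> /(_ sI) /eqP; rewrite subr_eq0 => /eqP.
apply: fundamental_lemma => // X X' BX.
have cX := bump_cont0 BX; have [_ cX' [c [e [c0 ce el X0]]]] := BX.
have i1 := locint_bump_integrable lg BX; have i2 := locint_bump_integrable lh BX.
have [j1 _] := supp_cont_integral lv c0 el (fun s _ => cX' s) (fun s h => proj2 (X0 s h)).
have [j2 _] := supp_cont_integral lw c0 el (fun s _ => cX' s) (fun s h => proj2 (X0 s h)).
transitivity (RintI l (fun s => g s * X s - h s * X s)).
  by apply: eq_Rintegral => s _; rewrite mulrBl.
rewrite RintegralB//.
have E : RintI l (fun s => v s * X' s) = RintI l (fun s => w s * X' s).
  rewrite /Rintegral; congr fine; apply: ae_eq_integral.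
  - exact: measurable_I.
  - exact: measurable_int j1.
  - exact: measurable_int j2.
  apply: (ae_sub A) => s + sI.
  by move: sI; rewrite /= in_itv /= => sI -> //.
by move: E; rewrite (Hv _ _ BX) (Hw _ _ BX) => /oppr_inj ->; rewrite subrr.
Qed.

Lemma amgm (t y c : R) : 0 < c -> t * y <= t ^+ 2 / (4 * c) + c * y ^+ 2.
Proof.
move=> c0; rewrite -subr_ge0.
have -> : t ^+ 2 / (4 * c) + c * y ^+ 2 - t * y = (t - 2 * c * y) ^+ 2 / (4 * c) by field; lra.
by rewrite divr_ge0 ?sqr_ge0// mulr_ge0// ltW.
Qed.

Lemma normr_le1sqr (x : R) : `|x| <= 1 + x ^+ 2.
Proof. by rewrite ler_norml; have := sqr_ge0 (x - 1); have := sqr_ge0 (x + 1); have := sqr_ge0 x; nra. Qed.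

Definition L2a (a : R -> R) (F : R * R -> R) :=
  measurable_fun (chart l) F /\ mu2.-integrable (chart l) (EFin \o (fun z : RR => F z ^+ 2 * a z.1)).

(** A Cauchy-Schwarz bound in the angle, obtained from [amgm] with constant [pi]: for
    [t = angproj Y F s], the square [t^2] is the circle integral of [t F Y], at most [t^2 / 2] plus
    [pi B^2] times the integral of [F^2], and the first term is absorbed. *)
Lemma angproj_L2 (a : R -> R) (F : R * R -> R) (Y f : R -> R) (B : R) : L2a a F ->
  (forI l s, 0 < a s) -> contI l a ->
  continuous Y -> (forall p : R, `|Y p| <= B) ->
  contI l f ->
  {aeI l s, angproj Y F s = f s} ->
  intI l (fun s => f s ^+ 2 * a s).
Proof.
move=> [mF iF] a0 ca cY bY cf A; have mI := measurable_I; have mC := measurable_circle.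
have [iG _ ae1] := fubini_rect mI mC iF.
pose G s := Rintegral mu circle (fun p => F (s, p) ^+ 2 * a s).
have pi0 := pi_gt0 R; have B0 : 0 <= B by exact: le_trans (bY 0).
have mFs (s : R) : 0 < s < l -> measurable_fun circle (fun p => F (s, p)).
  move=> sI; have mF' : measurable_fun (setT : set RR) (F \_ (chart l)).
    by apply/(@measurable_restrictT _ _ RR RT _ F measurable_chart).
  have := measurable_fun_pair2 s mF'.
  move=> /(measurable_funS measurableT (@subsetT _ circle)).
  apply: eq_measurable_fun => p; rewrite inE /= => pI.
  by rewrite patchE mem_set//; split=> //=; rewrite in_itv.
have key (s : R) : 0 < s < l -> mu.-integrable circle (EFin \o (fun p => F (s, p) ^+ 2 * a s)) ->
    angproj Y F s ^+ 2 * a s <= 2 * pi * B ^+ 2 * G s.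
  move=> sI is_; have as0 := a0 s sI.
  have i2 : mu.-integrable circle (EFin \o (fun p => F (s, p) ^+ 2)).
    apply: eq_integrable (integrableZl mC (a s)^-1 is_) => // p _ /=.
    by congr (_%:E); rewrite mulrC mulfK// gt_eqF.
  have icst (k : R) : mu.-integrable circle (EFin \o (fun=> k)).
    apply: measurable_bounded_integrable => //.
      by rewrite [X in (X < _)%E](lebesgue_measure_itv `]0, 2 * pi[) /=; case: ifP => _; rewrite ?ltry.
    by exists `|k|; split; [exact: num_real|move=> L /ltW kL r _].
  have iFY : mu.-integrable circle (EFin \o (fun p => F (s, p) * Y p)).
    have i3 : mu.-integrable circle (EFin \o (fun p => B * (1 + F (s, p) ^+ 2))).
      by apply: rintegrableZ => //; exact: rintegrableD (icst 1) i2.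
    apply: (le_integrable mC _ _ i3).
      apply/measurable_EFinP; apply: measurable_funM; first exact: mFs.
      exact: measurable_fun_cont.
    move=> p _ /=; rewrite lee_fin (ger0_norm (_ : 0 <= B * _)); last first.
      by rewrite mulr_ge0// addr_ge0// sqr_ge0.
    rewrite normrM mulrC; apply: ler_pM => //.
    exact: normr_le1sqr.
  set t := angproj Y F s.
  have iFY2 : mu.-integrable circle (EFin \o (fun p => t ^+ 2 / (4 * pi) + pi * B ^+ 2 * F (s, p) ^+ 2)).
    by apply: rintegrableD => //; exact: rintegrableZ.
  have le1 : t * t <= Rintegral mu circle (fun p => t ^+ 2 / (4 * pi) + pi * B ^+ 2 * F (s, p) ^+ 2).
    rewrite {2}/t /angproj -RintegralZl//; apply: le_Rintegral => //.
      exact: rintegrableZ.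
    move=> p _.
    have h1 : t * (F (s, p) * Y p) <= t ^+ 2 / (4 * pi) + pi * (F (s, p) * Y p) ^+ 2.
      exact: amgm.
    apply: le_trans h1 _; rewrite lerD2l -mulrA ler_pM2l// exprMn mulrC ler_wpM2r ?sqr_ge0//.
    by rewrite -[Y p ^+ 2]ger0_norm ?sqr_ge0// normrX lerXn2r ?nnegrE.
  have E1 : Rintegral mu circle (fun p => t ^+ 2 / (4 * pi) + pi * B ^+ 2 * F (s, p) ^+ 2) =
      t ^+ 2 / 2 + pi * B ^+ 2 * Rintegral mu circle (fun p => F (s, p) ^+ 2).
    rewrite RintegralD//; last exact: rintegrableZ.
    congr (_ + _); last by rewrite RintegralZl.
    rewrite Rintegral_cst// [X in _ * fine X](lebesgue_measure_itv `]0, 2 * pi[) /= lte_fin.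
    have X (c u : R) : 0 < c -> u / (4 * c) * (2 * c) = u / 2 by move=> c0; field; lra.
    have h : (0 : R) < 2 * pi by rewrite mulr_gt0.
    by rewrite h /= oppr0 addr0 X.
  have E2 : G s = a s * Rintegral mu circle (fun p => F (s, p) ^+ 2).
    by rewrite /G -RintegralZl//; apply: eq_Rintegral => p _; rewrite mulrC.
  move: le1; rewrite E1 E2; set I2 := Rintegral _ _ _ => le1.
  have h : t ^+ 2 <= 2 * pi * B ^+ 2 * I2 by move: le1; generalize t I2 (pi : R) => x y q; clear; lra.
  apply: le_trans (ler_wpM2r (ltW as0) h) _.
  by apply: le_of_eq; ring.
apply/integrableP; split.
  apply/measurable_EFinP; apply: measurable_fun_I => s sI; apply: continuousM; last exact: ca.
  by apply: (continuousM (cf s sI) (cf s sI)).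
have iGG : intI l (fun s => 2 * pi * B ^+ 2 * G s).
  by apply: rintegrableZ => //; exact: iG.
have G0 (s : R) : 0 < s < l -> 0 <= G s.
  move=> sI; apply: Rintegral_ge0 => p _; by rewrite mulr_ge0 ?sqr_ge0// ltW// a0.
have [mGG lGG] := integrableP _ _ _ iGG.
apply: le_lt_trans lGG; apply: ae_ge0_le_integral => //.
- by apply: measurableT_comp => //; apply/measurable_EFinP; apply: measurable_fun_I => s sI;
    apply: continuousM; [apply: (continuousM (cf s sI) (cf s sI))|exact: ca].
- by apply: measurableT_comp.
have AA := ae_and A ae1.
apply: (ae_sub AA) => s [E i] sI' /=.
have sI : 0 < s < l by move: sI'; rewrite /= in_itv.
rewrite -E// lee_fin ger0_norm; last by rewrite mulr_ge0 ?sqr_ge0// ltW// a0.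
by apply: le_trans (ler_norm _); apply: key => //; exact: i.
Qed.

End Projection.

Local Open Scope complex_scope.

(** * Reduction of a weak eigenfunction to a radial profile *)

Section RadialProfile.
Variable l : R.

Lemma ae_fst (P : R -> Prop) : {ae mu, forall s : R, P s} -> {ae mu2, forall z : R * R, P z.1}.
Proof.
move=> [N [mN N0 sN]]; exists (N `*` (setT : set RT)); split.
- exact: measurableX.
- transitivity (mu N * mu (setT : set RT))%E; last by rewrite N0 mul0e.
  exact: (@product_measure1E _ _ RT RT R mu mu).
- by move=> z /= nP; split=> //; apply: sN.
Qed.

Lemma tensor_proj (F : R * R -> R) (X Y f : R -> R) :
  contI l X ->
  contI l f ->
  {aeI l s, angproj Y F s = f s} ->
  mu2.-integrable (chart l) (EFin \o (fun z : RR => F z * (X z.1 * Y z.2))) ->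
  intI l (fun s => f s * X s) /\
  Rintegral mu2 (chart l) (fun z : RR => F z * (X z.1 * Y z.2)) =
  RintI l (fun s => f s * X s).
Proof.
move=> cX cf A iF; have mI := measurable_I l; have mC := measurable_circle.
have [i1 E ae1] := fubini_rect mI mC iF.
have mfX : measurable_fun (`]0, l[ : set RT) (EFin \o (fun s => f s * X s)).
  by apply/measurable_EFinP; apply: measurable_fun_I => s sI; exact: (continuousM (cf s sI) (cX s sI)).
have aeE : {ae mu, forall s : R, `]0, l[%classic s ->
    (Rintegral mu circle (fun p => F (s, p) * (X s * Y p)))%:E = (f s * X s)%:E}.
  refine (ae_sub (ae_and A ae1) _) => s [E1 i2] sI.
  have sI' : 0 < s < l by move: sI; rewrite /= in_itv.
  congr (_%:E); have [X0|X0] := eqVneq (X s) 0.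
    rewrite X0 mulr0; under eq_Rintegral => p _ do rewrite mul0r mulr0.
    by rewrite Rintegral_cst// mul0r.
  rewrite -E1// [RHS]mulrC /angproj -RintegralZl//.
    by apply: eq_Rintegral => p _ /=; ring.
  apply: eq_integrable (rintegrableZ (X s)^-1 mC (i2 sI)) => // p _ /=.
  by congr (_%:E); field.
have ifX : intI l (fun s => f s * X s).
  apply/integrableP; split=> //; have [m1 l1] := integrableP _ _ _ i1.
  apply: le_lt_trans l1; apply: ae_ge0_le_integral => //.
  - exact: measurableT_comp.
  - exact: measurableT_comp.
  - by refine (ae_sub aeE _) => s /= H sI; move: (H sI) => [->].
split=> //; rewrite E /Rintegral; congr fine; apply: ae_eq_integral => //.
exact: measurable_int i1.
Qed.

(** Away from the pole, where [a] is bounded below, the weighted square bound dominates [|F|]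
    through [|F| <= 1 + F^2]. *)
Lemma L2_tensor_integrable (a : R -> R) (F : R * R -> R) (X Y : R -> R) (c e B : R) :
  L2a l a F -> continuous X -> continuous Y ->
  (forall p : R, `|Y p| <= B) -> (forall s : R, ~~ (c <= s <= e) -> X s = 0) ->
  (exists2 k : R, 0 < k & forI l s, c <= s -> k <= a s) ->
  mu2.-integrable (chart l) (EFin \o (fun z : RR => F z * (X z.1 * Y z.2))).
Proof.
move=> [mF iF] cX cY bY X0 [k k0 ka]; have mI := measurable_I l; have mC := measurable_circle.
have mCh := measurable_chart l; have B0 : 0 <= B by exact: le_trans (bY 0).
have [M M0 bX] : exists2 M, 0 <= M & forall s : R, `|X s| <= M.
  have cw : {within `[c, e], continuous X} by apply: continuous_subspaceT => s; exact: cX.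
  have [M [_ Mr]] := compact_bounded (continuous_compact cw (@segment_compact _ c e)).
  exists `|M + 1| => // s; have [sI|sI] := boolP (c <= s <= e); last by rewrite X0 ?normr0.
  apply: le_trans (ler_norm _); apply: (Mr (M + 1)); first by rewrite ltrDl.
  by exists s => //; rewrite /= in_itv.
have i1 : mu2.-integrable (chart l) (EFin \o (fun z : RR => M * B * (1 + k^-1 * (F z ^+ 2 * a z.1)))).
  apply: rintegrableZ => //; apply: rintegrableD => //; last exact: rintegrableZ.
  apply: measurable_bounded_integrable => //.
    rewrite /chart [X in (X < _)%E](@product_measure1E _ _ RT RT R mu mu)//.
    rewrite [X in (X * _)%E](lebesgue_measure_itv `]0, l[) [X in (_ * X)%E](lebesgue_measure_itv `]0, 2 * pi[) /=.
    by case: ifP => _; case: ifP => _; rewrite ?mule0 ?mul0e ?ltry// -EFinD -EFinM ltry.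
  by exists 1; split; [exact: num_real|move=> L /ltW kL r _ /=; rewrite normr1].
apply: (le_integrable mCh _ _ i1).
  apply/measurable_EFinP; apply: measurable_funM => //; apply: measurable_funM.
    by apply: measurable_fun_comp_fst => //; exact: measurable_fun_cont.
  by apply: measurable_fun_comp_snd => //; exact: measurable_fun_cont.
move=> [s p] [/= sI pI]; rewrite lee_fin; rewrite in_itv /= in sI.
have [sc|sc] := ltP s c.
  by rewrite X0 ?mul0r ?mulr0 ?normr0// negb_and -ltNge sc.
have as0 : 0 < a s by exact: lt_le_trans k0 (ka s sI sc).
have h : F (s, p) ^+ 2 <= k^-1 * (F (s, p) ^+ 2 * a s).
  by rewrite mulrCA ler_peMr ?sqr_ge0// mulrC ler_pdivlMr// mul1r ka.
rewrite [leRHS]ger0_norm; last by rewrite mulr_ge0 ?mulr_ge0// addr_ge0// (le_trans (sqr_ge0 _) h).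
rewrite mulrC normrM; apply: ler_pM => //.
  by rewrite normrM; apply: ler_pM.
by apply: le_trans (normr_le1sqr _) _; rewrite lerD2l.
Qed.

Lemma ae_sections (F : R * R -> R) (Y : R -> R) (B : R) : chart_locally_integrable l F ->
  continuous Y -> (forall p : R, `|Y p| <= B) ->
  {aeI l s, mu.-integrable circle (EFin \o (fun p => F (s, p) * Y p))}.
Proof.
move=> iF cY bY; have mC := measurable_circle.
apply: ae_exhaust => c e c0 ce el; have mI : measurable (`[c, e] : set RT) by exact: measurable_itv.
have [_ _ A] := fubini_rect mI mC (iF c e c0 el).
refine (ae_sub A _) => s H /andP[cs se].
have i1 : mu.-integrable circle (EFin \o (fun p => F (s, p))) by apply: H; rewrite /= in_itv /= !ltW.
have mY : measurable_fun circle Y by exact: measurable_fun_cont.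
apply: eq_integrable (integrable_bdM mC mY (fun x _ => bY x) i1) => // p _ /=.
by rewrite mulrC.
Qed.

Lemma angproj_lin (F G : R * R -> R) (k1 k2 Y : R -> R) (B : R) :
  chart_locally_integrable l F -> chart_locally_integrable l G ->
  continuous Y -> (forall p : R, `|Y p| <= B) ->
  {aeI l s,
    angproj Y (fun z => k1 z.1 * F z + k2 z.1 * G z) s = k1 s * angproj Y F s + k2 s * angproj Y G s}.
Proof.
move=> iF iG cY bY; have mC := measurable_circle.
refine (ae_sub (ae_and (ae_sections iF cY bY) (ae_sections iG cY bY)) _) => s [H1 H2] sI.
rewrite /angproj -RintegralZl ?H1// -[X in _ = _ + X]RintegralZl ?H2//.
rewrite -RintegralD//; try by apply: rintegrableZ => //; [exact: H1|exact: H2].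
  by apply: eq_Rintegral => p _ /=; ring.
- by apply: rintegrableZ => //; exact: H1.
- by apply: rintegrableZ => //; exact: H2.
Qed.

Lemma cli_coef (F : R * R -> R) (k : R -> R) : chart_locally_integrable l F ->
  contI l k ->
  chart_locally_integrable l (fun z => k z.1 * F z).
Proof.
move=> iF ck c e c0 el; have mC := measurable_circle.
have sub : `[c, e] `<=` `]0, l[.
  exact: segment_sub.
have [M _ bk] := cont_upper_bound ck c0 el.
have mk : measurable_fun (`[c, e] : set RT) k.
  by apply: (@measurable_funS _ _ _ _ `]0, l[) => //; exact: measurable_fun_I.
apply: (@integrable_bdM _ RR mu2 _ (fun z => k z.1) F M) (iF c e c0 el).
- by apply: measurableX => //; exact: measurable_itv.
- by apply: measurable_fun_comp_fst => //; exact: measurable_itv.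
- by move=> [s p] [/= sI _]; apply: bk; move: sI; rewrite in_itv.
Qed.

Lemma cliD (F G : R * R -> R) : chart_locally_integrable l F -> chart_locally_integrable l G ->
  chart_locally_integrable l (fun z => F z + G z).
Proof.
move=> iF iG c e c0 el; apply: rintegrableD; [|exact: iF|exact: iG].
by apply: measurableX; exact: measurable_itv.
Qed.

Lemma wderZ v g k : wder l v g -> wder l (fun s => k * v s) (fun s => k * g s).
Proof.
move=> [lv lg H].
have lk f : locint l f -> locint l (fun s => k * f s).
  by move=> lf c e c0 el; apply: rintegrableZ; [exact: measurable_itv|exact: lf].
split; [exact: lk|exact: lk|] => X X' BX.
have cX := bump_cont0 BX; have := H _ _ BX; have [_ cX' [c [e [c0 ce el X0]]]] := BX.
have i1 := locint_bump_integrable lg BX.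
have [i2 _] := supp_cont_integral lv c0 el (fun s _ => cX' s) (fun s h => proj2 (X0 s h)).
have E (f h : R -> R) : intI l (fun s => f s * h s) ->
    RintI l (fun s => k * f s * h s) =
    k * RintI l (fun s => f s * h s).
  move=> ifh; rewrite -RintegralZl//.
  by apply: eq_Rintegral => s _; rewrite mulrA.
by rewrite !E// => ->; rewrite mulrN.
Qed.

Lemma integrable_scale (f : R -> R) (k : R) : k != 0 ->
  intI l (fun s => k * f s) ->
  intI l f.
Proof.
move=> k0 i; apply: eq_integrable (rintegrableZ k^-1 (measurable_I l) i) => //.
by move=> s _ /=; rewrite mulKf.
Qed.

Variables (a : R -> R) (m : nat) (lambda0 alpha1 alpha2 : R).
Hypotheses (l0 : 0 < l) (m0 : (0 < m)%N).
Hypotheses (a_gt0 : forI l s, 0 < a s).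
Hypotheses (ca : forI l s, {for s, continuous a}).
Hypotheses (cda : forI l s, {for s, continuous (derive1 a)}).
Let a' := derive1 a.

(** The square-integrability fields are radial counterparts of entries of [H2_jet]. The Robin
    condition is kept in weak form, against functions of [s] supported away from the pole, because
    boundary values of [V] are not yet known to exist; the lower bound on [a] that it asks for is
    supplied later. *)
Record eigenprofile (V V1 V2 : R -> R) : Prop := EigenProfile {
  ep_d1 : forI l s, isd V s (V1 s);
  ep_d2 : forI l s, isd V1 s (V2 s);
  ep_ode : forI l s, V2 s = - (a' s / a s) * V1 s + (m%:R ^+ 2 / a s ^+ 2 - lambda0) * V s;
  ep_L2 : intI l (fun s => V s ^+ 2 * a s);
  ep_L2_1 : intI l (fun s => V1 s ^+ 2 * a s);
  ep_L2_a : intI l (fun s => (V s / a s) ^+ 2 * a s);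
  ep_L2_2 : intI l (fun s => V2 s ^+ 2 * a s);
  ep_L2_1a : intI l (fun s => (V1 s / a s - a' s / a s ^+ 2 * V s) ^+ 2 * a s);
  ep_robin : a l != 0 ->
    (forall c : R, 0 < c -> exists2 k : R, 0 < k & forI l s, c <= s -> k <= a s) ->
    forall (X X' : R -> R) (c e : R), 0 < c -> (forall s : R, isd X s (X' s)) ->
    continuous X' -> (forall s : R, ~~ (c <= s <= e) -> X s = 0 /\ X' s = 0) ->
    [/\ intI l (fun s => V s * X' s + V1 s * X s),
        intI l (fun s => V1 s * X' s + V2 s * X s) &
        alpha1 * RintI l (fun s => V s * X' s + V1 s * X s) +
        alpha2 * RintI l (fun s => V1 s * X' s + V2 s * X s) = 0] }.

Variables (W Ws Wp Wss Wsp Wpp : R * R -> R).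
Hypotheses (hs : weak_s_real l W Ws) (hp : weak_p_real l W Wp) (hss : weak_s_real l Ws Wss)
  (hsp : weak_s_real l Wp Wsp) (hpp : weak_p_real l Wp Wpp).
Hypotheses (LW : L2a l a W) (LWs : L2a l a Ws) (LWp : L2a l a (fun z => (a z.1)^-1 * Wp z))
  (LWss : L2a l a Wss)
  (LWsp : L2a l a (fun z => (a z.1)^-1 * Wsp z - a' z.1 / a z.1 ^+ 2 * Wp z)).
Hypothesis eqW : ae_chart l (fun z => Wss z + a' z.1 / a z.1 * Ws z + (a z.1 ^- 2) * Wpp z = - lambda0 * W z).
Hypothesis bcW : a l != 0 -> exists tr0 tr1 : R -> R, [/\ trace_real l W Ws tr0, trace_real l Ws Wss tr1 &
  {ae mu, forall p : R, 0 < p < 2 * pi -> alpha1 * tr0 p + alpha2 * tr1 p = 0}].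
Variables (Y Y1 : R -> R).
Hypotheses (AY : angular Y Y1 1) (AY1 : angular Y1 (fun p => - m%:R ^+ 2 * Y p) m%:R).

(** [V] is the continuous representative of the projection of [W]. The second weak derivative makes
    its derivative [V1] continuous, and the projected equation gives [V2] as a continuous
    expression, so [V] is a classical solution. The two angular derivatives contribute the factor
    [- m^2]. *)
Lemma extract_profile : exists V V1 V2, eigenprofile V V1 V2 /\
  {aeI l s, angproj Y W s = V s}.
Proof.
have cY := angular_cont AY; have bY := ang_bd AY; have cY1 := angular_cont AY1; have bY1 := ang_bd AY1.
have AY2 : angular (fun p => - m%:R ^+ 2 * Y p) (fun p => - m%:R ^+ 2 * Y1 p) (m%:R ^+ 2).
  split.
  - by move=> p; apply: isdZ; exact: ang_isd AY p.
  - by move=> p; apply: continuousM; [exact: cvg_cst|exact: cY1].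
  - by move=> p; rewrite (ang_per AY).
  - by move=> p; rewrite normrM normrN (ger0_norm (sqr_ge0 _)) -[leRHS]mulr1 ler_wpM2l ?sqr_ge0.
have [iW iWs _] := hs; have [_ iWp _] := hp; have [_ iWss _] := hss; have [_ iWsp _] := hsp; have [_ iWpp _] := hpp.
have wg := weak_s_proj hs AY; have wh := weak_s_proj hss AY.
have [V [AV cV dV]] := wder_classical l0 wg; have [V1 [AV1 cV1 dV1]] := wder_classical l0 wh.
have d1 := dV V1 cV1 AV1.
have pq : {aeI l s, angproj Y1 Wp s = m%:R ^+ 2 * V s}.
  have A0 : {aeI l s, angproj (fun p => - m%:R ^+ 2 * Y p) W s = - m%:R ^+ 2 * V s}.
    refine (ae_sub (ae_and (ae_sections iW cY bY) AV) _) => s [H1 H2] sI.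
    rewrite -H2// /angproj -RintegralZl ?H1//.
    by apply: eq_Rintegral => p _ /=; ring.
  refine (ae_sub (ae_and (weak_p_proj hp AY1 AY2) A0) _) => s [H1 H2] sI.
  by rewrite H1// H2// mulNr opprK.
have pWpp : {aeI l s, angproj Y Wpp s = - (m%:R ^+ 2 * V s)}.
  refine (ae_sub (ae_and (weak_p_proj hpp AY AY1) pq) _) => s [H1 H2] sI.
  by rewrite H1// H2.
have cda' : contI l a' := cda; have ca' : contI l a := ca; have [ca1 ca2] := contIV a_gt0 ca.
have caa : contI l (fun s => a' s / a s) by cont_tac.
have caa2 : contI l (fun s => a' s / a s ^+ 2) by cont_tac.
pose V2 s := - (a' s / a s) * V1 s + (m%:R ^+ 2 / a s ^+ 2 - lambda0) * V s.
have cV2 : contI l V2 by cont_tac.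
(* The equation on the chart is projected by testing, and then solved for the projection of
   [Wss]. *)
have AV2 : {aeI l s, angproj Y Wss s = V2 s}.
  pose F1 z := 1 * Wss z + a' z.1 / a z.1 * Ws z.
  pose F2 z := a z.1 ^- 2 * Wpp z + lambda0 * W z.
  have i1 : chart_locally_integrable l F1.
    apply: cliD; last exact: (cli_coef (k := fun s => a' s / a s)).
    by apply: (cli_coef (k := fun=> 1)) => // s _; exact: cvg_cst.
  have i2 : chart_locally_integrable l F2.
    apply: cliD; first exact: (cli_coef (k := fun s => a s ^- 2)).
    by apply: (cli_coef (k := fun=> lambda0)) => // s _; exact: cvg_cst.
  have i3 : chart_locally_integrable l (fun z => 1 * F1 z + 1 * F2 z).
    by apply: cliD; apply: (cli_coef (k := fun=> 1)) => // s _; exact: cvg_cst.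
  have K0 : {aeI l s, angproj Y (fun z => 1 * F1 z + 1 * F2 z) s = 0}.
    apply: fundamental_lemma; first exact: angproj_locint i3 cY bY.
    move=> X X' BX; have cX := bump_cont0 BX; have [_ _ [c [e [c0 ce el X0]]]] := BX.
    have [j1 <- _] := proj_fubini i3 c0 el cY bY (fun s _ => cX s) (fun s h => proj1 (X0 s h)).
    transitivity (Rintegral mu2 (chart l) (fun=> 0)); last first.
      by rewrite Rintegral_cst ?mul0r//; exact: measurable_chart.
    rewrite /Rintegral; congr fine; apply: ae_eq_integral.
    - exact: measurable_chart.
    - exact: measurable_int j1.
    - exact: measurable_cst.
    apply: (ae_sub eqW) => z H zI.
    congr (_%:E); rewrite (_ : _ + _ = 0) ?mul0r// /F1 /F2 !mul1r addrA H//.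
    by rewrite mulNr addNr.
  have L3 := angproj_lin (fun=> 1) (fun=> 1) i1 i2 cY bY.
  have L1 := angproj_lin (fun=> 1) (fun s => a' s / a s) iWss iWs cY bY.
  have L2' := angproj_lin (fun s => a s ^- 2) (fun=> lambda0) iWpp iW cY bY.
  refine (ae_sub (ae_and (ae_and K0 L3) (ae_and (ae_and L1 L2') (ae_and (ae_and AV AV1) pWpp))) _).
  move=> s [[k0 l3] [[l1 l2] [[e1 e2] e3]]] sI.
  move: (k0 sI); rewrite (l3 sI) (l1 sI) (l2 sI) (e1 sI) (e2 sI) (e3 sI) !mul1r /V2.
  move=> H; apply/eqP; rewrite -subr_eq0 -H; apply/eqP; ring.
have d2 := dV1 V2 cV2 AV2.
(* Uniqueness of weak derivatives: the projection of [Wp] is [m^2 V], so that of its [s]-derivative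
   [Wsp] is [m^2 V1]. *)
have AWsp : {aeI l s, angproj Y1 Wsp s = m%:R ^+ 2 * V1 s}.
  have E := wder_uniq (weak_s_proj hsp AY1) (wderZ (m%:R ^+ 2) wg).
  have AV' : {aeI l s, angproj Y1 Wp s = m%:R ^+ 2 * angproj Y W s}.
    by refine (ae_sub (ae_and pq AV) _) => s [H1 H2] sI; rewrite H1// H2.
  by refine (ae_sub (ae_and (E AV') AV1) _) => s [H1 H2] sI; rewrite H1// H2.
(* The projections with [Y1] carry the factor [m^2], squared in the integrals below; it is divided
   out, which uses [m > 0]. *)
have mm0 : (m%:R ^+ 4 : R) != 0 by rewrite expf_neq0// pnatr_eq0 -lt0n.
exists V, V1, V2; split=> //; split=> //.
- exact: angproj_L2 LW a_gt0 ca cY bY cV AV.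
- exact: angproj_L2 LWs a_gt0 ca cY bY cV1 AV1.
- have A1 : {aeI l s,
      angproj Y1 (fun z => (a z.1)^-1 * Wp z) s = m%:R ^+ 2 * (V s / a s)}.
    have L := angproj_lin (fun s => (a s)^-1) (fun=> 0) iWp iWp cY1 bY1.
    refine (ae_sub (ae_and L pq) _) => s [H1 H2] sI; have := H1 sI; rewrite H2// mul0r addr0.
    have -> : (fun z : R * R => (a z.1)^-1 * Wp z + 0 * Wp z) = (fun z => (a z.1)^-1 * Wp z).
      by apply/funext => z; rewrite mul0r addr0.
    by move=> ->; rewrite mulrC -mulrA.
  apply: (@integrable_scale _ (m%:R ^+ 4)) => //.
  have cVa : contI l (fun s => m%:R ^+ 2 * (V s / a s)) by cont_tac.
  apply: eq_integrable (angproj_L2 LWp a_gt0 ca cY1 bY1 cVa A1) => //.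
  by move=> s _ /=; congr (_%:E); ring.
- exact: angproj_L2 LWss a_gt0 ca cY bY cV2 AV2.
- have A1 : {aeI l s,
      angproj Y1 (fun z => (a z.1)^-1 * Wsp z - a' z.1 / a z.1 ^+ 2 * Wp z) s =
      m%:R ^+ 2 * (V1 s / a s - a' s / a s ^+ 2 * V s)}.
    have L := angproj_lin (fun s => (a s)^-1) (fun s => - (a' s / a s ^+ 2)) iWsp iWp cY1 bY1.
    refine (ae_sub (ae_and L (ae_and AWsp pq)) _) => s [H1 [H2 H3]] sI; have := H1 sI; rewrite H2// H3//.
    have -> : (fun z : R * R => (a z.1)^-1 * Wsp z + - (a' z.1 / a z.1 ^+ 2) * Wp z) =
        (fun z => (a z.1)^-1 * Wsp z - a' z.1 / a z.1 ^+ 2 * Wp z).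
      by apply/funext => z; rewrite mulNr.
    by move=> ->; ring.
  apply: (@integrable_scale _ (m%:R ^+ 4)) => //.
  have cVa : contI l (fun s => m%:R ^+ 2 * (V1 s / a s - a' s / a s ^+ 2 * V s)) by cont_tac.
  apply: eq_integrable (angproj_L2 LWsp a_gt0 ca cY1 bY1 cVa A1) => //.
  by move=> s _ /=; congr (_%:E); ring.
move=> al0 ak X X' c e c0 dX cX' X0; have [tr0 [tr1 [[itr0 T0] [itr1 T1] trE]]] := bcW al0.
have cX (s : R) : {for s, continuous X} by exact: isd_cont (dX s).
have T : test_on `]0, +oo[ (fun z : R * R => X z.1 * Y z.2) (fun z => X' z.1 * Y z.2) (fun z => X z.1 * Y1 z.2).
  apply: test_tensor AY => //; exists c, e; split; last by move=> s /X0[].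
  by move=> s /=; rewrite !in_itv /= andbT => /andP[h1 _]; exact: lt_le_trans h1.
have mC := measurable_circle; have mI := measurable_I l; have mCh := measurable_chart l.
have key (F G : R * R -> R) (f g tr : R -> R) : L2a l a F -> L2a l a G ->
    contI l f -> contI l g ->
    {aeI l s, angproj Y F s = f s} ->
    {aeI l s, angproj Y G s = g s} ->
    mu.-integrable circle (EFin \o tr) ->
    Rintegral mu2 (chart l) (fun z => F z * (X' z.1 * Y z.2) + G z * (X z.1 * Y z.2)) =
      Rintegral mu circle (fun p => tr p * (X l * Y p)) ->
    [/\ intI l (fun s => f s * X' s + g s * X s),
        mu.-integrable circle (EFin \o (fun p => Y p * tr p)) &
        RintI l (fun s => f s * X' s + g s * X s) =
        X l * Rintegral mu circle (fun p => Y p * tr p)].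
  move=> LF LG cf cg Af Ag itr E.
  have j1 := L2_tensor_integrable LF cX' cY bY (fun s h => proj2 (X0 s h)) (ak c c0).
  have j2 := L2_tensor_integrable LG cX cY bY (fun s h => proj1 (X0 s h)) (ak c c0).
  have [k1 E1] := tensor_proj (fun s _ => cX' s) cf Af j1.
  have [k2 E2] := tensor_proj (fun s _ => cX s) cg Ag j2.
  have mY : measurable_fun circle Y by exact: measurable_fun_cont.
  have iYt := integrable_bdM mC mY (fun x _ => bY x) itr.
  split=> //; first exact: rintegrableD.
  rewrite RintegralD// -E1 -E2 -RintegralD// E -RintegralZl//.
  by apply: eq_Rintegral => p _; ring.
have [r1 s1 E1] := key _ _ _ _ _ LW LWs cV cV1 AV AV1 itr0 (T0 _ _ _ T).
have [r2 s2 E2] := key _ _ _ _ _ LWs LWss cV1 cV2 AV1 AV2 itr1 (T1 _ _ _ T).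
split=> //; rewrite E1 E2 ![_ * (X l * _)]mulrCA -mulrDr.
rewrite -RintegralZl// -[X in _ + X]RintegralZl// -RintegralD//; [|exact: rintegrableZ|exact: rintegrableZ].
apply/eqP; rewrite mulf_eq0; apply/orP; right; apply/eqP.
transitivity (Rintegral mu circle (fun=> 0)); last by rewrite Rintegral_cst ?mul0r.
have i0 : mu.-integrable circle (EFin \o (fun p => alpha1 * (Y p * tr0 p) + alpha2 * (Y p * tr1 p))).
  by apply: rintegrableD => //; exact: rintegrableZ.
rewrite /Rintegral; congr fine; apply: ae_eq_integral => //.
  exact: measurable_int i0.
refine (ae_sub trE _) => p H pI; congr (_%:E); have : 0 < p < 2 * pi by move: pI; rewrite /= in_itv.
move=> /H H0; rewrite -[RHS](mulr0 (Y p)) -H0; ring.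
Qed.

End RadialProfile.

(** * Existence of the radial eigenprofile *)

Section EigenProfile.
Variable l : R.

Lemma circle_integral (f F : R -> R) : (forall p : R, isd F p (f p)) -> (forall p : R, {for p, continuous f}) ->
  Rintegral mu circle f = F (2 * pi) - F 0.
Proof.
move=> dF cf; have pi0 : 0 <= 2 * pi :> R by rewrite mulr_ge0// pi_ge0.
have [i <-] := isd_Rintegral pi0 (fun s _ => dF s) (fun s _ => cf s).
rewrite -Rintegral_itv_obnd_cbnd; last first.
  by apply: itv_integrableS i; apply: subset_itvr; rewrite bnd_simp.
rewrite -Rintegral_itv_bndo_bndc//.
by apply: itv_integrableS i; apply: subset_itvW.
Qed.

Variable m : nat.
Hypothesis m0 : (0 < m)%N.
Let mm : R := m%:R.

Lemma isd_angle (p : R) : isd (fun p => m%:R * p) p (m%:R : R).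
Proof. by apply: isd_eqd (isdZ _ (isd_id p)) _; rewrite mulr1. Qed.

Lemma isd_cosm (p : R) : isd (fun p => cos (m%:R * p)) p (- m%:R * sin (m%:R * p)).
Proof. by apply: isd_eqd (isd_cos (isd_angle p)) _; ring. Qed.

Lemma isd_sinm (p : R) : isd (fun p => sin (m%:R * p)) p (m%:R * cos (m%:R * p)).
Proof. by apply: isd_eqd (isd_sin (isd_angle p)) _; rewrite mulrC. Qed.

Lemma cosm_per (p : R) : cos (m%:R * (p + 2 * pi)) = cos (m%:R * p).
Proof.
rewrite mulrDr (_ : m%:R * (2 * pi) = (pi *+ 2) *+ m).
  exact: (periodicn (@cosD2pi R)).
by rewrite -[RHS]mulr_natl; congr (_ * _); rewrite mulr_natl.
Qed.

Lemma sinm_per (p : R) : sin (m%:R * (p + 2 * pi)) = sin (m%:R * p).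
Proof.
rewrite mulrDr (_ : m%:R * (2 * pi) = (pi *+ 2) *+ m).
  exact: (periodicn (@sinD2pi R)).
by rewrite -[RHS]mulr_natl; congr (_ * _); rewrite mulr_natl.
Qed.

Lemma angular_cos : angular (fun p : R => cos (m%:R * p)) (fun p => - m%:R * sin (m%:R * p)) 1.
Proof.
split.
- exact: isd_cosm.
- by move=> p; apply: continuousM; [exact: cvg_cst|exact: isd_cont (isd_sinm p)].
- exact: cosm_per.
- by move=> p; exact: cos_max.
Qed.

Lemma angular_cos' : angular (fun p : R => - m%:R * sin (m%:R * p)) (fun p => - m%:R ^+ 2 * cos (m%:R * p)) m%:R.
Proof.
split.
- by move=> p; apply: isd_eqd (isdZ _ (isd_sinm p)) _; ring.
- by move=> p; apply: continuousM; [exact: cvg_cst|exact: isd_cont (isd_cosm p)].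
- by move=> p; rewrite sinm_per.
- by move=> p; rewrite normrM normrN normr_nat -[leRHS]mulr1 ler_wpM2l// sin_max.
Qed.

Lemma angular_sin : angular (fun p : R => sin (m%:R * p)) (fun p => m%:R * cos (m%:R * p)) 1.
Proof.
split.
- exact: isd_sinm.
- by move=> p; apply: continuousM; [exact: cvg_cst|exact: isd_cont (isd_cosm p)].
- exact: sinm_per.
- by move=> p; exact: sin_max.
Qed.

Lemma angular_sin' : angular (fun p : R => m%:R * cos (m%:R * p)) (fun p => - m%:R ^+ 2 * sin (m%:R * p)) m%:R.
Proof.
split.
- by move=> p; apply: isd_eqd (isdZ _ (isd_cosm p)) _; ring.
- by move=> p; apply: continuousM; [exact: cvg_cst|exact: isd_cont (isd_sinm p)].
- by move=> p; rewrite cosm_per.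
- by move=> p; rewrite normrM normr_nat -[leRHS]mulr1 ler_wpM2l// cos_max.
Qed.

Lemma sinm_2pi : sin (m%:R * (2 * pi)) = 0 :> R.
Proof. by have := sinm_per 0; rewrite add0r mulr0 sin0. Qed.

Lemma angproj_mode (k q : R) (u : R -> R[i]) (s : R) :
  angproj (fun p => k * cos (m%:R * p) + q * sin (m%:R * p)) (@complex.Re R \o mode m u) s =
  pi * (k * complex.Re (u s) - q * complex.Im (u s)).
Proof.
have mp : (mm != 0) by rewrite pnatr_eq0 -lt0n.
set x := complex.Re (u s); set y := complex.Im (u s).
(* An explicit primitive in the angle of the integrand, whose products of cosine and sine are
   linearised below. *)
pose F p := (k * x - q * y) * (p / 2) + (k * x + q * y) * (sin (m%:R * p) * cos (m%:R * p) / (2 * m%:R))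
  + (q * x - k * y) * (sin (m%:R * p) ^+ 2 / (2 * m%:R)).
have -> : angproj (fun p => k * cos (m%:R * p) + q * sin (m%:R * p)) (@complex.Re R \o mode m u) s =
    Rintegral mu circle (fun p => (x * cos (m%:R * p) - y * sin (m%:R * p)) * (k * cos (m%:R * p) + q * sin (m%:R * p))).
  by apply: eq_Rintegral => p _; rewrite /mode /cis /x /y /=; case: (u s).
transitivity (F (2 * pi) - F 0); first apply: circle_integral.
- move=> p; have d1 := isdM (isd_sinm p) (isd_cosm p); have d2 := isdM (isd_sinm p) (isd_sinm p).
  apply: isd_eqd (isdD (isdD (isdZ _ (isdM (isd_id p) (isd_cst 2^-1 p))) (isdZ _ (isdM d1 (isd_cst (2 * m%:R)^-1 p))))
    (isdZ _ (isdM d2 (isd_cst (2 * m%:R)^-1 p)))) _.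
  have : cos (m%:R * p) ^+ 2 + sin (m%:R * p) ^+ 2 = 1 by exact: cos2Dsin2.
  set A := cos _; set B := sin _ => E.
  have -> : (x * A - y * B) * (k * A + q * B) = (k * x - q * y) * ((A ^+ 2 + B ^+ 2) / 2) +
    (k * x + q * y) * ((A ^+ 2 - B ^+ 2) / 2) + (q * x - k * y) * (A * B) by field.
  by rewrite E; field.
- move=> p; have c1 := isd_cont (isd_cosm p); have c2 := isd_cont (isd_sinm p).
  by apply: continuousM; [apply: continuousB|apply: continuousD]; apply: continuousM => //; exact: cvg_cst.
by rewrite /F sinm_2pi mulr0 sin0; field.
Qed.

Lemma angproj_mode_cos (u : R -> R[i]) (s : R) :
  angproj (fun p => cos (m%:R * p)) (@complex.Re R \o mode m u) s = pi * complex.Re (u s).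
Proof.
have := angproj_mode 1 0 u s; rewrite mul1r mul0r subr0 => <-.
by congr angproj; apply/funext => p; rewrite mul1r mul0r addr0.
Qed.

Lemma angproj_mode_sin (u : R -> R[i]) (s : R) :
  angproj (fun p => sin (m%:R * p)) (@complex.Re R \o mode m u) s = - pi * complex.Im (u s).
Proof.
have := angproj_mode 0 1 u s; rewrite mul1r mul0r sub0r mulrN -mulNr => <-.
by congr angproj; apply/funext => p; rewrite mul1r mul0r add0r.
Qed.

Lemma Re_scale (x : R) (z : R[i]) : complex.Re (x%:C * z) = x * complex.Re z.
Proof. by case: z => r i /=; rewrite mul0r subr0. Qed.

Lemma ReD (z w : R[i]) : complex.Re (z + w) = complex.Re z + complex.Re w.
Proof. by case: z => r i; case: w. Qed.

Lemma ReN (z : R[i]) : complex.Re (- z) = - complex.Re z.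
Proof. by case: z. Qed.

Variables (a : R -> R) (lambda0 alpha1 alpha2 : R).
Hypotheses (l0 : 0 < l).
Hypotheses (a_gt0 : forI l s, 0 < a s).
Hypotheses (ca : forI l s, {for s, continuous a}).
Hypotheses (cda : forI l s, {for s, continuous (derive1 a)}).

Lemma L2_Re (psi : R * R -> R[i]) : L2 l a psi -> L2a l a (@complex.Re R \o psi).
Proof.
move=> [m1 m2 i]; split=> //; have mCh := measurable_chart l.
apply: (le_integrable mCh _ _ i).
  apply/measurable_EFinP; apply: measurable_funM; first exact: measurable_funM.
  apply: measurable_fun_comp_fst; [exact: measurable_I|exact: measurable_circle|exact: measurable_fun_I].
move=> [s p] [/= sI _]; rewrite in_itv /= in sI; rewrite lee_fin.
have as0 := ltW (a_gt0 sI).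
have h : complex.Re (psi (s, p)) ^+ 2 <= sqnorm (psi (s, p)) by rewrite lerDl sqr_ge0.
rewrite !ger0_norm; first by rewrite ler_wpM2r.
  by apply: mulr_ge0 as0; exact: le_trans (sqr_ge0 _) h.
exact: mulr_ge0 (sqr_ge0 _) as0.
Qed.

(** The projections of the real part of [psi = u e^{i m phi}] on cosine and sine are [pi Re u] and
    [- pi Im u]. If both were zero, [psi] would vanish almost everywhere, so one of them is a
    nontrivial profile. *)
Theorem eigenprofile_exists : eigenvalue_neg_Delta_m l a alpha1 alpha2 m lambda0 ->
  exists V V1 V2, eigenprofile l a m lambda0 alpha1 alpha2 V V1 V2 /\ exists2 s : R, 0 < s < l & V s != 0.
Proof.
move=> [psi [lap [[[Lpsi [u psiE]] [j [Hj rob lapE]]] nt eqn]]].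
have [[ws _] [wp _] [wss _] [wsp _] [wpp _] Lp Ls Lpp Lss Lsp _] := Hj.
pose re := @complex.Re R.
have LWp : L2a l a (fun z => (a z.1)^-1 * (re \o d_p j) z).
  have := L2_Re Lpp; congr (L2a _ _ _); apply/funext => z /=; exact: Re_scale.
have LWsp : L2a l a (fun z => (a z.1)^-1 * (re \o d_sp j) z - derive1 a z.1 / a z.1 ^+ 2 * (re \o d_p j) z).
  have := L2_Re Lsp; congr (L2a _ _ _); apply/funext => z /=.
  by rewrite ReD ReN !Re_scale.
have eqW : ae_chart l (fun z => (re \o d_ss j) z + derive1 a z.1 / a z.1 * (re \o d_s j) z
    + (a z.1 ^- 2) * (re \o d_pp j) z = - lambda0 * (re \o psi) z).
  have A := ae_and lapE eqn.
  apply: (ae_sub A) => z [H1 H2] zI.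
  have := congr1 re (H2 zI); rewrite (H1 zI) /re ReN !ReD !Re_scale /= => H3.
  by rewrite mulNr -H3 opprK.
have bcW : a l != 0 -> exists tr0 tr1 : R -> R, [/\ trace_real l (re \o psi) (re \o d_s j) tr0,
    trace_real l (re \o d_s j) (re \o d_ss j) tr1 &
    {ae mu, forall p : R, 0 < p < 2 * pi -> alpha1 * tr0 p + alpha2 * tr1 p = 0}].
  move=> /rob[tr0 [tr1 [[t0 _] [t1 _] A]]]; exists (re \o tr0), (re \o tr1); split=> //.
  refine (ae_sub A _) => p H pI; have := congr1 re (H pI).
  by rewrite /re ReD !Re_scale.
have ext Y Y1 := @extract_profile l a m lambda0 alpha1 alpha2 l0 m0 a_gt0 ca cda _ _ _ _ _ _
  ws wp wss wsp wpp (L2_Re Lp) (L2_Re Ls) LWp (L2_Re Lss) LWsp eqW bcW Y Y1.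
have [V [V1 [V2 [EV AV]]]] := ext _ _ angular_cos angular_cos'.
have [U [U1 [U2 [EU AU]]]] := ext _ _ angular_sin angular_sin'.
have [[s sI Vs]|nV] := pselect (exists2 s : R, 0 < s < l & V s != 0).
  by exists V, V1, V2; split=> //; exists s.
exists U, U1, U2; split=> //; apply: contrapT => nU; apply: nt.
have A : {aeI l s, u s = 0}.
  refine (ae_sub (ae_and AV AU) _) => s [H1 H2] sI.
  have V0 : V s = 0 by apply/eqP/negPn/negP => h; apply: nV; exists s.
  have U0 : U s = 0 by apply/eqP/negPn/negP => h; apply: nU; exists s.
  move: (H1 sI) (H2 sI); rewrite V0 U0 psiE angproj_mode_cos angproj_mode_sin.
  have pi0 : (pi : R) != 0 by rewrite gt_eqF// pi_gt0.
  move=> /eqP; rewrite mulf_eq0 (negPf pi0) /= => /eqP r0.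
  move=> /eqP; rewrite mulf_eq0 oppr_eq0 (negPf pi0) /= => /eqP i0.
  by move: r0 i0; case: (u s) => x y /= -> ->.
have B := ae_fst A.
apply: (ae_sub B) => z H [zI _].
by rewrite psiE /mode H ?mul0r//; move: zI; rewrite /= in_itv.
Qed.

End EigenProfile.

End PlaneMeasure.

(** * The Gronwall estimate *)

Section Gronwall.
Context {R : realType}.
Implicit Types (E V : R -> R) (p q s t L : R).

(** [E exp(- L t)] is nonincreasing and [E exp(L t)] is nondecreasing, which gives the bound in both
    directions of time. *)
Lemma gronwall E E' L p q : (forall t : R, p < t < q -> isd E t (E' t)) ->
  (forall t : R, p < t < q -> `|E' t| <= L * E t) ->
  forall s t : R, p < s < q -> p < t < q -> E t <= E s * expR (L * `|t - s|).
Proof.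
move=> dE bE s t /andP[ps sq] /andP[pt tq].
have dexp (k u : R) : isd (fun t : R => expR (k * t)) u (expR (k * u) * k).
  by have := isd_expR (isdZ k (isd_id u)); rewrite mulr1.
have [st|/ltW ts] := leP s t.
- have := @isd_nincr _ _ _ p q s t (fun u uI => isdM (dE u uI) (dexp (- L) u)) _ ps st tq.
  rewrite ger0_norm ?subr_ge0// => H.
  have {}H : E t * expR (- L * t) <= E s * expR (- L * s).
    apply: H => u uI; have /ler_normlP[_ h] := bE u uI; have := expR_ge0 (- L * u); nra.
  rewrite -(ler_pM2r (expR_gt0 (- L * t))) -mulrA -expRD (le_trans H)//.
  by rewrite (_ : L * (t - s) + - L * t = - L * s)//; ring.
- have := @isd_ndecr _ _ _ p q t s (fun u uI => isdM (dE u uI) (dexp L u)) _ pt ts sq.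
  rewrite distrC ger0_norm ?subr_ge0// => H.
  have {}H : E t * expR (L * t) <= E s * expR (L * s).
    apply: H => u uI; have /ler_normlP[h _] := bE u uI; have := expR_ge0 (L * u); nra.
  rewrite -(ler_pM2r (expR_gt0 (L * t))) -mulrA -expRD (le_trans H)//.
  by rewrite (_ : L * (s - t) + L * t = L * s)//; ring.
Qed.
End Gronwall.

(** * Quasi-monotone behaviour near the ends *)

Section Ends.
Context {R : realType} (l : R).
Implicit Types (f g h : R -> R).

Lemma cont_lower_bound f (p q : R) : contI l f ->
  (forI l s, 0 < f s) -> 0 < p -> q < l ->
  exists2 c : R, 0 < c & forall s : R, p <= s <= q -> c <= f s.
Proof.
move=> cf f0 p0 ql; have [M M0 HM] := cont_upper_bound (contIV f0 cf).1 p0 ql.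
exists M^-1; rewrite ?invr_gt0// => s sI.
have fs : 0 < f s by apply: f0; case/andP: sI => h1 h2; rewrite (lt_le_trans p0 h1) (le_lt_trans h2 ql).
by rewrite invf_ple ?posrE// (le_trans (ler_norm _) (HM s sI)).
Qed.

(** The germ at [0] of the comparison clause of [weight]. It is stable under products of nonnegative
    functions, and the clause at [l] is obtained by reflecting [s] to [l - s]. *)
Definition monoend f := exists d K : R, [/\ 0 < d, 0 < K &
  forall s t : R, 0 < s -> s <= t -> t < d -> f s <= K * f t].

Lemma monoendM f g : monoend f -> monoend g ->
  (exists2 d : R, 0 < d & forI d s, 0 <= f s /\ 0 <= g s) ->
  monoend (fun s => f s * g s).
Proof.
move=> [d [K [d0 K0 H]]] [d' [K' [d0' K0' H']]] [d1 d10 P].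
exists (Num.min d1 (Num.min d d')), (K * K'); split.
- by rewrite !lt_min d10 d0.
- exact: mulr_gt0.
move=> s t s0 st; rewrite !lt_min => /andP[t1 /andP[td td']].
have [fs gs] : 0 <= f s /\ 0 <= g s by apply: P; rewrite s0 (le_lt_trans st t1).
by rewrite mulrACA ler_pM ?H ?H'.
Qed.

Lemma monoend_equiv f h (d c C : R) : 0 < d -> 0 < c -> 0 < C ->
  (forall s t : R, 0 < s -> s <= t -> t < d -> h s <= h t) ->
  (forI d s, c * h s <= f s <= C * h s) -> monoend f.
Proof.
move=> d0 c0 C0 hm H; exists d, (C / c); split=> //; first exact: divr_gt0.
move=> s t s0 st td; have t0 := lt_le_trans s0 st.
have /andP[_ Hs] : c * h s <= f s <= C * h s by apply: H; rewrite s0 (le_lt_trans st td).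
have /andP[Ht _] : c * h t <= f t <= C * h t by apply: H; rewrite t0 td.
have hst := hm s t s0 st td; apply: le_trans Hs _.
rewrite -mulrA ler_wpM2l ?(ltW C0)// mulrC ler_pdivlMr// mulrC (le_trans _ Ht)//.
by rewrite ler_wpM2l ?(ltW c0).
Qed.

(** On [[d, l / 2]] the function lies between two positive constants [c] and [M], so the germ
    condition extends at the price of a factor governed by [M / c]. *)
Lemma monoend_half f : 0 < l -> contI l f ->
  (forI l s, 0 < f s) -> monoend f ->
  exists2 K : R, 0 < K & forall s t : R, 0 < s -> s <= t -> t <= l / 2 -> f s <= K * f t.
Proof.
move=> l0 cf f0 [d0 [K [d00 K0 H]]].
have [d [dp dl dd]] : exists d : R, [/\ 0 < d, d < l / 2 & d < d0].
  exists (Num.min d0 (l / 2) / 2); set m := Num.min _ _.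
  have [m1 m2] : m <= d0 /\ m <= l / 2 by rewrite /m; split; rewrite ge_min lexx ?orbT.
  have m0 : 0 < m by rewrite /m lt_min d00 divr_gt0.
  by split; lra.
have lh : l / 2 < l by lra.
have [c c0 Hc] := cont_lower_bound cf f0 dp lh.
have [M M0 HM] := cont_upper_bound cf dp lh.
have fM (s : R) : d <= s <= l / 2 -> f s <= M.
  by move=> /HM; apply: le_trans; exact: ler_norm.
exists ((K + 1) * (M / c + 1)) => [|s t s0 st tl].
  by rewrite mulr_gt0// ?addr_gt0// divr_gt0.
have ft0 : 0 < f t by apply: f0; rewrite (lt_le_trans s0 st) (le_lt_trans tl lh).
have p0 : 0 < M / c by rewrite divr_gt0.
have [td|dt] := ltP t d.
  apply: le_trans (H s t s0 st (lt_trans td dd)) _; rewrite ler_wpM2r ?(ltW ft0)//.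
  by have := mulr_gt0 K0 p0; nra.
have Mt : M <= M / c * f t.
  by rewrite -mulrA ler_peMr ?(ltW M0)// mulrC ler_pdivlMr// mul1r Hc// dt tl.
have fs : f s <= (K + 1) * M.
  have [sd|ds] := ltP s d.
    apply: le_trans (H s d s0 (ltW sd) dd) _; apply: ler_pM => //; first exact: ltW.
    - by apply/ltW/f0; rewrite dp (lt_trans dl lh).
    - by rewrite lerDl.
    - by apply: fM; rewrite lexx (ltW dl).
  have := fM s; rewrite ds (le_trans st tl) => /(_ isT); nra.
apply: le_trans fs _; rewrite -mulrA ler_wpM2l ?addr_ge0 ?(ltW K0)//.
by rewrite mulrDl mul1r (le_trans Mt)// lerDl ltW.
Qed.

Lemma monoend_weight f : 0 < l -> contI l f ->
  (forI l s, 0 < f s) -> monoend f -> monoend (fun s => f (l - s)) ->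
  weight l f.
Proof.
move=> l0 cf f0 M1 M2.
have refl (s : R) : 0 < s < l -> 0 < l - s < l by move=> /andP[? ?]; lra.
have cf' : contI l (fun s => f (l - s)).
  move=> s sI; apply: (@continuous_comp _ _ _ (fun s => l - s) f); last exact/cf/refl.
  by apply: continuousB; [exact: cvg_cst|exact: cvg_id].
have [K K0 HK] := monoend_half l0 cf f0 M1.
have [K' K0' HK'] := monoend_half l0 cf' (fun s sI => f0 _ (refl s sI)) M2.
have fh : 0 < f (l / 2) by apply: f0; lra.
have mono (s t : R) : 0 < s < l -> 0 < t < l ->
    s <= t <= l / 2 \/ l / 2 <= t <= s -> f s <= (K + K') * f t.
  move=> sI tI st; have ft := f0 _ tI; have [s0 sl] := andP sI.
  case: st => /andP[h1 h2].
    by apply: le_trans (HK s t s0 h1 h2) _; rewrite ler_wpM2r ?lerDl ?ltW.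
  have := HK' (l - s) (l - t); rewrite !subKr => H; apply: le_trans (H _ _ _) _; try lra.
  by rewrite ler_wpM2r ?lerDr ?ltW.
split=> //; last by exists (K + K') => //; exact: addr_gt0.
split=> //; exists ((K + K') * f (l / 2)) => s sI; rewrite (gtr0_norm (f0 s sI)).
have hI : 0 < l / 2 < l by lra.
by have [h|h] := leP s (l / 2); apply: mono => //; [left|right]; rewrite ?h ?lexx ?(ltW h).
Qed.

End Ends.

(** * Uniqueness for planar linear systems *)

Section LinearSystem.
Context {R : realType}.
Implicit Types (y z : R -> R).

Lemma lin2_gronwall y z (c11 c12 c21 c22 : R -> R) (B p q : R) :
  (forall t : R, p < t < q -> isd y t (c11 t * y t + c12 t * z t)) ->
  (forall t : R, p < t < q -> isd z t (c21 t * y t + c22 t * z t)) ->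
  (forall t : R, p < t < q -> [/\ `|c11 t| <= B, `|c12 t| <= B, `|c21 t| <= B & `|c22 t| <= B]) ->
  forall s t : R, p < s < q -> p < t < q ->
  y t ^+ 2 + z t ^+ 2 <= (y s ^+ 2 + z s ^+ 2) * expR (4 * B * `|t - s|).
Proof.
move=> dy dz cB; apply: (gronwall (E := fun t => y t ^+ 2 + z t ^+ 2)).
  by move=> t tI; exact: isdD (isd_sqr (dy t tI)) (isd_sqr (dz t tI)).
move=> t /cB[/ler_normlP[a1 a2] /ler_normlP[b1 b2] /ler_normlP[d1 d2] /ler_normlP[e1 e2]].
move: (y t) (z t) (c11 t) (c12 t) (c21 t) (c22 t) a1 a2 b1 b2 d1 d2 e1 e2 => u v k1 k2 k3 k4.
move=> a1 a2 b1 b2 d1 d2 e1 e2.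
have h1 := sqr_ge0 (u - v); have h2 := sqr_ge0 (u + v); have h3 := sqr_ge0 u; have h4 := sqr_ge0 v.
rewrite ler_norml; apply/andP; split; nra.
Qed.

(** Gronwall for [y^2 + z^2] on a compact interval that contains both points; the coefficients may
    blow up at the ends of [(0, l)]. *)
Lemma lin2_uniq y z (c11 c12 c21 c22 : R -> R) (l : R) :
  (forI l t, isd y t (c11 t * y t + c12 t * z t)) ->
  (forI l t, isd z t (c21 t * y t + c22 t * z t)) ->
  (forI l t, [/\ {for t, continuous c11}, {for t, continuous c12},
     {for t, continuous c21} & {for t, continuous c22}]) ->
  forI l s, y s = 0 -> z s = 0 -> forI l t, y t = 0.
Proof.
move=> dy dz cc s /andP[s0 sl] ys zs t /andP[t0 tl].
have [p [p0 ps pt]] : exists p : R, [/\ 0 < p, p < s & p < t].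
  exists (Num.min s t / 2); have h : Num.min s t <= s /\ Num.min s t <= t by rewrite !ge_min !lexx orbT.
  have h' : 0 < Num.min s t by rewrite lt_min s0.
  case: h => *; split; lra.
have [q [sq tq ql]] : exists q : R, [/\ s < q, t < q & q < l].
  exists ((Num.max s t + l) / 2).
  have h : s <= Num.max s t /\ t <= Num.max s t by rewrite !le_max !lexx orbT.
  have h' : Num.max s t < l by rewrite gt_max sl.
  case: h => *; split; lra.
have sub (r : R) : p < r < q -> 0 < r < l.
  by move=> /andP[h1 h2]; rewrite (lt_trans p0 h1) (lt_trans h2 ql).
have [B1 B10 H1] := cont_upper_bound (fun r rI => let: And4 h _ _ _ := cc r rI in h) p0 ql.
have [B2 B20 H2] := cont_upper_bound (fun r rI => let: And4 _ h _ _ := cc r rI in h) p0 ql.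
have [B3 B30 H3] := cont_upper_bound (fun r rI => let: And4 _ _ h _ := cc r rI in h) p0 ql.
have [B4 B40 H4] := cont_upper_bound (fun r rI => let: And4 _ _ _ h := cc r rI in h) p0 ql.
have sI : p < s < q by rewrite ps. have tI : p < t < q by rewrite pt.
have := @lin2_gronwall y z c11 c12 c21 c22 (B1 + B2 + B3 + B4) p q
  (fun r rI => dy r (sub r rI)) (fun r rI => dz r (sub r rI)) _ s t sI tI.
rewrite ys zs !expr0n addr0 mul0r => H; apply/eqP; rewrite -sqrf_eq0 eq_le sqr_ge0 andbT.
apply: le_trans (H _); first by rewrite lerDl sqr_ge0.
move=> r /andP[/ltW pr /ltW rq]; have rI : p <= r <= q by rewrite pr.
have w (x : R) : x <= B1 \/ x <= B2 \/ x <= B3 \/ x <= B4 -> x <= B1 + B2 + B3 + B4.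
  by clear -B10 B20 B30 B40 => h; case: h => [|[|[|]]] h; lra.
split; apply: w; [left|right; left|do 2 right; left|do 3 right]; [exact: H1|exact: H2|exact: H3|exact: H4].
Qed.

End LinearSystem.

(** * Behaviour of a radial solution at a pole *)

Section Pole.
Context {R : realType} (l mm lambda0 : R) (a a' V V1 V2 : R -> R).
Hypotheses (l0 : 0 < l) (mm0 : 0 < mm) (lam0 : 0 < lambda0).
Hypotheses (a_gt0 : forI l s, 0 < a s).
Hypotheses (da : forI l s, isd a s (a' s)).
Hypotheses (ca' : forI l s, {for s, continuous a'}).
Hypotheses (dV : forI l s, isd V s (V1 s)).
Hypotheses (dV1 : forI l s, isd V1 s (V2 s)).
Hypotheses (ode : forI l s, V2 s = - (a' s / a s) * V1 s + (mm ^+ 2 / a s ^+ 2 - lambda0) * V s).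
Hypothesis V_neq0 : exists2 s : R, 0 < s < l & V s != 0.

Lemma profile_uniq (s : R) : 0 < s < l -> V s = 0 -> V1 s != 0.
Proof.
move=> sI Vs; apply/eqP => V1s; have [t tI /eqP[]] := V_neq0.
have ca r : 0 < r < l -> {for r, continuous a} by move=> rI; exact: isd_cont (da rI).
apply: (@lin2_uniq _ V V1 (fun=> 0) (fun=> 1) (fun s => mm ^+ 2 / a s ^+ 2 - lambda0)
  (fun s => - (a' s / a s)) l _ _ _ s sI Vs V1s t tI).
- by move=> r rI; rewrite mul0r mul1r add0r; exact: dV.
- by move=> r rI; rewrite addrC -ode//; exact: dV1.
- move=> r rI; have ar := a_gt0 rI; split; try exact: cvg_cst.
    apply: continuousB; last exact: cvg_cst.
    apply: continuousM; first exact: cvg_cst.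
    by apply: continuousV; [rewrite expf_eq0 gt_eqF|apply: continuousM; exact: ca].
  apply: continuousN; apply: continuousM; first exact: ca'.
  by apply: continuousV; [rewrite gt_eqF|exact: ca].
Qed.

(* Near a pole [a V V'] is nondecreasing, because [(a V')' = (m^2 / a - lambda0 a) V]. *)
Lemma pole_monotone (C1 : R) : (forI l s, a s <= C1 * s) ->
  (forall c d : R, 0 < c -> 0 < d -> d < l -> ~ (forI d s, a s * (V s * V1 s) <= - c)) ->
  exists2 d : R, 0 < d < l & (forI d s, V s != 0) /\
    (forall s t : R, 0 < s -> s <= t -> t < d -> V s ^+ 2 <= V t ^+ 2).
Proof.
move=> aC H.
have ll := l0; have lm0 := lam0; have C10 : 0 < C1.
  have hI : 0 < l / 2 < l by lra.
  by have := lt_le_trans (a_gt0 hI) (aC _ hI); case/andP: hI => h _; rewrite pmulr_lgt0.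
(* Since [a <= C1 s], the centrifugal term [mm^2 / a^2] dominates [lambda0] close enough to the
   pole. *)
have [d [d0 dl hd]] : exists d : R, [/\ 0 < d, d < l & forI d s, 0 <= mm ^+ 2 / a s ^+ 2 - lambda0].
  pose k := mm ^+ 2 / (C1 ^+ 2 * lambda0).
  have k0 : 0 < k by rewrite /k divr_gt0 ?mulr_gt0 ?exprn_gt0.
  pose d := Num.min (Num.min (l / 2) 1) k; have d0 : 0 < d by rewrite !lt_min k0 divr_gt0//= ltr01.
  have [d1 [d2 d3]] : d <= l / 2 /\ d <= 1 /\ d <= k by rewrite /d !ge_min !lexx ?orbT.
  exists d; split=> //; first by lra.
  move=> s /andP[s0 sd]; have sl : s < l by lra.
  have sI : 0 < s < l by rewrite s0.
  have as0 := a_gt0 sI; have asC := aC _ sI.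
  rewrite subr_ge0 ler_pdivlMr ?exprn_gt0//.
  have sk : s ^+ 2 <= k.
    by apply: le_trans d3; apply: (le_trans _ (ltW sd)); rewrite expr2 ler_piMr ?(ltW s0)//; lra.
  have : k * (C1 ^+ 2 * lambda0) = mm ^+ 2 by rewrite /k divfK// mulf_neq0 ?expf_neq0 ?gt_eqF.
  move=> <-; have h : a s ^+ 2 <= (C1 * s) ^+ 2 by rewrite ler_sqr ?nnegrE ?(ltW as0)// ltW// (lt_le_trans as0).
  rewrite exprMn in h; have h1 := ler_wpM2l (ltW lam0) h.
  have h2 : lambda0 * (C1 ^+ 2 * s ^+ 2) <= lambda0 * (C1 ^+ 2 * k).
    by rewrite !ler_wpM2l ?sqr_ge0 ?(ltW lam0).
  by apply: le_trans h1 (le_trans h2 _); apply: le_of_eq; ring.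
have sub (s : R) : 0 < s < d -> 0 < s < l by move=> /andP[-> /lt_trans]; exact.
pose D (s : R) := a s * (V s * V1 s).
have dD (s : R) : 0 < s < d -> isd D s (a s * (V1 s ^+ 2 + (mm ^+ 2 / a s ^+ 2 - lambda0) * V s ^+ 2)).
  move=> /sub sI; have as0 := a_gt0 sI.
  apply: isd_eqd (isdM (da sI) (isdM (dV sI) (dV1 sI))) _; rewrite ode//.
  by field; rewrite gt_eqF.
have D'0 (s : R) : 0 < s < d -> 0 <= a s * (V1 s ^+ 2 + (mm ^+ 2 / a s ^+ 2 - lambda0) * V s ^+ 2).
  move=> sI; apply: mulr_ge0; first exact/ltW/a_gt0/sub.
  by rewrite addr_ge0 ?sqr_ge0// mulr_ge0 ?sqr_ge0// hd.
have D0 (s : R) : 0 < s < d -> 0 <= D s.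
  (* A negative value of [D] at [s] would be an upper bound of [D] on the whole of [(0, s)], which
     is the behaviour excluded by [H]. *)
  move=> /andP[s0 sd]; rewrite leNgt; apply/negP => Ds.
  have sl : s < l by exact: lt_trans dl.
  apply: (H (- D s) s _ s0 sl); first by rewrite oppr_gt0.
  by move=> t /andP[t0 ts]; rewrite opprK; exact: isd_ndecr dD D'0 t0 (ltW ts) sd.
have mono (s t : R) : 0 < s -> s <= t -> t < d -> V s ^+ 2 <= V t ^+ 2.
  apply: (@isd_ndecr _ (fun s => V s ^+ 2) (fun s => 2 * V s * V1 s) 0 d).
    by move=> r /sub rI; exact: isd_sqr (dV rI).
  by move=> r rI; have := D0 r rI; rewrite /D pmulr_rge0 ?a_gt0 ?sub// -mulrA; lra.
exists d; first by rewrite d0.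
(* A zero of [V] would propagate to all of [(0, s]] by monotonicity of [V^2], against uniqueness for
   the radial equation. *)
split=> // s /andP[s0 sd]; apply/eqP => Vs.
have V0 (t : R) : 0 < t <= s -> V t = 0.
  move=> /andP[t0 ts]; have := mono t s t0 ts sd; rewrite Vs expr0n => h.
  by apply/eqP; rewrite -sqrf_eq0 eq_le h sqr_ge0.
have hI : 0 < s / 2 < l by lra.
have hV : V (s / 2) = 0 by apply: V0; lra.
have /eqP[] := profile_uniq hI hV.
suff h : isd V (s / 2) 0 by exact: isd_uniq (dV hI) h.
apply: (isd_near (f := fun _ : R => 0 : R)).
near=> t; rewrite V0//; have : 0 < t < s by near: t; apply: near_in; lra.
by move=> /andP[-> /ltW].
Unshelve. all: by end_near. Qed.

(** The last hypothesis excludes infinite Dirichlet energy at the pole. As [a <= C1 s], either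
    [a V V1 <= - c] or [V^2 >= e] near [0] would bound the energy density below by a multiple of
    [1 / s]; excluding the former gives monotonicity, excluding the latter the limit 0. *)
Lemma pole_end (C1 : R) : 0 < C1 -> (forI l s, a s <= C1 * s) ->
  (forall c d : R, 0 < c -> 0 < d -> d < l ->
    ~ (forI d s, c / s <= (V s / a s) ^+ 2 * a s + V1 s ^+ 2 * a s)) ->
  exists2 d : R, 0 < d < l & [/\ forI d s, V s != 0,
    forall s t : R, 0 < s -> s <= t -> t < d -> V s ^+ 2 <= V t ^+ 2 &
    forall e : R, 0 < e -> exists2 d' : R, 0 < d' < d & forall s : R, 0 < s < d' -> V s ^+ 2 <= e].
Proof.
move=> C10 aC H.
have div_a (c s : R) : 0 < c -> 0 < s < l -> c / C1 / s <= c / a s.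
  move=> c0 sI; rewrite -mulrA ler_wpM2l ?(ltW c0)// -invfM lef_pV2 ?posrE ?a_gt0//; first exact: aC.
  by rewrite mulr_gt0//; case/andP: sI.
have [|d dI [V0 mono]] := pole_monotone aC.
  move=> c d c0 d0 dl Hc; apply: (H (c / C1) d) => //; first exact: divr_gt0.
  move=> s /andP[s0 sd]; have sI : 0 < s < l by rewrite s0 (lt_trans sd).
  have as0 := a_gt0 sI; apply: le_trans (div_a c s c0 sI) _.
  rewrite ler_pdivrMr// mulrDl.
  have -> : (V s / a s) ^+ 2 * a s * a s = V s ^+ 2 by field; rewrite gt_eqF.
  have h : a s * (V s * V1 s) <= - c by apply: Hc; rewrite s0.
  have := sqr_ge0 (V s + V1 s * a s); have := sqr_ge0 (V s); have := sqr_ge0 (V1 s * a s).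
  by move: h; rewrite !exprMn; move: (V s) (V1 s) (a s) => v w b; nra.
exists d => //; split=> // e e0; apply: contrapT => Hn; have [d0 dl] := andP dI.
apply: (H (e / C1) d) => //; first exact: divr_gt0.
move=> s /andP[s0 sd]; have sI : 0 < s < l by rewrite s0 (lt_trans sd).
have as0 := a_gt0 sI; apply: le_trans (div_a e s e0 sI) _.
apply: (@le_trans _ _ ((V s / a s) ^+ 2 * a s)); last by rewrite lerDl mulr_ge0 ?sqr_ge0 ?(ltW as0).
rewrite ler_pdivrMr//.
have -> : (V s / a s) ^+ 2 * a s * a s = V s ^+ 2 by field; rewrite gt_eqF.
rewrite leNgt; apply/negP => Vs; apply: Hn; exists s; first by rewrite s0.
by move=> t /andP[t0 ts]; apply: le_trans (mono t s t0 (ltW ts) sd) (ltW Vs).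
Qed.

End Pole.

(** * Divergence of the integral of c / s at an end *)

Section NonIntegrable.
Context {R : realType} (l : R).
Notation mu := (@lebesgue_measure R).
Notation RT := (measurableTypeR R).

Lemma integrable_primitive_bound (g h H : R -> R) (p q : R) :
  intI l g -> (forI l s, 0 <= g s) ->
  0 < p -> p <= q -> q < l -> (forall s : R, p <= s <= q -> isd H s (h s)) ->
  (forall s : R, p <= s <= q -> {for s, continuous h}) ->
  (forall s : R, p <= s <= q -> h s <= g s) ->
  H q - H p <= RintI l g.
Proof.
move=> ig g0 p0 pq ql dH ch hg; have [ih <-] := isd_Rintegral pq dH ch.
have sub : `[p, q] `<=` `]0, l[.
  exact: segment_sub.
have mI : measurable (`[p, q] : set RT) by exact: measurable_itv.
have mJ : measurable (`]0, l[ : set RT) by exact: measurable_itv.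
have igI : mu.-integrable (`[p, q] : set RT) (EFin \o g) by exact: itv_integrableS ig.
apply: (@le_trans _ _ (Rintegral mu (`[p, q] : set RT) g)).
  by apply: le_Rintegral => // s /=; rewrite in_itv /=; exact: hg.
rewrite /Rintegral; apply: fine_le; try exact: integrable_fin_num.
apply: ge0_subset_integral => //; first exact: measurable_int ig.
Qed.

Lemma log_gap (c d M : R) : 0 < c -> 0 < d -> 0 <= M ->
  exists p q : R, [/\ 0 < p, p <= q, q < d & c * ln q - c * ln p = M + 1].
Proof.
move=> c0 d0 M0; have N0 : 0 < (M + 1) / c by rewrite divr_gt0// ltr_wpDl.
have q0 : 0 < d / 2 by rewrite divr_gt0.
exists (d / 2 * expR (- ((M + 1) / c))), (d / 2); split; first by rewrite mulr_gt0 ?expR_gt0.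
- by rewrite ler_piMr ?(ltW q0)// -[leRHS]expR0 ler_expR oppr_le0 ltW.
- lra.
rewrite [ln (_ * expR _)]lnM ?posrE ?expR_gt0// expRK mulrDr mulrN opprD opprK addrA subrr add0r mulrC divfK ?gt_eqF//.
Qed.

(** On a suitable [[p, q]] near [0] the primitive [c ln s] gains more than the total integral of
    [g]. *)
Lemma not_integrable_left (g : R -> R) (c d : R) :
  intI l g -> (forI l s, 0 <= g s) ->
  0 < c -> 0 < d -> d < l -> ~ (forI d s, c / s <= g s).
Proof.
move=> ig g0 c0 d0 dl H.
have M0 : 0 <= RintI l g by apply: Rintegral_ge0 => s /=; rewrite in_itv /=; exact: g0.
have [p [q [p0 pq qd E]]] := log_gap c0 d0 M0.
have s0 (s : R) : p <= s <= q -> 0 < s by move=> /andP[h _]; exact: lt_le_trans h.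
have := @integrable_primitive_bound g (fun s => c / s) (fun s => c * ln s) p q ig g0 p0 pq (lt_trans qd dl).
rewrite E => h; suff : RintI l g + 1 <= RintI l g by rewrite gerDl ler10.
apply: h => s sI; have ss := s0 s sI.
- exact: isdZ (is_derive1_ln ss).
- apply: continuousM; first exact: cvg_cst.
  by apply: continuousV; [rewrite gt_eqF|exact: cvg_id].
- by apply: H; rewrite ss; case/andP: sI => _ /le_lt_trans; exact.
Qed.

Lemma not_integrable_right (g : R -> R) (c d : R) :
  intI l g -> (forI l s, 0 <= g s) ->
  0 < c -> 0 < d -> d < l -> ~ (forI d s, c / s <= g (l - s)).
Proof.
move=> ig g0 c0 d0 dl H.
have M0 : 0 <= RintI l g by apply: Rintegral_ge0 => s /=; rewrite in_itv /=; exact: g0.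
have [p [q [p0 pq qd E]]] := log_gap c0 d0 M0.
have P1 : 0 < l - q by rewrite subr_gt0 (lt_trans qd).
have s0 (s : R) : l - q <= s <= l - p -> 0 < l - s by move=> /andP[h1 h2]; lra.
have := @integrable_primitive_bound g (fun s => c / (l - s)) (fun s => - (c * ln (l - s))) (l - q) (l - p)
  ig g0 P1 _ _.
rewrite !subKr opprK [- _ + _]addrC E => h; suff : RintI l g + 1 <= RintI l g by rewrite gerDl ler10.
apply: h; [by rewrite lerD2l lerN2|by rewrite ltrBlDr ltrDl|..] => s sI; have ss := s0 s sI.
- have dl' : isd (fun s => l - s) s (- 1) by apply: isd_eqd (isdB (isd_cst l s) (isd_id s)) _; rewrite sub0r.
  by apply: isd_eqd (isdN (isdZ c (isd_comp dl' (is_derive1_ln ss)))) _; rewrite mulrN1 mulrN opprK.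
- apply: continuousM; first exact: cvg_cst.
  apply: continuousV; first by rewrite gt_eqF.
  by apply: continuousB; [exact: cvg_cst|exact: cvg_id].
- have := H (l - s); rewrite subKr; apply; rewrite ss /=; case/andP: sI => h1 h2; lra.
Qed.

End NonIntegrable.

(** * Derivatives relative to a set and the surface profile *)

Section RelativeDerivatives.
Context {R : realType}.
Implicit Types (D : set R) (f : R -> R) (x y d e l : R).

Lemma diffq_in_eps D f x d : diffq_in D f x --> d -> forall e, 0 < e ->
  exists2 r : R, 0 < r & forall y, D y -> y != x -> `|x - y| < r -> `|d - (f y - f x) / (y - x)| <= e.
Proof.
move=> /cvgrPdist_le H e e0; have := H e e0.
move=> /nbhs_ballP[r r0 Hr]; exists r => // y Dy yx xy.
exact: Hr.
Qed.

Lemma deriv_in_cvg D f x : derivable_in D f -> D x -> diffq_in D f x --> deriv_in D f x.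
Proof. by move=> H /H. Qed.

Lemma derivable_in_continuous D f x : derivable_in D f -> D x -> forall e, 0 < e ->
  exists2 r : R, 0 < r & forall y, D y -> `|x - y| < r -> `|f x - f y| <= e.
Proof.
move=> dD Dx e e0; have [r r0 H] := diffq_in_eps (deriv_in_cvg dD Dx) ltr01.
set k := `|deriv_in D f x| + 1; have k0 : 0 < k by rewrite ltr_wpDl.
exists (Num.min r (e / k)); first by rewrite lt_min r0 divr_gt0.
move=> y Dy; rewrite lt_min => /andP[yr ye].
have [->|yx] := eqVneq y x; first by rewrite subrr normr0 ltW.
have := H y Dy yx yr; rewrite distrC => h.
have yx0 : y - x != 0 by rewrite subr_eq0.
have h2 : `|(f y - f x) / (y - x)| <= k.
  rewrite -[X in `|X|](subrK (deriv_in D f x)) addrC (le_trans (ler_normD _ _))// lerD2l//.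
rewrite distrC -[f y - f x](divfK yx0) normrM (distrC y x).
by rewrite ltr_pdivlMr// mulrC in ye; rewrite (le_trans _ (ltW ye))// ler_wpM2r.
Qed.

Lemma isd_deriv_in D f x : (\forall y \near x, D y) -> derivable_in D f -> isd f x (deriv_in D f x).
Proof.
move=> Dn dD; have Dx := nbhs_singleton Dn.
apply: isd_cvg; apply/cvgrPdist_le => e e0; have [r r0 H] := diffq_in_eps (deriv_in_cvg dD Dx) e0.
near=> h.
have h0 : h != 0 by near: h; exact: nbhs_dnbhs_neq.
have := H (x + h) _ _ _; rewrite addrAC subrr add0r mulrC; apply.
- near: h; apply: nbhs_dnbhs; have := Dn; rewrite -{1}[x]addr0 => Dn'.
  have c : {for 0, continuous (fun h : R => x + h)} by apply: continuousD; [exact: cvg_cst|exact: cvg_id].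
  exact: c.
- by rewrite -subr_eq0 addrAC subrr add0r.
- by rewrite opprD addNKr normrN; near: h; exact: dnbhs0_lt.
Unshelve. all: by end_near. Qed.

End RelativeDerivatives.

(* At each end of [0, l] the profile either vanishes like the distance to that
   end or stays positive. *)
Record profile {R : realType} (l : R) (a : R -> R) : Prop := Profile {
  pf_l : 0 < l;
  pf_gt0 : forI l s, 0 < a s;
  pf_isd : forI l s, isd a s (derive1 a s);
  pf_cont1 : forI l s, {for s, continuous (derive1 a)};
  pf_bd1 : forI l s, `|derive1 a s| <= 1;
  pf_pole0 : (forI l s, a s <= 3 * s) /\
    exists2 d : R, 0 < d < l & forI d s, s / 2 <= a s;
  pf_pole1 : a l = 0 -> (forI l s, a s <= 3 * (l - s)) /\
    exists2 d : R, 0 < d < l & forI d s, s / 2 <= a (l - s);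
  pf_boundary : a l != 0 -> 0 < a l /\ exists2 d : R, 0 < d < l &
    forI d s, a l / 2 <= a (l - s) <= 2 * a l }.

(** Derivatives relative to [[0, ss]] are ordinary derivatives inside. At a pole the value 1 or -1
    of the derivative gives the lower bound [s / 2], and arc length gives [|a'| <= 1], hence the
    linear upper bound. *)
Lemma surface_profile (R : realType) (nu ss : R) (a atil : R -> R) :
  surface_of_revolution nu ss a atil -> profile ss a.
Proof.
move=> [_ l0 [da dda _] _ arc _ a0 apos d0 d1].
pose D := [set` `[0, ss]%R].
have near_I (s : R) : 0 < s < ss -> \forall y \near s, D y.
  move=> sI; near=> y; rewrite /D /= in_itv /=.
  have /andP[? ?] : 0 < y < ss by near: y; exact: near_in.
  by rewrite !ltW.
have D0 : D (0 : R) by rewrite /D /= in_itv /= lexx ltW.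
have D1 : D ss by rewrite /D /= in_itv /= lexx ltW.
have DI (s : R) : 0 < s < ss -> D s by move=> /andP[? ?]; rewrite /D /= in_itv /= !ltW.
have isda (s : R) : 0 < s < ss -> isd a s (deriv_in D a s).
  by move=> sI; apply: isd_deriv_in => //; exact: near_I.
have E (s : R) : 0 < s < ss -> derive1 a s = deriv_in D a s.
  by move=> sI; rewrite derive1E; apply: derive_val; exact: isda.
have isda' (s : R) : 0 < s < ss -> isd a s (derive1 a s) by move=> sI; rewrite E//; exact: isda.
have bd1 (s : R) : 0 < s < ss -> `|derive1 a s| <= 1.
  move=> sI; rewrite E//; have := arc s; move: (DI s sI); rewrite /D /= in_itv /= => -> /(_ isT) h.
  have := sqr_ge0 (deriv_in D atil s) => h'.
  have : `|deriv_in D a s| ^+ 2 <= 1 by rewrite real_normK ?num_real//; lra.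
  by rewrite expr_le1.
clear arc.
have lip (s t : R) : 0 < s < ss -> 0 < t < ss -> `|a s - a t| <= `|s - t|.
  by move=> sI tI; have := isd_lip isda' bd1 sI tI; rewrite mul1r.
(* The Lipschitz bound is available only between interior points, so the end [z] is replaced by an
   interior point [t] with [|a t| <= |s - z|]; the constant 3 leaves slack. *)
have upper (z : R) : z = 0 \/ z = ss -> a z = 0 -> (forI ss s, a s <= 3 * `|s - z|).
  move=> zI az s sI; have Dz : D z by case: zI => ->.
  have r0 : 0 < `|s - z|.
    by rewrite normr_gt0 subr_eq0; case/andP: sI => h1 h2; case: zI => ->; [rewrite gt_eqF|rewrite lt_eqF].
  have [r rr H] := derivable_in_continuous da Dz r0.
  have [t tI [tr ts]] : exists2 t : R, 0 < t < ss & `|z - t| < r /\ `|s - t| <= `|s - z|.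
    case/andP: sI => h1 h2; pose k := Num.min s (ss - s); have k0 : 0 < k by rewrite lt_min h1 subr_gt0.
    have [k1 k2] : k <= s /\ k <= ss - s by rewrite !ge_min !lexx orbT.
    pose e := Num.min (r / 2) (k / 2); have e0 : 0 < e by rewrite lt_min !divr_gt0.
    have [e1 e2] : e <= r / 2 /\ e <= k / 2 by rewrite !ge_min !lexx orbT.
    have er : e < r by lra. have ek : e < k by lra.
    case: zI => ->.
      exists e; first by lra.
      by split; [rewrite sub0r normrN gtr0_norm|rewrite subr0 (gtr0_norm h1) ger0_norm; lra].
    exists (ss - e); first by lra.
    split; first by rewrite subKr gtr0_norm.
    by rewrite (ltr0_norm (x := s - ss)) ?subr_lt0// ler0_norm; lra.
  have h1 := H t (DI t tI) tr; rewrite az sub0r normrN in h1.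
  have h2 := lip s t sI tI; have h3 := ler_norm (a s - a t); have h4 := ler_norm (a t); lra.
have cda (s : R) : 0 < s < ss -> {for s, continuous (derive1 a)}.
  move=> sI; apply: (@cont_near _ (deriv_in D a)).
    by near=> y; rewrite E//; near: y; exact: near_in.
  exact: isd_cont (isd_deriv_in (near_I s sI) dda).
have small r (Pr : R -> Prop) : 0 < r -> (forall s : R, 0 < s -> s < r -> s < ss / 2 -> Pr s) ->
    exists2 d : R, 0 < d < ss & forI d s, Pr s.
  move=> r0 H; exists (Num.min r (ss / 2)); first by rewrite lt_min r0 divr_gt0//= gt_min; apply/orP; right; lra.
  by move=> s /andP[s0]; rewrite lt_min => /andP[]; exact: H.
split=> //.
- split; first by move=> s sI; have := upper 0 (or_introl erefl) a0 s sI; rewrite subr0 gtr0_norm//; case/andP: sI.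
  have h0 : 0 < 1 / 2 :> R by lra.
  have [r r0 H] := diffq_in_eps (deriv_in_cvg da D0) h0.
  apply: (small _ _ r0) => s s0 sr sl.
  have := H s; rewrite d0 a0 !subr0 sub0r normrN gtr0_norm// gt_eqF//.
  move=> /(_ (DI s _) isT sr) h; have {}h : `|1 - a s / s| <= 1 / 2 by apply: h; lra.
  have : 1 / 2 <= a s / s by move/ler_normlP: h => [_ h]; lra.
  by rewrite ler_pdivlMr// mulrC mulrA mulr1.
- move=> al; split.
    move=> s sI; have := upper ss (or_intror erefl) al s sI.
    by rewrite distrC gtr0_norm// subr_gt0; case/andP: sI.
  have h0 : 0 < 1 / 2 :> R by lra.
  have [r r0 H] := diffq_in_eps (deriv_in_cvg da D1) h0.
  apply: (small _ _ r0) => s s0 sr sl.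
  have := H (ss - s); rewrite d1// al subr0 subKr (gtr0_norm s0).
  move=> /(_ (DI _ _) _ sr) h; have {}h : `|-1 - a (ss - s) / (ss - s - ss)| <= 1 / 2.
    by apply: h; [lra|rewrite lt_eqF// ltrBlDr ltrDl].
  have E2 : ss - s - ss = - s by ring.
  rewrite E2 invrN mulrN opprK in h.
  have : 1 / 2 <= a (ss - s) / s by move/ler_normlP: h => [h _]; lra.
  by rewrite ler_pdivlMr// mulrC mulrA mulr1.
- move=> al0.
  have al : 0 < a ss.
    rewrite lt_neqAle eq_sym al0 leNgt; apply/negP => aln.
    have e0 : 0 < - a ss / 2 by lra.
    have [r r0 H] := derivable_in_continuous da D1 e0.
    pose e := Num.min (r / 2) (ss / 2); have ep : 0 < e by rewrite lt_min !divr_gt0.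
    have [e1 e2] : e <= r / 2 /\ e <= ss / 2 by rewrite !ge_min !lexx orbT.
    have eI : 0 < ss - e < ss by lra.
    have := H (ss - e) (DI _ eI); rewrite subKr gtr0_norm// => h.
    have {}h : `|a ss - a (ss - e)| <= - a ss / 2 by apply: h; lra.
    have := apos _ eI; move/ler_normlP: h => [h _]; lra.
  split=> //; have e0 : 0 < a ss / 2 by lra.
  have [r r0 H] := derivable_in_continuous da D1 e0.
  apply: (small _ _ r0) => s s0 sr sl.
  have := H (ss - s); rewrite subKr gtr0_norm// => h.
  have {}h : `|a ss - a (ss - s)| <= a ss / 2 by apply: h => //; apply: DI; lra.
  move/ler_normlP: h => [h h']; lra.
Unshelve. all: by end_near. Qed.

(** * One-sided limits at the right end *)

Section EndLimits.
Context {R : realType} (l : R).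

(** [f s + M s] is nondecreasing and bounded, so its supremum is its limit at [l]. *)
Lemma lip_limit (f : R -> R) (M p : R) : p < l -> 0 <= M ->
  (forall s t : R, p < s < l -> p < t < l -> `|f s - f t| <= M * `|s - t|) ->
  exists L : R, forall s : R, p < s < l -> `|f s - L| <= M * (l - s).
Proof.
move=> pl M0 lip; pose E := [set f s + M * s | s in [set s | p < s < l]].
have ub s : p < s < l -> ubound E (f s + M * (2 * l - s)).
  move=> sI _ [t tI <-]; have := lip t s tI sI; case/andP: (sI) => h1 h2; case/andP: (tI) => h3 h4.
  have [st|ts] := leP s t.
    by rewrite [`|t - s|]ger0_norm ?subr_ge0// => /ler_normlP[_ h]; nra.
  by rewrite [`|t - s|]ltr0_norm ?subr_lt0// => /ler_normlP[_ h]; nra.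
have hI : p < (p + l) / 2 < l by lra.
have hs : has_sup E.
  split; first by exists (f ((p + l) / 2) + M * ((p + l) / 2)); exists ((p + l) / 2).
  by exists (f ((p + l) / 2) + M * (2 * l - (p + l) / 2)); exact: ub.
exists (sup E - M * l) => s sI.
have h1 : f s + M * s <= sup E by apply: sup_upper_bound => //; exists s.
have h2 : sup E <= f s + M * (2 * l - s) by apply: ge_sup; [case: hs|exact: ub].
by rewrite ler_norml; apply/andP; split; lra.
Qed.

(** The fundamental theorem of calculus with the right end value known only as a limit, which is how
    boundary values enter the weak formulations. *)
Lemma prim_end (H h : R -> R) (HL : R) : 0 < l -> bdcont l h -> derivI l H h ->
  (exists2 c : R, 0 < c < l & forI c s, H s = 0) ->
  (forall e : R, 0 < e -> exists2 d : R, 0 < d < l & forI d s, `|H (l - s) - HL| <= e) ->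
  RintI l h = HL.
Proof.
move=> l0 bh dH [c /andP[c0 cl] H0] HE; rewrite -prim_total.
have [K K0 HK] := bdcont_bound bh.
have lip s t := @prim_lip _ _ h K s t bh (ltW K0) HK.
have k0 (s : R) : 0 < s < l -> H s = prim l h s.
  move=> sI; apply/eqP; rewrite -subr_eq0 -normr_eq0 eq_le normr_ge0 andbT; apply/ler_addgt0Pr => e e0.
  pose t := Num.min (c / 2) (e / K); have t0 : 0 < t by rewrite lt_min !divr_gt0.
  have [t1 t2] : t <= c / 2 /\ t <= e / K by rewrite !ge_min !lexx orbT.
  have tc : t < c by lra.
  have tI : 0 < t < l by rewrite t0 (lt_trans tc).
  have -> : H s - prim l h s = H t - prim l h t.
    apply: (@isd_const _ (fun s => H s - prim l h s) 0 l) => // r rI.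
    by apply: isd_eqd (isdB (dH r rI) (isd_prim bh rI)) (subrr _).
  rewrite H0 ?t0// sub0r normrN add0r.
  have := lip t 0 (ltW t0) (lexx 0); rewrite (prim_le0 _ _ (lexx 0)) !subr0 (gtr0_norm t0) => h1.
  by apply: le_trans h1 _; rewrite -ler_pdivlMl// mulrC.
apply/eqP; rewrite -subr_eq0 -normr_eq0 eq_le normr_ge0 andbT; apply/ler_addgt0Pr => e e0; rewrite add0r.
have e20 : 0 < e / 2 by rewrite divr_gt0.
have [d /andP[d0 dl] Hd] := HE _ e20.
pose t := Num.min (d / 2) (e / 2 / K); have t0 : 0 < t by rewrite lt_min !divr_gt0.
have [t1 t2] : t <= d / 2 /\ t <= e / 2 / K by rewrite !ge_min !lexx orbT.
have td : 0 < t < d by lra.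
have tI : 0 < l - t < l by lra.
have h1 := Hd t td; rewrite (k0 _ tI) in h1.
rewrite -(subrK (prim l h (l - t)) (prim l h l)) -addrA (le_trans (ler_normD _ _))//.
rewrite [e]splitr lerD//.
case/andP: tI => /ltW h2 _; have := lip l (l - t) (ltW l0) h2; rewrite subKr (gtr0_norm t0) => h3.
by apply: le_trans h3 _; rewrite -ler_pdivlMl// mulrC.
Qed.

Lemma bdcont_continuous (f : R -> R) : 0 < l -> continuous f -> bdcont l f.
Proof.
move=> l0 cf; split=> [s _|]; first exact: cf.
have cw : {within `[0, l], continuous (fun s => `|f s|)}.
  by apply: continuous_subspaceT => s; apply: cvg_norm; exact: cf.
have [c _ Hc] := EVT_max (ltW l0) cw; exists `|f c| => s /andP[s0 sl].
by apply: Hc; rewrite in_itv /= !ltW.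
Qed.

(** A C^1 test function that is supported away from the pole but does not vanish at [l], so that it
    detects the boundary condition. *)
Lemma boundary_bump (c : R) : 0 < c -> c < l -> exists X X' : R -> R,
  [/\ forall s : R, isd X s (X' s), forall s : R, {for s, continuous X'},
      forall s : R, ~~ (c <= s <= l + 1) -> X s = 0 /\ X' s = 0 & 0 < X l].
Proof.
move=> c0 cl; pose u (s : R) := Num.min (c - s) 0; pose w (s : R) := Num.min (s - (l + 1)) 0.
have cu (s : R) : {for s, continuous u}.
  by apply: continuous_min; [apply: continuousB; [exact: cvg_cst|exact: cvg_id]|exact: cvg_cst].
have cw (s : R) : {for s, continuous w}.
  by apply: continuous_min; [apply: continuousB; [exact: cvg_id|exact: cvg_cst]|exact: cvg_cst].
exists (fun s => npsq (c - s) * npsq (s - (l + 1))),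
  (fun s => 2 * u s * npsq (s - (l + 1)) + npsq (c - s) * (- 2 * w s)).
have d1 (s : R) : isd (fun s => npsq (c - s)) s (2 * u s).
  have h : isd (fun s => c - s) s (- 1) by apply: isd_eqd (isdB (isd_cst c s) (isd_id s)) _; rewrite sub0r.
  by apply: isd_eqd (isd_comp h (isd_npsq _)) _; rewrite /u; ring.
have d2 (s : R) : isd (fun s => npsq (s - (l + 1))) s (- 2 * w s).
  have h : isd (fun s => s - (l + 1)) s 1 by apply: isd_eqd (isdB (isd_id s) (isd_cst _ s)) _; rewrite subr0.
  by apply: isd_eqd (isd_comp h (isd_npsq _)) _; rewrite /w mulr1.
split.
- by move=> s; exact: isdM (d1 s) (d2 s).
- move=> s; have e1 := isd_cont (d1 s); have e2 := isd_cont (d2 s).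
  apply: continuousD; apply: continuousM => //; apply: continuousM; try exact: cvg_cst; [exact: cu|exact: cw].
- move=> s; rewrite negb_and -!ltNge => /orP[sc|ls].
    have h : 0 <= c - s by rewrite subr_ge0 ltW.
    by rewrite npsq_ge0// /u (min_idPr h) !mul0r mulr0 !mul0r add0r.
  have h : 0 <= s - (l + 1) by rewrite subr_ge0 ltW.
  by rewrite (npsq_ge0 h) /w (min_idPr h) !mulr0 addr0.
- by rewrite nmulr_rgt0 npsq_lt0//; lra.
Qed.

End EndLimits.

(** * End behaviour of the eigenprofile *)

Section EndBehaviour.
Context {R : realType} (l : R) (a : R -> R) (m : nat) (lambda0 alpha1 alpha2 : R) (V V1 V2 : R -> R).
Notation mu := (@lebesgue_measure R).
Notation RT := (measurableTypeR R).
Hypotheses (P : profile l a) (m0 : (0 < m)%N) (lam0 : 0 < lambda0).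
Hypotheses (al1 : 0 <= alpha1) (al2 : 0 <= alpha2) (al12 : ~ (alpha1 = 0 /\ alpha2 = 0)).
Hypothesis EP : eigenprofile l a m lambda0 alpha1 alpha2 V V1 V2.
Hypothesis V_neq0 : exists2 s : R, 0 < s < l & V s != 0.

Definition vanishing_end (f : R -> R) := forall e : R, 0 < e ->
  exists2 d : R, 0 < d < l & forI d s, f s ^+ 2 <= e.

Definition nonzero_end (f : R -> R) := exists2 d : R, 0 < d < l & forI d s, f s != 0.

Lemma refl_itv (s : R) : 0 < s < l -> 0 < l - s < l.
Proof. by move=> /andP[? ?]; lra. Qed.

Lemma isd_refl (f : R -> R) (s d : R) : isd f (l - s) d -> isd (fun t => f (l - t)) s (- d).
Proof.
move=> H; have dl : isd (fun t => l - t) s (- 1).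
  by apply: isd_eqd (isdB (isd_cst l s) (isd_id s)) _; rewrite sub0r.
by apply: isd_eqd (isd_comp dl H) _; rewrite mulrN1.
Qed.

Lemma cont_refl (f : R -> R) (s : R) : {for l - s, continuous f} -> {for s, continuous (fun t => f (l - t))}.
Proof.
move=> cf; apply: (@continuous_comp _ _ _ (fun s => l - s) f); last exact: cf.
by apply: continuousB; [exact: cvg_cst|exact: cvg_id].
Qed.

Let iF := @rintegrableD R _ RT mu _ _ _ (measurable_I l) (ep_L2_a EP) (ep_L2_1 EP).
Let g0 (s : R) : 0 < s < l -> 0 <= (V s / a s) ^+ 2 * a s + V1 s ^+ 2 * a s.
Proof. by move=> sI; rewrite addr_ge0// mulr_ge0 ?sqr_ge0// ltW// (pf_gt0 P). Qed.

Lemma monoend_sqr (f : R -> R) d : 0 < d ->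
  (forall s t : R, 0 < s -> s <= t -> t < d -> f s ^+ 2 <= f t ^+ 2) -> monoend (fun s => f s ^+ 2).
Proof. by move=> d0 H; exists d, 1; split=> // s t *; rewrite mul1r; exact: H. Qed.

Lemma profile_end0 : [/\ nonzero_end V, monoend (fun s => V s ^+ 2) & vanishing_end V].
Proof.
have mm0 : (0 : R) < m%:R by rewrite ltr0n.
have [d dI [H1 H2 H3]] := pole_end (pf_l P) mm0 lam0 (pf_gt0 P) (pf_isd P) (pf_cont1 P) (ep_d1 EP) (ep_d2 EP)
  (ep_ode EP) V_neq0 (ltr0Sn R 2) (proj1 (pf_pole0 P)) (fun c d => not_integrable_left iF g0).
have [d0 dl] := andP dI; split; [by exists d|exact: monoend_sqr d0 H2|].
by move=> e /H3[d' /andP[p q] H]; exists d' => //; rewrite p (lt_trans q dl).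
Qed.

Lemma profile_end1_pole : a l = 0 -> [/\ nonzero_end (fun s => V (l - s)),
  monoend (fun s => V (l - s) ^+ 2) & vanishing_end (fun s => V (l - s))].
Proof.
move=> al0; have mm0 : (0 : R) < m%:R by rewrite ltr0n.
have Vn : exists2 s : R, 0 < s < l & V (l - s) != 0.
  by have [s sI Vs] := V_neq0; exists (l - s); [exact: refl_itv|rewrite subKr].
have aC (s : R) : 0 < s < l -> a (l - s) <= 3 * s.
  by move=> /refl_itv sI; have := proj1 (pf_pole1 P al0) _ sI; rewrite subKr.
have ode' (s : R) : 0 < s < l -> V2 (l - s) =
    - (- derive1 a (l - s) / a (l - s)) * - V1 (l - s) + (m%:R ^+ 2 / a (l - s) ^+ 2 - lambda0) * V (l - s).
  by move=> sI; rewrite (ep_ode EP (refl_itv sI)); ring.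
have ni (c d : R) : 0 < c -> 0 < d -> d < l -> ~ (forI d s, c / s <= (V (l - s) / a (l - s)) ^+ 2 * a (l - s) + (- V1 (l - s)) ^+ 2 * a (l - s)).
  move=> c0 d0 dl H; apply: (not_integrable_right iF g0 c0 d0 dl) => s sI.
  by apply: le_trans (H s sI) _; rewrite sqrrN.
have [d dI [H1 H2 H3]] := @pole_end R l m%:R lambda0 (fun s => a (l - s)) (fun s => - derive1 a (l - s))
  (fun s => V (l - s)) (fun s => - V1 (l - s)) (fun s => V2 (l - s)) (pf_l P) mm0 lam0
  (fun s sI => pf_gt0 P (refl_itv sI)) (fun s sI => isd_refl (pf_isd P (refl_itv sI)))
  (fun s sI => continuousN (cont_refl (pf_cont1 P (refl_itv sI))))
  (fun s sI => isd_refl (ep_d1 EP (refl_itv sI)))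
  (fun s sI => isd_eqd (isdN (isd_refl (ep_d2 EP (refl_itv sI)))) (opprK _)) ode' Vn 3 (ltr0Sn R 2) aC ni.
have [d0 dl] := andP dI; split; [by exists d|exact: (@monoend_sqr (fun s => V (l - s))) d0 H2|].
by move=> e /H3[d' /andP[p q] H]; exists d' => //; rewrite p (lt_trans q dl).
Qed.
Lemma profile_lower_bound : a l != 0 -> forall c : R, 0 < c ->
  exists2 k : R, 0 < k & forI l s, c <= s -> k <= a s.
Proof.
move=> al c c0; have [al0 [d /andP[d0 dl] H]] := pf_boundary P al.
have ca : contI l a := derivI_cont (pf_isd P).
have ql : l - d / 2 < l by lra.
have [k k0 Hk] := cont_lower_bound ca (pf_gt0 P) c0 ql.
exists (Num.min k (a l / 2)); first by rewrite lt_min k0 divr_gt0.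
move=> s /andP[s0 sl] cs; rewrite ge_min; have [h|h] := leP s (l - d / 2).
  by rewrite Hk// cs.
have := H (l - s); rewrite subKr => /(_ _)/andP; case; [lra|by move=> -> _; rewrite orbT].
Qed.

Lemma profile_cont2 (s : R) : 0 < s < l -> {for s, continuous V2}.
Proof.
move=> sI; have as0 := pf_gt0 P sI; have ca : {for s, continuous a} by exact: isd_cont (pf_isd P sI).
have cVa : {for s, continuous (fun s => (a s)^-1)} by apply: continuousV => //; rewrite gt_eqF.
apply: (@cont_near _ (fun s => - (derive1 a s / a s) * V1 s + (m%:R ^+ 2 * ((a s)^-1 * (a s)^-1) - lambda0) * V s)).
  near=> t; rewrite (ep_ode EP); first by rewrite -invfM -expr2.
  by near: t; exact: near_in.
apply: continuousD; apply: continuousM; try exact: isd_cont (ep_d2 EP sI); try exact: isd_cont (ep_d1 EP sI).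
  by apply: continuousN; apply: continuousM => //; exact: (pf_cont1 P sI).
apply: continuousB; last exact: cvg_cst.
by apply: continuousM; [exact: cvg_cst|apply: continuousM].
Unshelve. all: by end_near. Qed.

(** The one-sided limits [VL] and [V1L] at [l] are recorded with a linear rate because the profile
    lives on the open interval only. *)
Definition boundary_data (VL V1L M d : R) := [/\ 0 < d < l,
  forI d s, [/\ `|V (l - s)| <= M, `|V1 (l - s)| <= M & `|V2 (l - s)| <= M],
  forI d s, `|V (l - s) - VL| <= M * s /\ `|V1 (l - s) - V1L| <= M * s,
  alpha1 * VL + alpha2 * V1L = 0 & VL != 0 \/ V1L != 0].

(** Near a boundary the coefficients are bounded, so Gronwall bounds [(V, V1)] up to [l] and makes
    both Lipschitz. The weak Robin condition, tested with a bump that has [X l > 0], becomes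
    [(alpha1 VL + alpha2 V1L) X l = 0]. Gronwall run backwards from [l] shows that the Cauchy data
    cannot both vanish. *)
Lemma boundary_data_exists : a l != 0 -> exists VL V1L M d, boundary_data VL V1L M d.
Proof.
move=> al; have [al0 [d /andP[d0 dl] H]] := pf_boundary P al; have l0 := pf_l P.
have lm0 := lam0.
pose p := l - d; have pl : p < l by rewrite /p ltrBlDr ltrDl.
have p0 : 0 < p by rewrite subr_gt0.
have sub (s : R) : p < s < l -> 0 < s < l by move=> /andP[h1 ->]; rewrite (lt_trans p0 h1).
have aI (s : R) : p < s < l -> a l / 2 <= a s <= 2 * a l.
  by move=> /andP[h1 h2]; have := H (l - s); rewrite subKr; apply; rewrite /p in h1; lra.
pose k := (a l / 2)^-1; have k0 : 0 < k by rewrite invr_gt0 divr_gt0.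
have aV (s : R) : p < s < l -> 0 <= (a s)^-1 <= k.
  move=> sI; have /andP[h1 _] := aI s sI; have as0 : 0 < a s by apply: lt_le_trans h1; rewrite divr_gt0.
  by rewrite invr_ge0 (ltW as0) /= lef_pV2 ?posrE ?divr_gt0.
pose B := 1 + k + (m%:R ^+ 2 * k ^+ 2 + lambda0).
have mk : 0 <= m%:R ^+ 2 * k ^+ 2 by rewrite mulr_ge0 ?sqr_ge0.
have [B01 B02 B03 B04] : [/\ 0 <= B, 1 <= B, m%:R ^+ 2 * k ^+ 2 + lambda0 <= B & k <= B].
  by rewrite /B; move: (m%:R ^+ 2 * k ^+ 2) mk => w w0; split; lra.
have B1 (s : R) : p < s < l -> `|- (derive1 a s / a s)| <= k.
  move=> sI; have /andP[h1 h2] := aV s sI; rewrite normrN normrM (ger0_norm h1).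
  by rewrite -[k]mul1r ler_pM// (pf_bd1 P)// sub.
have B2 (s : R) : p < s < l -> `|m%:R ^+ 2 / a s ^+ 2 - lambda0| <= m%:R ^+ 2 * k ^+ 2 + lambda0.
  move=> sI; have /andP[h1 h2] := aV s sI; rewrite (le_trans (ler_normB _ _))// (gtr0_norm lam0) lerD2r.
  by rewrite -exprVn -exprMn ger0_norm ?sqr_ge0// exprMn ler_wpM2l ?sqr_ge0// ler_sqr ?nnegrE// ltW.
have gr := @lin2_gronwall R V V1 (fun=> 0) (fun=> 1) (fun s => m%:R ^+ 2 / a s ^+ 2 - lambda0)
  (fun s => - (derive1 a s / a s)) B p l.
have {}gr (s t : R) : p < s < l -> p < t < l ->
    V t ^+ 2 + V1 t ^+ 2 <= (V s ^+ 2 + V1 s ^+ 2) * expR (4 * B * l).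
  move=> sI tI; apply: le_trans (gr _ _ _ s t sI tI) _.
  - by move=> r rI; rewrite mul0r mul1r add0r; exact: (ep_d1 EP (sub r rI)).
  - by move=> r rI; rewrite addrC mulNr -mulNr -(ep_ode EP (sub r rI)); exact: (ep_d2 EP (sub r rI)).
  - move=> r rI; have b1 := B1 r rI; have b2 := B2 r rI; rewrite normr0 normr1; split=> //.
    + exact: le_trans b2 _.
    + exact: le_trans b1 _.
  rewrite ler_wpM2l ?addr_ge0 ?sqr_ge0// ler_expR ler_wpM2l ?mulr_ge0//.
  case/andP: sI => h1 h2; case/andP: tI => h3 h4; rewrite ler_norml; lra.
pose K := expR (4 * B * l); have K0 : 0 < K by exact: expR_gt0.
have hI : p < (p + l) / 2 < l by lra.
set h := (p + l) / 2 in hI; pose N0 := V h ^+ 2 + V1 h ^+ 2.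
have N00 : 0 < N0.
  rewrite /N0 lt_neqAle addr_ge0 ?sqr_ge0// andbT eq_sym paddr_eq0 ?sqr_ge0// !sqrf_eq0.
  apply/negP => /andP[/eqP v /eqP v1]; have /eqP := v1; apply/negP.
  exact: (profile_uniq (pf_gt0 P) (pf_isd P) (pf_cont1 P) (ep_d1 EP) (ep_d2 EP) (ep_ode EP) V_neq0 (sub _ hI) v).
pose M1 := 1 + N0 * K.
have N0K : 0 <= N0 * K by rewrite ltW// mulr_gt0.
have sq1 (x y : R) : x ^+ 2 + y ^+ 2 <= N0 * K -> `|x| <= M1.
  by move=> xy; apply: le_trans (normr_le1sqr x) _; rewrite lerD2l; have := sqr_ge0 y; lra.
have bV (s : R) : p < s < l -> `|V s| <= M1 by move=> sI; apply: (sq1 _ (V1 s)); exact: gr.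
have bV1 (s : R) : p < s < l -> `|V1 s| <= M1 by move=> sI; apply: (sq1 _ (V s)); rewrite addrC; exact: gr.
have M10 : 0 <= M1 by rewrite /M1 addr_ge0.
pose M := B * M1.
have M1M : M1 <= M by rewrite /M ler_peMl.
have bV2 (s : R) : p < s < l -> `|V2 s| <= M.
  move=> sI; rewrite (ep_ode EP (sub s sI)) (le_trans (ler_normD _ _))// !normrM.
  apply: (@le_trans _ _ (k * M1 + (m%:R ^+ 2 * k ^+ 2 + lambda0) * M1)).
    by apply: lerD; apply: ler_pM => //; [exact: B1|exact: bV1|exact: B2|exact: bV].
  by rewrite -mulrDl ler_wpM2r// /B; lra.
have M0 : 0 <= M by exact: le_trans M1M.
have [VL HVL] := lip_limit pl M0 (fun s t sI tI => isd_lip (fun r rI => ep_d1 EP (sub r rI))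
  (fun r rI => le_trans (bV1 r rI) M1M) sI tI).
have [V1L HV1L] := lip_limit pl M0 (fun s t sI tI => isd_lip (fun r rI => ep_d2 EP (sub r rI)) bV2 sI tI).
have toI (s : R) : 0 < s < d -> p < l - s < l by rewrite /p => /andP[? ?]; lra.
exists VL, V1L, M, d; split; first by rewrite d0.
- by move=> s /toI sI; split; [exact: le_trans (bV _ sI) M1M|exact: le_trans (bV1 _ sI) M1M|exact: bV2].
- by move=> s /toI sI; have := HVL _ sI; have := HV1L _ sI; rewrite subKr.
- have [X [X' [dX cX' X0 Xl]]] := boundary_bump (lt_trans p0 (proj1 (andP hI))) (proj2 (andP hI)).
  have h0 : 0 < h by exact: lt_trans p0 (proj1 (andP hI)).
  have cX (s : R) : {for s, continuous X} by exact: isd_cont (dX s).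
  have bX := bdcont_continuous l0 cX; have bX' := bdcont_continuous l0 cX'.
  have [_ _] := ep_robin EP al (profile_lower_bound al) h0 dX cX' X0.
  have end_int (f g : R -> R) (L : R) : derivI l f g ->
      contI l g ->
      (forall s : R, p < s < l -> `|f s| <= M) -> (forall s : R, p < s < l -> `|g s| <= M) ->
      (forall s : R, p < s < l -> `|f s - L| <= M * (l - s)) ->
      RintI l (fun s => f s * X' s + g s * X s) = L * X l.
    move=> df cg bf bg fL; apply: (@prim_end _ l (fun s => f s * X s)) => //.
    + split.
        move=> s sI; apply: continuousD; apply: continuousM; [exact: isd_cont (df s sI)|exact: cX'|exact: cg|exact: cX].
      have [K1 K10 HK1] := bdcont_bound bX; have [K2 K20 HK2] := bdcont_bound bX'.
      exists (M * K2 + M * K1) => s sI; have [hs|sh] := leP h s.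
        have sI' : p < s < l by case/andP: sI => _ ->; rewrite (lt_le_trans (proj1 (andP hI)) hs).
        rewrite (le_trans (ler_normD _ _))// !normrM lerD// ler_pM//; [exact: bf|exact: HK2|exact: bg|exact: HK1].
      have [-> ->] : X s = 0 /\ X' s = 0 by apply: X0; rewrite leNgt sh.
      by rewrite !mulr0 addr0 normr0 addr_ge0// mulr_ge0// ltW.
    + by move=> s sI; apply: isd_eqd (isdM (df s sI) (dX s)) _; rewrite addrC [g s * _]mulrC [X s * _]mulrC.
    + exists h; first by rewrite h0; case/andP: hI.
      by move=> s /andP[s0 sh]; have [-> _] : X s = 0 /\ X' s = 0; [by apply: X0; rewrite leNgt sh|rewrite mulr0].
    + move=> e e0.
      have e20 : 0 < e / 2 by rewrite divr_gt0.
      pose k1 := `|L| + 1; have k10 : 0 < k1 by rewrite ltr_wpDl.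
      have [K1 K10 HK1] := bdcont_bound bX.
      have /cvgrPdist_le/(_ _ (divr_gt0 e20 k10)) /nbhs_ballP[r r0 Hr] := cX l.
      pose q := Num.min (Num.min d (r / 2)) (e / 2 / (M * K1 + 1)).
      have MK : 0 < M * K1 + 1 by rewrite ltr_wpDl// mulr_ge0// ltW.
      have q0 : 0 < q by rewrite !lt_min d0 !divr_gt0.
      have [q1 [q2 q3]] : q <= d /\ q <= r / 2 /\ q <= e / 2 / (M * K1 + 1) by rewrite /q !ge_min !lexx ?orbT.
      exists q; first by rewrite q0 (le_lt_trans q1 dl).
      move=> s /andP[s0 sq]; have sd : 0 < s < d by rewrite s0 (lt_le_trans sq q1).
      have sI := toI s sd.
      have -> : f (l - s) * X (l - s) - L * X l = (f (l - s) - L) * X (l - s) - L * (X l - X (l - s)) by ring.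
      rewrite (le_trans (ler_normB _ _))// [e]splitr lerD// normrM.
        have h1 := fL _ sI; rewrite subKr in h1; apply: le_trans (ler_pM _ _ h1 (HK1 _ (sub _ sI))) _ => //.
        rewrite -mulrA [s * _]mulrC mulrA; have : (M * K1 + 1) * s <= e / 2.
          by rewrite -ler_pdivlMl// mulrC (le_trans (ltW sq) q3).
        by apply: le_trans; rewrite ler_wpM2r ?lerDl// ltW.
      have h2 : `|X l - X (l - s)| <= e / 2 / k1.
        by apply: Hr; rewrite /ball /= subKr (gtr0_norm s0); lra.
      apply: (@le_trans _ _ (k1 * (e / 2 / k1))); last by rewrite mulrC divfK// gt_eqF.
      by rewrite ler_pM// lerDl.
  have cV1 : contI l V1 := derivI_cont (ep_d2 EP).
  have cV2 := profile_cont2.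
  rewrite (end_int V V1 VL (fun s sI => ep_d1 EP sI) cV1 (fun s sI => le_trans (bV s sI) M1M)
    (fun s sI => le_trans (bV1 s sI) M1M) HVL).
  rewrite (end_int V1 V2 V1L (fun s sI => ep_d2 EP sI) cV2 (fun s sI => le_trans (bV1 s sI) M1M) bV2 HV1L).
  rewrite !mulrA -mulrDl => /eqP; rewrite mulf_eq0 => /orP[/eqP//|/eqP Xl0].
  by move: Xl; rewrite Xl0 ltxx.
- apply/orP; rewrite -negb_and; apply/negP => /andP[/eqP VL0 /eqP V1L0].
  pose s := Num.min (d / 2) (Num.min 1 (N0 / K / (4 * (M ^+ 2 + 1)))).
  have M20 : 0 < 4 * (M ^+ 2 + 1) by rewrite mulr_gt0// ltr_wpDl ?sqr_ge0.
  have s0 : 0 < s by rewrite !lt_min ltr01 !divr_gt0.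
  have [s1 [s2 s3]] : s <= d / 2 /\ s <= 1 /\ s <= N0 / K / (4 * (M ^+ 2 + 1)) by rewrite !ge_min !lexx !orbT.
  have sd : 0 < s < d by rewrite s0 (le_lt_trans s1)// ltr_pdivrMr// ltr_pMr// ltr1n.
  have sI := toI s sd; have := gr _ _ sI hI; rewrite -/N0 -/K -ler_pdivrMr//.
  have h1 := HVL _ sI; have h2 := HV1L _ sI; rewrite VL0 V1L0 !subr0 subKr in h1 h2.
  have q (x : R) : `|x| <= M * s -> x ^+ 2 <= M ^+ 2 * s.
    move=> xs; apply: (@le_trans _ _ ((M * s) ^+ 2)).
      by rewrite -(real_normK (num_real x)) ler_sqr// ?nnegrE ?mulr_ge0// ltW.
    by rewrite exprMn ler_wpM2l ?sqr_ge0// expr2 ler_piMl// ltW.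
  have := q _ h1; have := q _ h2; rewrite ler_pdivlMr// in s3.
  have NK : 0 < N0 / K by rewrite divr_gt0.
  move: NK s3 s0; move: (s) (V _ ^+ 2) (V1 _ ^+ 2) (N0 / K) (M ^+ 2) => r u v n w; nra.
Qed.

(** If [VL] is nonzero, [V^2] is comparable to a constant near [l]. If [VL = 0], the slope [V1L] is
    nonzero and [V^2] is comparable to the squared distance to the boundary. Both models are
    nondecreasing in that distance. *)
Lemma boundary_nonzero VL V1L M d : boundary_data VL V1L M d ->
  nonzero_end (fun s => V (l - s)) /\ monoend (fun s => V (l - s) ^+ 2).
Proof.
move=> [/andP[d0 dl] bV HL _ nz].
have h2 : 0 < d / 2 < d by lra.
have M0 : 0 <= M by have [h _ _] := bV _ h2; exact: le_trans h.
have [VL0|VL0] := eqVneq VL 0.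
- have V1L0 : V1L != 0 by case: nz; rewrite ?VL0 ?eqxx.
  pose k := `|V1L| / 2; have k0 : 0 < k by rewrite divr_gt0// normr_gt0.
  pose d' := Num.min d (k / (M + 1)); have Mp : 0 < M + 1 by rewrite ltr_wpDl.
  have d'0 : 0 < d' by rewrite lt_min d0 divr_gt0.
  have [d'1 d'2] : d' <= d /\ d' <= k / (M + 1) by rewrite !ge_min !lexx orbT.
  pose sg := Num.sg V1L; have sgV : sg * V1L = `|V1L| by rewrite normrEsg.
  have sg1 : `|sg| = 1 by rewrite normr_sg V1L0.
  have low (s : R) : l - d' < s < l -> k <= sg * V1 s.
    move=> /andP[h1 h3]; have sd : 0 < l - s < d by lra.
    have [_] := HL _ sd; rewrite subKr => h4.
    have h5 : M * (l - s) <= k.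
      apply: (@le_trans _ _ ((M + 1) * d')); first by apply: ler_pM; lra.
      by rewrite -ler_pdivlMl// mulrC.
    have : `|sg * (V1 s - V1L)| <= k by rewrite normrM sg1 mul1r (le_trans h4 h5).
    by rewrite mulrBr sgV => /ler_normlP[h6 _]; rewrite /k in h6 *; lra.
  have lowV (s : R) : 0 < s < d' -> k * s <= `|V (l - s)| <= M * s.
    move=> /andP[s0 sd]; have sd1 : 0 < s < d by rewrite s0 (lt_le_trans sd d'1).
    have [h _] := HL _ sd1; rewrite VL0 subr0 in h; rewrite h andbT.
    suff : sg * V (l - s) + k * s <= 0.
      have := ler_norm (- (sg * V (l - s))); rewrite normrN normrM sg1 mul1r; lra.
    apply/ler_addgt0Pr => e e0; rewrite add0r.
    pose t := Num.min (s / 2) (e / (M + k)); have Mk : 0 < M + k by rewrite ltr_wpDl.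
    have t0 : 0 < t by rewrite lt_min !divr_gt0.
    have [t1 t2] : t <= s / 2 /\ t <= e / (M + k) by rewrite !ge_min !lexx orbT.
    have ts : t < s by lra.
    have td : 0 < t < d by rewrite t0 (lt_trans ts)//; case/andP: sd1.
    have dF (r : R) : l - d' < r < l -> isd (fun r => sg * V r - k * r) r (sg * V1 r - k).
      move=> rI; have r0 : 0 < r < l by lra.
      by apply: isd_eqd (isdB (isdZ sg (ep_d1 EP r0)) (isdZ k (isd_id r))) _; rewrite mulr1.
    have dF0 (r : R) : l - d' < r < l -> 0 <= sg * V1 r - k by move=> /low; rewrite subr_ge0.
    have := @isd_ndecr _ _ _ _ _ (l - s) (l - t) dF dF0 _ _ _.
    move=> H; have {}H : sg * V (l - s) - k * (l - s) <= sg * V (l - t) - k * (l - t) by apply: H; lra.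
    have [h3 _] := HL _ td; rewrite VL0 subr0 in h3.
    have h4 : sg * V (l - t) <= M * t by apply: le_trans (ler_norm _) _; rewrite normrM sg1 mul1r.
    have h5 : (M + k) * t <= e by rewrite -ler_pdivlMl// mulrC.
    by move: H h4 h5; rewrite !mulrBr mulrDl; lra.
  split.
    exists d'; first by rewrite d'0 (le_lt_trans d'1 dl).
    move=> s sd; rewrite -normr_gt0; have /andP[h _] := lowV s sd; apply: lt_le_trans h.
    by rewrite mulr_gt0//; case/andP: sd.
  apply: (@monoend_equiv _ _ (fun s => s ^+ 2) d' (k ^+ 2) (M ^+ 2 + 1)) => //.
  + by rewrite exprn_gt0.
  + by rewrite ltr_wpDl ?sqr_ge0.
  + by move=> s t s0 st _; rewrite ler_sqr ?nnegrE ?(ltW s0)// ltW// (lt_le_trans s0 st).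
  + move=> s sd; have /andP[h1 h3] := lowV s sd; have s0 : 0 < s by case/andP: sd.
    rewrite -(real_normK (num_real (V (l - s)))) mulrDl mul1r -!exprMn.
    have p1 : 0 <= k * s by rewrite mulr_ge0// ltW.
    rewrite ler_sqr ?nnegrE// h1/=; apply: (@le_trans _ _ ((M * s) ^+ 2)); last by rewrite lerDl sqr_ge0.
    by rewrite ler_sqr ?nnegrE// mulr_ge0// ltW.
- pose k := `|VL| / 2; have k0 : 0 < k by rewrite divr_gt0// normr_gt0.
  pose d' := Num.min d (k / (M + 1)); have Mp : 0 < M + 1 by rewrite ltr_wpDl.
  have d'0 : 0 < d' by rewrite lt_min d0 divr_gt0.
  have [d'1 d'2] : d' <= d /\ d' <= k / (M + 1) by rewrite !ge_min !lexx orbT.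
  have low (s : R) : 0 < s < d' -> k <= `|V (l - s)| <= M.
    move=> /andP[s0 sd]; have sd1 : 0 < s < d by rewrite s0 (lt_le_trans sd d'1).
    have [h _ _] := bV _ sd1; rewrite h andbT.
    have [h3 _] := HL _ sd1.
    have h5 : M * s <= k.
      apply: (@le_trans _ _ ((M + 1) * d')); first by apply: ler_pM; lra.
      by rewrite -ler_pdivlMl// mulrC.
    have := lerB_dist VL (V (l - s)); rewrite distrC => h6.
    by have := le_trans h6 (le_trans h3 h5); rewrite /k; lra.
  split.
    exists d'; first by rewrite d'0 (le_lt_trans d'1 dl).
    by move=> s sd; rewrite -normr_gt0; have /andP[h _] := low s sd; apply: lt_le_trans h.
  apply: (@monoend_equiv _ _ (fun=> 1) d' (k ^+ 2) (M ^+ 2 + 1)) => //.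
  + by rewrite exprn_gt0.
  + by rewrite ltr_wpDl ?sqr_ge0.
  + move=> s sd; have /andP[h1 h3] := low s sd.
    rewrite -(real_normK (num_real (V (l - s)))) !mulr1 ler_sqr ?nnegrE ?(ltW k0)// h1/=.
    apply: (@le_trans _ _ (M ^+ 2)); last by rewrite lerDl.
    by rewrite ler_sqr ?nnegrE.
Qed.

Lemma profile_end1 : nonzero_end (fun s => V (l - s)) /\ monoend (fun s => V (l - s) ^+ 2).
Proof.
have [al|al] := eqVneq (a l) 0; first by have [] := profile_end1_pole al.
by have [VL [V1L [M [d H]]]] := boundary_data_exists al; exact: boundary_nonzero H.
Qed.

End EndBehaviour.

(** * A bump function of class C^2 *)

Section CubeBump.
Context {R : realType}.

Lemma lt3_exists (x y z : R) : 0 < x -> 0 < y -> 0 < z -> exists c : R, [/\ 0 < c, c < x, c < y & c < z].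
Proof.
move=> x0 y0 z0; exists (Num.min x (Num.min y z) / 2); set k := Num.min _ _.
have k0 : 0 < k by rewrite !lt_min x0 y0.
have [k1 [k2 k3]] : k <= x /\ k <= y /\ k <= z by rewrite /k !ge_min !lexx ?orbT.
by split; lra.
Qed.

Lemma half_le (x y : R) : 0 < x -> x <= y -> x / 2 <= y.
Proof. by move=> x0 xy; lra. Qed.

Lemma half_lt (l c : R) : 0 < l -> 0 < c -> c < l / 2 -> c < l - c /\ c < l.
Proof. by split; lra. Qed.

Definition possq (t : R) : R := Num.max t 0 ^+ 2.

Lemma isd_possq (t : R) : isd possq t (2 * Num.max t 0).
Proof.
have E : possq = (fun t => - npsq (- t)).
  apply/funext => s; rewrite /possq /npsq opprK; have [s0|s0] := leP s 0.
    by rewrite (min_idPr _)// oppr_ge0.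
  by rewrite (min_idPl _) ?sqrrN// oppr_le0 ltW.
rewrite E; apply: isd_eqd (isdN (isd_comp (isdN (isd_id t)) (isd_npsq _))) _.
have [s0|s0] := leP t 0; first by rewrite (min_idPr _) ?oppr_ge0// !mulr0 mul0r oppr0.
by rewrite (min_idPl _) ?oppr_le0 ?ltW//; ring.
Qed.

(** The bump is the cube of the positive part of [(s - p) (q - s)], the cube being the first power
    that is twice continuously differentiable. *)
Lemma cube_bump (p q : R) : p < q -> exists X X1 X2 : R -> R,
  [/\ forall s : R, isd X s (X1 s) /\ isd X1 s (X2 s), forall s, {for s, continuous X2},
      forall s, p < s < q -> 0 < X s, forall s, 0 <= X s &
      forall s : R, ~~ (p < s < q) -> [/\ X s = 0, X1 s = 0 & X2 s = 0]].
Proof.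
move=> pq; pose w (s : R) := (s - p) * (q - s); pose w1 (s : R) := p + q - 2 * s.
have dw (s : R) : isd w s (w1 s).
  by apply: isd_eqd (isdM (isdB (isd_id s) (isd_cst p s)) (isdB (isd_cst q s) (isd_id s))) _; rewrite /w1; ring.
have dw1 (s : R) : isd w1 s (- 2).
  by apply: isd_eqd (isdB (isd_cst (p + q) s) (isdZ 2 (isd_id s))) _; ring.
have dp (s : R) : isd (fun s => possq (w s)) s (2 * Num.max (w s) 0 * w1 s).
  exact: isd_comp (dw s) (isd_possq _).
have wp (s : R) : w s * possq (w s) = Num.max (w s) 0 * possq (w s).
  by rewrite /possq; case: (leP (w s) 0) => h; rewrite ?expr0n ?mulr0.
have w2 (s : R) : w s * Num.max (w s) 0 = possq (w s).
  by rewrite /possq; case: (leP (w s) 0) => h; rewrite ?mulr0 ?expr0n// expr2.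
exists (fun s => w s * possq (w s)), (fun s => 3 * (possq (w s) * w1 s)),
  (fun s => 3 * (2 * Num.max (w s) 0 * w1 s * w1 s - 2 * possq (w s))).
have cw (s : R) : {for s, continuous w} by exact: isd_cont (dw s).
split.
- move=> s; split.
    apply: isd_eqd (isdM (dw s) (dp s)) _; rewrite -(w2 s); ring.
  by apply: isd_eqd (isdZ 3 (isdM (dp s) (dw1 s))) _; ring.
- move=> s; have c1 := isd_cont (dw1 s).
  have c2 : {for s, continuous (fun s => Num.max (w s) 0)} by apply: continuous_max; [exact: cw|exact: cvg_cst].
  apply: continuousM; first exact: cvg_cst.
  apply: continuousB; last by apply: continuousM; [exact: cvg_cst|exact: isd_cont (dp s)].
  by apply: continuousM => //; apply: continuousM => //; apply: continuousM => //; exact: cvg_cst.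
- move=> s /andP[ps sq]; have h : 0 < w s by rewrite mulr_gt0 ?subr_gt0.
  by rewrite mulr_gt0// /possq (max_idPl (ltW h)) exprn_gt0.
- by move=> s; rewrite wp mulr_ge0 ?sqr_ge0// le_max lexx orbT.
- move=> s sI; have h : w s <= 0.
    move: sI; rewrite negb_and -!leNgt /w => /orP[h|h].
      by rewrite mulr_le0_ge0 ?subr_le0// subr_ge0 (le_trans h) ?ltW.
    by rewrite mulr_ge0_le0 ?subr_le0// subr_ge0 (le_trans _ h) ?ltW.
  by rewrite /possq (max_idPr h) expr0n !mulr0 !mul0r subr0 mulr0.
Qed.

End CubeBump.

(** * A positive reference profile *)

Section Reference.
Context {R : realType} (l : R) (a : R -> R) (m : nat) (lambda0 alpha1 alpha2 : R).
Notation mu := (@lebesgue_measure R).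
Notation RT := (measurableTypeR R).

Definition near_ends (Pr : R -> Prop) := exists2 d : R, 0 < d < l &
  forI d s, Pr s /\ Pr (l - s).

(* [th] is a positive C^2 substitute for [|V|], where V is an eigenprofile with
   possible interior zeros, and [Y = V / th]; they agree near both ends. *)
Record reference (th th1 th2 Q Y : R -> R) : Prop := Reference {
  rf_gt0 : forI l s, 0 < th s;
  rf_d1 : forI l s, isd th s (th1 s);
  rf_d2 : forI l s, isd th1 s (th2 s);
  rf_cont2 : forI l s, {for s, continuous th2};
  rf_ode : forI l s, th2 s = - (derive1 a s / a s) * th1 s + (m%:R ^+ 2 / a s ^+ 2 - Q s) * th s;
  rf_bd : bdcont l th;
  rf_bdQ : bdcont l Q;
  rf_endQ : near_ends (fun s => Q s = lambda0);
  rf_weight : weight l (fun s => a s * th s ^+ 2);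
  rf_sub : neumann l (fun s => a s * th s ^+ 2) (fun s => (Q s - lambda0) * Y s) Y;
  rf_Y : forI l s, `|Y s| <= 1;
  rf_endY : near_ends (fun s => `|Y s| = 1);
  rf_L2 : intI l (fun s => th s ^+ 2 * a s);
  rf_L2_1 : intI l (fun s => th1 s ^+ 2 * a s);
  rf_L2_a : intI l (fun s => (th s / a s) ^+ 2 * a s);
  rf_L2_2 : intI l (fun s => th2 s ^+ 2 * a s);
  rf_L2_1a : intI l (fun s => (th1 s / a s - derive1 a s / a s ^+ 2 * th s) ^+ 2 * a s);
  rf_vanish0 : vanishing_end l th;
  rf_vanish1 : a l = 0 -> vanishing_end l (fun s => th (l - s));
  rf_boundary : a l != 0 -> exists VL V1L M d, boundary_data l alpha1 alpha2 th th1 th2 VL V1L M d }.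

Lemma integrable_ends (f g : R -> R) (c : R) : 0 < c -> contI l f ->
  contI l g -> 
  (forI l s, ~~ (c <= s <= l - c) -> f s = g s) ->
  intI l g -> intI l f.
Proof.
move=> c0 cf cg fg ig.
have i1 : intI l (fun s => f s - g s).
  have mI : measurable (`[c, l - c] : set RT) by exact: measurable_itv.
  have mJ : measurable (`]0, l[ : set RT) by exact: measurable_itv.
  have sub : `[c, l - c] `<=` `]0, l[.
    move=> s /=; rewrite !in_itv /= => /andP[h1 h2]; rewrite (lt_le_trans c0 h1) (le_lt_trans h2)//.
    by rewrite ltrBlDr ltrDl.
  apply: (proj1 (@integrable_supp R _ RT mu _ _ _ mJ mI sub _)).
    move=> s /=; rewrite !in_itv /= => sI /negP h; rewrite fg ?subrr//.
  apply: (@locint_cont _ l (fun s => f s - g s)) => // [s sI|].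
    by apply: continuousB; [exact: cf|exact: cg].
  by rewrite ltrBlDr ltrDl.
have := rintegrableD (measurable_I l) i1 ig.
by apply: eq_integrable => // s _ /=; rewrite subrK.
Qed.
End Reference.
Section ReferenceExists.
Context {R : realType} (l : R) (a : R -> R) (m : nat) (lambda0 alpha1 alpha2 : R) (V V1 V2 : R -> R).
Hypotheses (P : profile l a) (m0 : (0 < m)%N) (lam0 : 0 < lambda0).
Hypothesis EP : eigenprofile l a m lambda0 alpha1 alpha2 V V1 V2.
Hypothesis V_neq0 : exists2 s : R, 0 < s < l & V s != 0.

Lemma monoend_eq (f g : R -> R) d : 0 < d -> (forI d s, f s = g s) -> monoend f -> monoend g.
Proof.
move=> d0 fg [d' [K [d'0 K0 H]]]; exists (Num.min d d'), K; split=> //; first by rewrite lt_min d0.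
move=> s t s0 st; rewrite lt_min => /andP[td td'].
by rewrite -!fg ?(H s t)// ?s0 ?(lt_le_trans s0 st)//= (le_lt_trans st).
Qed.

Lemma monoend_profile0 : monoend a.
Proof.
have [aC [d /andP[d0 dl] aD]] := pf_pole0 P.
apply: (@monoend_equiv _ _ id d 2^-1 3) => // s sd; rewrite mulrC aD//= aC//.
by case/andP: sd => -> /lt_trans; apply.
Qed.

Lemma monoend_profile1 : monoend (fun s => a (l - s)).
Proof.
have [al|al] := eqVneq (a l) 0.
  have [aC [d /andP[d0 dl] aD]] := pf_pole1 P al.
  apply: (@monoend_equiv _ _ id d 2^-1 3) => // s sd; rewrite mulrC aD//=.
  have sI : 0 < s < l by case/andP: sd => -> /lt_trans; apply.
  by have := aC _ (refl_itv sI); rewrite subKr.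
have [al0 [d /andP[d0 dl] aD]] := pf_boundary P al.
by apply: (@monoend_equiv _ _ (fun=> 1) d (a l / 2) (2 * a l)) => //; [exact: divr_gt0|exact: mulr_gt0|move=> s sd; rewrite !mulr1 aD].
Qed.

(** The reference is [th = sqrt (V^2 + X)], where the bump [X] lives on an interior interval that
    contains all possible zeros of [V]. [Q] is the potential that makes [th] solve the radial
    equation; outside the bump [th = Y V] with [Y = 1] or [Y = -1], so [Q = lambda0] there. *)
Theorem reference_exists : exists th th1 th2 Q Y,
  reference l a m lambda0 alpha1 alpha2 th th1 th2 Q Y /\ (forI l s, V s = Y s * th s).
Proof.
have l0 := pf_l P; have a0 := pf_gt0 P; have da := pf_isd P.
have dV := ep_d1 EP; have dV1 := ep_d2 EP.
have ca := derivI_cont da.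
have cVi := derivI_cont dV.
have cV1 := derivI_cont dV1.
have cV2 := profile_cont2 P EP.
have [[d0 /andP[d00 d0l] nz0] mV0 vV0] := profile_end0 P m0 lam0 EP V_neq0.
have [[d1 /andP[d10 d1l] nz1] mV1] := profile_end1 P m0 lam0 EP V_neq0.
(* Below both ranges on which [V] has no zero, so the bump on [(c, l - c)] covers all zeros. *)
have [c [c0 cd0 cd1 cl]] := lt3_exists d00 d10 (divr_gt0 l0 (ltr0Sn R 1)).
have [c1 c2] := half_lt l0 c0 cl.
have [X [X1 [X2 [dX cX2 X0 Xge Xend]]]] := cube_bump c1.
have endV (s : R) : 0 < s < l -> ~~ (c < s < l - c) -> V s != 0.
  move=> /andP[s0 sl]; rewrite negb_and -!leNgt => /orP[h|h].
    by apply: nz0; rewrite s0 (le_lt_trans h).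
  have := nz1 (l - s); rewrite subKr; apply; rewrite subr_gt0 sl/=.
  by apply: le_lt_trans cd1; rewrite lerBlDr addrC -lerBlDr.
pose T (s : R) := V s ^+ 2 + X s.
have T0 (s : R) : 0 < s < l -> 0 < T s.
  move=> sI; have [h|h] := boolP (c < s < l - c); first by rewrite ltr_wpDl ?sqr_ge0// X0.
  by rewrite ltr_pwDl// exprn_even_gt0// endV.
pose th (s : R) := Num.sqrt (T s); have thE (s : R) : 0 < s < l -> th s ^+ 2 = T s.
  by move=> sI; rewrite sqr_sqrtr// ltW// T0.
have th0 (s : R) : 0 < s < l -> 0 < th s by move=> sI; rewrite sqrtr_gt0 T0.
pose T1 (s : R) := 2 * V s * V1 s + X1 s.
pose T2 (s : R) := 2 * (V1 s * V1 s + V s * V2 s) + X2 s.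
have dT : derivI l T T1.
  by move=> s sI; exact: isdD (isd_sqr (dV s sI)) (proj1 (dX s)).
have dT1 : derivI l T1 T2.
  move=> s sI; have [_ dX1] := dX s.
  have -> : T1 = (fun s => 2 * (V s * V1 s) + X1 s) by apply/funext => r; rewrite /T1 mulrA.
  exact: isdD (isdZ 2 (isdM (dV s sI) (dV1 s sI))) dX1.
pose th1 (s : R) := T1 s / (2 * th s).
pose th2 (s : R) := (T2 s / 2 - th1 s ^+ 2) / th s.
have dth : derivI l th th1.
  move=> s sI; apply: isd_eqd (isd_comp (dT s sI) (is_derive1_sqrt (T0 s sI))) _.
  by rewrite /th1 mulrC.
have dth1 : derivI l th1 th2.
  move=> s sI; have h0 := th0 s sI; have h2 : 2 * th s != 0 by rewrite mulf_neq0// gt_eqF.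
  apply: isd_eqd (@isd_div _ T1 (fun s => 2 * th s) s _ _ h2 (dT1 s sI) (isdZ 2 (dth s sI))) _.
  have -> : T1 s = th1 s * (2 * th s) by rewrite /th1 divfK.
  by rewrite /th2; field; rewrite gt_eqF.
have cX2' : contI l X2 by move=> s _; exact: cX2.
have cth := derivI_cont dth.
have cth1 := derivI_cont dth1.
have [cthV cthV2] := contIV th0 cth; have [caV ca2] := contIV a0 ca.
have cV2' : contI l V2 := cV2; have cda : contI l (derive1 a) := pf_cont1 P.
have cth2 : contI l th2 by cont_tac.
pose Y (s : R) := V s / th s.
have VE (s : R) : 0 < s < l -> V s = Y s * th s by move=> sI; rewrite /Y divfK// gt_eqF// th0.
(* The derivative of [Y]. Its flux [a th^2 y] is [a] times the Wronskian of [th] and [V], whose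
   derivative involves only the difference of the two potentials. *)
pose y (s : R) := (V1 s * th s - V s * th1 s) / th s ^+ 2.
have dY : derivI l Y y.
  by move=> s sI; apply: isd_div (dV s sI) (dth s sI); rewrite gt_eqF// th0.
pose Q (s : R) := m%:R ^+ 2 / a s ^+ 2 - (th2 s + derive1 a s / a s * th1 s) / th s.
have outer (s : R) : 0 < s < l -> ~~ (c < s < l - c) ->
    [/\ Y s ^+ 2 = 1, th s = Y s * V s, th1 s = Y s * V1 s, th2 s = Y s * V2 s & Q s = lambda0].
  move=> sI so; have [x0 x1 x2] := Xend s so; have h0 := th0 s sI; have v0 := endV s sI so.
  have TV : th s ^+ 2 = V s ^+ 2 by rewrite thE// /T x0 addr0.
  have hn : th s != 0 by rewrite gt_eqF.
  have Y2 : Y s ^+ 2 = 1 by rewrite /Y expr_div_n TV divff// expf_neq0.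
  have E0 : th s = Y s * V s by rewrite /Y mulrAC -expr2 -TV expr2 mulfK.
  have E1 : th1 s = Y s * V1 s.
    by rewrite /th1 /T1 x1 addr0 /Y; field.
  have E2 : th2 s = Y s * V2 s.
    rewrite /th2 E1 exprMn Y2 mul1r /T2 x2 addr0 /Y; field => //.
  have yn : Y s != 0 by rewrite -sqrf_eq0 Y2 oner_eq0.
  split=> //; rewrite /Q E0 E1 E2 (ep_ode EP)//; field.
  by rewrite v0 yn gt_eqF// a0.
have wE (s : R) : 0 < s < l -> th2 s = - (derive1 a s / a s) * th1 s + (m%:R ^+ 2 / a s ^+ 2 - Q s) * th s.
  by move=> sI; rewrite /Q; field; rewrite !gt_eqF ?th0 ?a0.
have cQ : contI l Q by cont_tac.
have lc : l - c < l by rewrite ltrBlDr ltrDl.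
have inner_bd (f : R -> R) (K : R) : contI l f ->
    (forI l s, ~~ (c < s < l - c) -> `|f s| <= K) -> bdcont l f.
  move=> cf fK; split=> //; have [M M0 HM] := cont_upper_bound cf c0 lc.
  exists (Num.max M K) => s sI; rewrite le_max; have [/andP[h1 h2]|h] := boolP (c < s < l - c).
    by rewrite HM// !ltW.
  by rewrite fK ?orbT.
have ends (Pr : R -> Prop) : (forI l s, ~~ (c < s < l - c) -> Pr s) -> near_ends l Pr.
  move=> H; exists c; first by rewrite c0.
  move=> s /andP[s0 sc]; have sI : 0 < s < l by rewrite s0 (lt_trans sc).
  split; apply: H => //; first by rewrite negb_and -leNgt ltW.
    exact: refl_itv.
  by rewrite negb_and -!leNgt lerD2l lerN2 (ltW sc) orbT.
have out0 (s : R) : 0 < s < c -> 0 < s < l /\ ~~ (c < s < l - c).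
  by move=> /andP[s0 sc]; rewrite s0 (lt_trans sc)// negb_and -leNgt ltW.
have out1 (s : R) : 0 < s < c -> 0 < l - s < l /\ ~~ (c < l - s < l - c).
  move=> sc; have [sI _] := out0 s sc; split; first exact: refl_itv.
  by rewrite negb_and -!leNgt lerD2l lerN2 (ltW (proj2 (andP sc))) orbT.
have thV (s : R) : 0 < s < l -> ~~ (c < s < l - c) -> th s ^+ 2 = V s ^+ 2.
  by move=> sI so; have [h1 -> _ _ _] := outer s sI so; rewrite exprMn h1 mul1r.
have W : weight l (fun s => a s * th s ^+ 2).
  apply: monoend_weight => //.
  - by cont_tac.
  - by move=> s sI; rewrite mulr_gt0 ?a0// exprn_gt0// th0.
  - apply: (@monoend_eq (fun s => a s * V s ^+ 2) _ c) => //.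
      by move=> s /out0[sI so]; rewrite thV.
    apply: monoendM => //; first exact: monoend_profile0.
    by exists c => // s /out0[sI _]; rewrite sqr_ge0 ltW ?a0.
  - apply: (@monoend_eq (fun s => a (l - s) * V (l - s) ^+ 2) _ c) => //.
      by move=> s /out1[sI so]; rewrite thV.
    apply: (@monoendM _ (fun s => a (l - s)) (fun s => V (l - s) ^+ 2)) => //; first exact: monoend_profile1.
    by exists c => // s /out1[sI _]; rewrite sqr_ge0 ltW ?a0.
have Y1 (s : R) : 0 < s < l -> `|Y s| <= 1.
  move=> sI; have h0 := th0 s sI; rewrite /Y normf_div (gtr0_norm h0) ler_pdivrMr// mul1r.
  rewrite -ler_sqr ?nnegrE ?(ltW h0)// real_normK ?num_real// thE// lerDl; exact: Xge.
have yo (s : R) : 0 < s < l -> ~~ (c < s < l - c) -> y s = 0.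
  move=> sI so; have [_ E0 E1 _ _] := outer s sI so; rewrite /y E0 E1; ring.
have sqeq (f g : R -> R) : contI l f ->
    contI l g ->
    (forI l s, ~~ (c < s < l - c) -> f s = Y s * g s) ->
    intI l (fun s => g s ^+ 2 * a s) ->
    intI l (fun s => f s ^+ 2 * a s).
  move=> cf cg fg; apply: (@integrable_ends _ _ _ _ c c0).
  - by cont_tac.
  - by cont_tac.
  - move=> s sI so; have so' : ~~ (c < s < l - c).
      by apply: contra so => /andP[h1 h2]; rewrite !ltW.
    by have [h _ _ _ _] := outer s sI so'; rewrite fg// exprMn h mul1r.
have vth0 : vanishing_end l th.
  move=> e e0; have [d /andP[dp dl] H] := vV0 e e0; exists (Num.min d c).
    by rewrite lt_min dp c0 gt_min dl.
  by move=> s /andP[s0]; rewrite lt_min => /andP[sd sc]; rewrite thV ?H ?s0// ?(proj2 (out0 s _)) ?s0//= (lt_trans sc).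
have bd_end (VL V1L M d : R) : boundary_data l alpha1 alpha2 V V1 V2 VL V1L M d ->
    exists VL V1L M d, boundary_data l alpha1 alpha2 th th1 th2 VL V1L M d.
  move=> [/andP[dp dl] bV HL rob nz].
  (* Near the boundary [th] is [V] up to a constant sign, because [Y' = 0] there. *)
  pose sg := Y (l - c / 2).
  have c20 : 0 < c / 2 < c by rewrite divr_gt0//= ltr_pdivrMr// ltr_pMr// ltr1n.
  have [cI co] := out1 _ c20; have [sg2 _ _ _ _] := outer _ cI co.
  have sg1 : `|sg| = 1 by apply/eqP; rewrite -(@eqrXn2 _ 2)// expr1n real_normK ?num_real// sg2.
  have YE (s : R) : 0 < s < c -> Y (l - s) = sg.
    move=> sc; apply: (@isd_const _ Y (l - c) l).
    - move=> t /andP[t1 t2]; have tc : 0 < l - t < c by rewrite subr_gt0 t2 /= ltrBlDr addrC -ltrBlDr.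
      by have := out1 _ tc; rewrite subKr => -[tI to]; rewrite -(yo t tI to); exact: dY.
    - by case/andP: sc => s0 sc; rewrite ltrD2l ltrN2 sc ltrBlDr ltrDl.
    - by case/andP: c20 => s0 s1; rewrite ltrD2l ltrN2 s1 ltrBlDr ltrDl.
  exists (sg * VL), (sg * V1L), M, (Num.min d c).
  have H (s : R) : 0 < s < Num.min d c -> [/\ 0 < s < d, th (l - s) = sg * V (l - s),
      th1 (l - s) = sg * V1 (l - s) & th2 (l - s) = sg * V2 (l - s)].
    move=> /andP[s0]; rewrite lt_min => /andP[sd sc]; have sc' : 0 < s < c by rewrite s0.
    by have [sI so] := out1 s sc'; have [_ -> -> -> _] := outer _ sI so; rewrite YE// s0.
  have mn (z w : R) : `|sg * z - sg * w| = `|z - w| by rewrite -mulrBr normrM sg1 mul1r.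
  have m1 (z : R) : `|sg * z| = `|z| by rewrite normrM sg1 mul1r.
  split.
  - by rewrite lt_min dp c0 gt_min dl.
  - by move=> s /H[sd -> -> ->]; rewrite !m1; exact: bV.
  - by move=> s /H[sd -> -> _]; rewrite !mn; exact: HL.
  - by rewrite !(mulrCA _ sg) -mulrDr rob mulr0.
  - have sn : sg != 0 by rewrite -normr_eq0 sg1 oner_eq0.
    by case: nz => h; [left|right]; exact: mulf_neq0.
have vth1 : a l = 0 -> vanishing_end l (fun s => th (l - s)).
  move=> al e e0; have [_ _ vV1] := profile_end1_pole P m0 lam0 EP V_neq0 al.
  have [d /andP[dp dl] H] := vV1 e e0; exists (Num.min d c); first by rewrite lt_min dp c0 gt_min dl.
  move=> s /andP[s0]; rewrite lt_min => /andP[sd sc]; have sc' : 0 < s < c by rewrite s0.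
  by have [sI so] := out1 s sc'; rewrite thV// H// s0.
(* Boundedness at the ends: [th] tends to 0 at a pole and is controlled by the boundary data
   otherwise. *)
have bth : bdcont l th.
  have [e1 [h1 H1]] : exists e, 0 < e < l /\ forI e s, `|th s| <= 1.
    have [d dI H] := vth0 1 ltr01; exists d; split=> // s sd.
    by rewrite -(@expr_le1 _ 2)// real_normK ?num_real// H.
  have [e2 [K [h2 H2]]] : exists e K, 0 < e < l /\ forI e s, `|th (l - s)| <= K.
    have [al|al] := eqVneq (a l) 0.
      have [d dI H] := vth1 al 1 ltr01; exists d, 1; split=> // s sd.
      by rewrite -(@expr_le1 _ 2)// real_normK ?num_real// H.
    have [VL [V1L [M [d HH]]]] := boundary_data_exists P lam0 EP V_neq0 al.
    have [VL' [V1L' [M' [d' [dI H _ _ _]]]]] := bd_end _ _ _ _ HH.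
    by exists d', M'; split=> // s /H[].
  have [e10 e1l] := andP h1; have [e20 e2l] := andP h2.
  have p1 : 0 < e1 / 2 by rewrite divr_gt0.
  have p2 : l - e2 / 2 < l by rewrite ltrBlDr ltrDl divr_gt0.
  split=> //; have [M M0 HM] := cont_upper_bound cth p1 p2.
  exists (Num.max M (Num.max 1 K)) => s /andP[s0 sl]; rewrite !le_max.
  have [h|h] := ltP s e1; first by rewrite H1 ?s0// orbT.
  have [h'|h'] := ltP (l - e2) s.
    have := H2 (l - s); rewrite subKr => ->; rewrite ?orbT// subr_gt0 sl/=.
    by rewrite ltrBlDr addrC -ltrBlDr.
  by rewrite HM// half_le//= (le_trans h')// lerD2l lerN2 half_le.
exists th, th1, th2, Q, Y; split; last exact: VE; split=> //.
- apply: (inner_bd _ `|lambda0|) => // s sI so; by have [_ _ _ _ ->] := outer s sI so.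
- by apply: ends => s sI so; have [] := outer s sI so.
- have cy : contI l y by cont_tac.
  have [M M0 HM] := cont_upper_bound cy c0 lc.
  exists y, (M / c); split=> //.
    move=> s sI; have ms := min_gt0 sI; have [/andP[h1 h2]|h] := boolP (c < s < l - c).
      apply: (@le_trans _ _ M); first by rewrite HM// !ltW.
      rewrite -mulrA ler_peMr ?(ltW M0)// mulrC ler_pdivlMr// mul1r le_min (ltW h1) /=.
      by rewrite lerBrDr addrC -lerBrDr ltW.
    by rewrite yo// normr0 mulr_ge0 ?(ltW ms)// divr_ge0 ?ltW.
  move=> s sI; have h0 := th0 s sI; have as0 := a0 s sI.
  apply: (@isd_near _ (fun t => a t * (V1 t * th t - V t * th1 t))).
    near=> t; have tI : 0 < t < l by near: t; exact: near_in.
    by rewrite /y; field; rewrite gt_eqF// th0.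
  apply: isd_eqd (isdM (da s sI) (isdB (isdM (dV1 s sI) (dth s sI)) (isdM (dV s sI) (dth1 s sI)))) _.
  rewrite (ep_ode EP)// wE// (VE s sI); field; by rewrite gt_eqF.
- apply: ends => s sI so; have [h _ _ _ _] := outer s sI so.
  by apply/eqP; rewrite -(@eqrXn2 _ 2)// expr1n real_normK ?num_real// h.
- by apply: (sqeq th V) (ep_L2 EP) => // s sI so; have [] := outer s sI so.
- by apply: (sqeq th1 V1) (ep_L2_1 EP) => // s sI so; have [] := outer s sI so.
- apply: (sqeq (fun s => th s / a s) (fun s => V s / a s)) (ep_L2_a EP).
  + by cont_tac.
  + by cont_tac.
  + by move=> s sI so; have [_ -> _ _ _] := outer s sI so; rewrite mulrA.
- by apply: (sqeq th2 V2) (ep_L2_2 EP) => // s sI so; have [] := outer s sI so.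
- apply: (sqeq (fun s => th1 s / a s - derive1 a s / a s ^+ 2 * th s)
               (fun s => V1 s / a s - derive1 a s / a s ^+ 2 * V s)) (ep_L2_1a EP).
  + by cont_tac.
  + by cont_tac.
  + by move=> s sI so; have [_ -> -> _ _] := outer s sI so; field; rewrite gt_eqF// a0.
- move=> al; have [VL [V1L [M [d HH]]]] := boundary_data_exists P lam0 EP V_neq0 al.
  exact: bd_end HH.
Unshelve. all: by end_near. Qed.

End ReferenceExists.
Lemma half_in {R : realType} (l : R) : 0 < l -> 0 < l / 2 < l.
Proof. by move=> l0; lra. Qed.

(** [p] and [p1] are within [A t] of [v] and [v1], whose product is nonpositive; every remaining
    term is an error of order [t]. *)
Lemma robin_flux_bound {R : realType} (t v v1 p p1 z y A B K : R) : 0 <= t -> 0 <= A -> 0 <= B ->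
  `|p| <= A -> `|p1| <= A -> `|p - v| <= A * t -> `|p1 - v1| <= A * t -> `|z| <= B -> `|y| <= K * t ->
  v * v1 <= 0 -> p * z * (p1 * z + p * y) <= (B ^+ 2 * (A * (A + `|v|)) + A ^+ 2 * B * K) * t.
Proof.
move=> t0 A0 B0 pA p1A pv pv1 zB yK vv.
have h1 : p * p1 <= A * (A + `|v|) * t.
  have -> : p * p1 = v * v1 + ((p - v) * p1 + v * (p1 - v1)) by ring.
  have e1 : (p - v) * p1 <= A * t * A by apply: le_trans (ler_norm _) _; rewrite normrM ler_pM.
  have e2 : v * (p1 - v1) <= `|v| * (A * t) by apply: le_trans (ler_norm _) _; rewrite normrM ler_wpM2l.
  by have := lerD vv (lerD e1 e2); rewrite add0r => /le_trans; apply; apply: le_of_eq; ring.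
have z2 : z ^+ 2 <= B ^+ 2 by rewrite -(real_normK (num_real z)) lerXn2r ?nnegrE.
have p0 : 0 <= A * (A + `|v|) * t by rewrite !mulr_ge0// addr_ge0.
have h2 : z ^+ 2 * (p * p1) <= B ^+ 2 * (A * (A + `|v|) * t).
  apply: (@le_trans _ _ (z ^+ 2 * (A * (A + `|v|) * t))); first by rewrite ler_wpM2l ?sqr_ge0.
  by rewrite ler_wpM2r.
have h3 : p ^+ 2 * z * y <= A ^+ 2 * B * (K * t).
  have p2 : p ^+ 2 <= A ^+ 2 by rewrite -(real_normK (num_real p)) lerXn2r ?nnegrE.
  apply: le_trans (ler_norm _) _; rewrite (normrM (p ^+ 2 * z)) (normrM (p ^+ 2)) (ger0_norm (sqr_ge0 p)).
  by apply: ler_pM => //; [rewrite mulr_ge0 ?sqr_ge0|apply: ler_pM => //; exact: sqr_ge0].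
by have := lerD h2 h3; congr (_ <= _); ring.
Qed.

Lemma sqr_diff_bound {R : realType} (t T x z M : R) : 0 <= t -> t <= T -> 0 <= x -> x <= z -> z <= M ->
  `|t * x ^+ 2 - t * z ^+ 2| * x <= T * (2 * M * M) * (z - x).
Proof.
move=> t0 tT x0 xz zM; have zx : 0 <= z - x by rewrite subr_ge0.
have -> : t * x ^+ 2 - t * z ^+ 2 = - (t * (z + x) * (z - x)) by ring.
have zx' : 0 <= z + x by rewrite addr_ge0// (le_trans x0).
rewrite normrN ger0_norm ?mulr_ge0// mulrAC ler_wpM2r// -[leLHS]mulrA ler_pM ?mulr_ge0//.
by apply: ler_pM => //; last exact: le_trans zM; lra.
Qed.

Lemma sub_product_mono {R : realType} (lam L q f g D x z k Qb fb K : R) : 0 < lam -> 0 < L -> 0 <= x -> x <= z -> `|q| <= Qb ->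
  `|f - g| <= L * D -> `|g| <= fb -> D * x <= K * (z - x) -> k = Qb + lam * (fb + L * K) ->
  (k - (q - lam * f)) * x <= (k - (q - lam * g)) * z.
Proof.
move=> lp Lp x0 xz /ler_normlP[q1 q2] /ler_normlP[d1 d2] /ler_normlP[g1 g2] DK ->.
have h1 : (f - g) * x <= L * (K * (z - x)).
  apply: (@le_trans _ _ (L * D * x)); first by rewrite ler_wpM2r.
  by rewrite -mulrA ler_wpM2l// ltW.
have h2 : lam * ((f - g) * x) <= lam * (L * (K * (z - x))) by rewrite ler_wpM2l// ltW.
have zx : 0 <= z - x by rewrite subr_ge0.
have h3 : 0 <= (Qb - q) * (z - x) by rewrite mulr_ge0// subr_ge0.
have h4 : 0 <= lam * ((fb + g) * (z - x)).
  by rewrite mulr_ge0 ?(ltW lp)// mulr_ge0// -[g]opprK subr_ge0.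
rewrite -subr_ge0.
have -> : (Qb + lam * (fb + L * K) - (q - lam * g)) * z - (Qb + lam * (fb + L * K) - (q - lam * f)) * x =
  (Qb - q) * (z - x) + lam * ((fb + g) * (z - x)) + (lam * (L * (K * (z - x))) - lam * ((f - g) * x)) by ring.
by rewrite addr_ge0 ?subr_ge0// addr_ge0.
Qed.

(** * The ground state of the unperturbed equation *)

Section GroundState.
Context {R : realType} (l : R) (a : R -> R) (m : nat) (lambda0 alpha1 alpha2 : R) (th th1 th2 Q Y : R -> R).
Context (lam C Lf : R) (ft : R -> R).
Hypotheses (P : profile l a) (RF : reference l a m lambda0 alpha1 alpha2 th th1 th2 Q Y).
Hypotheses (lam0 : 0 < lambda0) (lamlt : lambda0 < lam) (C0 : 0 < C) (Lf0 : 0 < Lf).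
Hypotheses (al1 : 0 <= alpha1) (al2 : 0 <= alpha2) (al12 : ~ (alpha1 = 0 /\ alpha2 = 0)).
Hypotheses (ft_lip : forall x y : R, 0 <= x -> 0 <= y -> `|ft x - ft y| <= Lf * `|x - y|).
Hypotheses (ft_le1 : forall x : R, 0 <= x -> ft x <= 1) (ft0 : ft 0 = 1).
Hypothesis ft_tail : forall x : R, C <= x -> ft x = C - x.

Notation rho := (fun s => a s * th s ^+ 2).
Let h (s x : R) : R := Q s - lam * ft (th s ^+ 2 * x ^+ 2).
Let ll0 : 0 < l. Proof. exact: pf_l P. Qed.
Let lm0 : 0 < lam. Proof. exact: lt_trans lamlt. Qed.

(** The Lipschitz bound on [ft] holds for nonnegative arguments only, hence the detour through the
    maximum of [v s] and 0. *)
Lemma bdcont_ft (v : R -> R) : bdcont l v -> (forI l s, 0 <= v s) ->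
  bdcont l (fun s => ft (v s)).
Proof.
move=> bv v0; apply: bdcont_unif => e e0; have [cv [K HK]] := bv.
have L1 := Lf0; have cft : bdcont l (fun s => ft (Num.max (v s) 0)).
  split=> [s sI|]; last first.
    exists (`|ft 0| + Lf * K) => s sI; rewrite (max_idPl (v0 s sI)) -[ft (v s)](subrK (ft 0)) addrC.
    rewrite (le_trans (ler_normD _ _))// lerD2l (le_trans (ft_lip (v0 s sI) (lexx 0)))//.
    by rewrite subr0 ler_wpM2l ?(ltW Lf0)// HK.
  apply/cvgrPdist_le => d d0; near=> t.
  apply: le_trans (ft_lip _ _) _; try by rewrite le_max lexx orbT.
  rewrite -ler_pdivlMl// mulrC; near: t.
  have cm : {for s, continuous (fun t => Num.max (v t) 0)} by apply: continuous_max; [exact: cv|exact: cvg_cst].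
  by apply: cvgr_dist_le; [exact: cm|exact: divr_gt0].
by exists (fun s => ft (Num.max (v s) 0)) => // s sI; rewrite (max_idPl (v0 s sI)) subrr normr0 ltW.
Unshelve. all: by end_near. Qed.

Lemma bdcont_h (z : R -> R) : bdcont l z -> bdcont l (fun s => h s (z s)).
Proof.
move=> bz; apply: bdcontB; first exact: rf_bdQ RF.
apply: bdcontZ; apply: (@bdcont_ft (fun s => th s ^+ 2 * z s ^+ 2)).
  by apply: bdcontM; apply: bdcontX => //; exact: rf_bd RF.
by move=> s _; rewrite mulr_ge0 ?sqr_ge0.
Qed.

(** Large constants fail near a pole: there [th] is small, the reaction is close to 1 and [h] is
    negative. Hence [Zb = N exp(c0 x)], where [(rho x')' = - rho] near the ends provides the
    negative source needed there; in the middle a large [N] puts [th^2 Zb^2] into the linear tail of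
    [ft]. *)
Lemma supersolution : exists N0 : R, 0 < N0 /\ exists Zb FZ M, [/\ neumann l rho FZ Zb,
  forI l s, N0 <= Zb s <= M &
  forI l s, FZ s <= h s (Zb s) * Zb s].
Proof.
have aux1 (c k e : R) : 2 * c * k ^+ 2 * e ^+ 2 <= 1 -> c * (k * e) ^+ 2 <= 1 / 2 by rewrite exprMn; lra.
have aux2 (A c L0 L f : R) : c = 2 * (L - L0) -> A <= c * (1 / 2) -> f <= L -> c * (- 1) + A <= L0 - f.
  by move=> ->; lra.
have aux4 (e t : R) : e < l / 4 -> l - e <= t -> 3 * l / 4 <= t by lra.
have aux3 (q d e : R) : q * d + d <= 1 -> q * e <= q * d -> 0 < d -> q * e <= 1 by lra.
have W := rf_weight RF; have brho := weight_bd W; have l0 := ll0; have lp := lm0.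
have [X [X1 [X2 [dX cX2 X0 Xge Xend]]]] := @cube_bump R (l / 4) (3 * l / 4) ltac:(lra).
have bX : bdcont l X by apply: bdcont_continuous => // s; exact: isd_cont (proj1 (dX s)).
have hI : 0 < l / 2 < l by lra.
have rp := weight_gt0 W.
have I1 : 0 < prim l (fun s => rho s * X s) l.
  apply: (@prim_gt0 _ l (fun s => rho s * X s) (l / 2)) => //; first exact: bdcontM.
    by move=> t tI; rewrite mulr_ge0// ltW// rp.
  by rewrite mulr_gt0 ?rp// X0//; lra.
(* Balances the source [- 1] to weighted mean zero, the compatibility condition. *)
pose kp := prim l rho l / prim l (fun s => rho s * X s) l.
have [x [y [K [Hy dx dy]]]] : exists x, neumann l rho (fun s => - 1 + kp * X s) x.
  apply: neumann_exists => //; first by apply: bdcontD; [exact: bdcont_cst|exact: bdcontZ].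
  rewrite (@eq_prim _ l _ (fun s => (-1) * rho s + kp * (rho s * X s))); last by move=> t _; ring.
  have brX := bdcontM brho bX.
  rewrite primD; [|exact: bdcontZ|exact: bdcontZ]; rewrite !primZ//.
  by rewrite mulN1r /kp divfK ?gt_eqF// addNr.
have bF : bdcont l (fun s => -1 + kp * X s) by apply: bdcontD; [exact: bdcont_cst|exact: bdcontZ].
have Nx : neumann l rho (fun s => -1 + kp * X s) x by exists y, K.
have bx := neumann_bdcont W Nx.
have [Xi Xi0 HXi] := bdcont_bound bx; have [B B0 HB] := bdcont_bound bF.
have [Qb Qb0 HQ] := bdcont_bound (rf_bdQ RF).
pose K1 := `|K| + 1; have K10 : 0 < K1 by rewrite ltr_wpDl.
have Hy1 (s : R) : 0 < s < l -> `|y s| <= K1 * Num.min s (l - s).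
  move=> sI; apply: le_trans (Hy s sI) _; rewrite ler_wpM2r ?(ltW (min_gt0 sI))//.
  by rewrite (le_trans (ler_norm _))// lerDl.
(* Near the ends the source of [Zb] is at most [- c0 / 2] times [Zb], and [c0 = 2 (lam - lambda0)]
   turns this factor into [lambda0 - lam]. *)
have [c0 c0E] : exists c0, c0 = 2 * (lam - lambda0) by eexists.
have c00 : 0 < c0 by rewrite c0E mulr_gt0// subr_gt0.
have [dQ /andP[dQ0 dQl] HdQ] := rf_endQ RF.
have p1 : 0 < (2 * c0 * K1 ^+ 2 + 1)^-1 by rewrite invr_gt0 ltr_wpDl// mulr_ge0 ?sqr_ge0// mulr_ge0// ltW.
have [d1 [d10 d1Q d1l d1K]] := lt3_exists dQ0 (divr_gt0 l0 (ltr0Sn R 3)) p1.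
pose d := Num.min d1 1; have d0 : 0 < d by rewrite lt_min d10 ltr01.
have [dd1 dd2] : d <= d1 /\ d <= 1 by rewrite !ge_min !lexx orbT.
have dK : 2 * c0 * K1 ^+ 2 * d ^+ 2 <= 1.
  have q : (2 * c0 * K1 ^+ 2 + 1) * d <= 1.
    rewrite -ler_pdivlMl ?mulr1; first exact: le_trans dd1 (ltW d1K).
    by rewrite -invr_gt0.
  have q2 : d ^+ 2 <= d by rewrite expr2 ler_piMr// ltW.
  have q3 : 0 <= 2 * c0 * K1 ^+ 2 by rewrite mulr_ge0 ?sqr_ge0// mulr_ge0// ltW.
  by apply: aux3 (ler_wpM2l q3 q2) d0; rewrite mulrDl mul1r in q.
have cth : contI l th := derivI_cont (rf_d1 RF).
have ld : l - d < l by rewrite ltrBlDr ltrDl.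
have [tm tm0 Htm] := cont_lower_bound cth (rf_gt0 RF) d0 ld.
pose E := expR (c0 * Xi).
have E0 : 0 < E by exact: expR_gt0.
pose B1 := c0 * B + c0 ^+ 2 * (K1 * l) ^+ 2.
have [w wE] : exists w, w = tm ^+ 2 / E ^+ 2 by eexists.
have w0 : 0 < w by rewrite wE divr_gt0 ?exprn_gt0.
(* Large enough that [th^2 Zb^2 >= C + (B1 + Qb) / lam] on [[d, l - d]], where [ft] is then at most
   [- (B1 + Qb) / lam]. *)
pose N := 1 + (C + (B1 + Qb) / lam) / w.
have B10 : 0 <= B1 by apply: addr_ge0; [rewrite mulr_ge0 ?(ltW c00) ?(ltW B0)|rewrite mulr_ge0 ?sqr_ge0].
have N1 : 1 <= N.
  by rewrite lerDl divr_ge0 ?(ltW w0)// addr_ge0 ?(ltW C0)// divr_ge0 ?(ltW lp)// addr_ge0 ?(ltW Qb0).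
have Np : 0 < N by exact: lt_le_trans N1.
pose Zb (s : R) := N * expR (c0 * x s).
have ZbE (s : R) : 0 < s < l -> N / E <= Zb s <= N * E.
  move=> sI; have := HXi s sI; rewrite ler_norml => /andP[h1 h2].
  rewrite /Zb !ler_wpM2l ?(ltW Np)// -?expRN ler_expR -?mulrN ler_wpM2l// ltW//.
have Zb0 (s : R) : 0 < s < l -> 0 < Zb s by move=> sI; rewrite mulr_gt0// expR_gt0.
exists E^-1; split; first by rewrite invr_gt0.
exists Zb, (fun s => Zb s * (c0 * (-1 + kp * X s) + c0 ^+ 2 * y s ^+ 2)), (N * E); split.
- exists (fun s => Zb s * (c0 * y s)), (N * E * (c0 * `|K|)); split.
  + move=> s sI; have /andP[_ h2] := ZbE s sI; rewrite normrM (gtr0_norm (Zb0 s sI)) normrM (gtr0_norm c00).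
    have h3 : c0 * `|y s| <= c0 * (`|K| * Num.min s (l - s)).
      by rewrite ler_pM2l// (le_trans (Hy s sI))// ler_wpM2r ?(ltW (min_gt0 sI))// ler_norm.
    have -> : N * E * (c0 * `|K|) * Num.min s (l - s) = N * E * (c0 * (`|K| * Num.min s (l - s))) by ring.
    by apply: (ler_pM (ltW (Zb0 s sI)) _ h2 h3); rewrite pmulr_rge0.
  + by move=> s sI; apply: isd_eqd (isdZ N (isd_expR (isdZ c0 (dx s sI)))) _; rewrite mulrA.
  + move=> s sI; have dz : isd Zb s (Zb s * (c0 * y s)).
      by apply: isd_eqd (isdZ N (isd_expR (isdZ c0 (dx s sI)))) _; rewrite mulrA.
    have -> : (fun t => rho t * (Zb t * (c0 * y t))) = (fun t => c0 * (Zb t * (rho t * y t))).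
      by apply/funext => t; ring.
    by apply: isd_eqd (isdZ c0 (isdM dz (dy s sI))) _; ring.
- move=> s sI; have /andP[h1 h2] := ZbE s sI; rewrite h2 andbT (le_trans _ h1)//.
  by rewrite ler_peMl// invr_ge0 ltW.
- move=> s sI; rewrite mulrC ler_wpM2r ?(ltW (Zb0 s sI))// /h.
  set v := th s ^+ 2 * _; have v0 : 0 <= v by rewrite mulr_ge0 ?sqr_ge0.
  have lf : lam * ft v <= lam by rewrite -[leRHS]mulr1 ler_wpM2l ?(ltW lp)// ft_le1.
  have [s0 sl] := andP sI.
  have ysq (e : R) : Num.min s (l - s) <= e -> y s ^+ 2 <= (K1 * e) ^+ 2.
    move=> me; have e0 : 0 <= K1 * e by rewrite mulr_ge0 ?(ltW K10)// (le_trans _ me)// ltW// min_gt0.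
    rewrite -(real_normK (num_real (y s))) ler_sqr ?nnegrE//.
    by apply: le_trans (Hy1 s sI) _; rewrite ler_wpM2l// ltW.
  have near_case : Q s = lambda0 -> X s = 0 -> Num.min s (l - s) <= d ->
      c0 * (-1 + kp * X s) + c0 ^+ 2 * y s ^+ 2 <= Q s - lam * ft v.
    move=> -> -> /ysq yd; rewrite mulr0 addr0.
    have h1 : c0 ^+ 2 * y s ^+ 2 <= c0 * (c0 * (K1 * d) ^+ 2) by rewrite expr2 -mulrA !ler_wpM2l// ltW.
    have h2 : c0 * (c0 * (K1 * d) ^+ 2) <= c0 * (1 / 2).
      by rewrite ler_wpM2l ?(ltW c00)// aux1.
    exact: aux2 c0E (le_trans h1 h2) lf.
  have [sd|ds] := ltP s d.
    apply: near_case.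
    - by have [] := HdQ s; rewrite // s0 (lt_le_trans sd)// (le_trans dd1)// ltW.
    - by have [|-> //] := Xend s; rewrite negb_and -leNgt (le_trans (ltW sd))// (le_trans dd1)// ltW.
    - by rewrite ge_min (ltW sd).
  have [sd|ds'] := ltP (l - d) s.
    have sd' : l - s < d by rewrite ltrBlDr addrC -ltrBlDr.
    apply: near_case.
    - have := HdQ (l - s); rewrite subKr subr_gt0 sl /= => H.
      by have [] // := H _; rewrite (lt_le_trans sd')// (le_trans dd1)// ltW.
    - have [|-> //] := Xend s; rewrite negb_and orbC -leNgt.
      by rewrite (aux4 d1)// ltW// (le_lt_trans _ sd)// lerD2l lerN2.
    - by rewrite ge_min (ltW sd') orbT.
  have h1 : c0 * (-1 + kp * X s) <= c0 * B.
    by rewrite ler_wpM2l ?(ltW c00)// (le_trans (ler_norm _))// HB.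
  have h2 : c0 ^+ 2 * y s ^+ 2 <= c0 ^+ 2 * (K1 * l) ^+ 2.
    by rewrite ler_wpM2l ?sqr_ge0// ysq// (min_le W).
  have h3 : C + (B1 + Qb) / lam <= v.
    have /andP[z1 _] := ZbE s sI.
    have t1 : tm <= th s by rewrite Htm// ds ds'.
    apply: (@le_trans _ _ (N * w)); first by rewrite /N [leRHS]mulrDl mul1r divfK ?gt_eqF// lerDr ltW.
    apply: (@le_trans _ _ (tm ^+ 2 * (N / E) ^+ 2)).
      have -> : tm ^+ 2 * (N / E) ^+ 2 = N ^+ 2 * w by rewrite wE expr_div_n; ring.
      by rewrite ler_wpM2r ?(ltW w0)// expr2 ler_peMr// ltW.
    have NE : 0 <= N / E by rewrite divr_ge0 ?ltW.
    by apply: ler_pM; rewrite ?sqr_ge0//; apply: lerXn2r; rewrite ?nnegrE// ltW// ?(rf_gt0 RF)// Zb0.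
  have Cv : C <= v.
    by apply: le_trans h3; rewrite lerDl divr_ge0 ?(ltW lp)// addr_ge0// ltW.
  have h4 : B1 + Qb <= lam * (v - C).
    by rewrite -ler_pdivrMl// [_^-1 * _]mulrC lerBrDl.
  have := HQ s sI; rewrite ler_norml => /andP[h5 _].
  rewrite (ft_tail Cv); apply: (@le_trans _ _ B1); first exact: lerD.
  by rewrite -[C - v]opprB mulrN opprK; have := lerD h5 h4; rewrite addrC addrK.
Qed.

(** The subsolution is [ep |Y|], with [ep] small enough for the linear growth rate [lam - lambda0]
    to win. Strict positivity is a uniqueness argument: at an interior zero [z] is minimal, so [z]
    and its flux vanish there and hence everywhere, against [ep <= z] near the ends, where
    [|Y| = 1]. *)
Lemma positive_solution : exists z, neumann l rho (fun s => h s (z s) * z s) z /\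
  exists2 c : R, 0 < c & forI l s, c <= z s.
Proof.
have W := rf_weight RF; have l0 := ll0; have lp := lm0.
have [N0 [N00 [Zb [FZ [M [NZ bZ HZ]]]]]] := supersolution.
have [T T0 HT] := bdcont_bound (rf_bd RF); have [Qb Qb0 HQ] := bdcont_bound (rf_bdQ RF).
have bq : 0 < 1 - lambda0 / lam by rewrite subr_gt0 ltr_pdivrMr ?mul1r.
have LT : 0 < Lf * T ^+ 2 by rewrite mulr_gt0// exprn_gt0.
(* Below the supersolution, below 1, and with [Lf T^2 ep <= 1 - lambda0 / lam], so that
   [ft >= lambda0 / lam] along [ep |Y|]. *)
have [ep [ep0 epN ep1 epL]] := lt3_exists N00 ltr01 (divr_gt0 bq LT).
have M0 : 0 < M by have /andP[h1 h2] := bZ _ (@half_in R l l0); exact: lt_le_trans N00 (le_trans h1 h2).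
pose fb := 1 + Lf * (T ^+ 2 * M ^+ 2).
have fb0 : 0 < fb by rewrite ltr_pwDl// mulr_ge0 ?(ltW Lf0)// mulr_ge0 ?sqr_ge0.
have vM (s x : R) : 0 < s < l -> 0 <= x <= M -> 0 <= th s ^+ 2 * x ^+ 2 <= T ^+ 2 * M ^+ 2.
  move=> sI /andP[x0 xM]; rewrite mulr_ge0 ?sqr_ge0//=; apply: ler_pM; rewrite ?sqr_ge0//; apply: lerXn2r;
    rewrite ?nnegrE ?(ltW T0) ?(ltW M0) ?(ltW (rf_gt0 RF sI))//.
  by apply: le_trans (ler_norm _) _; exact: HT.
have ftb (x : R) : 0 <= x <= T ^+ 2 * M ^+ 2 -> `|ft x| <= fb.
  move=> /andP[x0 xM]; rewrite -[ft x](subrK (ft 0)) addrC (le_trans (ler_normD _ _))//.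
  rewrite ft0 normr1 lerD2l -ft0 (le_trans (ft_lip x0 (lexx 0)))// subr0 ger0_norm//.
  by rewrite ler_wpM2l// ltW.
pose k := Qb + lam * (fb + Lf * (T ^+ 2 * (2 * M * M))).
have TM : 0 <= T ^+ 2 * (2 * M * M) by rewrite mulr_ge0 ?sqr_ge0// !mulr_ge0// ltW.
have k0 : 0 < k by rewrite ltr_pwDl// mulr_ge0 ?(ltW lp)// addr_ge0 ?(ltW fb0)// mulr_ge0 ?(ltW Lf0).
have hb (s x : R) : 0 < s < l -> 0 <= x <= M -> `|h s x| <= Qb + lam * fb.
  move=> sI xI; rewrite (le_trans (ler_normB _ _))// lerD ?HQ// normrM (gtr0_norm lp).
  by rewrite ler_wpM2l ?(ltW lp)// ftb// vM.
have mono (s x z : R) : 0 < s < l -> 0 <= x -> x <= z -> z <= M -> (k - h s x) * x <= (k - h s z) * z.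
  move=> sI x0 xz zM; have z0 := le_trans x0 xz.
  have xI : 0 <= x <= M by rewrite x0 (le_trans xz). have zI : 0 <= z <= M by rewrite z0.
  have /andP[vx _] := vM s x sI xI; have /andP[vz _] := vM s z sI zI.
  have L := ft_lip vx vz; have B := ftb _ (vM s z sI zI).
  have Q' := HQ s sI; have tT : th s ^+ 2 <= T ^+ 2.
    by apply: lerXn2r; rewrite ?nnegrE ?(ltW T0) ?(ltW (rf_gt0 RF sI))// (le_trans (ler_norm _) (HT s sI)).
  have D : `|th s ^+ 2 * x ^+ 2 - th s ^+ 2 * z ^+ 2| * x <= T ^+ 2 * (2 * M * M) * (z - x).
    by apply: sqr_diff_bound; rewrite ?sqr_ge0.
  exact: sub_product_mono lp Lf0 x0 xz Q' L B D erefl.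
have bY : neumann l rho (fun s => (Q s - lambda0) * (ep * Y s)) (fun s => ep * Y s).
  by apply: neumann_eq (neumannZ ep (rf_sub RF)) => // s _; rewrite mulrCA.
have epY (s : R) : 0 < s < l -> `|ep * Y s| <= ep.
  by move=> sI; rewrite normrM (gtr0_norm ep0) ler_piMr ?(ltW ep0)// (rf_Y RF).
have ZM (s : R) : 0 < s < l -> `|ep * Y s| <= Zb s <= M.
  move=> sI; have /andP[h1 h2] := bZ s sI; rewrite h2 andbT (le_trans (epY s sI))//.
  by rewrite (le_trans _ h1)// ltW.
have sub (s : R) : 0 < s < l -> ep * Y s != 0 -> h s `|ep * Y s| <= Q s - lambda0.
  move=> sI _; rewrite lerD2l lerN2 real_normK ?num_real//.
  set v := th s ^+ 2 * _; have v0 : 0 <= v by rewrite mulr_ge0 ?sqr_ge0.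
  have vb : v <= T ^+ 2 * ep.
    rewrite /v -exprMn; apply: (@le_trans _ _ ((T * ep) ^+ 2)).
      rewrite -(real_normK (num_real (th s * _))); apply: lerXn2r; rewrite ?nnegrE ?mulr_ge0 ?(ltW T0) ?(ltW ep0)//.
      by rewrite normrM ler_pM ?HT ?epY.
    by rewrite exprMn ler_wpM2l ?sqr_ge0// expr2 ler_piMr// ltW.
  have f1 : 1 - Lf * v <= ft v.
    by have := ft_lip (lexx 0) v0; rewrite ft0 sub0r normrN (ger0_norm v0) => /ler_normlP[_]; lra.
  have f2 : Lf * v <= 1 - lambda0 / lam.
    apply: (@le_trans _ _ (Lf * T ^+ 2 * ep)); first by rewrite -mulrA ler_wpM2l// ltW.
    by rewrite -ler_pdivlMl// mulrC ltW.
  have : lambda0 / lam <= ft v by lra.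
  by rewrite ler_pdivrMr// mulrC.
have kh (s x : R) : 0 < s < l -> 0 <= x <= M -> (k - h s x) * x <= (k + (Qb + lam * fb)) * M.
  move=> sI xI; apply: le_trans (ler_norm _) _; rewrite normrM ler_pM//; last by rewrite ger0_norm; case/andP: xI.
  by rewrite (le_trans (ler_normB _ _))// (gtr0_norm k0) lerD2l hb.
have [z [Nz bz]] := sub_super_solution W k0 mono
  (fun z bz' _ => bdcontM (bdcontB (bdcont_cst l k) (bdcont_h bz')) bz') kh bY sub NZ ZM HZ.
exists z; split=> //; have bzc := neumann_bdcont W Nz.
have z0 (s : R) : 0 < s < l -> 0 <= z s by move=> /bz/andP[h1 _]; exact: le_trans h1.
have [dY /andP[dY0 dYl] HY] := rf_endY RF.
have zend (s : R) : 0 < s < l -> `|Y s| = 1 -> ep <= z s.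
  by move=> sI Y1; have /andP[+ _] := bz s sI; rewrite normrM Y1 mulr1 gtr0_norm.
have rp := weight_gt0 W.
have zp (s : R) : 0 < s < l -> 0 < z s.
  move=> sI; rewrite lt_neqAle z0// andbT eq_sym; apply/eqP => zs.
  have [y [K [Hy dz dy]]] := Nz.
  have ys : y s = 0.
    have := @derive1_at_min R z 0 l s (ltW l0) _ _ _.
    move=> H; apply: (isd_uniq (dz s sI)); apply: H.
    - by move=> t; rewrite in_itv /= => tI; case: (dz t tI).
    - by rewrite in_itv.
    - by move=> t; rewrite in_itv /= => tI; rewrite zs z0.
  have d2I : 0 < dY / 2 < dY by exact: half_in.
  have tI : 0 < dY / 2 < l by case/andP: d2I => -> h1; exact: lt_trans dYl.
  have [Y1 _] := HY _ d2I.
  have crho (t : R) : 0 < t < l -> {for t, continuous rho} by move=> tI'; exact: (proj1 (weight_bd W)).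
  (* The equation is read as a linear system for [z] and its flux, with the coefficient [h t (z t)]
     frozen. *)
  have := zend _ tI Y1; rewrite (@lin2_uniq _ z (fun t => rho t * y t) (fun=> 0) (fun t => (rho t)^-1)
    (fun t => rho t * h t (z t)) (fun=> 0) l _ _ _ s sI zs _ (dY / 2) tI); first by rewrite leNgt ep0.
  - by move=> t tI'; rewrite mul0r add0r mulKf ?gt_eqF ?rp//; exact: dz.
  - by move=> t tI'; rewrite mul0r addr0 -mulrA; exact: dy.
  - move=> t tI'; split; try exact: cvg_cst.
      by apply: continuousV; [rewrite gt_eqF// rp|exact: crho].
    by apply: continuousM; [exact: crho|exact: (proj1 (bdcont_h bzc))].
  - by rewrite ys mulr0.
have d20 : 0 < dY / 2 by exact: divr_gt0.
have lp2 : l - dY / 2 < l by rewrite ltrBlDr ltrDl.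
have [c c0 Hc] := cont_lower_bound (proj1 bzc) zp d20 lp2.
exists (Num.min c ep); first by rewrite lt_min c0.
move=> s /[dup] sI /andP[s0 sl]; rewrite ge_min.
have [h1|h1] := ltP s dY; first by rewrite zend ?orbT//; have [] := HY s; rewrite // s0.
have [h2|h2] := ltP (l - dY) s.
  have := HY (l - s); rewrite subKr subr_gt0 sl ltrBlDr addrC -ltrBlDr h2 => /(_ isT)[_ Y1].
  by rewrite zend ?orbT.
by rewrite Hc// half_le//= (le_trans h2)// lerD2l lerN2 half_le.
Qed.

Lemma robin_product_le0 (v v1 : R) : alpha1 * v + alpha2 * v1 = 0 -> v * v1 <= 0.
Proof.
move=> E; have [a20|a20] := eqVneq alpha2 0.
  have a10 : alpha1 != 0 by apply/eqP => h0; apply: al12.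
  by move/eqP: E; rewrite a20 mul0r addr0 mulf_eq0 (negPf a10) => /eqP ->; rewrite mul0r.
have p2 : 0 < alpha2 by rewrite lt_neqAle eq_sym a20.
have E1 : alpha2 * v1 = - (alpha1 * v) by apply/eqP; rewrite -addr_eq0 addrC E.
by rewrite -(pmulr_rle0 _ p2) mulrCA E1 mulrN oppr_le0 mulrCA mulr_ge0// -expr2 sqr_ge0.
Qed.

(* The flux [a u u' ((u^2 - C)_+)^2] is nondecreasing along solutions, vanishes
   at the poles and has the favourable sign at a Robin boundary. *)
Lemma solution_bound (z : R -> R) : neumann l rho (fun s => h s (z s) * z s) z ->
  (forI l s, 0 < z s) -> forI l s, th s ^+ 2 * z s ^+ 2 <= C.
Proof.
move=> Nz z0; have l0 := ll0; have lp := lm0; have W0 := rf_weight RF; have Cp := C0.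
have bz := neumann_bdcont W0 Nz; have [M M0 HM] := bdcont_bound bz.
have [y [K [Hy dz dy]]] := Nz.
pose u (s : R) := th s * z s; pose u1 (s : R) := th1 s * z s + th s * y s.
have du : derivI l u u1 by move=> s sI; exact: isdM (rf_d1 RF sI) (dz s sI).
pose w (s : R) := u s ^+ 2 - C.
have dw (s : R) : 0 < s < l -> isd w s (2 * u s * u1 s).
  by move=> sI; apply: isd_eqd (isdB (isd_sqr (du s sI)) (isd_cst C s)) _; rewrite subr0.
pose b (s : R) := m%:R ^+ 2 / a s ^+ 2 - lam * ft (u s ^+ 2).
have dG (s : R) : 0 < s < l -> isd (fun s => a s * u1 s) s (a s * b s * u s).
  move=> sI; have t0 := rf_gt0 RF sI; have a0 := pf_gt0 P sI.
  apply: (@isd_near _ (fun s => a s * th1 s * z s + (rho s * y s) / th s)).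
    near=> t; have tI : 0 < t < l by near: t; exact: near_in.
    by rewrite /u1; field; rewrite gt_eqF// (rf_gt0 RF).
  have tn : th s != 0 by rewrite gt_eqF.
  apply: isd_eqd (isdD (isdM (isdM (pf_isd P sI) (rf_d2 RF sI)) (dz s sI)) (isd_div tn (dy s sI) (rf_d1 RF sI))) _.
  by rewrite (rf_ode RF sI) /b /h /u exprMn; field; rewrite tn gt_eqF.
pose D (s : R) := a s * u1 s * (u s * possq (w s)).
pose D' (s : R) := a s * ((b s * u s ^+ 2 + u1 s ^+ 2) * possq (w s) + 4 * (u s * u1 s) ^+ 2 * Num.max (w s) 0).
have dD : derivI l D D'.
  move=> s sI; apply: isd_eqd (isdM (dG s sI) (isdM (du s sI) (isd_comp (dw s sI) (isd_possq _)))) _.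
  by rewrite /D'; ring.
have D'ge (s : R) : 0 < s < l -> 0 <= D' s /\ (0 < w s -> 0 < D' s).
  move=> sI; have a0 := pf_gt0 P sI; rewrite /D'; have [ws|ws] := leP (w s) 0.
    by rewrite /possq (max_idPr ws) expr0n !mulr0 addr0 mulr0.
  have us : C <= u s ^+ 2 by rewrite -subr_ge0 ltW.
  have b0 : 0 < b s.
    rewrite /b (ft_tail us) -[C - _]opprB mulrN opprK ltr_wpDl//; first by rewrite divr_ge0 ?sqr_ge0.
    by rewrite mulr_gt0.
  have p0 : 0 < possq (w s) by rewrite /possq (max_idPl (ltW ws)) exprn_gt0.
  have us0 : 0 < u s ^+ 2 by exact: lt_le_trans us.
  suff : 0 < a s * ((b s * u s ^+ 2 + u1 s ^+ 2) * possq (w s) + 4 * (u s * u1 s) ^+ 2 * w s) by move=> h1; split=> //; exact: ltW.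
  rewrite mulr_gt0// ltr_pwDl//.
    by rewrite mulr_gt0// ltr_pwDl ?sqr_ge0// mulr_gt0.
  by rewrite mulr_ge0 ?(ltW ws)// mulr_ge0// sqr_ge0.
(* Where [th^2 <= C / M^2] the density [u^2] is at most [C] and the flux [D] vanishes; this settles
   every pole. *)
have van (t : R) : 0 < t < l -> th t ^+ 2 <= C / M ^+ 2 -> D t = 0.
  move=> tI tC; rewrite /D /possq (max_idPr _) ?expr0n ?mulr0// subr_le0 /u exprMn.
  rewrite -ler_pdivlMr ?exprn_gt0 ?z0//; apply: le_trans tC _.
  rewrite ler_wpM2l ?(ltW Cp)// lef_pV2 ?posrE ?exprn_gt0 ?z0//.
  by apply: lerXn2r; rewrite ?nnegrE ?(ltW M0) ?(ltW (z0 t tI))// (le_trans (ler_norm _) (HM t tI)).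
have CM : 0 < C / M ^+ 2 by rewrite divr_gt0 ?exprn_gt0.
have mono (s t : R) : 0 < s -> s <= t -> t < l -> D s <= D t.
  by move=> s0 st tl; apply: (isd_ndecr dD (fun r rI => proj1 (D'ge r rI)) s0 st tl).
have Dge (s : R) : 0 < s < l -> 0 <= D s.
  move=> /andP[s0 sl]; have [d /andP[d0 dl] Hd] := rf_vanish0 RF CM.
  have [t [t0 td ts _]] := lt3_exists d0 s0 l0.
  have Dt : D t = 0 by apply: van; [rewrite t0 (lt_trans td)|rewrite Hd// t0].
  by rewrite -Dt mono// ltW.
have Dend (e : R) : 0 < e -> exists2 d : R, 0 < d < l & forI d t, D (l - t) <= e.
  move=> e0; have [al|al] := eqVneq (a l) 0.
    have [d dI Hd] := rf_vanish1 RF al CM; exists d => // t td.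
    have tI : 0 < t < l by case/andP: dI => _ dl; case/andP: td => -> /lt_trans; apply.
    by rewrite van ?Hd ?refl_itv// ltW.
  have [VL [V1L [M1 [d1 [/andP[d10 d1l] Hb HL rob _]]]]] := rf_boundary RF al.
  have [al0 [d2 /andP[d20 d2l] aD]] := pf_boundary P al.
  (* At a boundary [u u1] is at most of order [t], since its limit is a square times this
     nonpositive product of the Robin data. *)
  have vv := robin_product_le0 rob.
  have M10 : 0 <= M1 by have [h1 _ _] := Hb _ (@half_in R d1 d10); exact: le_trans h1.
  pose K2 := M ^+ 2 * (M1 * (M1 + `|VL|)) + M1 ^+ 2 * M * `|K|.
  have K20 : 0 <= K2.
    by rewrite addr_ge0// ?mulr_ge0 ?sqr_ge0 ?addr_ge0// ltW.
  pose K3 := 2 * a l * K2 * ((M1 * M) ^+ 2) ^+ 2.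
  have K30 : 0 <= K3 by rewrite !mulr_ge0 ?sqr_ge0// ltW.
  have K31 : 0 < K3 + 1 by rewrite ltr_wpDl.
  have [d [d0 dd1 dd2 de]] := lt3_exists d10 d20 (divr_gt0 e0 K31).
  exists d; first by rewrite d0 (lt_trans dd1).
  move=> t /andP[t0 td]; have t1 : 0 < t < d1 by rewrite t0 (lt_trans td).
  have tI : 0 < l - t < l by apply: refl_itv; rewrite t0 (lt_trans (proj2 (andP t1))).
  have [b1 b2 _] := Hb _ t1; have [c1 c2] := HL _ t1.
  have /andP[_ a2] : a l / 2 <= a (l - t) <= 2 * a l by apply: aD; rewrite t0 (lt_trans td).
  have zM := HM _ tI.
  have yK : `|y (l - t)| <= `|K| * t.
    have m0 := ltW (min_gt0 tI); apply: le_trans (Hy _ tI) _; apply: le_trans (ler_wpM2r m0 (ler_norm K)) _.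
    by rewrite ler_wpM2l// ge_min subKr lexx orbT.
  have uu : u (l - t) * u1 (l - t) <= K2 * t.
    apply: robin_flux_bound b1 b2 c1 c2 zM yK vv => //; exact: ltW.
  have up : possq (w (l - t)) <= ((M1 * M) ^+ 2) ^+ 2.
    apply: lerXn2r; rewrite ?nnegrE ?sqr_ge0 ?le_max ?lexx ?orbT//= ge_max sqr_ge0 andbT.
    rewrite lerBlDr; apply: (@le_trans _ _ ((M1 * M) ^+ 2)); last by rewrite lerDl ltW.
    rewrite -(real_normK (num_real (u _))); apply: lerXn2r; rewrite ?nnegrE ?mulr_ge0 ?(ltW M0)//.
    by rewrite normrM ler_pM.
  have a0 := pf_gt0 P tI.
  have -> : D (l - t) = a (l - t) * (u (l - t) * u1 (l - t)) * possq (w (l - t)) by rewrite /D; ring.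
  apply: (@le_trans _ _ (K3 * t)); last first.
    apply: (@le_trans _ _ ((K3 + 1) * t)); first by rewrite ler_wpM2r ?lerDl// ltW.
    by rewrite -ler_pdivlMl// mulrC ltW// (lt_trans td).
  apply: (@le_trans _ _ (a (l - t) * (K2 * t) * possq (w (l - t)))).
    by rewrite ler_wpM2r ?sqr_ge0// ler_wpM2l// ltW.
  have -> : K3 * t = 2 * a l * (K2 * t) * ((M1 * M) ^+ 2) ^+ 2 by rewrite /K3; ring.
  have Kt : 0 <= K2 * t by rewrite mulr_ge0// ltW.
  by apply: ler_pM => //; [exact: mulr_ge0 (ltW a0) Kt|exact: sqr_ge0|exact: ler_wpM2r].
have D0 (s : R) : 0 < s < l -> D s = 0.
  move=> sI; apply/eqP; rewrite eq_le Dge// andbT; apply/ler_addgt0Pr => e e0; rewrite add0r.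
  have [d /andP[d0 dl] Hd] := Dend e e0; have [s0 sl] := andP sI.
  have ls0 : 0 < l - s by rewrite subr_gt0.
  have [t [t0 td ts _]] := lt3_exists d0 ls0 l0.
  apply: le_trans (Hd t _); last by rewrite t0.
  by apply: mono => //; [rewrite lerBrDl -lerBrDr ltW|rewrite ltrBlDr ltrDl].
move=> s sI; rewrite leNgt; apply/negP => Cs.
have ws : 0 < w s by rewrite /w /u exprMn subr_gt0.
have D1 : isd D s 0.
  apply: (@isd_near _ (fun _ : R => 0 : R)).
  by near=> t; rewrite D0//; near: t; exact: near_in.
by have := proj2 (D'ge s sI) ws; rewrite (isd_uniq (dD s sI) D1) ltxx.
Unshelve. all: by end_near. Qed.

End GroundState.

(** * Uniformity of the reaction near b = 0 *)

Section Nonlinearity.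
Context {R : realType} (d : nat).
Notation vec := 'rV[R]_d.
Implicit Types (g f : R -> vec -> R) (b v : vec).

Definition nonneg_continuous g :=
  {within `[0, +oo[ `*` setT, continuous (fun z : R * vec => g z.1 z.2)}.

Lemma nonneg_continuous_eps g (x e : R) : nonneg_continuous g -> 0 <= x -> 0 < e ->
  exists2 r : R, 0 < r & forall (y : R) b, 0 <= y -> `|x - y| < r -> (forall i, `|b ord0 i| < r) ->
    `|g x 0 - g y b| <= e.
Proof.
move=> /subspace_continuousP cg x0 e0.
have D : (`[0, +oo[ `*` setT) (x, 0 : vec) by split=> //=; rewrite in_itv /= x0.
have /cvgrPdist_le/(_ e e0) := cg _ D.
move=> /nbhs_ballP[r r0 H]; exists r => // y b y0 xy br.
have := H (y, b); apply; last by split=> //=; rewrite in_itv /= y0.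
split=> //; split=> // i j; rewrite !mxE /ball /= sub0r normrN ord1; exact: br.
Qed.

(** Only [y] ranges over a compact set while [b] stays near 0, so compactness of [[0, M]] suffices
    for a uniform radius; the second point [y'] may leave [[0, M]]. *)
Lemma tube g (M e : R) : nonneg_continuous g -> 0 < e ->
  exists2 r : R, 0 < r & forall (y y' : R) b, 0 <= y <= M -> 0 <= y' -> `|y - y'| <= r ->
    (forall i, `|b ord0 i| <= r) -> `|g y 0 - g y' b| <= e.
Proof.
move=> cg e0; have /compact_near_coveringP K := @segment_compact R 0 M.
have e20 : 0 < e / 2 by rewrite divr_gt0.
pose Pr (r y : R) := 0 <= y -> forall (y' : R) b, 0 <= y' -> `|y - y'| <= r ->
  (forall i, `|b ord0 i| <= r) -> `|g y 0 - g y' b| <= e.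
have : \forall r \near (0 : R)^'+, `[0, M] `<=` Pr r.
  apply: K => x; rewrite /= in_itv /= => /andP[x0 _].
  have [r r0 H] := nonneg_continuous_eps cg x0 e20.
  have r20 : 0 < r / 2 by rewrite divr_gt0.
  near=> y t => y0 y' b y'0 yy' bt.
  have ty : t < r / 2 by near: t; exact: nbhs_right_lt.
  have xy : `|x - y| < r / 2 by near: y; apply: cvgr_dist_lt => //; exact: cvg_id.
  have tr : r / 2 < r by rewrite ltr_pdivrMr// ltr_pMr// ltr1n.
  rewrite -(subrK (g x 0) (g y 0)) -addrA [e]splitr (le_trans (ler_normD _ _))// lerD//.
    rewrite distrC; apply: (H y 0 y0 (lt_trans xy tr)) => i; by rewrite mxE normr0.
  apply: (H y' b y'0) => [|i]; last exact: le_lt_trans (bt i) (lt_trans ty tr).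
  rewrite [r]splitr -(subrK y x) -addrA; apply: le_lt_trans (ler_normD _ _) _.
  by rewrite ltrD// (le_lt_trans yy').
move=> /nbhs_ballP[r r0 H]; have r20 : 0 < r / 2 by rewrite divr_gt0.
have rb : ball (0 : R) r (r / 2) by rewrite /ball /= sub0r normrN gtr0_norm// ltr_pdivrMr// ltr_pMr// ltr1n.
exists (r / 2) => // y y' b yI; have yI' : `[0, M]%classic y by rewrite /= in_itv.
by apply: (H _ rb r20 y yI'); case/andP: yI.
Unshelve. all: by end_near. Qed.

(** The interval is crossed in steps of length [r], along each of which [g] varies by at most 1. *)
Lemma nonneg_continuous_bound g (M : R) : nonneg_continuous g ->
  exists2 B : R, 0 < B & forall y : R, 0 <= y <= M -> `|g y 0| <= B.
Proof.
move=> cg; have [r r0 H] := @tube g M 1 cg ltr01.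
have step (n : nat) (y : R) : 0 <= y <= M -> y <= n%:R * r -> `|g y 0| <= `|g 0 0| + n%:R.
  elim: n y => [|n IH] y /andP[y0 yM] yn.
    by have -> : y = 0; [apply/eqP; rewrite eq_le y0 andbT (le_trans yn)// mul0r|rewrite addr0].
  pose y' := Num.max 0 (y - r); have y'0 : 0 <= y' by rewrite le_max lexx.
  have y'y : y' <= y by rewrite ge_max y0 lerBlDr lerDl ltW.
  have h1 : `|g y' 0| <= `|g 0 0| + n%:R.
    apply: IH; first by rewrite y'0 (le_trans y'y).
    rewrite ge_max mulr_ge0 ?(ltW r0)//= lerBlDr; apply: le_trans yn _.
    by rewrite -natr1 mulrDl mul1r.
  have h2 : `|g y 0 - g y' 0| <= 1.
    apply: H => //; [by rewrite y0|rewrite ger0_norm ?subr_ge0//|by move=> i; rewrite mxE normr0 ltW].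
    by rewrite lerBlDr -lerBlDl /y' le_max lexx orbT.
  rewrite -(subrK (g y' 0) (g y 0)) -natr1 addrA [leRHS]addrC.
  by apply: le_trans (ler_normD _ _) _; exact: lerD.
pose n := (Num.bound (M / r)); exists (`|g 0 0| + n%:R + 1) => [|y yI]; first by rewrite ltr_wpDl// addr_ge0.
have yn : y <= n%:R * r.
  case/andP: yI => y0 yM; rewrite -ler_pdivrMr//.
  apply: (@le_trans _ _ (M / r)); first by rewrite ler_wpM2r// invr_ge0 ltW.
  by apply/ltW/archi_boundP; rewrite divr_ge0 ?(ltW r0)// (le_trans y0).
by apply: le_trans (step n y yI yn) _; rewrite lerDl.
Qed.

Lemma coord_le_enorm b (i : 'I_d) : `|b ord0 i| <= enorm b.
Proof.
rewrite /enorm -sqrtr_sqr ler_wsqrtr// (bigD1 i)//= lerDl sumr_ge0// => j _; exact: sqr_ge0.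
Qed.

Lemma sum_coord_le b : \sum_i `|b ord0 i| <= d%:R * enorm b.
Proof.
apply: (@le_trans _ _ (\sum_(i < d) enorm b)); first by apply: ler_sum => i _; exact: coord_le_enorm.
by rewrite sumr_const card_ord mulr_natl.
Qed.

Lemma isd_db (i : 'I_d) f (y t : R) v : (forall b, derivable (f y) b (delta_mx ord0 i)) ->
  isd (fun t => f y (v + t *: delta_mx ord0 i)) t (db i f y (v + t *: delta_mx ord0 i)).
Proof.
move=> /(_ (v + t *: delta_mx ord0 i)) df; apply: isd_cvg.
have -> : (fun h => h^-1 * (f y (v + (t + h) *: delta_mx ord0 i) - f y (v + t *: delta_mx ord0 i))) =
  (fun h => h^-1 *: ((f y \o shift (v + t *: delta_mx ord0 i)) (h *: delta_mx ord0 i) - f y (v + t *: delta_mx ord0 i))).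
  by apply/funext => h /=; rewrite scalerDl addrA (addrC (v + _)).
exact: df.
Qed.

(* First-order expansion at [b = 0], uniform for bounded [y]; the coordinates of
   [b] are switched on one at a time since only partial derivatives are given. *)
Lemma first_order f (M e : R) : (forall i y b, 0 <= y -> derivable (f y) b (delta_mx ord0 i)) ->
  (forall i, nonneg_continuous (db i f)) -> 0 < e ->
  exists2 r : R, 0 < r & forall (y : R) b, 0 <= y <= M -> \sum_i `|b ord0 i| <= r ->
    `|f y b - f y 0 - \sum_i b ord0 i * db i f y 0| <= e * \sum_i `|b ord0 i|.
Proof.
move=> df cf e0.
have [r r0 H] : exists2 r : R, 0 < r & forall (i : 'I_d) (y : R) b, 0 <= y <= M ->
    (forall j, `|b ord0 j| <= r) -> `|db i f y 0 - db i f y b| <= e.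
  have /choice[rr Hr] : forall i : 'I_d, exists r : R, 0 < r /\ forall (y : R) b, 0 <= y <= M ->
      (forall j, `|b ord0 j| <= r) -> `|db i f y 0 - db i f y b| <= e.
    move=> i; have [r r0 H] := tube M (cf i) e0; exists r; split=> // y b yI br.
    by apply: H => //; [case/andP: yI|rewrite subrr normr0 ltW].
  exists (\big[Num.min/1]_i rr i); first by apply: (big_ind (fun x : R => 0 < x)) => // [x y x0 y0|i _]; [rewrite lt_min x0|case: (Hr i)].
  by move=> i y b yI br; apply: (proj2 (Hr i)) => // j; apply: le_trans (br j) _; exact: bigmin_le.
have r2 : 0 < r / 2 by rewrite divr_gt0.
exists (r / 3) => [|y b yI]; first by rewrite divr_gt0.
have y0 : 0 <= y by case/andP: yI.
pose bs (s : seq 'I_d) := \sum_(i <- s) b ord0 i *: delta_mx ord0 i : vec.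
have main (s : seq 'I_d) : \sum_(i <- s) `|b ord0 i| <= r / 3 ->
    `|f y (bs s) - f y 0 - \sum_(i <- s) b ord0 i * db i f y 0| <= e * \sum_(i <- s) `|b ord0 i|.
  elim: s => [|k s IH]; first by rewrite /bs !big_nil subrr subr0 normr0 mulr0.
  rewrite /bs !big_cons -/(bs s) => hs.
  have hs' : \sum_(i <- s) `|b ord0 i| <= r / 3 by apply: le_trans hs; rewrite lerDr.
  have hk : `|b ord0 k| <= r / 3 by apply: le_trans hs; rewrite lerDl sumr_ge0.
  have cs (j : 'I_d) : `|bs s ord0 j| <= r / 3.
    apply: le_trans hs'; rewrite /bs summxE; apply: le_trans (ler_norm_sum _ _ _) _.
    apply: ler_sum => i _; rewrite !mxE eqxx normrM /=; case: (j == i); rewrite /= ?normr1 ?normr0 ?mulr1 ?mulr0//.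
  have dphi (t : R) : - (r / 2) < t < r / 2 -> isd (fun t => f y (bs s + t *: delta_mx ord0 k) - db k f y 0 * t) t
      (db k f y (bs s + t *: delta_mx ord0 k) - db k f y 0).
    move=> _; apply: isd_eqd (isdB (isd_db _ _ (fun b => df k y b y0)) (isdZ _ (isd_id t))) _.
    by rewrite mulr1.
  have bphi (t : R) : - (r / 2) < t < r / 2 -> `|db k f y (bs s + t *: delta_mx ord0 k) - db k f y 0| <= e.
    move=> tI; rewrite distrC; apply: H => // j.
    rewrite !mxE eqxx /=; apply: le_trans (ler_normD _ _) _.
    have tn : `|t| <= r / 2 by rewrite ler_norml; case/andP: tI => h1 h2; rewrite !ltW.
    have := cs j; rewrite normrM; case: (j == k); rewrite /= ?normr1 ?normr0 ?mulr1 ?mulr0; lra.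
  have kI : - (r / 2) < b ord0 k < r / 2 by move: hk r0; clear; rewrite ler_norml; lra.
  have zI : - (r / 2) < 0 < r / 2 by lra.
  have := isd_lip dphi bphi kI zI; rewrite scale0r !addr0 mulr0 !subr0 => h1.
  rewrite mulrDr [_ *: _ + _]addrC; apply: le_trans (lerD h1 (IH hs')); apply: le_trans (ler_normD _ _).
  apply: le_of_eq; congr (`|_|); ring.
move=> hb; have := main (index_enum 'I_d) hb.
by rewrite /bs -(row_sum_delta b).
Qed.

End Nonlinearity.
Lemma close_gt0 {R : realType} (u v : R) : 0 < u -> `|u - v| <= u / 2 -> 0 < v.
Proof. by move=> u0; rewrite ler_norml => /andP[_ h]; lra. Qed.

Lemma close_lt0 {R : realType} (u v : R) : u < 0 -> `|u - v| <= - u / 2 -> v < 0.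
Proof. by move=> u0; rewrite ler_norml => /andP[h _]; lra. Qed.

(** * Consequences of (A1) and (A2) *)

Section Reaction.
Context {R : realType} (d : nat) (fR fI : R -> 'rV[R]_d -> R) (C : R).
Hypotheses (hR : classC 3 fR) (hI : classC 3 fI) (hA1 : A1 fR fI C) (hA2 : A2 fR C).
Implicit Types f : R -> 'rV[R]_d -> R.

Lemma classC_continuous f : classC 3 f -> [/\ nonneg_continuous f, nonneg_continuous (dy f) &
  forall i, nonneg_continuous (db i f)].
Proof. by move=> [cf [_ [cdy _] H]]; split; [exact: cf|exact: cdy|move=> i; have [_ [+ _]] := H i]. Qed.

Lemma classC_derivable_b f i y b : classC 3 f -> 0 <= y -> derivable (f y) b (delta_mx ord0 i).
Proof. by move=> [_ [_ _ H]] y0; have [+ _] := H i; apply. Qed.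

Lemma isd_dy f b (y : R) : classC 3 f -> 0 < y -> isd (fun y => f y b) y (dy f y b).
Proof.
move=> [_ [df _ _]] y0; apply: isd_deriv_in; last exact: df.
by near=> x; rewrite /= in_itv /= andbT ltW//; near: x; exact: lt_nbhsr.
Unshelve. all: by end_near. Qed.

Lemma nonneg_continuous_pt f (x e : R) : nonneg_continuous f -> 0 <= x -> 0 < e ->
  exists2 r : R, 0 < r & forall y : R, 0 <= y -> `|x - y| < r -> `|f x 0 - f y 0| <= e.
Proof.
move=> cf x0 e0; have [r r0 H] := nonneg_continuous_eps cf x0 e0.
by exists r => // y y0 xy; apply: H => // i; rewrite mxE normr0.
Qed.

(** Two-sided derivatives of the reaction are available only for [y > 0], so estimates on closed
    intervals are proved between slightly inner points. *)
Lemma inner_points f (x y e : R) : nonneg_continuous f -> 0 <= x -> x < y -> 0 < e ->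
  exists x' y', [/\ x < x', x' < y', y' < y, `|f x 0 - f x' 0| <= e & `|f y 0 - f y' 0| <= e].
Proof.
move=> cf x0 xy e0; have y0 : 0 < y by exact: le_lt_trans xy.
have [r r0 H] := nonneg_continuous_pt cf x0 e0; have [r' r'0 H'] := nonneg_continuous_pt cf (ltW y0) e0.
have xy0 : 0 < (y - x) / 2 by rewrite divr_gt0// subr_gt0.
have [t [t0 tr tr' txy]] := lt3_exists r0 r'0 xy0.
have h1 : x < x + t by rewrite ltrDl.
have h2 : x + t < y - t by lra.
have h3 : y - t < y by rewrite ltrBlDr ltrDl.
exists (x + t), (y - t); split=> //.
  by apply: H; [rewrite addr_ge0// ltW|rewrite opprD addNKr normrN gtr0_norm].
by apply: H'; [rewrite ltW// (le_lt_trans _ h2)// addr_ge0// ltW|rewrite subKr gtr0_norm].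
Qed.

Let C0 : 0 < C. Proof. by case: hA1. Qed.
Let cR := classC_continuous hR.
Let df (p q t : R) : 0 <= p -> p < t < q -> isd (fun y => fR y 0) t (dy fR t 0).
Proof. by move=> p0 /andP[pt _]; apply: isd_dy => //; exact: le_lt_trans pt. Qed.

Lemma reaction_nonincreasing (x y : R) : 0 <= x -> x <= y -> y <= C -> fR y 0 <= fR x 0.
Proof.
move=> x0; rewrite le_eqVlt => /predU1P[->//|xy] yC; have [cf _ _] := cR.
apply/ler_addgt0Pr => e e0; have e20 : 0 < e / 2 by rewrite divr_gt0.
have [x' [y' [xx' xy' yy']]] := inner_points cf x0 xy e20; rewrite !ler_norml => /andP[h1 _] /andP[_ h2].
have [_ dneg] := hA2; have x'0 : 0 < x' by exact: le_lt_trans xx'.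
have := isd_nincr (fun t => @df 0 C t (lexx 0)) dneg x'0 (ltW xy') (lt_le_trans yy' yC).
by move: h1 h2; lra.
Qed.

Lemma reaction_lip : exists2 B : R, 0 < B & forall x y : R, 0 <= x <= C -> 0 <= y <= C ->
  `|fR x 0 - fR y 0| <= B * `|x - y|.
Proof.
have [cf cd _] := cR; have [B B0 HB] := nonneg_continuous_bound C cd; exists B => // x y.
wlog xy : x y / x < y.
  move=> H xI yI; case: (ltgtP x y) => [h|h|->]; [exact: H| |by rewrite !subrr normr0 mulr0].
  by rewrite distrC [`|x - y|]distrC H.
move=> /andP[x0 _] /andP[_ yC]; apply/ler_addgt0Pr => e e0; have e20 : 0 < e / 2 by rewrite divr_gt0.
have [x' [y' [xx' xy' yy' h1 h2]]] := inner_points cf x0 xy e20.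
have bd (t : R) : 0 < t < C -> `|dy fR t 0| <= B by move=> /andP[t0 tC]; rewrite HB// !ltW.
have x'0 : 0 < x' by exact: le_lt_trans xx'.
have x'I : 0 < x' < C by rewrite x'0 (lt_trans xy')// (lt_le_trans yy').
have y'I : 0 < y' < C by rewrite (lt_trans x'0 xy') (lt_le_trans yy').
have h3 := isd_lip (fun t => @df 0 C t (lexx 0)) bd x'I y'I.
have h4 : `|x' - y'| <= `|x - y| by rewrite !ltr0_norm ?subr_lt0//; move: xx' yy'; lra.
have h5 : `|fR x' 0 - fR y' 0| <= B * `|x - y| by rewrite (le_trans h3)// ler_wpM2l// ltW.
have -> : fR x 0 - fR y 0 = (fR x' 0 - fR y' 0) + ((fR x 0 - fR x' 0) - (fR y 0 - fR y' 0)) by ring.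
apply: le_trans (ler_normD _ _) _; apply: lerD => //.
by rewrite [e]splitr; apply: le_trans (ler_normB _ _) _; exact: lerD.
Qed.

(** The derivative at 0 is negative, so the reaction drops strictly below 1 at once; monotonicity
    keeps it there. *)
Lemma reaction_lt1 (y : R) : 0 < y <= C -> fR y 0 < 1.
Proof.
move=> /andP[y0 yC]; have [f01 _ _ _ _] := hA1; have [d0 _] := hA2; have [_ [dF _ _]] := hR.
have D0 : [set` `[0, +oo[%R] (0 : R) by rewrite /= in_itv /= lexx.
have e0 : 0 < - dy fR 0 0 / 2 by rewrite divr_gt0// oppr_gt0.
have [r r0 H] := diffq_in_eps (deriv_in_cvg (dF 0) D0) e0.
have [t [t0 tr ty _]] := lt3_exists r0 y0 y0.
have tD : [set` `[0, +oo[%R] t by rewrite /= in_itv /= andbT ltW.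
have := H t tD; rewrite gt_eqF// sub0r normrN gtr0_norm// subr0 f01 => /(_ isT tr).
rewrite -/(dy fR 0 0) ler_norml => /andP[h1 _].
have : (fR t 0 - 1) / t < 0 by lra.
rewrite pmulr_llt0 ?invr_gt0// subr_lt0; apply: le_lt_trans.
exact: reaction_nonincreasing (ltW t0) (ltW ty) yC.
Qed.

Lemma reaction_bounds (y : R) : 0 <= y <= C -> 0 <= fR y 0 <= 1.
Proof.
move=> /andP[y0 yC]; have [f01 _ fC _ _] := hA1.
by rewrite -{1}fC -f01 !reaction_nonincreasing.
Qed.

(** At [y = C], which (A2) does not cover, the sign follows by continuity from the left. *)
Lemma dy_reaction_le0 (y : R) : 0 < y <= C -> dy fR y 0 <= 0.
Proof.
move=> /andP[y0]; have [d0 dneg] := hA2; rewrite le_eqVlt => /predU1P[->|yC]; last by rewrite dneg// y0.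
rewrite leNgt; apply/negP => dC; have [_ cd _] := cR.
have e0 : 0 < dy fR C 0 / 2 by rewrite divr_gt0.
have [r r0 H] := nonneg_continuous_pt cd (ltW C0) e0.
have [t [t0 tr tC _]] := lt3_exists r0 C0 C0.
have Ct : 0 < C - t < C by rewrite subr_gt0 tC ltrBlDr ltrDl.
have := H (C - t) (ltW (proj1 (andP Ct))); rewrite subKr gtr0_norm// => /(_ tr).
by move=> /(close_gt0 dC); rewrite ltNge dneg.
Qed.

Lemma dy_reaction_lt0 : exists2 r : R, 0 < r & forall y : R, 0 <= y < r -> dy fR y 0 < 0.
Proof.
have [d0 _] := hA2; have [_ cd _] := cR.
have e0 : 0 < - dy fR 0 0 / 2 by rewrite divr_gt0// oppr_gt0.
have [r r0 H] := nonneg_continuous_pt cd (lexx 0) e0; exists r; first exact: r0.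
move=> y /andP[y0 yr]; have := H y y0; rewrite sub0r normrN ger0_norm// => /(_ yr).
exact: close_lt0.
Qed.

(** The hypotheses give no rate of decay beyond [C], so the reaction is replaced there by the line
    [C - y]. This keeps it Lipschitz, at most 1 and unbounded below, and [solution_bound] shows that
    the solution never enters the modified range. *)
Definition truncated_reaction (y : R) : R := fR (Num.min y C) 0 - Num.max 0 (y - C).

Lemma truncated_reactionE (y : R) : y <= C -> truncated_reaction y = fR y 0.
Proof. by move=> yC; rewrite /truncated_reaction (min_idPl yC) (max_idPl _) ?subr0// subr_le0. Qed.

Lemma truncated_reaction_tail (y : R) : C <= y -> truncated_reaction y = C - y.
Proof.
move=> Cy; have [_ _ fC _ _] := hA1.
by rewrite /truncated_reaction (min_idPr Cy) (max_idPr _) ?subr_ge0// fC sub0r opprB.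
Qed.

Lemma truncated_reaction_le1 (y : R) : 0 <= y -> truncated_reaction y <= 1.
Proof.
move=> y0; have [yC|/ltW Cy] := leP y C.
  have yI : 0 <= y <= C by rewrite y0.
  by rewrite truncated_reactionE//; case/andP: (reaction_bounds yI).
by rewrite truncated_reaction_tail// (@le_trans _ _ 0)// subr_le0.
Qed.

Lemma truncated_reaction_lip : exists2 L : R, 0 < L & forall x y : R, 0 <= x -> 0 <= y ->
  `|truncated_reaction x - truncated_reaction y| <= L * `|x - y|.
Proof.
have [B B0 HB] := reaction_lip; exists (B + 1) => [|x y]; first by rewrite addr_gt0.
wlog xy : x y / x <= y.
  move=> H x0 y0; have [h|/ltW h] := leP x y; first exact: H.
  by rewrite distrC [`|x - y|]distrC H.
move=> x0 y0; rewrite [`|x - y|]ler0_norm ?subr_le0// [- (x - y)]opprB.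
have m0 (z : R) : 0 <= z -> 0 <= Num.min z C <= C by move=> z0; rewrite le_min z0 (ltW C0) ge_min lexx orbT.
have -> : truncated_reaction x - truncated_reaction y = (fR (Num.min x C) 0 - fR (Num.min y C) 0) +
    (Num.max 0 (y - C) - Num.max 0 (x - C)) by rewrite /truncated_reaction; ring.
rewrite mulrDl mul1r; apply: le_trans (ler_normD _ _) _; apply: lerD.
  apply: le_trans (HB _ _ (m0 x x0) (m0 y y0)) _; rewrite ler_wpM2l ?(ltW B0)// ler_norml.
  by case: (leP x C) => h1; case: (leP y C) => h2; apply/andP; split; lra.
rewrite ler_norml; case: (leP 0 (x - C)) => h1; case: (leP 0 (y - C)) => h2; apply/andP; split; lra.
Qed.

End Reaction.
Lemma partial_sums_le {R : realType} (x1 x2 x3 x4 x5 x6 x7 : R) : 0 <= x1 -> 0 <= x2 -> 0 <= x3 -> 0 <= x4 ->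
  0 <= x5 -> 0 <= x6 -> 0 <= x7 -> let S := x1 + x2 + (x3 + x4) + (x5 + x6 + x7) in
  [/\ x1 <= S, x1 + x2 <= S, x1 + (x3 + x4) <= S, x1 + x5 <= S & x1 + x6 + x7 <= S].
Proof. by move=> h1 h2 h3 h4 h5 h6 h7 S; rewrite /S; split; lra. Qed.

(** * From Neumann solutions to square-integrable modes *)

Section ModeProfile.
Context {R : realType} (l : R) (a : R -> R) (m : nat) (lambda0 alpha1 alpha2 : R).

Definition L2w (f : R -> R) := intI l (fun s => f s ^+ 2 * a s).

Record mode_profile (u u1 u2 : R -> R) : Prop := ModeProfile {
  mp_d1 : forI l s, isd u s (u1 s);
  mp_d2 : forI l s, isd u1 s (u2 s);
  mp_cont2 : forI l s, {for s, continuous u2};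
  mp_L2 : L2w u;
  mp_L2_1 : L2w u1;
  mp_L2_a : L2w (fun s => u s / a s);
  mp_L2_2 : L2w u2;
  mp_L2_1a : L2w (fun s => u1 s / a s - derive1 a s / a s ^+ 2 * u s);
  mp_L2_pp : L2w (fun s => derive1 a s / a s * u1 s - m%:R ^+ 2 / a s ^+ 2 * u s);
  mp_boundary : a l != 0 -> exists UL U1L M d, [/\ 0 < d < l,
    forI d s, [/\ `|u (l - s)| <= M, `|u1 (l - s)| <= M & `|u2 (l - s)| <= M],
    forI d s, `|u (l - s) - UL| <= M * s /\ `|u1 (l - s) - U1L| <= M * s &
    alpha1 * UL + alpha2 * U1L = 0] }.

Hypothesis P : profile l a.

(** This turns [w' = O(distance to the ends)] into boundedness of [w' / a], the quantity that enters
    the Hessian at the poles. *)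
Lemma dist_over_profile : exists2 K : R, 0 < K & forI l s, Num.min s (l - s) <= K * a s.
Proof.
have l0 := pf_l P; have ca : contI l a := derivI_cont (pf_isd P).
have [_ [d0 /andP[d00 d0l] H0]] := pf_pole0 P.
have [d1 [k [d10 k0 H1]]] : exists d k : R, [/\ 0 < d, 0 < k & forI d s, s <= k * a (l - s)].
  have [al|al] := eqVneq (a l) 0.
    have [_ [d /andP[dp _] H]] := pf_pole1 P al; exists d, 2; split=> // s /H; lra.
  have [al0 [d /andP[dp dl] H]] := pf_boundary P al; exists d, (2 * d / a l); split=> //.
    by rewrite divr_gt0 ?mulr_gt0.
  move=> s sd; have /andP[h _] := H s sd; case/andP: sd => _ /ltW sd; apply: le_trans sd _.
  rewrite -[leLHS](_ : 2 * d / a l * (a l / 2) = d); last by field.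
  by rewrite ler_wpM2l// ltW// divr_gt0// mulr_gt0.
have p1 : 0 < d0 / 2 by rewrite divr_gt0. have p2 : l - d1 / 2 < l by rewrite ltrBlDr ltrDl divr_gt0.
have [c c0 Hc] := cont_lower_bound ca (pf_gt0 P) p1 p2.
have lc : 0 < l / c by rewrite divr_gt0.
exists (2 + k + l / c) => [|s /[dup] sI /andP[s0 sl]]; first by rewrite !addr_gt0.
have as0 := pf_gt0 P sI; have k2 : 0 <= 2 + k by rewrite addr_ge0 ?ltW.
have mono (q : R) : q <= 2 + k + l / c -> q * a s <= (2 + k + l / c) * a s by move=> h; rewrite ler_wpM2r// ltW.
have [h|h] := ltP s d0.
  apply: le_trans (mono 2 _); last by rewrite -addrA lerDl addr_ge0 ?ltW.
  by rewrite ge_min; apply/orP; left; have := H0 s; rewrite s0 h => /(_ isT); lra.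
have [h'|h'] := ltP (l - d1) s.
  apply: le_trans (mono k _); last by rewrite addrAC lerDr addr_ge0 ?ltW.
  by rewrite ge_min; have := H1 (l - s); rewrite subKr subr_gt0 sl ltrBlDr addrC -ltrBlDr h' => ->; rewrite ?orbT.
apply: le_trans (mono (l / c) _); last by rewrite lerDr.
have ac : c <= a s by rewrite Hc// half_le//= (le_trans h')// lerD2l lerN2 half_le.
apply: (@le_trans _ _ l); first by rewrite ge_min (ltW sl).
by rewrite -mulrA ler_peMr ?(ltW l0)// mulrC ler_pdivlMr// mul1r.
Qed.

Lemma L2w_dominated (f g h : R -> R) (c1 c2 : R) : contI l f ->
  (forI l s, `|f s| <= c1 * `|g s| + c2 * `|h s|) -> L2w g -> L2w h -> L2w f.
Proof.
move=> cf fgh ig ih; have mI := measurable_I l.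
have i := rintegrableD mI (rintegrableZ (2 * c1 ^+ 2) mI ig) (rintegrableZ (2 * c2 ^+ 2) mI ih).
apply: (le_integrable mI _ _ i).
  apply/measurable_EFinP; apply: measurable_fun_I => s sI.
  apply: continuousM; last exact: isd_cont (pf_isd P sI).
  by apply: continuousM; exact: cf.
move=> s; rewrite /= in_itv /= => sI; have a0 := pf_gt0 P sI.
rewrite lee_fin ger0_norm; last by rewrite mulr_ge0 ?sqr_ge0// ltW.
apply: le_trans (ler_norm _).
have -> : 2 * c1 ^+ 2 * (g s ^+ 2 * a s) + 2 * c2 ^+ 2 * (h s ^+ 2 * a s) =
  (2 * c1 ^+ 2 * g s ^+ 2 + 2 * c2 ^+ 2 * h s ^+ 2) * a s by ring.
rewrite ler_wpM2r ?(ltW a0)// -(real_normK (num_real (f s))).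
have H := fgh s sI; have f0 := normr_ge0 (f s).
apply: (@le_trans _ _ ((c1 * `|g s| + c2 * `|h s|) ^+ 2)); first by rewrite lerXn2r ?nnegrE// (le_trans f0).
have -> : g s ^+ 2 = `|g s| ^+ 2 by rewrite real_normK ?num_real.
have -> : h s ^+ 2 = `|h s| ^+ 2 by rewrite real_normK ?num_real.
rewrite -subr_ge0; set A := `|g s|; set B := `|h s|.
by rewrite (_ : _ - _ = (c1 * A - c2 * B) ^+ 2) ?sqr_ge0//; ring.
Qed.

Variables (th th1 th2 Q Y F w : R -> R).
Hypotheses (RF : reference l a m lambda0 alpha1 alpha2 th th1 th2 Q Y) (bF : bdcont l F).

(** [th w] inherits the bounds of [th]: since [w], [w'] and [w' / a] are bounded, each expression to
    be estimated is a bounded combination of those of the reference. The Robin condition passes to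
    [th w] because [w'] vanishes at the boundary. *)
Lemma neumann_mode_profile : neumann l (fun s => a s * th s ^+ 2) F w -> exists u1 u2,
  mode_profile (fun s => th s * w s) u1 u2 /\ forI l s, u2 s + derive1 a s / a s * u1 s - m%:R ^+ 2 / a s ^+ 2 * (th s * w s) = th s * (F s - Q s * w s).
Proof.
move=> N; have W := rf_weight RF; have bw := neumann_bdcont W N; have l0 := pf_l P.
have [w1 [K0 [Hw0 dw dw1]]] := N.
have [K K00 Hw] : exists2 K : R, 0 < K & forI l s, `|w1 s| <= K * Num.min s (l - s).
  exists (`|K0| + 1) => [|s sI]; first by rewrite ltr_wpDl.
  by apply: le_trans (Hw0 s sI) _; rewrite ler_wpM2r ?(ltW (min_gt0 sI))// (le_trans (ler_norm _))// lerDl.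
have [Ka Ka0 HKa] := dist_over_profile; have [M M0 HM] := bdcont_bound bw; have [MF MF0 HF] := bdcont_bound bF.
have a0 := pf_gt0 P; have t0 := rf_gt0 RF.
pose u1 (s : R) := th1 s * w s + th s * w1 s.
pose u2 (s : R) := - (derive1 a s / a s) * u1 s + m%:R ^+ 2 / a s ^+ 2 * (th s * w s) + th s * (F s - Q s * w s).
have u2E (s : R) : 0 < s < l -> u2 s = th2 s * w s + th s * (F s - derive1 a s * (w1 s / a s)).
  by move=> sI; rewrite /u2 /u1 (rf_ode RF sI); field; rewrite gt_eqF// a0.
have du (s : R) : 0 < s < l -> isd (fun s => th s * w s) s (u1 s) by move=> sI; exact: isdM (rf_d1 RF sI) (dw s sI).
have du1 : derivI l u1 u2.
  move=> s sI; have as0 := a0 s sI; have ts0 := t0 s sI.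
  apply: (@isd_near _ (fun s => th1 s * w s + a s * th s ^+ 2 * w1 s / (a s * th s))).
    near=> t; have tI : 0 < t < l by near: t; exact: near_in.
    by rewrite /u1; field; rewrite !gt_eqF ?a0 ?t0.
  have n : a s * th s != 0 by rewrite mulf_neq0// gt_eqF.
  apply: isd_eqd (isdD (isdM (rf_d2 RF sI) (dw s sI)) (@isd_div _ _ (fun s => a s * th s) _ _ _ n (dw1 s sI)
    (isdM (pf_isd P sI) (rf_d1 RF sI)))) _.
  by rewrite u2E//; field; rewrite !gt_eqF.
have cw := derivI_cont dw.
have cth : contI l th := derivI_cont (rf_d1 RF).
have ca : contI l a := derivI_cont (pf_isd P).
have [caV ca2] := contIV a0 ca.
have cu := derivI_cont du.
have cu1 := derivI_cont du1.
have cda : contI l (derive1 a) := pf_cont1 P; have [cQ _] := rf_bdQ RF; have [cF _] := bF.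
have cu2 : contI l u2 by cont_tac.
have w1l (s : R) : 0 < s < l -> `|w1 s| <= K * l.
  by move=> sI; apply: le_trans (Hw s sI) _; rewrite ler_wpM2l ?(ltW K00)// (min_le W).
have w1a (s : R) : 0 < s < l -> `|w1 s / a s| <= K * Ka.
  move=> sI; have as0 := a0 s sI; rewrite normf_div (gtr0_norm as0) ler_pdivrMr//.
  by apply: le_trans (Hw s sI) _; rewrite -mulrA ler_wpM2l ?(ltW K00)// HKa.
have Fa (s : R) : 0 < s < l -> `|F s - derive1 a s * (w1 s / a s)| <= MF + K * Ka.
  move=> sI; rewrite (le_trans (ler_normB _ _))// lerD ?HF// normrM -[leRHS]mul1r.
  by rewrite ler_pM ?(pf_bd1 P)// w1a.
have bu2 (s : R) : 0 < s < l -> `|u2 s| <= M * `|th2 s| + (MF + K * Ka) * `|th s|.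
  move=> sI; rewrite u2E//; apply: le_trans (ler_normD _ _) _; rewrite !normrM.
  by apply: lerD; rewrite mulrC ler_wpM2r// ?HM// Fa.
have i2 : L2w u2 by apply: (L2w_dominated cu2 bu2); [exact: (rf_L2_2 RF)|exact: (rf_L2 RF)].
have [MQ MQ0 HQ] := bdcont_bound (rf_bdQ RF).
exists u1, u2; split; last by move=> s sI; rewrite /u2; ring.
split=> //.
- by apply: (L2w_dominated (c1 := M) (c2 := 0) cu) (rf_L2 RF) (rf_L2 RF) => s sI; rewrite normrM mul0r addr0 mulrC ler_wpM2r// HM.
- apply: (L2w_dominated (c1 := M) (c2 := K * l) cu1) (rf_L2_1 RF) (rf_L2 RF) => s sI.
  apply: le_trans (ler_normD _ _) _; rewrite !normrM.
  by apply: lerD; rewrite mulrC ler_wpM2r// ?HM// w1l.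
- apply: (L2w_dominated (c1 := M) (c2 := 0)) (rf_L2_a RF) (rf_L2_a RF).
    by cont_tac.
  by move=> s sI; rewrite mul0r addr0 mulrAC normrM mulrC ler_wpM2r// HM.
- apply: (L2w_dominated (c1 := M) (c2 := K * Ka)) (rf_L2_1a RF) (rf_L2 RF).
    by cont_tac.
  move=> s sI; have -> : u1 s / a s - derive1 a s / a s ^+ 2 * (th s * w s) =
    w s * (th1 s / a s - derive1 a s / a s ^+ 2 * th s) + (w1 s / a s) * th s by rewrite /u1; ring.
  apply: le_trans (ler_normD _ _) _; rewrite (normrM (w s)) (normrM (w1 s / a s)).
  by apply: lerD; rewrite ler_wpM2r// ?HM// w1a.
- apply: (L2w_dominated (c1 := 1) (c2 := MF + MQ * M)) i2 (rf_L2 RF).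
    by cont_tac.
  move=> s sI; have -> : derive1 a s / a s * u1 s - m%:R ^+ 2 / a s ^+ 2 * (th s * w s) =
    - u2 s + (F s - Q s * w s) * th s by rewrite /u2; ring.
  apply: le_trans (ler_normD _ _) _; rewrite normrN mul1r lerD2l normrM ler_wpM2r//.
  by rewrite (le_trans (ler_normB _ _))// lerD ?HF// normrM ler_pM ?HQ ?HM.
- move=> al; have [VL [V1L [M1 [d [/andP[d0 dl] Hb HL rob _]]]]] := rf_boundary RF al.
  have M10 : 0 <= M1 by have [h1 _ _] := Hb _ (half_in d0); exact: le_trans h1.
  have Kl0 : 0 <= K * l by rewrite mulr_ge0// ltW.
  have [WL HWL] := lip_limit l0 Kl0 (fun s t sI tI => isd_lip dw w1l sI tI).
  have Kb : 0 <= K * Ka by rewrite mulr_ge0// ltW.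
  have VW0 : 0 <= `|VL| * (K * l) by rewrite mulr_ge0.
  have V1W0 : 0 <= `|V1L| * (K * l) by rewrite mulr_ge0.
  have M1M : 0 <= M1 * M by rewrite mulr_ge0// ltW.
  have MF1 : 0 <= MF * M1 by rewrite mulr_ge0// ltW.
  have [K1 [K2 K3]] : 0 <= M1 * (K * l) /\ 0 <= K * Ka * M1 /\ 0 <= M1 * K.
    by rewrite !mulr_ge0 ?(ltW K00) ?(ltW l0) ?(ltW Ka0).
  have [] := partial_sums_le M1M K1 MF1 K2 VW0 V1W0 K3; set MM := _ + _ + _ + _ => m1 m2 m3 m4 m5.
  exists (VL * WL), (V1L * WL), MM, d; split; first by rewrite d0.
  + move=> s sd; have [b1 b2 b3] := Hb s sd; have sI : 0 < l - s < l.
      by case/andP: sd => h1 h2; apply: refl_itv; rewrite h1 (lt_trans h2).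
    have e1 : `|th (l - s) * w (l - s)| <= M1 * M by rewrite normrM ler_pM ?HM.
    have e2 : `|u1 (l - s)| <= M1 * M + M1 * (K * l).
      by apply: le_trans (ler_normD _ _) _; rewrite !normrM lerD// ler_pM ?HM ?w1l.
    have e3 : `|u2 (l - s)| <= M1 * M + (MF * M1 + K * Ka * M1).
      apply: le_trans (bu2 _ sI) _; rewrite [M * _]mulrC lerD//; first by rewrite ler_wpM2r// ltW.
      by rewrite -mulrDl ler_wpM2l// addr_ge0// ltW.
    by split; [exact: le_trans e1 m1|exact: le_trans e2 m2|exact: le_trans e3 m3].
  + move=> s sd; have [b1 b2 b3] := Hb s sd; have [c1 c2] := HL s sd; have s0 : 0 <= s by rewrite ltW//; case/andP: sd.
    have sI : 0 < l - s < l by case/andP: sd => h1 h2; apply: refl_itv; rewrite h1 (lt_trans h2).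
    have := HWL _ sI; rewrite subKr => hW.
    have w1s : `|w1 (l - s)| <= K * s.
      by apply: le_trans (Hw _ sI) _; rewrite ler_wpM2l ?(ltW K00)// ge_min subKr lexx orbT.
    have e1 : `|th (l - s) * w (l - s) - VL * WL| <= (M1 * M + `|VL| * (K * l)) * s.
      have -> : th (l - s) * w (l - s) - VL * WL = (th (l - s) - VL) * w (l - s) + VL * (w (l - s) - WL) by ring.
      have -> : (M1 * M + `|VL| * (K * l)) * s = M1 * s * M + `|VL| * (K * l * s) by ring.
      apply: le_trans (ler_normD _ _) _.
      by rewrite !normrM; apply: lerD; [rewrite ler_pM ?HM|rewrite ler_wpM2l].
    have e2 : `|u1 (l - s) - V1L * WL| <= (M1 * M + `|V1L| * (K * l) + M1 * K) * s.
      have -> : u1 (l - s) - V1L * WL = (th1 (l - s) - V1L) * w (l - s) + V1L * (w (l - s) - WL) + th (l - s) * w1 (l - s).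
        by rewrite /u1; ring.
      have -> : (M1 * M + `|V1L| * (K * l) + M1 * K) * s = M1 * s * M + `|V1L| * (K * l * s) + M1 * (K * s) by ring.
      apply: le_trans (ler_normD _ _) _; apply: lerD; last by rewrite normrM ler_pM.
      apply: le_trans (ler_normD _ _) _; apply: lerD; rewrite normrM; first by rewrite ler_pM ?HM.
      by rewrite ler_wpM2l.
    by split; [apply: le_trans e1 _|apply: le_trans e2 _]; rewrite ler_wpM2r.
  + by rewrite !mulrA -mulrDl rob mul0r.
Unshelve. all: by end_near. Qed.

End ModeProfile.

(** * Modes on the chart: weak derivatives and traces *)

Section PlaneModes.
Context {R : realType}.
Notation mu := (@lebesgue_measure R).
Notation mu2 := ((@lebesgue_measure R) \x (@lebesgue_measure R))%E.
Notation RT := (measurableTypeR R).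
Notation RR := (measurableTypeR R * measurableTypeR R)%type.
Notation circle := ([set` `]0, 2 * pi[] : set RT).

Section CircleModes.
Variables (l : R) (m : nat).
Hypotheses (l0 : 0 < l) (m0 : (0 < m)%N).
Implicit Types (A B : R -> R) (chi : R * R -> R).

Lemma Rintegral_eq0 (D : set RT) (f : R -> R) : (forall s : R, D s -> f s = 0) -> Rintegral mu D f = 0.
Proof.
move=> f0; rewrite /Rintegral integral0_eq// => s Ds.
by rewrite f0.
Qed.

Lemma continuous_slice2 chi (s p : R) : continuous chi -> {for p, continuous (fun p : R => chi (s, p))}.
Proof.
move=> cc; apply: (@continuous_comp _ _ _ (fun p : R => (s, p)) chi); last exact: cc.
exact: (cvg_pair (cvg_cst s) cvg_id).
Qed.

Lemma continuous_slice1 chi (s p : R) : continuous chi -> {for s, continuous (fun s : R => chi (s, p))}.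
Proof.
move=> cc; apply: (@continuous_comp _ _ _ (fun s : R => (s, p)) chi); last exact: cc.
exact: (cvg_pair cvg_id (cvg_cst p)).
Qed.

(** Measurability refers to the product sigma-algebra: [chi] is the limit of functions that are
    steps of width [1 / n.+1] in [s] and continuous in the angle. *)
Lemma measurable_continuous2 chi : continuous chi -> measurable_fun (chart l) chi.
Proof.
move=> cc; pose k (n : nat) (s : R) := Num.truncn (n.+1%:R * s).
apply: (@measurable_fun_cvg _ RR R (chart l) (fun n z => chi ((k n z.1)%:R / n.+1%:R, z.2))).
- move=> n mC B mB; have n0 : 0 < n.+1%:R :> R by rewrite ltr0n.
  pose S (j : nat) : set RT := [set` `]0, l[%R] `&` [set` `[j%:R / n.+1%:R, j.+1%:R / n.+1%:R[%R].
  pose T (j : nat) : set RT := circle `&` (fun p => chi (j%:R / n.+1%:R, p)) @^-1` B.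
  rewrite (_ : _ `&` _ = \bigcup_j (S j `*` T j : set RR)).
    apply: bigcupT_measurable => j; apply: measurableX.
      by apply: measurableI; exact: measurable_itv.
    have mc := @measurable_circle R.
    have mf : measurable_fun circle (fun p => chi (j%:R / n.+1%:R, p)); last exact: mf.
    by apply: measurable_fun_cont => // p; exact: continuous_slice2.
  apply/seteqP; split=> [[s p] [[/= sI pI] Bsp]|[s p] [j _ [[/= sI sj] [/= pI Bsp]]]].
    have s0 : 0 <= n.+1%:R * s by move: sI; rewrite in_itv /= => /andP[h _]; rewrite mulr_ge0// ltW.
    exists (k n s) => //; split; last by split.
    by split=> //=; rewrite in_itv /= ler_pdivrMr// ltr_pdivlMr// mulrC; exact: truncn_itv.
  split=> //=; suff -> : k n s = j by [].
  move: sj sI; rewrite !in_itv /= ler_pdivrMr// ltr_pdivlMr// mulrC => h /andP[s0 _].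
  by apply: truncn_def; rewrite ?mulr_ge0// ltW.
- move=> [s p] [/= sI _]; have s0 : 0 <= s by move: sI; rewrite in_itv /= => /andP[/ltW].
  suff h : ((k n s)%:R / n.+1%:R : R) @[n --> \oo] --> (s : R).
    exact: (@cvg_comp _ _ _ (fun n => ((k n s)%:R / n.+1%:R, p)) chi _ _ _ (cvg_pair h (cvg_cst p)) (cc (s, p))).
  apply/cvgrPdist_le => e e0; near=> n.
  have n0 : 0 < n.+1%:R :> R by rewrite ltr0n.
  have /andP[h1 h2] := truncn_itv (mulr_ge0 (ltW n0) s0).
  rewrite -/(k n s) in h1 h2; rewrite ger0_norm; last by rewrite subr_ge0 ler_pdivrMr// mulrC.
  apply: (@le_trans _ _ (n.+1%:R^-1)); last first.
    near: n; have [N _ HN] := near_infty_natSinv_lt (PosNum e0); exists N => // n /= nN.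
    exact/ltW/HN.
  by rewrite lerBlDr -[X in X + _]mul1r -mulrDl ler_pdivlMr// mulrC addrC natr1 ltW.
Unshelve. all: by end_near. Qed.

Lemma cont_upper_bound4 f1 f2 f3 f4 (p q : R) : contI l f1 -> contI l f2 -> contI l f3 -> contI l f4 -> 0 < p -> q < l ->
  exists2 M : R, 0 < M & forall s : R, p <= s <= q -> [/\ `|f1 s| <= M, `|f2 s| <= M, `|f3 s| <= M & `|f4 s| <= M].
Proof.
move=> c1 c2 c3 c4 p0 ql; have [M1 M10 H1] := cont_upper_bound c1 p0 ql; have [M2 M20 H2] := cont_upper_bound c2 p0 ql.
have [M3 M30 H3] := cont_upper_bound c3 p0 ql; have [M4 M40 H4] := cont_upper_bound c4 p0 ql.
exists (Num.max (Num.max M1 M2) (Num.max M3 M4)) => [|s sI]; first by rewrite !lt_max M10.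
by rewrite !le_max H1 ?H2 ?H3 ?H4 ?orbT.
Qed.

Definition cmode A B (z : R * R) : R := A z.1 * cos (m%:R * z.2) + B z.1 * sin (m%:R * z.2).

Lemma cmode_le A B z : `|cmode A B z| <= `|A z.1| + `|B z.1|.
Proof.
apply: le_trans (ler_normD _ _) _; rewrite !normrM.
by apply: lerD; rewrite ler_piMr// ler_norml ?cos_geN1 ?cos_le1 ?sin_geN1 ?sin_le1.
Qed.

Lemma cmode_slice A B (p : R) : contI l A -> contI l B -> contI l (fun s => cmode A B (s, p)).
Proof.
move=> cA cB s sI; apply: (@continuousD _ _ _ (fun s => A s * cos (m%:R * p)) (fun s => B s * sin (m%:R * p)));
  apply: continuousM; [exact: cA|exact: cvg_cst|exact: cB|exact: cvg_cst].
Qed.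

Lemma isd_cmode A B A1 B1 (s p : R) : isd A s (A1 s) -> isd B s (B1 s) ->
  isd (fun s => cmode A B (s, p)) s (cmode A1 B1 (s, p)).
Proof.
move=> dA dB; apply: (@isd_near _ (fun s => cos (m%:R * p) * A s + sin (m%:R * p) * B s)).
  by near=> t; rewrite /cmode /= mulrC (mulrC (sin _)).
by apply: isd_eqd (isdD (isdZ (cos (m%:R * p)) dA) (isdZ (sin (m%:R * p)) dB)) _; rewrite /cmode /=; ring.
Unshelve. all: by end_near. Qed.

Lemma cmode_measurable A B : contI l A -> contI l B -> measurable_fun (chart l) (cmode A B : RR -> R).
Proof.
move=> cA cB; have mI := @measurable_I R l; have mC := @measurable_circle R.
have ct (f : R -> R) : continuous f -> measurable_fun (chart l) (fun z : RR => f (m%:R * z.2)).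
  move=> cf; apply: (measurable_fun_comp_snd (f := fun p => f (m%:R * p))) => //; apply: measurable_fun_cont => // p.
  apply: continuous_comp; last exact: cf.
  by apply: continuousM; [exact: cvg_cst|exact: cvg_id].
apply: measurable_funD; apply: measurable_funM.
- by apply: measurable_fun_comp_fst => //; exact: measurable_fun_I.
- by apply: ct => p; exact: continuous_cos.
- by apply: measurable_fun_comp_fst => //; exact: measurable_fun_I.
- by apply: ct => p; exact: continuous_sin.
Qed.

Lemma integrable_bounded_rect (S : set RT) (f : RR -> R) (c e K : R) : measurable S -> S `<=` `[c, e] ->
  measurable_fun (S `*` circle) f -> (forall z, (S `*` circle) z -> `|f z| <= K) ->
  mu2.-integrable (S `*` circle : set RR) (EFin \o f).
Proof.
move=> mS sS mf fK; have mC := @measurable_circle R.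
have i1 (p q : R) (T : set RT) : measurable T -> T `<=` `[p, q] -> mu.-integrable T (EFin \o (fun=> 1 : R)).
  have ipq : mu.-integrable ([set` `[p, q]%R] : set RT) (EFin \o (fun=> 1 : R)).
    apply: continuous_compact_integrable; first exact: segment_compact.
    by apply: continuous_subspaceT => s; exact: cvg_cst.
  by move=> mT sT; apply: integrableS ipq => //; exact: measurable_itv.
have iS := i1 c e S mS sS.
have iC : mu.-integrable circle (EFin \o (fun=> 1 : R)).
  by apply: (i1 0 (2 * pi)) => // p /=; rewrite !in_itv /= => /andP[/ltW -> /ltW ->].
have := integrable_bdM (measurableX mS mC) mf fK (integrable_tensor mS mC iS iC).
by apply: eq_integrable; [exact: measurableX|move=> z _ /=; rewrite !mulr1].
Qed.

Lemma cmode_locint A B : contI l A -> contI l B -> chart_locally_integrable l (cmode A B).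
Proof.
move=> cA cB c e c0 el; have mS : measurable ([set` `[c, e]%R] : set RT) by exact: measurable_itv.
have [M1 _ H1] := cont_upper_bound cA c0 el; have [M2 _ H2] := cont_upper_bound cB c0 el.
apply: (@integrable_bounded_rect _ _ c e (M1 + M2)) => //.
  apply: (measurable_funS _ _ (cmode_measurable cA cB)); first exact: measurable_chart.
  move=> [s p] [/= h1 h2]; split=> //=; move: h1; rewrite !in_itv /= => /andP[h1 h3].
  by rewrite (lt_le_trans c0 h1) (le_lt_trans h3 el).
move=> [s p] [/= sI _]; apply: le_trans (cmode_le A B (s, p)) _.
by rewrite in_itv /= in sI; rewrite lerD ?H1 ?H2.
Qed.

Section Test.
Variables (J : set R) (chi chi_s chi_p : R * R -> R).
Hypotheses (T : test_on J chi chi_s chi_p) (J0 : J `<=` [set s | 0 < s]).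

Lemma continuous2_bounded (f : R * R -> R) (c e : R) : continuous f ->
  exists2 M : R, 0 <= M & forall s p : R, c <= s <= e -> 0 <= p <= 2 * pi -> `|f (s, p)| <= M.
Proof.
move=> cf; have K := compact_setX (@segment_compact R c e) (@segment_compact R 0 (2 * pi)).
have cw : {within `[c, e] `*` `[0, 2 * pi], continuous f} by apply: continuous_subspaceT => z; exact: cf.
have [M [_ Mr]] := compact_bounded (continuous_compact cw K).
exists `|M + 1| => // s p sI pI; apply: le_trans (ler_norm _); apply: (Mr (M + 1)); first by rewrite ltrDl.
by exists (s, p) => //; split; rewrite /= in_itv.
Qed.

(** The partial derivatives vanish outside the support too, as derivatives of functions that vanish
    nearby. The support may reach beyond [l] when [J] does, which is the case for traces. *)
Lemma test_support : exists c e : R, [/\ 0 < c, c < l, (J `<=` [set s | s < l] -> e < l) &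
  forall s p : R, ~~ (c <= s <= e) -> [/\ chi (s, p) = 0, chi_s (s, p) = 0 & chi_p (s, p) = 0]].
Proof.
have ll := l0; have [c [e [ceJ X0]]] := test_supp T.
have [c' [e' [c0 cl el sup]]] : exists c e : R, [/\ 0 < c, c < l, (J `<=` [set s | s < l] -> e < l) &
    forall s p : R, ~~ (c <= s <= e) -> chi (s, p) = 0].
  have [ce|ec] := leP c e.
    exists (Num.min c (l / 2)), e; split.
    - by rewrite lt_min divr_gt0// andbT; apply/J0/ceJ; rewrite /= in_itv /= lexx.
    - by rewrite gt_min; apply/orP; right; lra.
    - by apply; apply: ceJ; rewrite /= in_itv /= lexx andbT.
    - by move=> s p h; apply: X0; apply: contra h => /andP[h1 ->]; rewrite ge_min h1.
  exists (l / 2), (l / 2); split=> [|||s p _]; [exact: divr_gt0|lra|move=> _; lra|].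
  by apply: X0; apply/negP => /andP[h1 h2]; move: (lt_le_trans ec (le_trans h1 h2)); rewrite ltxx.
exists c', e'; split=> // s p h; have n0 : \forall t \near s, forall p : R, chi (t, p) = 0.
  move: h; rewrite negb_and -!ltNge => /orP[h|h]; near=> t => p0; apply: sup; rewrite negb_and -!ltNge; apply/orP.
    by left; near: t; exact: lt_nbhsl.
  by right; near: t; exact: lt_nbhsr.
split; first exact: sup.
- suff D : isd (fun t => chi (t, p)) s 0 by exact: isd_uniq (test_ds T s p) D.
  apply: (isd_near (f := fun _ : R => 0 : R)).
  by apply: filterS n0 => t ->.
- suff D : isd (fun t => chi (s, t)) p 0 by exact: isd_uniq (test_dp T s p) D.
  apply: (isd_near (f := fun _ : R => 0 : R)).
  by near=> t; rewrite sup.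
Unshelve. all: by end_near. Qed.

Lemma cmode_test_integrable A B c e M (f : R * R -> R) : 0 < c -> continuous f ->
  (forall s p : R, ~~ (c <= s <= e) -> f (s, p) = 0) -> contI l A -> contI l B -> 0 <= M ->
  (forI l s, c <= s <= e -> `|A s| <= M /\ `|B s| <= M) ->
  exists2 K : R, 0 <= K & (forall s p : R, 0 < s < l -> 0 <= p <= 2 * pi -> `|cmode A B (s, p) * f (s, p)| <= K) /\
  mu2.-integrable (chart l) (EFin \o (fun z : RR => cmode A B z * f z)).
Proof.
move=> c0 cf f0 cA cB M0 AB; have [Mf Mf0 Hf] := continuous2_bounded c e cf.
have bd (s p : R) : 0 < s < l -> 0 <= p <= 2 * pi -> `|cmode A B (s, p) * f (s, p)| <= (M + M) * Mf.
  move=> sI pI; have [se|se] := boolP (c <= s <= e); last by rewrite f0// mulr0 normr0 mulr_ge0// addr_ge0.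
  rewrite normrM ler_pM ?Hf//; apply: le_trans (cmode_le _ _ _) _; have [h1 h2] := AB s sI se.
  exact: lerD.
exists ((M + M) * Mf); first by rewrite mulr_ge0// addr_ge0.
split=> //; apply: (@integrable_bounded_rect [set` `]0, l[%R] _ 0 l ((M + M) * Mf)).
- exact: measurable_itv.
- by move=> s /=; rewrite !in_itv /= => /andP[/ltW -> /ltW ->].
- by apply: measurable_funM; [exact: cmode_measurable|exact: measurable_continuous2].
- move=> [s p] [/= sI pI]; apply: bd; first by rewrite in_itv in sI.
  by move: pI; rewrite /= in_itv /= => /andP[/ltW -> /ltW ->].
Qed.

(** One integration by parts in [s] for each angle. The limit [(AL, BL)] of the coefficients at [l]
    is kept as a parameter, so that the same statement gives weak derivatives, with zero boundary
    term, and traces. *)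
Lemma cmode_ibp A B A1 B1 (M AL BL : R) c e : 0 < c -> c < l ->
  (forall s p : R, ~~ (c <= s <= e) -> [/\ chi (s, p) = 0, chi_s (s, p) = 0 & chi_p (s, p) = 0]) ->
  derivI l A A1 -> derivI l B B1 ->
  contI l A1 -> contI l B1 -> 0 <= M ->
  (forI l s, c <= s <= e -> [/\ `|A s| <= M, `|B s| <= M, `|A1 s| <= M & `|B1 s| <= M]) ->
  (forall p e' : R, 0 < e' -> exists2 d : R, 0 < d < l & forI d s, `|cmode A B (l - s, p) * chi (l - s, p) - (AL * cos (m%:R * p) + BL * sin (m%:R * p)) * chi (l, p)| <= e') ->
  [/\ mu2.-integrable (chart l) (EFin \o (fun z : RR => cmode A B z * chi_s z)),
      mu2.-integrable (chart l) (EFin \o (fun z : RR => cmode A1 B1 z * chi z)) &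
      Rintegral mu2 (chart l) (fun z : RR => cmode A B z * chi_s z + cmode A1 B1 z * chi z) =
      Rintegral mu circle (fun p => (AL * cos (m%:R * p) + BL * sin (m%:R * p)) * chi (l, p))].
Proof.
move=> c0 cl sup dA dB cA1 cB1 M0 bd lim.
have cA := derivI_cont dA.
have cB := derivI_cont dB.
have [K1 K10 [b1 i1]] := cmode_test_integrable c0 (test_C1s T) (fun s p h => let: And3 _ h' _ := sup s p h in h')
  cA cB M0 (fun s sI se => let: And4 h1 h2 _ _ := bd s sI se in conj h1 h2).
have [K2 K20 [b2 i2]] := cmode_test_integrable c0 (test_C0 T) (fun s p h => let: And3 h' _ _ := sup s p h in h')
  cA1 cB1 M0 (fun s sI se => let: And4 _ _ h1 h2 := bd s sI se in conj h1 h2).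
have mI := @measurable_I R l; have mC := @measurable_circle R.
split=> //; have i12 := rintegrableD (measurableX mI mC) i1 i2.
rewrite (fubini_rect2 mI mC i12); apply: eq_Rintegral => p; rewrite inE /= in_itv /= => pI.
have pI' : 0 <= p <= 2 * pi by case/andP: pI => /ltW -> /ltW ->.
apply: (prim_end (H := fun s => cmode A B (s, p) * chi (s, p))) => //.
- split=> [s sI|].
    apply: continuousD; apply: continuousM; [exact: cmode_slice|exact: continuous_slice1 (test_C1s T)|exact: cmode_slice|exact: continuous_slice1 (test_C0 T)].
  by exists (K1 + K2) => s sI; apply: le_trans (ler_normD _ _) _; apply: lerD; [exact: b1|exact: b2].
- move=> s sI; have dm := isd_cmode p (dA s sI) (dB s sI).
  by apply: isd_eqd (isdM dm (test_ds T s p)) _; ring.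
- exists c; first by rewrite c0.
  move=> s /andP[s0 sc]; have h : ~~ (c <= s <= e) by rewrite negb_and -ltNge sc.
  by have [-> _ _] := sup s p h; rewrite mulr0.
- exact: lim.
Qed.

End Test.

Lemma cmode_weak_s A B A1 B1 : derivI l A A1 ->
  derivI l B B1 -> contI l A1 -> contI l B1 ->
  weak_s_real l (cmode A B) (cmode A1 B1).
Proof.
move=> dA dB cA1 cB1.
have cA := derivI_cont dA.
have cB := derivI_cont dB.
split; [exact: cmode_locint|exact: cmode_locint|] => chi chi_s chi_p T.
have J0 : `]0, l[ `<=` [set s | 0 < s] by move=> s /=; rewrite in_itv /= => /andP[].
have [c [e [c0 cl el sup]]] := test_support T J0.
have {}el : e < l by apply: el => s /=; rewrite in_itv /= => /andP[].
have [M M0 HM] := cont_upper_bound4 cA cB cA1 cB1 c0 el.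
have [] := @cmode_ibp _ _ _ _ T A B A1 B1 M 0 0 c e c0 cl sup dA dB cA1 cB1 (ltW M0).
- by move=> s _; exact: HM.
- move=> p e' e'0; exists (Num.min (l - e) (l / 2)); first by rewrite lt_min subr_gt0 el gt_min /=; apply/andP; split; [|apply/orP; right]; lra.
  move=> s /andP[s0]; rewrite lt_min => /andP[se _].
  have h : ~~ (c <= l - s <= e) by rewrite negb_and -!ltNge (_ : e < l - s) ?orbT// ltrBrDr -ltrBrDl.
  by have [-> _ _] := sup (l - s) p h; rewrite !mul0r addr0 mul0r mulr0 subrr normr0 ltW.
move=> i1 i2 E; apply/eqP; rewrite -addr_eq0; have mI := @measurable_chart R l; rewrite -(RintegralD mI i1 i2) E.
by apply/eqP/Rintegral_eq0 => p _; rewrite !mul0r addr0 mul0r.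
Qed.

Lemma isd_cmode_angle A B (s p : R) :
  isd (fun p => cmode A B (s, p)) p (cmode (fun s => m%:R * B s) (fun s => - (m%:R * A s)) (s, p)).
Proof.
apply: isd_eqd (isdD (isdZ (A s) (isd_cosm m p)) (isdZ (B s) (isd_sinm m p))) _.
by rewrite /cmode /=; ring.
Qed.

Lemma cmode_weak_p A B : contI l A -> contI l B ->
  weak_p_real l (cmode A B) (cmode (fun s => m%:R * B s) (fun s => - (m%:R * A s))).
Proof.
move=> cA cB; set A1 := fun s => m%:R * B s; set B1 := fun s => - (m%:R * A s).
have cA1 : contI l A1 by cont_tac.
have cB1 : contI l B1 by cont_tac.
split; [exact: cmode_locint|exact: cmode_locint|] => chi chi_s chi_p T.
have J0 : `]0, l[ `<=` [set s | 0 < s] by move=> s /=; rewrite in_itv /= => /andP[].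
have [c [e [c0 cl el sup]]] := test_support T J0.
have {}el : e < l by apply: el => s /=; rewrite in_itv /= => /andP[].
have [M /ltW M0 HM] := cont_upper_bound4 cA cB cA1 cB1 c0 el.
have b1 (s : R) : 0 < s < l -> c <= s <= e -> `|A s| <= M /\ `|B s| <= M by move=> _ /HM[].
have b2 (s : R) : 0 < s < l -> c <= s <= e -> `|A1 s| <= M /\ `|B1 s| <= M by move=> _ /HM[].
have s1 (s p : R) : ~~ (c <= s <= e) -> chi_p (s, p) = 0 by move=> h; have [_ _ ->] := sup s p h.
have s2 (s p : R) : ~~ (c <= s <= e) -> chi (s, p) = 0 by move=> h; have [-> _ _] := sup s p h.
have [_ _ [_ i1]] := cmode_test_integrable c0 (test_C1p T) s1 cA cB M0 b1.
have [_ _ [_ i2]] := cmode_test_integrable c0 (test_C0 T) s2 cA1 cB1 M0 b2.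
have mI := @measurable_I R l; have mC := @measurable_circle R; have mX := @measurable_chart R l.
apply/eqP; rewrite -addr_eq0 -(RintegralD mX i1 i2); have i12 := rintegrableD mX i1 i2.
have [_ -> _] := fubini_rect mI mC i12; apply/eqP; apply: Rintegral_eq0 => s _.
have dH (p : R) : isd (fun p => cmode A B (s, p) * chi (s, p)) p (cmode A B (s, p) * chi_p (s, p) + cmode A1 B1 (s, p) * chi (s, p)).
  by apply: isd_eqd (isdM (isd_cmode_angle A B s p) (test_dp T s p)) _; rewrite /A1 /B1; ring.
have cH (p : R) : {for p, continuous (fun p => cmode A B (s, p) * chi_p (s, p) + cmode A1 B1 (s, p) * chi (s, p))}.
  apply: continuousD; apply: continuousM.
  - exact: isd_cont (isd_cmode_angle A B s p).
  - exact: continuous_slice2 (test_C1p T).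
  - exact: isd_cont (isd_cmode_angle A1 B1 s p).
  - exact: continuous_slice2 (test_C0 T).
have := circle_integral dH cH => ->.
have := test_periodic T s 0; rewrite add0r => ->; rewrite /cmode /= mulr0 sinm_2pi.
by have := @cosm_per R m 0; rewrite add0r mulr0 => ->; rewrite sin0 subrr.
Qed.

Lemma cmode_trace A B A1 B1 (AL BL M d : R) : derivI l A A1 ->
  derivI l B B1 -> contI l A1 -> contI l B1 -> 0 < d < l ->
  (forI d s, [/\ `|A (l - s)| <= M, `|B (l - s)| <= M, `|A1 (l - s)| <= M & `|B1 (l - s)| <= M]) ->
  (forI d s, `|A (l - s) - AL| <= M * s /\ `|B (l - s) - BL| <= M * s) ->
  trace_real l (cmode A B) (cmode A1 B1) (fun p => AL * cos (m%:R * p) + BL * sin (m%:R * p)).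
Proof.
move=> dA dB cA1 cB1 /andP[d0 dl] Hb HL.
have cA := derivI_cont dA.
have cB := derivI_cont dB.
have M0 : 0 <= M by have [h _ _ _] := Hb _ (half_in d0); exact: le_trans h.
have mC := @measurable_circle R.
split.
  have i1 : mu.-integrable ([set` `[0, 2 * pi]%R] : set RT) (EFin \o (fun p : R => AL * cos (m%:R * p) + BL * sin (m%:R * p))).
    apply: continuous_compact_integrable; first exact: segment_compact.
    by apply: continuous_subspaceT => p; exact: isd_cont (isd_cmode_angle (fun=> AL) (fun=> BL) 0 p).
  have mI1 : measurable ([set` `[0, 2 * pi]%R] : set RT) by exact: measurable_itv.
  apply: (integrableS mI1 mC _ i1).
  by move=> p /=; rewrite !in_itv /= => /andP[/ltW -> /ltW ->].
move=> chi chi_s chi_p T.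
have J0 : `]0, +oo[ `<=` [set s | 0 < s :> R] by move=> s /=; rewrite in_itv /= andbT.
have [c [e [c0 cl _ sup]]] := test_support T J0.
have el : l - d / 2 < l by rewrite ltrBlDr ltrDl divr_gt0.
have [M' M'0 HM] := cont_upper_bound4 cA cB cA1 cB1 c0 el.
have [MM [m0' m1 m2]] : exists MM : R, [/\ 0 <= MM, M <= MM & M' <= MM].
  by exists (Num.max M M'); rewrite !le_max !lexx M0 orbT.
have [] := @cmode_ibp _ _ _ _ T A B A1 B1 MM AL BL c e c0 cl sup dA dB cA1 cB1 m0' => //.
- move=> s /andP[s0 sl] /andP[cs se]; have [h|h] := leP s (l - d / 2).
    have hs : c <= s <= l - d / 2 by rewrite cs.
    by have [? ? ? ?] := HM s hs; split; apply: le_trans m2.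
  have hs : 0 < l - s < d by rewrite subr_gt0 sl /=; lra.
  by have [] := Hb _ hs; rewrite subKr => b1 b2 b3 b4; split; apply: le_trans m1.
- move=> p e' e'0; set t := AL * _ + _; pose q := `|chi (l, p)| + 1; pose T0 := `|t| + 1.
  have q0 : 0 < q by rewrite ltr_wpDl. have T00 : 0 < T0 by rewrite ltr_wpDl.
  have [q1 q1E] : exists q1, q1 = Num.min 1 (e' / (2 * T0)) by eexists.
  have q10 : 0 < q1 by rewrite q1E lt_min ltr01 divr_gt0// mulr_gt0.
  have := @continuous_slice1 chi l p (test_C0 T) => /cvgrPdist_le /(_ _ q10) [r /= r0 Hr].
  have [d1 d1E] : exists d1, d1 = e' / (4 * (M + 1) * q) by eexists.
  have M11 : 0 < M + 1 by rewrite ltr_wpDl.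
  have d10 : 0 < d1 by rewrite d1E divr_gt0// !mulr_gt0.
  have [d2 [d20 d2d d2r d2d1]] := lt3_exists d0 r0 d10.
  exists d2; first by rewrite d20 (lt_trans d2d).
  move=> s /andP[s0 sd]; have hs : 0 < s < d by rewrite s0 (lt_trans sd).
  have [hA hB] := HL s hs; have h1 : `|chi (l, p) - chi (l - s, p)| <= q1.
    by apply: Hr; rewrite /= subKr gtr0_norm// (lt_trans sd).
  have h2 : `|chi (l - s, p)| <= q.
    rewrite -[chi (l - s, p)](subKr (chi (l, p))); apply: le_trans (ler_normB _ _) _.
    by rewrite lerD2l (le_trans h1)// q1E ge_min lexx.
  have h3 : `|cmode A B (l - s, p) - t| <= 2 * M * s.
    have -> : cmode A B (l - s, p) - t = cmode (fun s => A s - AL) (fun s => B s - BL) (l - s, p).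
      by rewrite /cmode /t /=; ring.
    apply: le_trans (cmode_le _ _ _) _; apply: le_trans (lerD hA hB) _; rewrite [leRHS](_ : _ = M * s + M * s)//; ring.
  have -> : cmode A B (l - s, p) * chi (l - s, p) - t * chi (l, p) =
    (cmode A B (l - s, p) - t) * chi (l - s, p) - t * (chi (l, p) - chi (l - s, p)) by ring.
  apply: le_trans (ler_normB _ _) _; rewrite !normrM (splitr e'); apply: lerD.
    apply: (@le_trans _ _ (2 * (M + 1) * d1 * q)).
      apply: ler_pM => //; apply: le_trans h3 _; apply: ler_pM => //; [by rewrite mulr_ge0|exact: ltW| |].
        by rewrite ler_wpM2l// lerDl.
      exact/ltW/(lt_trans sd).
    by rewrite d1E le_eqVlt; apply/orP; left; apply/eqP; field; rewrite !gt_eqF.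
  apply: (@le_trans _ _ (T0 * (e' / (2 * T0)))); last first.
    by apply: le_of_eq; field; rewrite gt_eqF.
  by apply: ler_pM => //; [rewrite lerDl|rewrite (le_trans h1)// q1E ge_min lexx orbT].
Qed.

End CircleModes.

(** * The Laplacian of a mode *)

Section ModeLaplacian.
Variables (l : R) (a : R -> R) (m : nat) (alpha1 alpha2 : R).
Hypotheses (P : profile l a).
Implicit Types (f fr fi gr gi : R -> R).

Definition modeC fr fi : R * R -> R[i] := mode m (fun s => fr s +i* fi s)%C.

Lemma Re_modeC fr fi : @complex.Re R \o modeC fr fi = cmode m fr (fun s => - fi s).
Proof. by apply/funext => z; rewrite /modeC /mode /cis /cmode /= mulNr. Qed.

Lemma Im_modeC fr fi : @complex.Im R \o modeC fr fi = cmode m fi fr.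
Proof. by apply/funext => z; rewrite /modeC /mode /cis /cmode /= addrC. Qed.

Lemma sqnorm_modeC fr fi z : sqnorm (modeC fr fi z) = fr z.1 ^+ 2 + fi z.1 ^+ 2.
Proof.
have := congr1 (@^~ z) (Re_modeC fr fi); have := congr1 (@^~ z) (Im_modeC fr fi); rewrite /sqnorm /= => -> ->.
rewrite /cmode; have := cos2Dsin2 (m%:R * z.2); set c := cos _; set s := sin _ => h.
by rewrite -[RHS]mul1r -h; ring.
Qed.

Lemma weak_s_modeC fr fi gr gi : derivI l fr gr ->
  derivI l fi gi -> contI l gr -> contI l gi ->
  weak_s l (modeC fr fi) (modeC gr gi).
Proof.
move=> dr di cr ci; rewrite /weak_s !Re_modeC !Im_modeC; split; apply: (cmode_weak_s m (pf_l P)) => //.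
  by move=> s sI; exact: isdN (di s sI).
by cont_tac.
Qed.

(** The angular derivative is multiplication by [i m], which sends [(fr, fi)] to
    [(- m fi, m fr)]. *)
Lemma weak_p_modeC fr fi : contI l fr -> contI l fi ->
  weak_p l (modeC fr fi) (modeC (fun s => - (m%:R * fi s)) (fun s => m%:R * fr s)).
Proof.
move=> cr ci; rewrite /weak_p !Re_modeC !Im_modeC; split; last exact: (cmode_weak_p m (pf_l P)).
have cni : contI l (fun s => - fi s) by cont_tac.
have := cmode_weak_p m (pf_l P) cr cni.
rewrite (_ : (fun s => m%:R * - fi s) = fun s => - (m%:R * fi s)) //; by apply/funext => s; rewrite mulrN.
Qed.

Lemma L2_modeC fr fi : contI l fr -> contI l fi -> L2w l a fr -> L2w l a fi -> L2 l a (modeC fr fi).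
Proof.
move=> cr ci ir ii; have mI := @measurable_I R l; have mC := @measurable_circle R; split.
- rewrite Re_modeC; apply: cmode_measurable => //.
  by cont_tac.
- by rewrite Im_modeC; exact: cmode_measurable.
have i1 : mu.-integrable circle (EFin \o (fun=> 1 : R)).
  have mI1 : measurable ([set` `[0, 2 * pi]%R] : set RT) by exact: measurable_itv.
  have ipq : mu.-integrable ([set` `[0, 2 * pi]%R] : set RT) (EFin \o (fun=> 1 : R)).
    apply: continuous_compact_integrable; first exact: segment_compact.
    by apply: continuous_subspaceT => s; exact: cvg_cst.
  apply: (integrableS mI1 mC _ ipq).
  by move=> p /=; rewrite !in_itv /= => /andP[/ltW -> /ltW ->].
have ir2 := rintegrableD mI ir ii.
apply: eq_integrable (integrable_tensor mI mC ir2 i1); first exact: measurable_chart.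
by move=> z _ /=; congr (_%:E); rewrite sqnorm_modeC mulr1 mulrDl.
Qed.

Lemma trace_modeC fr fi gr gi (rL iL M d : R) : derivI l fr gr ->
  derivI l fi gi -> contI l gr -> contI l gi -> 0 < d < l ->
  (forI d s, [/\ `|fr (l - s)| <= M, `|fi (l - s)| <= M, `|gr (l - s)| <= M & `|gi (l - s)| <= M]) ->
  (forI d s, `|fr (l - s) - rL| <= M * s /\ `|fi (l - s) - iL| <= M * s) ->
  trace l (modeC fr fi) (modeC gr gi) (fun p => (rL +i* iL) * cis (m%:R * p))%C.
Proof.
move=> dr di cr ci dl Hb HL; have cni : contI l (fun s => - gi s) by cont_tac.
have dni (s : R) : 0 < s < l -> isd (fun s => - fi s) s (- gi s) by move=> sI; exact: isdN (di s sI).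
rewrite /trace !Re_modeC !Im_modeC; split.
  rewrite (_ : _ \o _ = fun p => rL * cos (m%:R * p) + (- iL) * sin (m%:R * p)).
    apply: (cmode_trace m (pf_l P) (M := M) (d := d)) => // s sI; rewrite ?normrN.
      by have [? ? ? ?] := Hb s sI.
    rewrite (_ : - fi (l - s) - - iL = - (fi (l - s) - iL)); last by ring.
    by rewrite normrN; exact: HL.
  by apply/funext => p; rewrite /cis /= mulNr.
rewrite (_ : _ \o _ = fun p => iL * cos (m%:R * p) + rL * sin (m%:R * p)).
  apply: (cmode_trace m (pf_l P) (M := M) (d := d)) => // s sI.
    by have [? ? ? ?] := Hb s sI.
  by have [] := HL s sI.
by apply/funext => p; rewrite /cis /= addrC.
Qed.

Lemma L2wZ k f : L2w l a f -> L2w l a (fun s => k * f s).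
Proof.
move=> i; apply: eq_integrable (rintegrableZ (k ^+ 2) (@measurable_I R l) i) => // s _ /=.
by congr (_%:E); ring.
Qed.

Lemma L2wN f : L2w l a f -> L2w l a (fun s => - f s).
Proof. by move=> /(L2wZ (-1)); under eq_fun do rewrite mulN1r. Qed.

(** The jet is written down explicitly; each square-integrability field reduces to one of
    [mode_profile] after the common factor [e^{i m phi}] is pulled out. *)
Theorem mode_Delta_m (ur ur1 ur2 ui ui1 ui2 : R -> R) :
  mode_profile l a m alpha1 alpha2 ur ur1 ur2 -> mode_profile l a m alpha1 alpha2 ui ui1 ui2 ->
  Delta_m l a alpha1 alpha2 m (modeC ur ui)
    (modeC (fun s => ur2 s + derive1 a s / a s * ur1 s - m%:R ^+ 2 / a s ^+ 2 * ur s)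
           (fun s => ui2 s + derive1 a s / a s * ui1 s - m%:R ^+ 2 / a s ^+ 2 * ui s)).
Proof.
move=> Pr Pi; have l0 := pf_l P; have a0 := pf_gt0 P.
have [dr dr1 cr2] := And3 (mp_d1 Pr) (mp_d2 Pr) (mp_cont2 Pr).
have [di di1 ci2] := And3 (mp_d1 Pi) (mp_d2 Pi) (mp_cont2 Pi).
have cr := derivI_cont dr.
have ci := derivI_cont di.
have cr1 := derivI_cont dr1.
have ci1 := derivI_cont di1.
have ca : contI l a := derivI_cont (pf_isd P); have [caV caV2] := contIV a0 ca.
have cda : contI l (derive1 a) := pf_cont1 P.
pose dp (fr fi : R -> R) := modeC (fun s => - (m%:R * fi s)) (fun s => m%:R * fr s).
pose j := Jet (modeC ur1 ui1) (dp ur ui) (modeC ur2 ui2) (dp ur1 ui1)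
  (dp (fun s => - (m%:R * ui s)) (fun s => m%:R * ur s)).
have Hj : H2_jet l a (modeC ur ui) j.
  split.
  - exact: weak_s_modeC.
  - exact: weak_p_modeC.
  - exact: weak_s_modeC.
  - apply: weak_s_modeC; [| |by cont_tac|by cont_tac] => s sI; last exact: isdZ (dr s sI).
    exact: isdN (isdZ m%:R (di s sI)).
  - by apply: weak_p_modeC; cont_tac.
  - by apply: L2_modeC => //; [exact: mp_L2 Pr|exact: mp_L2 Pi].
  - by apply: L2_modeC => //; [exact: mp_L2_1 Pr|exact: mp_L2_1 Pi].
  - have -> : (fun z => (a z.1)^-1%:C * d_p j z)%C = modeC (fun s => - (m%:R * (ui s / a s))) (fun s => m%:R * (ur s / a s)).
      apply/funext => z; rewrite /j /dp /modeC /mode /= mulrA; congr (_ * _); complex_ring.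
    apply: L2_modeC; [by cont_tac|by cont_tac|exact/L2wN/L2wZ/(mp_L2_a Pi)|exact/L2wZ/(mp_L2_a Pr)].
  - by apply: L2_modeC => //; [exact: mp_L2_2 Pr|exact: mp_L2_2 Pi].
  - pose h (u u1 : R -> R) s := m%:R * (u1 s / a s - derive1 a s / a s ^+ 2 * u s).
    have -> : (fun z => (a z.1)^-1%:C * d_sp j z - (derive1 a z.1 / a z.1 ^+ 2)%:C * d_p j z)%C =
        modeC (fun s => - h ui ui1 s) (h ur ur1).
      apply/funext => z; rewrite /j /dp /modeC /mode /h /= !mulrA -mulrBl; congr (_ * _); complex_ring.
    apply: L2_modeC; [by rewrite /h; cont_tac|by rewrite /h; cont_tac|exact/L2wN/L2wZ/(mp_L2_1a Pi)|exact/L2wZ/(mp_L2_1a Pr)].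
  - pose h (u u1 : R -> R) s := derive1 a s / a s * u1 s - m%:R ^+ 2 / a s ^+ 2 * u s.
    have -> : (fun z => (a z.1 ^- 2)%:C * d_pp j z + (derive1 a z.1 / a z.1)%:C * d_s j z)%C = modeC (h ur ur1) (h ui ui1).
      apply/funext => z; rewrite /j /dp /modeC /mode /h /= !mulrA -mulrDl; congr (_ * _); complex_ring.
    apply: L2_modeC; [by rewrite /h; cont_tac|by rewrite /h; cont_tac|exact: (mp_L2_pp Pr)|exact: (mp_L2_pp Pi)].
split; first by split; [exact: L2_psi Hj|exists (fun s => ur s +i* ui s)%C].
exists j; split=> //.
- move=> al; have [UL [U1L [M [d [dl Hb HL rob]]]]] := mp_boundary Pr al.
  have [VL [V1L [M' [d' [dl' Hb' HL' rob']]]]] := mp_boundary Pi al.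
  exists (fun p => (UL +i* VL) * cis (m%:R * p))%C, (fun p => (U1L +i* V1L) * cis (m%:R * p))%C.
  case/andP: dl => d0 dl; case/andP: dl' => d0' dl'.
  have d2 : 0 < Num.min d d' < l by rewrite lt_min d0 d0' gt_min dl.
  have sd (s : R) : 0 < s < Num.min d d' -> 0 < s < d /\ 0 < s < d' by rewrite lt_min => /andP[-> /andP[-> ->]].
  have mx x : x <= M \/ x <= M' -> x <= Num.max M M' by rewrite le_max => -[->|->]; rewrite ?orbT.
  have mxs x s : 0 < s -> x <= M * s \/ x <= M' * s -> x <= Num.max M M' * s.
    by move=> s0 [h|h]; apply: le_trans h _; rewrite ler_pM2r// le_max lexx ?orbT.
  split; last first.
    apply/aeW => p _; rewrite !mulrA -mulrDl.
    have -> : (alpha1%:C * (UL +i* VL) + alpha2%:C * (U1L +i* V1L) = 0)%C; last by rewrite mul0r.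
    apply/eqP; rewrite eq_complex /=; apply/andP; split; apply/eqP.
      by rewrite -[RHS]rob; ring.
    by rewrite -[RHS]rob'; ring.
  1,2: apply: (trace_modeC (M := Num.max M M') (d := Num.min d d')) => // s /sd[/[dup] h1 /andP[s0 _] h2];
    have [b1 b2 b3] := Hb s h1; have [b4 b5 b6] := Hb' s h2; have [b7 b8] := HL s h1; have [b9 b10] := HL' s h2;
    split; first [apply: mx; tauto|apply: mxs => //; tauto].
- apply/aeW => z _; rewrite /j /dp /modeC /mode /= !mulrA -!mulrDl; congr (_ * _); complex_ring.
Qed.

End ModeLaplacian.
End PlaneModes.

(** * Assembly of the rotating mode *)

Section RotatingMode.
Context {R : realType} (l : R) (a : R -> R) (m : nat) (lambda0 alpha1 alpha2 : R) (th th1 th2 Q Y : R -> R).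
Hypotheses (P : profile l a) (RF : reference l a m lambda0 alpha1 alpha2 th th1 th2 Q Y).
Variables (lam c K : R) (z x ph g A B : R -> R).
Notation rho := (fun s => a s * th s ^+ 2).
Notation rho1 := (fun s => rho s * z s ^+ 2).
Hypotheses (Nz : neumann l rho (fun s => (Q s - lam * g s) * z s) z).
Hypotheses (c0 : 0 < c) (cz : forI l s, c <= z s).
Hypotheses (Nx : neumann l rho1 (fun s => (1 + x s) * (lam * (g s - A s) + ph s ^+ 2)) x).
Hypotheses (x4 : forI l s, `|x s| <= 1 / 4) (bx : bdcont l x).
Hypotheses (bph : bdcont l ph) (phK : forI l s, `|ph s| <= K * Num.min s (l - s)).
Hypotheses (bA : bdcont l A) (bB : bdcont l B).
Hypothesis dph : forI l s, isd (fun t => wgt rho1 x t * ph t) s (- lam * (wgt rho1 x s * B s)).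

Notation phase := (prim l ph).
Let p (s : R) : R := z s * (1 + x s).

Lemma amplitude_gt0 (s : R) : 0 < s < l -> 0 < p s.
Proof.
move=> sI; have zs : 0 < z s := lt_le_trans c0 (cz sI); have := x4 sI; rewrite ler_norml => /andP[h _].
by rewrite mulr_gt0//; lra.
Qed.

Lemma rotating_flux : exists p1 : R -> R, [/\ forI l s, isd p s (p1 s),
  forI l s, isd (fun t => rho t * p1 t) s (rho s * (p s * (Q s - lam * A s + ph s ^+ 2))),
  forI l s, isd (fun t => rho t * p t * ph t) s (- lam * (rho s * p s * B s) - rho s * ph s * p1 s) &
  exists K' : R, forI l s, `|p1 s| <= K' * Num.min s (l - s) /\ `|p s * ph s| <= K' * Num.min s (l - s)].
Proof.
have [z1 [Kz [Hz dz dz1]]] := Nz; have [x1 [Kx [Hx dx dx1]]] := Nx.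
have W := rf_weight RF; have bz := neumann_bdcont W Nz; have [M M0 HM] := bdcont_bound bz.
have zn (s : R) : 0 < s < l -> z s != 0 by move=> sI; rewrite gt_eqF// (lt_le_trans c0 (cz sI)).
have xn (s : R) : 0 < s < l -> 1 + x s != 0.
  by move=> sI; have := amplitude_gt0 sI; rewrite /p; case: eqVneq => // ->; rewrite mulr0 ltxx.
have x54 (s : R) : 0 < s < l -> `|1 + x s| <= 5 / 4.
  by move=> sI; apply: le_trans (ler_normD _ _) _; rewrite normr1; have := x4 sI; lra.
pose p1 (s : R) := z1 s * (1 + x s) + z s * x1 s.
have dp : derivI l p p1.
  move=> s sI; apply: isd_eqd (isdM (dz s sI) (isdD (isd_cst 1 s) (dx s sI))) _.
  by rewrite /p1; ring.
exists p1; split=> //.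
- move=> s sI; apply: (@isd_near _ (fun s => rho s * z1 s * (1 + x s) + rho1 s * x1 s / z s)).
    near=> t; have tI : 0 < t < l by near: t; exact: near_in.
    by rewrite /p1; field; exact: zn.
  apply: isd_eqd (isdD (isdM (dz1 s sI) (isdD (isd_cst 1 s) (dx s sI))) (isd_div (zn s sI) (dx1 s sI) (dz s sI))) _.
  by rewrite /p; field; exact: zn.
- move=> s sI; apply: (@isd_near _ (fun s => wgt rho1 x s * ph s / p s)).
    near=> t; have tI : 0 < t < l by near: t; exact: near_in.
    by rewrite /p /wgt; field; rewrite zn ?xn.
  have pn : p s != 0 by rewrite gt_eqF// amplitude_gt0.
  apply: isd_eqd (isd_div pn (dph sI) (dp s sI)) _.
  by rewrite /wgt /p; field; rewrite zn ?xn.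
- exists (Kz * (5 / 4) + M * Kx + M * (5 / 4) * K) => s sI.
  have h1 : `|z1 s * (1 + x s)| <= Kz * (5 / 4) * Num.min s (l - s).
    rewrite normrM [leRHS](_ : _ = Kz * Num.min s (l - s) * (5 / 4)); last by ring.
    by rewrite ler_pM ?Hz ?x54.
  have h2 : `|z s * x1 s| <= M * Kx * Num.min s (l - s).
    by rewrite normrM -mulrA ler_pM ?Hx ?HM.
  have h3 : `|p s * ph s| <= M * (5 / 4) * K * Num.min s (l - s).
    by rewrite normrM -mulrA ler_pM ?phK// normrM ler_pM ?HM ?x54.
  have h0 := ler_normD (z1 s * (1 + x s)) (z s * x1 s); rewrite -/(p1 s) in h0.
  have n1 := normr_ge0 (z1 s * (1 + x s)); have n2 := normr_ge0 (z s * x1 s); have n3 := normr_ge0 (p s * ph s).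
  have E : (Kz * (5 / 4) + M * Kx + M * (5 / 4) * K) * Num.min s (l - s) =
    Kz * (5 / 4) * Num.min s (l - s) + M * Kx * Num.min s (l - s) + M * (5 / 4) * K * Num.min s (l - s) by ring.
  rewrite E; split.
    by apply: le_trans h0 (le_trans (lerD h1 h2) _); rewrite lerDl (le_trans n3 h3).
  by apply: le_trans h3 _; rewrite lerDr addr_ge0// ?(le_trans n1 h1)// (le_trans n2 h2).
Unshelve. all: by end_near. Qed.

(** These are the real and imaginary parts of [p e^{i phase}]: differentiating the phase factor
    twice produces [- ph^2], which cancels the [ph^2] of the amplitude equation, and the first-order
    cross terms are absorbed by the flux equation. *)
Lemma rotating_neumann :
  neumann l rho (fun s => (Q s - lam * A s) * (p s * cos (phase s)) + lam * B s * (p s * sin (phase s)))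
    (fun s => p s * cos (phase s)) /\
  neumann l rho (fun s => (Q s - lam * A s) * (p s * sin (phase s)) - lam * B s * (p s * cos (phase s)))
    (fun s => p s * sin (phase s)).
Proof.
have [p1 [dp dp1 dpp [K' HK]]] := rotating_flux.
have dc (s : R) : 0 < s < l -> isd (fun s => cos (phase s)) s (- sin (phase s) * ph s).
  by move=> sI; exact: isd_comp (isd_prim bph sI) (is_derive_cos _).
have ds (s : R) : 0 < s < l -> isd (fun s => sin (phase s)) s (cos (phase s) * ph s).
  by move=> sI; exact: isd_comp (isd_prim bph sI) (is_derive_sin _).
have bd (s u v : R) : 0 < s < l -> `|u| <= 1 -> `|v| <= 1 -> `|p1 s * u + p s * ph s * v| <= 2 * K' * Num.min s (l - s).
  move=> sI u1 v1; have [h1 h2] := HK s sI; apply: le_trans (ler_normD _ _) _.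
  rewrite [leRHS](_ : _ = K' * Num.min s (l - s) * 1 + K' * Num.min s (l - s) * 1); last by ring.
  by rewrite (normrM (p1 s)) (normrM (p s * ph s)); apply: lerD; apply: ler_pM.
have cs1 (y : R) : `|cos y| <= 1 by rewrite ler_norml cos_geN1 cos_le1.
have sn1 (y : R) : `|sin y| <= 1 by rewrite ler_norml sin_geN1 sin_le1.
split.
- exists (fun s => p1 s * cos (phase s) + p s * ph s * - sin (phase s)), (2 * K'); split=> s sI.
  + by apply: bd; rewrite ?normrN.
  + by apply: isd_eqd (isdM (dp s sI) (dc s sI)) _; ring.
  + apply: (@isd_near _ (fun s => rho s * p1 s * cos (phase s) - rho s * p s * ph s * sin (phase s))).
      by near=> t; ring.
    by apply: isd_eqd (isdB (isdM (dp1 s sI) (dc s sI)) (isdM (dpp s sI) (ds s sI))) _; ring.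
- exists (fun s => p1 s * sin (phase s) + p s * ph s * cos (phase s)), (2 * K'); split=> s sI.
  + by apply: bd.
  + by apply: isd_eqd (isdM (dp s sI) (ds s sI)) _; ring.
  + apply: (@isd_near _ (fun s => rho s * p1 s * sin (phase s) + rho s * p s * ph s * cos (phase s))).
      by near=> t; ring.
    by apply: isd_eqd (isdD (isdM (dp1 s sI) (ds s sI)) (isdM (dpp s sI) (dc s sI))) _; ring.
Unshelve. all: by end_near. Qed.

Theorem rotating_mode : exists2 lap, Delta_m l a alpha1 alpha2 m
    (modeC m (fun s => th s * (p s * cos (phase s))) (fun s => th s * (p s * sin (phase s)))) lap &
  forall s y : R, 0 < s < l -> lap (s, y) = (- lam%:C * (A s +i* B s) *
    modeC m (fun s => th s * (p s * cos (phase s))) (fun s => th s * (p s * sin (phase s))) (s, y))%C.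
Proof.
have [Nr Ni] := rotating_neumann; have W := rf_weight RF; have bQ := rf_bdQ RF.
have br := neumann_bdcont W Nr; have bi := neumann_bdcont W Ni.
have bQA : bdcont l (fun s => Q s - lam * A s) by apply: bdcontB => //; exact: bdcontZ.
have bFr := bdcontD (bdcontM bQA br) (bdcontM (bdcontZ lam bB) bi).
have bFi := bdcontB (bdcontM bQA bi) (bdcontM (bdcontZ lam bB) br).
have [ur1 [ur2 [Pr Er]]] := neumann_mode_profile P RF bFr Nr.
have [ui1 [ui2 [Pi Ei]]] := neumann_mode_profile P RF bFi Ni.
eexists; first exact: (mode_Delta_m P Pr Pi).
move=> s y sI; rewrite /modeC /mode [RHS]mulrA; congr (_ * _); have Er' := Er s sI; have Ei' := Ei s sI.
by apply/eqP; rewrite eq_complex; apply/andP; split; apply/eqP; [apply: etrans Er' _|apply: etrans Ei' _] => /=; ring.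
Qed.

Notation psi := (modeC m (fun s => th s * (p s * cos (phase s))) (fun s => th s * (p s * sin (phase s)))).

Lemma sqnorm_rotating (s y : R) : sqnorm (psi (s, y)) = th s ^+ 2 * p s ^+ 2.
Proof.
rewrite sqnorm_modeC /=; have := cos2Dsin2 (phase s); move: (cos _) (sin _) => u v h.
by rewrite -[RHS]mulr1 -h; ring.
Qed.

Lemma nontrivial_rotating : nontrivial l psi.
Proof.
move=> H; have l0 := pf_l P; have mI := @measurable_I R l; have mC := @measurable_circle R.
have z0 : forall z, chart l z -> psi z <> 0.
  move=> [s y] sy E; have := sqnorm_rotating s y; rewrite E.
  have sI : 0 < s < l by case: sy => /=; rewrite in_itv.
  rewrite /sqnorm /= expr0n addr0 => /eqP; rewrite eq_sym mulf_eq0 !expf_eq0 /=.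
  by rewrite !gt_eqF ?amplitude_gt0 ?(rf_gt0 RF).
case: H => N [mN N0 sN].
have sub : chart l `<=` N by move=> q qI; apply: sN => /(_ qI); exact: z0.
have := @subset_measure0 _ _ _ ((@lebesgue_measure R) \x (@lebesgue_measure R))%E _ _ (@measurable_chart R l) mN sub N0.
move=> Z; have := product_measure1E (@lebesgue_measure R) (@lebesgue_measure R) mI mC; rewrite [LHS]Z.
rewrite [X in (X * _)%E](lebesgue_measure_itv `]0, l[) [X in (_ * X)%E](lebesgue_measure_itv `]0, 2 * pi[) /= !lte_fin l0 mulr_gt0 ?pi_gt0//.
by rewrite -!EFinB -EFinM => -[] /esym/eqP; rewrite !subr0 gt_eqF// !mulr_gt0 ?pi_gt0.
Qed.

Lemma spiral_rotating (s0 : R) : 0 < s0 < l -> ph s0 != 0 -> spiral l m psi.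
Proof.
move=> s0I ph0; exists (fun s => (th s * (p s * cos (phase s)) +i* (th s * (p s * sin (phase s))))%C); split=> //.
have t0 := rf_gt0 RF.
exists s0, phase; split=> //.
- apply/eqP => /(congr1 (@sqnorm R)); rewrite /sqnorm /= expr0n addr0.
  have := cos2Dsin2 (phase s0); move: (cos _) (sin _) => u v h.
  have -> : (th s0 * (p s0 * u)) ^+ 2 + (th s0 * (p s0 * v)) ^+ 2 = th s0 ^+ 2 * p s0 ^+ 2 * (u ^+ 2 + v ^+ 2) by ring.
  by rewrite h mulr1 => /eqP; rewrite mulf_eq0 !expf_eq0 /= !gt_eqF ?amplitude_gt0 ?t0.
- near=> s; have sI : 0 < s < l by near: s; exact: near_in.
  split; last by have [] := isd_prim bph sI.
  rewrite /modulus /sqnorm /=; have := cos2Dsin2 (phase s); rewrite /cis; move: (cos _) (sin _) => u v h.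
  have -> : (th s * (p s * u)) ^+ 2 + (th s * (p s * v)) ^+ 2 = (th s * p s) ^+ 2 * (u ^+ 2 + v ^+ 2) by ring.
  rewrite h mulr1 sqrtr_sqr gtr0_norm; last exact: mulr_gt0 (t0 s sI) (amplitude_gt0 sI).
  complex_ring.
- by rewrite derive1E; have := isd_prim bph s0I => -[_ ->].
Unshelve. all: by end_near. Qed.

(** [A + i B] is the quotient of [f_R + i (f_I + Om)] by [1 + i eta]. *)
Lemma solves_rotating d (fR fI : R -> 'rV[R]_d -> R) eta b Om :
  (forI l s, let y := th s ^+ 2 * p s ^+ 2 in
    A s = (fR y b + eta * fI y b + eta * Om) / (1 + eta ^+ 2) /\
    B s = (Om - (eta * fR y b - fI y b)) / (1 + eta ^+ 2)) ->
  solves l a alpha1 alpha2 m fR fI lam eta b Om psi.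
Proof.
move=> AB; have [lap D E] := rotating_mode; exists lap => //.
apply/aeW => -[s y] [/= sI _]; rewrite in_itv /= in sI; rewrite (E s y sI) sqnorm_rotating.
have [] := AB s sI; move: (fR _ b) (fI _ b) => u v -> ->.
have e0 : 1 + eta ^+ 2 != 0 by rewrite gt_eqF// ltr_pwDl// sqr_ge0.
rewrite mulrA -mulrDl -mulrDl; set k := (_ + _ : R[i]); suff -> : k = 0 by rewrite mul0r.
by apply/eqP; rewrite /k eq_complex /=; apply/andP; split; apply/eqP; field.
Qed.

End RotatingMode.

(** * Weighted means and the rotation criterion *)

Section WeightedMean.
Context {R : realType} (l : R) (rho : R -> R).
Hypothesis W : weight l rho.

Lemma bdcont_wgt1 (x : R -> R) : bdcont l x -> bdcont l (wgt rho x).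
Proof.
move=> bx; apply: bdcontM; first exact: weight_bd W.
by apply: bdcontX; apply: bdcontD => //; exact: bdcont_cst.
Qed.

Lemma wgt_bounds (x : R -> R) (s : R) : 0 < s < l -> `|x s| <= 1 / 4 ->
  9 / 16 * rho s <= wgt rho x s /\ wgt rho x s <= 25 / 16 * rho s.
Proof.
move=> sI; rewrite ler_norml => /andP[h1 h2]; have r0 := weight_gt0 W sI.
by rewrite /wgt; split; rewrite [_ * rho s]mulrC ler_wpM2l ?(ltW r0)//; nra.
Qed.

(** For [|x| <= 1/4] the weight [wgt rho x] lies between [9/16 rho] and [25/16 rho], so one constant
    serves for all [x]: the mean at [x = 0] times [9/25]. *)
Lemma weighted_mean_gt0 (H : R -> R) (t : R) : bdcont l H -> (forI l s, 0 <= H s) ->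
  0 < t < l -> 0 < H t -> exists2 e : R, 0 < e & forall x : R -> R, bdcont l x ->
    (forI l s, `|x s| <= 1 / 4) -> e * prim l (wgt rho x) l <= prim l (fun s => wgt rho x s * H s) l.
Proof.
move=> bH H0 tI Ht; have br := weight_bd W; have r0 := weight_gt0 W.
have I0 : 0 < prim l rho l by apply: (prim_gt0 br (t := t)) => // [s sI|]; [exact: ltW (r0 s sI)|exact: r0].
have brH := bdcontM br bH.
have I1 : 0 < prim l (fun s => rho s * H s) l.
  by apply: (prim_gt0 brH (t := t)) => // [s sI|]; [rewrite mulr_ge0 ?H0// ltW// r0|rewrite mulr_gt0// r0].
exists (9 / 25 * (prim l (fun s => rho s * H s) l / prim l rho l)) => [|x bx x4].
  by rewrite mulr_gt0// divr_gt0.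
have bw := bdcont_wgt1 bx.
have h1 : prim l (wgt rho x) l <= 25 / 16 * prim l rho l.
  rewrite -primZ//; apply: le_prim => // [|s sI]; first exact: bdcontZ.
  by have [] := wgt_bounds sI (x4 s sI).
have h2 : 9 / 16 * prim l (fun s => rho s * H s) l <= prim l (fun s => wgt rho x s * H s) l.
  rewrite -primZ//; apply: le_prim => // [||s sI]; [exact: bdcontZ|exact: bdcontM|].
  by rewrite mulrA ler_wpM2r ?H0//; have [] := wgt_bounds sI (x4 s sI).
apply: le_trans h2; apply: (@le_trans _ _ (9 / 25 * (prim l (fun s => rho s * H s) l / prim l rho l) * (25 / 16 * prim l rho l))).
  by rewrite ler_wpM2l// ltW// mulr_gt0// divr_gt0.
by apply: le_of_eq; field; rewrite gt_eqF.
Qed.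

(** The rotation rate [ell] is [kap G] up to [e |kap|]. If [Om = 0], the mean of [G] would be at
    most [e] in modulus. If [P] vanished identically, [ell] would be the constant [Om], and [G]
    would stay within [5/2 e] of its end value [G0]. Both contradict the margin [3 e]. *)
Lemma mean_rotation_spiral (x P ell G : R -> R) (k Om G0 e kap : R) : bdcont l x ->
  (forI l s, `|x s| <= 1 / 4) -> bdcont l ell -> bdcont l G ->
  (forI l s, isd (fun t => wgt rho x t * P t) s (k * (wgt rho x s * (Om - ell s)))) ->
  prim l (fun s => wgt rho x s * (Om - ell s)) l = 0 -> k != 0 -> kap != 0 -> 0 < e ->
  (forI l s, `|ell s - kap * G s| <= e * `|kap|) ->
  (forall e' : R, 0 < e' -> exists2 s : R, 0 < s < l & `|G s - G0| <= e') ->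
  3 * e * prim l (wgt rho x) l <= `|prim l (fun s => wgt rho x s * G s) l| ->
  3 * e * prim l (wgt rho x) l <= `|prim l (fun s => wgt rho x s * (G s - G0)) l| ->
  Om != 0 /\ exists2 s : R, 0 < s < l & P s != 0.
Proof.
move=> bx x4 bl bG dP Om0 k0 kap0 e0 near lim m1 m2; have bw := bdcont_wgt1 bx; have l0 := weight_l W.
have w0 (s : R) : 0 < s < l -> 0 < wgt rho x s.
  by move=> sI; have [h _] := wgt_bounds sI (x4 s sI); apply: lt_le_trans h; rewrite mulr_gt0// (weight_gt0 W).
have [w wE] : exists w, w = prim l (wgt rho x) l by eexists.
have wp : 0 < w.
  by rewrite wE; apply: (prim_gt0 bw (t := l / 2)) (w0 _ (half_in l0)) => [s /w0/ltW|]; [|exact: half_in].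
have mean (H : R -> R) c : bdcont l H -> (forI l s, `|H s| <= c) ->
    `|prim l (fun s => wgt rho x s * H s) l| <= c * w.
  move=> bH Hc; have bwH := bdcontM bw bH; rewrite ler_norml wE -mulNr -!primZ//; apply/andP; split;
    apply: le_prim => //; try exact: bdcontZ; move=> s sI; rewrite [_ * wgt _ _ _]mulrC ler_wpM2l ?(ltW (w0 s sI))//;
    by have := Hc s sI; rewrite ler_norml => /andP[].
have kp : 0 < `|kap| by rewrite normr_gt0.
rewrite -wE in m1 m2; split.
  apply/negP.
  move=> /eqP O0; have bD : bdcont l (fun s => ell s - kap * G s) by apply: bdcontB => //; exact: bdcontZ.
  have := mean _ _ bD near.
  have -> : prim l (fun s => wgt rho x s * (ell s - kap * G s)) l = - (kap * prim l (fun s => wgt rho x s * G s) l).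
    rewrite -[RHS]add0r -[X in X + _]oppr0 -Om0 -primN; last first.
      by apply: bdcontM => //; apply: bdcontB => //; exact: bdcont_cst.
    rewrite -primZ; last exact: bdcontM.
    rewrite -prim_subr; [|by apply: bdcontN; apply: bdcontM => //; apply: bdcontB => //; exact: bdcont_cst|by apply: bdcontZ; exact: bdcontM].
    by congr (prim l _ l); apply/funext => s; rewrite O0; ring.
  rewrite normrN normrM mulrAC mulrC ler_pM2r// => h; have := le_trans m1 h.
  by rewrite ler_pM2r//; lra.
apply: contrapT => NP.
have P0 (s : R) : 0 < s < l -> P s = 0 by move=> sI; apply: contrapT => /eqP h; apply: NP; exists s.
have E (s : R) : 0 < s < l -> ell s = Om.
  move=> sI; have D : isd (fun t => wgt rho x t * P t) s 0.
    apply: (isd_near (f := fun _ : R => 0 : R)).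
    by near=> t; rewrite P0 ?mulr0//; near: t; exact: near_in.
  have := isd_uniq (dP s sI) D => /eqP; rewrite mulf_eq0 (negPf k0) /= (mulf_eq0 (wgt rho x s)) (gt_eqF (w0 s sI)) /=.
  by rewrite subr_eq0 => /eqP.
have e2 : 0 < e / 2 by rewrite divr_gt0.
have [t tI Gt] := lim _ e2.
have GG (s : R) : 0 < s < l -> `|G s - G0| <= 5 / 2 * e.
  move=> sI; have h1 := near s sI; have h2 := near t tI; rewrite (E s sI) in h1; rewrite (E t tI) in h2.
  have -> : G s - G0 = (G s - G t) + (G t - G0) by ring.
  apply: le_trans (ler_normD _ _) _; suff h : `|G s - G t| <= 2 * e by lra.
  rewrite -(ler_pM2l kp) -normrM.
  have -> : kap * (G s - G t) = (Om - kap * G t) - (Om - kap * G s) by ring.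
  by apply: le_trans (ler_normB _ _) _; lra.
have bD : bdcont l (fun s => G s - G0) by apply: bdcontB => //; exact: bdcont_cst.
have := le_trans m2 (mean _ _ bD GG); rewrite ler_pM2r//; lra.
Unshelve. all: by end_near. Qed.

End WeightedMean.

(** * The cone around the eta-axis *)

Section Cones.
Context {R : realType} (d : nat) (l C lam : R) (rho U : R -> R) (fR fI : R -> 'rV[R]_d -> R).
Implicit Types (b : 'rV[R]_d) (f g : R -> 'rV[R]_d -> R).
Hypotheses (W : weight l rho) (C0 : 0 < C) (lam0 : 0 < lam) (bU : bdcont l U).
Hypothesis hU : forI l s, 0 < U s <= C.
Hypothesis U0 : forall e : R, 0 < e -> exists2 s : R, 0 < s < l & U s < e.

Definition rotation eta b (x : R -> R) (s : R) : R := eta * fR (modsq U x s) b - fI (modsq U x s) b.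

(** Stated for every [(x, P, Om)] with the properties that [perturbation] delivers, so that the
    required closeness [tau] is available before the branch is constructed. *)
Definition spiral_in (cone : R -> 'rV[R]_d -> Prop) := exists tau r : R, [/\ 0 < tau, 0 < r &
  forall eta b (x P : R -> R) (Om : R), cone eta b -> (forall i, `|b ord0 i| <= r) -> bdcont l x ->
    (forI l s, `|x s| <= tau /\ `|x s| <= 1 / 4) -> bdcont l (rotation eta b x) ->
    (forI l s, isd (fun t => wgt rho x t * P t) s
      (- lam / (1 + eta ^+ 2) * (wgt rho x s * (Om - rotation eta b x s)))) ->
    prim l (fun s => wgt rho x s * (Om - rotation eta b x s)) l = 0 ->
    Om != 0 /\ exists2 s : R, 0 < s < l & P s != 0].

Lemma modsq_near (x : R -> R) (s tau : R) : 0 < s < l -> `|x s| <= tau -> `|x s| <= 1 / 4 ->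
  0 < modsq U x s < 3 * C /\ `|U s - modsq U x s| <= 3 * C * tau.
Proof.
move=> sI h1 h2; have /andP[u0 uC] := hU sI; have c0 := C0.
have h3 : 9 / 16 <= (1 + x s) ^+ 2 <= 25 / 16 by move: h2; rewrite ler_norml => /andP[h h']; apply/andP; split; nra.
case/andP: h3 => h3 h4; split.
  rewrite /modsq mulr_gt0//=; last by apply: lt_le_trans h3.
  apply: (@le_lt_trans _ _ (C * (25 / 16))); last by rewrite mulrC ltr_pM2r//; lra.
  by rewrite ler_pM ?sqr_ge0// ltW.
have -> : U s - modsq U x s = U s * (- x s * (2 + x s)) by rewrite /modsq; ring.
rewrite normrM [leRHS](_ : _ = C * (tau * 3)); last by ring.
apply: ler_pM => //; first by rewrite gtr0_norm.
rewrite normrM normrN; apply: ler_pM => //; apply: le_trans (ler_normD _ _) _.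
by rewrite gtr0_norm//; lra.
Qed.

Lemma tube_modsq g (e : R) : nonneg_continuous g -> 0 < e -> exists tau r : R, [/\ 0 < tau, 0 < r &
  forall b (x : R -> R) (s : R), (forall i, `|b ord0 i| <= r) -> 0 < s < l -> `|x s| <= tau -> `|x s| <= 1 / 4 ->
    `|g (U s) 0 - g (modsq U x s) b| <= e].
Proof.
move=> cg e0; have c0 := C0; have [r r0 H] := tube C cg e0.
exists (r / (3 * C)), r; split=> //; first by rewrite divr_gt0// mulr_gt0.
move=> b x s br sI h1 h2; have [/andP[m0 m1] m2] := modsq_near sI h1 h2; apply: H => //.
- by have /andP[/ltW -> ->] := hU sI.
- exact: ltW.
- by apply: le_trans m2 _; apply: le_of_eq; field; rewrite gt_eqF.
Qed.

Lemma bdcont_comp_U g : nonneg_continuous g -> bdcont l (fun s => g (U s) (0 : 'rV[R]_d)).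
Proof.
move=> cg; have [B B0 HB] := nonneg_continuous_bound C cg; split=> [s sI|]; last first.
  by exists B => s sI; apply: HB; have /andP[/ltW -> ->] := hU sI.
have /andP[/ltW u0 _] := hU sI; apply/cvgrPdist_le => e e0; have [r r0 H] := nonneg_continuous_pt cg u0 e0.
near=> t; have tI : 0 < t < l by near: t; exact: near_in.
have /andP[/ltW ut0 _] := hU tI; apply: H => //; near: t.
have := proj1 bU s sI => /cvgrPdist_lt; exact.
Unshelve. all: by end_near. Qed.

Lemma end_value g (e : R) : nonneg_continuous g -> 0 < e ->
  exists2 s : R, 0 < s < l & `|g (U s) (0 : 'rV[R]_d) - g 0 0| <= e.
Proof.
move=> cg e0; have [r r0 H] := nonneg_continuous_pt cg (lexx 0) e0; have [s sI Us] := U0 r0.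
have /andP[u0 _] := hU sI; exists s => //; rewrite distrC; apply: H; first exact: ltW.
by rewrite sub0r normrN gtr0_norm.
Qed.

Hypotheses (hR : classC 3 fR) (hI : classC 3 fI) (hA1 : A1 fR fI C) (hA2 : A2 fR C).

(** First-order expansion at [b = 0], where the value is zero by assumption and the coefficients
    [db i f y 0] are bounded on the compact range. *)
Lemma reaction_lip_b f : classC 3 f -> (forall y : R, 0 <= y -> f y 0 = 0) ->
  exists L r : R, [/\ 0 < L, 0 < r & forall (y : R) b, 0 <= y <= 3 * C -> (forall i, `|b ord0 i| <= r) ->
    `|f y b| <= L * enorm b].
Proof.
move=> hf f0; have [_ _ cf] := classC_continuous hf.
have /choice[B HB] : forall i : 'I_d, exists B : R, 0 < B /\ forall y : R, 0 <= y <= 3 * C -> `|db i f y 0| <= B.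
  by move=> i; have [B B0 HB] := nonneg_continuous_bound (3 * C) (cf i); exists B.
have [r r0 H] := first_order (3 * C) (fun i y b y0 => classC_derivable_b hf y0) cf ltr01.
have S0 : 0 <= \sum_i B i by apply: sumr_ge0 => i _; have [/ltW] := HB i.
have [S SE] : exists S, S = \sum_i B i by eexists.
rewrite -SE in S0; have d0 : 0 < d%:R + 1 :> R by rewrite ltr_wpDl.
exists ((S + 1) * (d%:R + 1)), (r / (d%:R + 1)); split=> [||y b yI br]; first by rewrite mulr_gt0// ltr_wpDl.
  by rewrite divr_gt0.
have en0 : 0 <= enorm b by exact: sqrtr_ge0.
have sb : \sum_i `|b ord0 i| <= r.
  apply: (@le_trans _ _ (\sum_(i < d) r / (d%:R + 1))); first exact: ler_sum.
  rewrite sumr_const card_ord -[leLHS]mulr_natl mulrA ler_pdivrMr// mulrC ler_pM2l// lerDl.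
  exact: ler01.
have := H y b yI sb; rewrite f0 ?subr0 ?mul1r; last by case/andP: yI.
move=> h1; have h2 : `|\sum_i b ord0 i * db i f y 0| <= S * \sum_i `|b ord0 i|.
  apply: le_trans (ler_norm_sum _ _ _) _; rewrite mulr_sumr; apply: ler_sum => i _.
  rewrite normrM mulrC ler_wpM2r//; have [_ h] := HB i; apply: le_trans (h y yI) _.
  by rewrite SE (bigD1 i)//= lerDl sumr_ge0// => j _; have [/ltW] := HB j.
rewrite -[f y b](subrK (\sum_i b ord0 i * db i f y 0)).
apply: le_trans (ler_normD _ _) _; apply: le_trans (lerD h1 h2) _.
rewrite [leLHS](_ : _ = (S + 1) * \sum_i `|b ord0 i|); last by ring.
rewrite -mulrA ler_wpM2l ?addr_ge0//; apply: le_trans (sum_coord_le b) _.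
by rewrite mulrDl lerDl mul1r.
Qed.

(** Here [kap = eta], [G = f_R(U, 0)] and [G0 = 1], its value at zero density. Both means have a
    sign because [0 <= f_R <= 1], with [f_R < 1] for positive density. The cone condition makes
    [f_I], which is [O(|b|)], at most [e / 2] times [|eta|]. *)
Lemma spiral_cone_eta : exists2 kap : R, 0 < kap & spiral_in (fun eta b => eta != 0 /\ enorm b <= kap * `|eta|).
Proof.
have [cR _ _] := classC_continuous hR; have [f01 _ _ _ fI0] := hA1; have l0 := weight_l W.
have bG := bdcont_comp_U cR; have bG1 := bdcontB (bdcont_cst l 1) bG.
have hU' (s : R) : 0 < s < l -> 0 <= U s <= C by move=> /hU/andP[/ltW -> ->].
have h20 : 0 < 1 / 2 :> R by lra.
(* A point of small density, where the reaction is at least [1/2], makes its mean positive. *)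
have [t tI Ut] := end_value cR h20.
have Gt : 0 < fR (U t) 0 by move: Ut; rewrite f01 ler_norml => /andP[h _]; lra.
have [e1 e10 H1] := weighted_mean_gt0 W bG (fun s sI => proj1 (andP (reaction_bounds hR hA1 hA2 (hU' s sI)))) tI Gt.
have Gt1 : 0 < 1 - fR (U (l / 2)) 0 by rewrite subr_gt0 (reaction_lt1 hR hA1 hA2) ?hU ?half_in.
have G1 (s : R) : 0 < s < l -> 0 <= 1 - fR (U s) 0.
  by move=> sI; rewrite subr_ge0; case/andP: (reaction_bounds hR hA1 hA2 (hU' s sI)).
have [e2 e20 H2] := weighted_mean_gt0 W bG1 G1 (half_in l0) Gt1.
have [e [e0 ee1 ee2 _]] : exists e : R, [/\ 0 < e, 3 * e < e1, 3 * e < e2 & true].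
  by have [c [c0 h1 h2 _]] := lt3_exists e10 e20 e10; exists (c / 3); split=> //; [exact: divr_gt0|lra|lra].
have e20' : 0 < e / 2 by rewrite divr_gt0.
have [tau [r1 [tau0 r10 T]]] := tube_modsq cR e20'.
have [L [r2 [L0 r20 HL]]] := reaction_lip_b hI fI0.
exists (e / (2 * L)); first by rewrite divr_gt0// mulr_gt0.
exists tau, (Num.min r1 r2); split=> //; first by rewrite lt_min r10.
move=> eta b x P Om [eta0 be] br bx xs bl dP Om0.
have xs4 (s : R) : 0 < s < l -> `|x s| <= 1 / 4 by move=> /xs[].
have eta2 : - lam / (1 + eta ^+ 2) != 0.
  by rewrite mulf_neq0 ?oppr_eq0 ?invr_eq0 ?gt_eqF// ltr_pwDl// sqr_ge0.
have w0 : 0 <= prim l (wgt rho x) l.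
  apply: prim_ge0; first exact: bdcont_wgt1.
  by move=> s sI; rewrite mulr_ge0 ?sqr_ge0// ltW// (weight_gt0 W).
apply: (mean_rotation_spiral W (G0 := 1) (e := e) (kap := eta) bx xs4 bl bG dP Om0) => //.
- move=> s sI; have [x1 x2] := xs s sI.
  have br1 i : `|b ord0 i| <= r1 by apply: le_trans (br i) _; rewrite ge_min lexx.
  have br2 i : `|b ord0 i| <= r2 by apply: le_trans (br i) _; rewrite ge_min lexx orbT.
  have [/andP[m0 m1] _] := modsq_near sI x1 x2.
  have -> : rotation eta b x s - eta * fR (U s) 0 = - (eta * (fR (U s) 0 - fR (modsq U x s) b)) - fI (modsq U x s) b.
    by rewrite /rotation; ring.
  apply: le_trans (ler_normB _ _) _; rewrite normrN normrM.
  have mI : 0 <= modsq U x s <= 3 * C by rewrite !ltW.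
  have h1 := T b x s br1 sI x1 x2; have h2 := HL _ b mI br2.
  have h3 : L * enorm b <= e / 2 * `|eta|.
    apply: le_trans (ler_wpM2l (ltW L0) be) _; apply: le_of_eq.
    by field; rewrite gt_eqF.
  rewrite [leRHS](_ : _ = `|eta| * (e / 2) + e / 2 * `|eta|); last by field.
  by apply: lerD; [rewrite ler_wpM2l|exact: le_trans h2 h3].
- by move=> e' e'0; have [s sI h] := end_value cR e'0; exists s => //; rewrite -f01.
- apply: le_trans (ler_norm _); apply: le_trans (H1 x bx xs4); rewrite ler_wpM2r// ltW//.
- have -> : prim l (fun s => wgt rho x s * (fR (U s) 0 - 1)) l = - prim l (fun s => wgt rho x s * (1 - fR (U s) 0)) l.
    rewrite -primN; last by apply: bdcontM => //; exact: bdcont_wgt1.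
    by congr (prim l _ l); apply/funext => s; ring.
  rewrite normrN; apply: le_trans (ler_norm _); apply: le_trans (H2 x bx xs4); rewrite ler_wpM2r// ltW//.
Qed.

End Cones.

(** * The cone around the beta-axis *)

Section ConeB.
Context {R : realType} (l C lam : R) (rho U : R -> R) (fR fI : R -> 'rV[R]_1 -> R).
Hypotheses (W : weight l rho) (C0 : 0 < C) (lam0 : 0 < lam) (bU : bdcont l U).
Hypothesis hU : forI l s, 0 < U s <= C.
Hypothesis U0 : forall e : R, 0 < e -> exists2 s : R, 0 < s < l & U s < e.
Hypotheses (hR : classC 3 fR) (hI : classC 3 fI) (hA1 : A1 fR fI C).
Hypothesis dI_neq0 : forI C y, db ord0 fI y 0 <> 0.
Hypothesis I00 : forall b : 'rV[R]_1, fI 0 b = 0.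

Notation g := (fun y => db ord0 fI y (0 : 'rV[R]_1)).

Lemma enorm1 (b : 'rV[R]_1) : enorm b = `|b ord0 ord0|.
Proof. by rewrite /enorm big_ord1 sqrtr_sqr. Qed.

(** A change of sign would produce a zero in [(0, C)] by the intermediate value theorem. The product
    with the value at [C / 2] spares a case distinction on the sign, and the end [y = C], where a
    zero is not excluded, is treated apart. *)
Lemma db_sign (y : R) : 0 < y <= C -> 0 <= g (C / 2) * g y.
Proof.
move=> /andP[y0 yC]; have c0 := C0; have C2 : 0 < C / 2 < C by apply/andP; split; lra.
have [_ _ /(_ ord0) cg] := classC_continuous hI.
have cgw (p q : R) : 0 < p -> {within `[p, q], continuous g}.
  move=> p0; apply: continuous_in_subspaceT => z; rewrite inE /= in_itv /= => /andP[pz _].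
  have z0 : 0 < z := lt_le_trans p0 pz.
  apply/cvgrPdist_le => e e0; have [r r0 H] := nonneg_continuous_pt cg (ltW z0) e0; near=> t.
  by apply: H; [apply/ltW; near: t; exact: lt_nbhsr|near: t; exact: cvgr_dist_lt].
rewrite leNgt; apply/negP => neg.
have gy0 : g y != 0 by apply/eqP => h; move: neg; rewrite h mulr0 ltxx.
have key (p q : R) : 0 < p -> p <= q -> q <= C -> g p * g q < 0 -> (q = C -> g q != 0) -> False.
  move=> p0 pq qC pqn gq; have mm : Num.min (g p) (g q) <= 0 <= Num.max (g p) (g q).
    move: pqn; rewrite ge_min le_max; move: (g p) (g q) => u v; case: (leP 0 u) => hu; case: (leP 0 v) => hv /=.
    - by rewrite ltNge mulr_ge0.
    - by rewrite (ltW hv) orbT.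
    - by rewrite (ltW hu).
    - by rewrite ltNge mulr_le0// ltW.
  have [z] := IVT pq (cgw p q p0) mm; rewrite in_itv /= => /andP[pz zq] gz.
  have [zC|zC] := ltP z C; first by apply: (@dI_neq0 z) => //; rewrite (lt_le_trans p0).
  have E : z = q by apply/eqP; rewrite eq_le zq (le_trans qC).
  by move: gz; rewrite E; apply/eqP/gq/eqP; rewrite eq_le qC -E.
have [h|/ltW h] := leP (C / 2) y.
  apply: (key (C / 2) y) => //; first by case/andP: C2.
apply: (key y (C / 2)) => //; [by case/andP: C2 => _ /ltW|by rewrite mulrC|].
by move=> h'; move: C2; rewrite {2}h' ltxx andbF.
Unshelve. all: by end_near. Qed.

Lemma db_pole : g 0 = 0.
Proof.
rewrite /db; have -> : fI 0 = (fun=> 0) by apply/funext => b; exact: I00.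
exact: derive_cst.
Qed.

(** Now [kap = - beta] and [G] is the derivative of [f_I] in [beta] at 0 along [U]. Its end value is
    [G0 = 0] because [f_I] vanishes at zero density, so the two lower bounds required of [G]
    coincide. *)
Lemma spiral_cone_b : exists2 kap : R, 0 < kap &
  spiral_in l lam rho U fR fI (fun eta b => b != 0 /\ `|eta| <= kap * enorm b).
Proof.
have [cR _ _] := classC_continuous hR; have [_ _ /[dup] cdb /(_ ord0) cg] := classC_continuous hI.
have [_ _ _ _ fI0] := hA1; have l0 := weight_l W; have c0 := C0.
have bG := bdcont_comp_U bU hU cg; have bG1 := bdcontZ (g (C / 2)) bG.
have C2 : 0 < C / 2 < C by apply/andP; split; lra.
have k0 : g (C / 2) != 0 by apply/eqP/dI_neq0.
have C20 : 0 < C / 2 by case/andP: C2.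
have [t tI Ut] := U0 C20; have /andP[Ut0 UtC] := hU tI.
have Ht : 0 < g (C / 2) * g (U t).
  rewrite lt_neqAle db_sign ?hU// andbT eq_sym mulf_neq0//; apply/eqP/dI_neq0.
  by rewrite Ut0 (lt_trans Ut)//; case/andP: C2.
have [e1 e10 H1] := weighted_mean_gt0 W bG1 (fun s sI => db_sign (hU sI)) tI Ht.
have kp : 0 < `|g (C / 2)| by rewrite normr_gt0.
have [e eE] : exists e, e = e1 / `|g (C / 2)| / 3 by eexists.
have e0 : 0 < e by rewrite eE !divr_gt0.
have e3 : 0 < e / 3 by rewrite divr_gt0.
have [tau1 [r1 [tau10 r10 T1]]] := tube_modsq C0 hU cg e3.
have [tau2 [r2 [tau20 r20 T2]]] := tube_modsq C0 hU cR (@ltr01 R).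
have [Mf Mf0 HMf] := nonneg_continuous_bound C cR.
have [r3 r30 H3] := first_order (3 * C) (fun i y b y0 => classC_derivable_b hI y0) cdb e3.
have Mf1 : 0 < Mf + 1 by rewrite addr_gt0.
exists (e / 3 / (Mf + 1)); first by rewrite divr_gt0.
have [r [r0 rr1 rr2 rr3]] := lt3_exists r10 r20 r30.
exists (Num.min tau1 tau2), r; split=> //; first by rewrite lt_min tau10.
move=> eta b x P Om [b0 be] br bx xs bl dP Om0.
have xs4 (s : R) : 0 < s < l -> `|x s| <= 1 / 4 by move=> /xs[].
have eta2 : - lam / (1 + eta ^+ 2) != 0.
  by rewrite mulf_neq0 ?oppr_eq0 ?invr_eq0 ?gt_eqF// ltr_pwDl// sqr_ge0.
have bet0 : - b ord0 ord0 != 0.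
  rewrite oppr_eq0; apply: contra b0 => /eqP h; apply/eqP/matrixP => i j.
  by rewrite !ord1 h mxE.
have big : 3 * e * prim l (wgt rho x) l <= `|prim l (fun s => wgt rho x s * g (U s)) l|.
  have E := primZ (g (C / 2)) l (bdcontM (bdcont_wgt1 W bx) bG).
  rewrite -(ler_pM2l kp) -normrM -E.
  have -> : `|g (C / 2)| * (3 * e * prim l (wgt rho x) l) = e1 * prim l (wgt rho x) l.
    by rewrite eE; field; rewrite gt_eqF.
  apply: le_trans (H1 x bx xs4) _; apply: le_trans (ler_norm _) _.
  by apply: le_of_eq; congr `|prim l _ l|; apply/funext => s; ring.
apply: (mean_rotation_spiral W (G0 := 0) (e := e) (kap := - b ord0 ord0) bx xs4 bl bG dP Om0) => //.
- move=> s sI; have [] := xs s sI; rewrite le_min => /andP[x1 x2] x4.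
  have br1 i : `|b ord0 i| <= r1 by exact: le_trans (br i) (ltW rr1).
  have br2 i : `|b ord0 i| <= r2 by exact: le_trans (br i) (ltW rr2).
  have b3 : \sum_i `|b ord0 i| <= r3 by rewrite big_ord1; exact: le_trans (br ord0) (ltW rr3).
  have [/andP[m0 m1] _] := modsq_near C0 hU sI x1 x4.
  have mI : 0 <= modsq U x s <= 3 * C by rewrite !ltW.
  have := H3 _ b mI b3; rewrite !big_ord1 fI0 ?subr0 ?(ltW m0)// => h1.
  have br0 i : `|(0 : 'rV[R]_1) ord0 i| <= r1 by rewrite mxE normr0 ltW.
  have h2 := T1 0 x s br0 sI x1 x4; have h3 := T2 b x s br2 sI x2 x4.
  have h4 : `|fR (modsq U x s) b| <= Mf + 1.
    rewrite -[fR _ b](subKr (fR (U s) 0)); apply: le_trans (ler_normB _ _) _; apply: lerD => //.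
    by apply: HMf; have /andP[/ltW -> ->] := hU sI.
  have -> : rotation U fR fI eta b x s - - b ord0 ord0 * g (U s) = eta * fR (modsq U x s) b -
      (fI (modsq U x s) b - b ord0 ord0 * g (modsq U x s)) + b ord0 ord0 * (g (U s) - g (modsq U x s)).
    by rewrite /rotation; ring.
  rewrite enorm1 in be; rewrite normrN.
  have h5 : `|eta * fR (modsq U x s) b| <= e / 3 * `|b ord0 ord0|.
    rewrite normrM; apply: le_trans (ler_pM (normr_ge0 _) (normr_ge0 _) be h4) _.
    by apply: le_of_eq; field; rewrite gt_eqF.
  have h6 : `|b ord0 ord0 * (g (U s) - g (modsq U x s))| <= e / 3 * `|b ord0 ord0|.
    by rewrite normrM mulrC ler_wpM2r.
  apply: le_trans (ler_normD _ _) _; apply: le_trans (lerD (ler_normB _ _) (lexx _)) _.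
  rewrite [leRHS](_ : _ = e / 3 * `|b ord0 ord0| + e / 3 * `|b ord0 ord0| + e / 3 * `|b ord0 ord0|); last by field.
  by apply: lerD => //; exact: lerD.
- by move=> e' e'0; have [s sI h] := end_value hU U0 cg e'0; exists s => //; rewrite -db_pole.
- rewrite (_ : (fun s => _ * (_ - 0)) = fun s => wgt rho x s * g (U s)) //.
  by apply/funext => s; rewrite subr0.
Qed.

End ConeB.
(** The additional hypotheses are made part of the cone, so that one choice of [eps] covers both
    cones; when they fail, the cone is empty and the claim is void. *)
Lemma spiral_cone_b_dim {R : realType} (d : nat) (l C lam : R) (rho U : R -> R) (fR fI : R -> 'rV[R]_d -> R) :
  weight l rho -> 0 < C -> 0 < lam -> bdcont l U -> (forI l s, 0 < U s <= C) ->
  (forall e : R, 0 < e -> exists2 s : R, 0 < s < l & U s < e) -> classC 3 fR -> classC 3 fI -> A1 fR fI C ->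
  exists2 kap : R, 0 < kap & spiral_in l lam rho U fR fI (fun eta b => [/\ d = 1%N,
    forall (i : 'I_d) (y : R), 0 < y < C -> db i fI y 0 <> 0, forall b, fI 0 b = 0 & b != 0 /\ `|eta| <= kap * enorm b]).
Proof.
move=> W C0 lam0 bU hU U0 hR hI h1.
have [[d1 [D N]]|H] := pselect (d = 1%N /\ (forall (i : 'I_d) (y : R), 0 < y < C -> db i fI y 0 <> 0) /\ forall b, fI 0 b = 0).
  subst d; have [kap k0 [tau [r [tau0 r0 S]]]] := spiral_cone_b W C0 lam0 bU hU U0 hR hI h1 (D ord0) N.
  by exists kap => //; exists tau, r; split=> // eta b x P Om [_ _ _]; exact: S.
by exists 1 => //; exists 1, 1; split=> // eta b x P Om [h2 h3 h4 _]; exfalso; apply: H.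
Qed.

(** * The branch of rotating modes *)

Section Branch.
Context {R : realType} (d m : nat) (l C lam lambda0 alpha1 alpha2 : R) (a th th1 th2 Q Y : R -> R).
Context (fR fI : R -> 'rV[R]_d -> R) (z : R -> R) (c : R).
Implicit Types (b : 'rV[R]_d) (f : R -> 'rV[R]_d -> R).
Hypotheses (P : profile l a) (RF : reference l a m lambda0 alpha1 alpha2 th th1 th2 Q Y).
Hypotheses (C0 : 0 < C) (lam0 : 0 < lam).
Hypotheses (hR : classC 3 fR) (hI : classC 3 fI) (hA1 : A1 fR fI C) (hA2 : A2 fR C).
Notation rho := (fun s => a s * th s ^+ 2).
Notation rho1 := (fun s => rho s * z s ^+ 2).
Notation U := (fun s => th s ^+ 2 * z s ^+ 2).
Hypotheses (Nz : neumann l rho (fun s => (Q s - lam * fR (U s) 0) * z s) z).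
Hypotheses (c0 : 0 < c) (cz : forI l s, c <= z s).
Hypothesis UC : forI l s, U s <= C.

Lemma branch_density (s : R) : 0 < s < l -> 0 < U s <= C.
Proof.
move=> sI; rewrite UC// andbT mulr_gt0//; apply: exprn_gt0; first exact: rf_gt0 RF _ sI.
exact: lt_le_trans c0 (cz sI).
Qed.

Lemma branch_bdcont : bdcont l U.
Proof.
have bz := neumann_bdcont (rf_weight RF) Nz.
by apply: bdcontM; apply: bdcontX => //; exact: rf_bd RF.
Qed.

(** [z] lies between the positive constants [c] and [M], so [z^2] changes the comparison clause only
    by the factor [M^2 / c^2]. *)
Lemma branch_weight : weight l rho1.
Proof.
have W := rf_weight RF; have bz := neumann_bdcont W Nz; have [M M0 HM] := bdcont_bound bz.
have z0 (s : R) : 0 < s < l -> 0 < z s by move=> sI; exact: lt_le_trans c0 (cz sI).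
have r0 := weight_gt0 W; split.
- exact: pf_l P.
- by apply: bdcontM; [exact: weight_bd W|exact: bdcontX].
- by move=> s sI; apply: mulr_gt0; [exact: r0|apply: exprn_gt0; exact: z0].
have [K K0 HK] := weight_mono W; exists (K * (M ^+ 2 / c ^+ 2)); first by rewrite mulr_gt0// divr_gt0// exprn_gt0.
move=> s t sI tI st; have h1 := HK s t sI tI st.
have h2 : z s ^+ 2 <= M ^+ 2 by rewrite lerXn2r ?nnegrE ?(ltW M0) ?(ltW (z0 s sI))// (le_trans (ler_norm _) (HM s sI)).
have h3 : 1 <= z t ^+ 2 / c ^+ 2 by rewrite ler_pdivlMr ?exprn_gt0// mul1r lerXn2r ?nnegrE ?(ltW c0) ?(ltW (z0 t tI))// cz.
apply: (@le_trans _ _ (K * rho t * M ^+ 2)); first by rewrite ler_pM ?sqr_ge0// ltW// r0.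
rewrite [leRHS](_ : _ = K * rho t * M ^+ 2 * (z t ^+ 2 / c ^+ 2)); last by ring.
by rewrite ler_peMr// (mulr_ge0 (mulr_ge0 (ltW K0) (ltW (r0 t tI))) (sqr_ge0 M)).
Qed.

Lemma branch_vanishing (e : R) : 0 < e -> exists2 s : R, 0 < s < l & U s < e.
Proof.
move=> e0; have bz := neumann_bdcont (rf_weight RF) Nz; have [M M0 HM] := bdcont_bound bz.
have e1 : 0 < e / (2 * M ^+ 2) by rewrite divr_gt0// mulr_gt0// exprn_gt0.
have [r /andP[r0 rl] H] := rf_vanish0 RF e1.
have sI : 0 < r / 2 < l by apply/andP; split; [rewrite divr_gt0|apply: le_lt_trans rl; exact: half_le].
exists (r / 2) => //; apply: (@le_lt_trans _ _ (e / (2 * M ^+ 2) * M ^+ 2)).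
  apply: ler_pM; rewrite ?sqr_ge0 ?H ?half_in// -(real_normK (num_real (z _))) lerXn2r ?nnegrE ?(ltW M0)//.
  exact: HM.
by rewrite [ltLHS](_ : _ = e / 2); [lra|field; rewrite gt_eqF].
Qed.

Lemma dy_eq0 f (y : R) : classC 3 f -> (forall y : R, 0 <= y -> f y 0 = 0) -> 0 < y -> dy f y 0 = 0.
Proof.
move=> hf f0 y0; apply: (isd_uniq (isd_dy 0 hf y0)); apply: (isd_near (f := fun _ : R => 0 : R)).
by near=> t; rewrite f0// ltW//; near: t; exact: lt_nbhsr.
Unshelve. all: by end_near. Qed.

Lemma bdcont_comp_modsq (F dF : R -> R) (x : R -> R) (M : R) : bdcont l x ->
  (forI l s, `|x s| <= 1 / 4) -> (forI (3 * C) y, isd F y (dF y)) ->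
  (forI (3 * C) y, `|F y| <= M) -> bdcont l (fun s => F (modsq U x s)).
Proof.
move=> bx x4 dF0 FM; have mI (s : R) : 0 < s < l -> 0 < modsq U x s < 3 * C.
  by move=> sI; have [] := modsq_near C0 branch_density sI (lexx _) (x4 s sI).
have bm : bdcont l (modsq U x).
  by apply: bdcontM; [exact: branch_bdcont|apply: bdcontX; apply: bdcontD => //; exact: bdcont_cst].
split=> [s sI|]; last by exists M => s sI; apply: FM; exact: mI.
apply: continuous_comp; first exact: (proj1 bm s sI).
exact: isd_cont (dF0 _ (mI s sI)).
Qed.

Lemma reaction_modulus : unif_mod (3 * C) (fun y => fR y 0) (fun y => dy fR y 0).
Proof.
have [cR cdR _] := classC_continuous hR; move=> e e0.
have [r1 r10 H1] := tube (3 * C) cR e0; have [r2 r20 H2] := tube (3 * C) cdR e0.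
exists (Num.min r1 r2); first by rewrite lt_min r10.
move=> y y' /andP[/ltW h1 /ltW h2] /andP[/ltW h3 _]; rewrite le_min => /andP[h4 h5].
by split; [apply: H1|apply: H2] => //; rewrite ?h1 ?h2// => i; rewrite mxE normr0 ltW.
Qed.

(** Both cones are treated at once because the same [Om] and [psi] must serve for them; the
    perturbation is run with the smaller of the two radii that they request. *)
Theorem rotating_branch (cone1 cone2 : R -> 'rV[R]_d -> Prop) :
  spiral_in l lam rho1 U fR fI cone1 -> spiral_in l lam rho1 U fR fI cone2 ->
  exists2 eps : R, 0 < eps & forall eta b, `|eta| < eps -> enorm b < eps -> exists Om psi,
    [/\ solves l a alpha1 alpha2 m fR fI lam eta b Om psi, nontrivial l psi,
        cone1 eta b -> rotating_spiral l m Om psi & cone2 eta b -> rotating_spiral l m Om psi].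
Proof.
move=> [tau1 [r1 [tau10 r10 S1]]] [tau2 [r2 [tau20 r20 S2]]].
have [cR cdR _] := classC_continuous hR; have [cI cdI _] := classC_continuous hI.
have [_ _ _ _ fI0] := hA1.
have [B1 B10 HB1] := nonneg_continuous_bound (3 * C) cR; have [B2 B20 HB2] := nonneg_continuous_bound (3 * C) cdR.
have fM (y : R) : 0 < y < 3 * C -> `|fR y 0| <= B1 + B2 /\ `|dy fR y 0| <= B1 + B2.
  move=> /andP[/ltW h1 /ltW h2]; have yI : 0 <= y <= 3 * C by rewrite h1.
  by split; [apply: le_trans (HB1 y yI) _; rewrite lerDl ltW|apply: le_trans (HB2 y yI) _; rewrite lerDr ltW].
have hU := branch_density; have W := branch_weight; have bU := branch_bdcont.
have dneg (s : R) : 0 < s < l -> dy fR (U s) 0 <= 0 by move=> sI; exact: (dy_reaction_le0 hR hA1 hA2 (hU s sI)).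
have dneg1 : exists2 s : R, 0 < s < l & dy fR (U s) 0 < 0.
  have [r r0 H] := dy_reaction_lt0 hR hA2; have [s sI Us] := branch_vanishing r0.
  by exists s => //; apply: H; rewrite Us andbT; case/andP: (hU s sI) => /ltW.
have tau0 : 0 < Num.min tau1 tau2 by rewrite lt_min tau10.
have [e e0 PT] := perturbation W bU C0 hU lam0 reaction_modulus fM dneg dneg1 tau0.
have [q1 q10 T1] := tube (3 * C) cR e0; have [q2 q20 T2] := tube (3 * C) cdR e0.
have [q3 q30 T3] := tube (3 * C) cI e0; have [q4 q40 T4] := tube (3 * C) cdI e0.
have [p1 [p10 p1a p1b p1c]] := lt3_exists q10 q20 q30; have [p2 [p20 p2a p2b p2c]] := lt3_exists q40 r10 r20.
(* [eps] lies below every tube radius, so [enorm b < eps] yields all coordinatewise bounds on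
   [b]. *)
have [eps [eps0 epse epsp epsq]] := lt3_exists e0 p10 p20.
exists eps => // eta b etae be.
have bi q i : eps < q -> `|b ord0 i| <= q.
  by move=> h; apply: le_trans (coord_le_enorm b i) _; apply/ltW/(lt_trans be).
have bq1 i : `|b ord0 i| <= q1 by apply: bi; exact: lt_trans epsp p1a.
have bq2 i : `|b ord0 i| <= q2 by apply: bi; exact: lt_trans epsp p1b.
have bq3 i : `|b ord0 i| <= q3 by apply: bi; exact: lt_trans epsp p1c.
have bq4 i : `|b ord0 i| <= q4 by apply: bi; exact: lt_trans epsq p2a.
have br1 i : `|b ord0 i| <= r1 by apply: bi; exact: lt_trans epsq p2b.
have br2 i : `|b ord0 i| <= r2 by apply: bi; exact: lt_trans epsq p2c.
have close f q : (forall (y y' : R) b, 0 <= y <= 3 * C -> 0 <= y' -> `|y - y'| <= q ->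
    (forall i, `|b ord0 i| <= q) -> `|f y 0 - f y' b| <= e) -> 0 < q -> (forall i, `|b ord0 i| <= q) ->
    forI (3 * C) y, `|f y 0 - f y b| <= e.
  by move=> T q0 bq y /andP[/ltW h1 /ltW h2]; apply: T => //; rewrite ?h1// subrr normr0 ltW.
have dR (y : R) : 0 < y < 3 * C -> isd (fun y => fR y b) y (dy fR y b) by move=> /andP[y0 _]; exact: isd_dy.
have dI (y : R) : 0 < y < 3 * C -> isd (fun y => fI y b) y (dy fI y b) by move=> /andP[y0 _]; exact: isd_dy.
have cI0 (y : R) : 0 < y < 3 * C -> `|fI y b| <= e /\ `|dy fI y b| <= e.
  move=> /[dup] /andP[y0 _] yI; have := close _ _ T3 q30 bq3 y yI; have := close _ _ T4 q40 bq4 y yI.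
  by rewrite (dy_eq0 hI fI0 y0) fI0 ?(ltW y0)// !sub0r !normrN.
have [||Om [x [ph [K [[bx xs] Nx [bph phK] dph Om0]]]]] := PT (fun y => fR y b) (fun y => dy fR y b) (fun y => fI y b) (fun y => dy fI y b) eta dR dI _ cI0.
- by move=> y yI; split; [exact: close T1 q10 bq1 y yI|exact: close T2 q20 bq2 y yI].
- by apply/ltW/(lt_trans etae).
have x4 (s : R) : 0 < s < l -> `|x s| <= 1 / 4 by move=> /xs[].
have FRM (y : R) : 0 < y < 3 * C -> `|fR y b| <= B1 + B2 + e.
  move=> yI; rewrite -[fR y b](subKr (fR y 0)); apply: le_trans (ler_normB _ _) _.
  by apply: lerD; [case: (fM y yI)|exact: close T1 q10 bq1 y yI].
have bFR := bdcont_comp_modsq bx x4 dR FRM.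
have bFI := bdcont_comp_modsq bx x4 dI (fun y yI => proj1 (cI0 y yI)).
pose A s := (fR (modsq U x s) b + eta * fI (modsq U x s) b + eta * Om) / (1 + eta ^+ 2).
pose B s := (Om - (eta * fR (modsq U x s) b - fI (modsq U x s) b)) / (1 + eta ^+ 2).
have brot : bdcont l (rotation U fR fI eta b x) by apply: bdcontB => //; exact: bdcontZ.
have bA : bdcont l A.
  apply: bdcontM; last exact: bdcont_cst.
  by apply: bdcontD; [apply: bdcontD => //; exact: bdcontZ|exact: bdcont_cst].
have bB : bdcont l B.
  apply: bdcontM; last exact: bdcont_cst.
  by apply: bdcontB => //; exact: bdcont_cst.
have dph' (s : R) : 0 < s < l -> isd (fun t => wgt rho1 x t * ph t) s (- lam * (wgt rho1 x s * B s)).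
  by move=> sI; apply: isd_eqd (dph s sI) _; rewrite /B; move: (wgt _ _ _) => w; ring.
pose psi := modeC m (fun s => th s * (z s * (1 + x s) * cos (prim l ph s)))
  (fun s => th s * (z s * (1 + x s) * sin (prim l ph s))).
have sp : (Om != 0 /\ exists2 s : R, 0 < s < l & ph s != 0) -> rotating_spiral l m Om psi.
  move=> [Om1 [s sI ph0]]; split => //.
  exact: (spiral_rotating RF c0 cz x4 bph sI ph0).
exists Om, psi; split.
- apply: (solves_rotating P RF Nz c0 cz Nx x4 bph phK bA bB dph') => s sI /=.
  have -> : th s ^+ 2 * (z s * (1 + x s)) ^+ 2 = modsq U x s by rewrite /modsq; ring.
  by [].
- exact: (nontrivial_rotating P RF c0 cz x4).
- move=> h; apply: sp; apply: (S1 eta b x ph Om h br1 bx _ brot dph Om0) => s sI.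
  by have [+ h2] := xs s sI; rewrite le_min => /andP[].
- move=> h; apply: sp; apply: (S2 eta b x ph Om h br2 bx _ brot dph Om0) => s sI.
  by have [+ h2] := xs s sI; rewrite le_min => /andP[].
Qed.

End Branch.

(** * Choice of the branch as functions of the parameters, and the two cones *)

Theorem theorem1p4 (R : realType) (nu ss : R) (a atil : R -> R)
  (alpha1 alpha2 : R) (d m : nat) (fR fI : R -> 'rV[R]_d -> R) (C lambda0 : R)
  (hM : surface_of_revolution nu ss a atil)
  (halpha1 : 0 <= alpha1) (halpha2 : 0 <= alpha2)
  (halpha : ~ (alpha1 = 0 /\ alpha2 = 0))
  (hd : (0 < d)%N) (hm : (0 < m)%N)
  (hfR : classC 3 fR) (hfI : classC 3 fI)
  (hA1 : A1 fR fI C) (hA2 : A2 fR C)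
  (hlambda0_gt0 : 0 < lambda0)
  (hlambda0 : principal_eigenvalue ss a alpha1 alpha2 m lambda0) :
  forall lambda : R, lambda0 < lambda ->
  exists epsilon : R, 0 < epsilon /\
  exists (Omega : R -> 'rV[R]_d -> R) (psi : R -> 'rV[R]_d -> R * R -> R[i]),
  [/\ forall (eta : R) (b : 'rV[R]_d), `|eta| < epsilon -> enorm b < epsilon ->
        solves ss a alpha1 alpha2 m fR fI lambda eta b (Omega eta b) (psi eta b)
        /\ nontrivial ss (psi eta b),
      exists kappa : R, 0 < kappa /\
        forall (eta : R) (b : 'rV[R]_d), ~ (eta = 0 /\ b = 0) ->
          `|eta| < epsilon -> enorm b < epsilon -> enorm b <= kappa * `|eta| ->
          rotating_spiral ss m (Omega eta b) (psi eta b) &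
      d = 1%N ->
      (forall (i : 'I_d) (y : R), 0 < y < C -> db i fI y 0 <> 0) ->
      (forall b : 'rV[R]_d, fI 0 b = 0) ->
      exists kappa : R, 0 < kappa /\
        forall (eta : R) (b : 'rV[R]_d), ~ (eta = 0 /\ b = 0) ->
          `|eta| < epsilon -> enorm b < epsilon -> `|eta| <= kappa * enorm b ->
          rotating_spiral ss m (Omega eta b) (psi eta b)].
Proof.
move=> lambda lt; have P := surface_profile hM; have lam0 : 0 < lambda := lt_trans hlambda0_gt0 lt.
have ca (s : R) : 0 < s < ss -> {for s, continuous a} by move=> sI; exact: isd_cont (pf_isd P sI).
have [V [V1 [V2 [EP V0]]]] := eigenprofile_exists hm (pf_l P) (pf_gt0 P) ca (pf_cont1 P) (proj1 hlambda0).
have [th [th1 [th2 [Q [Y [RF _]]]]]] := reference_exists P hm hlambda0_gt0 EP V0.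
have [fR0 C0 _ _ _] := hA1.
have [Lf Lf0 HLf] := truncated_reaction_lip hfR hA1.
have ft0 : truncated_reaction fR C 0 = 1 by rewrite truncated_reactionE// ltW.
have ft1 (y : R) : 0 <= y -> truncated_reaction fR C y <= 1 by exact: (truncated_reaction_le1 hfR hA1 hA2).
have ftt := truncated_reaction_tail hA1.
have [z [Nz [c c0 cz]]] := positive_solution P RF hlambda0_gt0 lt C0 Lf0 HLf ft1 ft0 ftt.
have z0 (s : R) : 0 < s < ss -> 0 < z s by move=> sI; exact: lt_le_trans c0 (cz s sI).
have UC := solution_bound P RF hlambda0_gt0 lt C0 halpha1 halpha2 halpha ftt Nz z0.
(* The bound [U <= C] removes the truncation from the equation. *)
have {}Nz : neumann ss (fun s => a s * th s ^+ 2) (fun s => (Q s - lambda * fR (th s ^+ 2 * z s ^+ 2) 0) * z s) z.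
  by apply: neumann_eq Nz => // s sI; rewrite truncated_reactionE// UC.
have W := branch_weight P RF Nz c0 cz; have bU := branch_bdcont RF Nz.
have hU := branch_density RF c0 cz UC; have U0 := branch_vanishing RF Nz.
have [k1 k10 S1] := spiral_cone_eta W C0 lam0 bU hU U0 hfR hfI hA1 hA2.
have [k2 k20 S2] := spiral_cone_b_dim W C0 lam0 bU hU U0 hfR hfI hA1.
have [eps eps0 H] := rotating_branch P RF C0 lam0 hfR hfI hA1 hA2 Nz c0 cz UC S1 S2.
(* One selected pair per parameter gives the functions [Omega] and [psi], shared by both cones;
   outside the range of small parameters the zero pair is a default value. *)
have /choice[F HF] : forall q : R * 'rV[R]_d, exists w : R * (R * R -> R[i]), `|q.1| < eps -> enorm q.2 < eps ->
    [/\ solves ss a alpha1 alpha2 m fR fI lambda q.1 q.2 w.1 w.2, nontrivial ss w.2,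
        q.1 != 0 /\ enorm q.2 <= k1 * `|q.1| -> rotating_spiral ss m w.1 w.2 &
        [/\ d = 1%N, forall (i : 'I_d) (y : R), 0 < y < C -> db i fI y 0 <> 0, forall b, fI 0 b = 0 &
            q.2 != 0 /\ `|q.1| <= k2 * enorm q.2] -> rotating_spiral ss m w.1 w.2].
  move=> [eta b] /=; have [[h1 h2]|h] := pselect (`|eta| < eps /\ enorm b < eps).
    by have [Om [psi Hp]] := H eta b h1 h2; exists (Om, psi).
  by exists (0, fun=> 0) => h1 h2; exfalso; apply: h.
have enorm_eq0 (b : 'rV[R]_d) : enorm b <= 0 -> b = 0.
  move=> h; apply/matrixP => i j; rewrite ord1 mxE; apply/eqP; rewrite -normr_eq0 eq_le normr_ge0 andbT.
  exact: le_trans (coord_le_enorm b j) h.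
exists eps; split=> //; exists (fun eta b => (F (eta, b)).1), (fun eta b => (F (eta, b)).2); split.
- by move=> eta b h1 h2; have [] := HF (eta, b) h1 h2.
- exists k1; split=> // eta b n h1 h2 h3; have [_ _ h _] := HF (eta, b) h1 h2; apply: h; split=> //=.
  apply/eqP => e0; apply: n; split=> //; apply: enorm_eq0.
  by rewrite e0 normr0 mulr0 in h3.
- move=> d1 D N; exists k2; split=> // eta b n h1 h2 h3; have [_ _ _ h] := HF (eta, b) h1 h2; apply: h; split=> //=.
  split=> //; apply/eqP => b0; apply: n; split=> //; apply/eqP; rewrite -normr_eq0 eq_le normr_ge0 andbT.
  apply: le_trans h3 _; rewrite b0 /enorm big1 ?sqrtr0 ?mulr0// => i _.
  by rewrite mxE expr0n.
Qed.
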